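(* Let $d\in\mathbb{N}$ and $A\in\{B,F\}$. Let $p\in(1,\infty)$, $q,q_0,r\in(0,\infty]$, $s,s_0\in\mathbb{R}$ with $s\neq s_0$, and $b\in\mathbb{R}\setminus\{0\}$. The following hold with equivalence of quasi-norms. (i) If $s_0>s$ and $b>0$, then $$T^b_rF^s_{p,q}(\mathbb{R}^d)=\big(F^s_{p,q}(\mathbb{R}^d),A^{s_0}_{p,q_0}(\mathbb{R}^d)\big)_{(0,b-1/r),r}.$$ (ii) If $s_0<s$ and $b<0$, then $$T^b_rF^s_{p,q}(\mathbb{R}^d)=\big(A^{s_0}_{p,q_0}(\mathbb{R}^d),F^s_{p,q}(\mathbb{R}^d)\big)_{(1,b-1/r),r}.$$
   Context: $\widehat{f}$, $f^\vee$ denote the Fourier transform and its inverse on $\mathcal{S}'(\mathbb{R}^d)$. $(\varphi_j)_{j\ge 0}$ is the usual smooth dyadic resolution of unity: $\varphi_0\in C_c^\infty(\mathbb{R}^d)$, $\varphi_0=1$ for $|\xi|\le 1$, $\operatorname{supp}\varphi_0\subset\{|\xi|\le 2\}$, $\varphi_j(\xi)=\varphi_0(2^{-j}\xi)-\varphi_0(2^{-j+1}\xi)$ for $j\ge1$. The spaces consist of all $f\in\mathcal S'(\mathbb{R}^d)$ with finite quasi-norm (usual modifications for infinite exponents; $1/\infty=0$): $$\|f\|_{B^{s}_{p,q}}=\Big(\sum_{j\ge0}2^{jsq}\|(\varphi_j\widehat f)^\vee\|_{L_p}^q\Big)^{1/q},\qquad \|f\|_{F^{s}_{p,q}}=\Big\|\Big(\sum_{j\ge0}2^{jsq}|(\varphi_j\widehat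 f)^\vee|^q\Big)^{1/q}\Big\|_{L_p},$$ $$\|f\|_{T^b_rF^s_{p,q}}=\Big(\sum_{j\ge0}2^{jbr}\Big\|\Big(\sum_{\nu=2^j-1}^{2^{j+1}-2}2^{\nu sq}|(\varphi_\nu\widehat f)^\vee|^q\Big)^{1/q}\Big\|_{L_p}^r\Big)^{1/r}.$$ Limiting interpolation: let $(A_0,A_1)$ be an ordered couple of quasi-Banach spaces, $A_1\hookrightarrow A_0$, and $K(t,f)=\inf\{\|f_0\|_{A_0}+t\|f_1\|_{A_1}: f=f_0+f_1,\ f_i\in A_i\}$. For $\theta\in\{0,1\}$, $\beta\in\mathbb{R}$, $r\in(0,\infty]$, $(A_0,A_1)_{(\theta,\beta),r}$ is the set of $f\in A_0$ with $$\|f\|_{(A_0,A_1)_{(\theta,\beta),r}}=\Big(\int_0^1\big(t^{-\theta}(1-\log t)^{\beta}K(t,f)\big)^r\frac{dt}{t}\Big)^{1/r}<\infty$$ (supremum over $t\in(0,1)$ if $r=\infty$). *)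

(* Defs.v *)
From HB Require Import structures.
From mathcomp Require Import all_boot all_order all_algebra.
From mathcomp Require Import complex.
From mathcomp Require Import all_classical all_reals all_analysis.

Set Implicit Arguments.
Unset Strict Implicit.
Unset Printing Implicit Defensive.

Import Order.TTheory GRing.Theory Num.Theory.
Import numFieldTopology.Exports numFieldNormedType.Exports.

Local Open Scope classical_set_scope.
Local Open Scope ring_scope.
Local Open Scope complex_scope.

(* Lebesgue measure on d.-tuple R is built by recursion on d: the point mass
   for d = 0, and the image of the product measure under
   (x, t) |-> x :: t for d.+1. *)
Section lebesgue_step.
Context (R : realType) (n : nat).
Local Notation mR := (measurableTypeR R).
Variable mu : {sigma_finite_measure set (n.-tuple mR) -> \bar R}.

Definition cons_pair (xt : mR * n.-tuple mR) : n.+1.-tuple mR :=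
  [tuple of xt.1 :: xt.2].

Lemma measurable_cons_pair : measurable_fun [set: mR * n.-tuple mR] cons_pair.
Proof. exact: measurable_cons. Qed.

Definition lebesgue_step : set (n.+1.-tuple mR) -> \bar R :=
  pushforward (@lebesgue_measure R \x mu)%E cons_pair.

HB.instance Definition _ := Measure.copy lebesgue_step
  (measure_function_pushforward__canonical__measure_function_Measure
     (@lebesgue_measure R \x mu)%E measurable_cons_pair).

Lemma lebesgue_step_sigma_finite : sigma_finite setT lebesgue_step.
Proof.
have /sigma_finiteP[F [TF ndF Foo]] := sigma_finiteT (@lebesgue_measure R).
have /sigma_finiteP[G [TG ndG Goo]] := sigma_finiteT mu.
pose hd (t : n.+1.-tuple mR) : mR := tnth t ord0.
pose tl (t : n.+1.-tuple mR) : n.-tuple mR := [tuple of behead t].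
exists (fun k => hd @^-1` F k `&` tl @^-1` G k).
  apply/seteqP; split=> // t _.
  have [i _ Fi] : (\bigcup_k F k) (hd t) by rewrite -TF.
  have [j _ Gj] : (\bigcup_k G k) (tl t) by rewrite -TG.
  exists (maxn i j) => //; split=> /=.
    by move: Fi; exact/subsetPset/ndF/leq_maxl.
  by move: Gj; exact/subsetPset/ndG/leq_maxr.
move=> k; have [mF Fk] := Foo k; have [mG Gk] := Goo k; split.
  apply: measurableI; rewrite -[X in measurable X]setTI.
    exact: measurable_tnth.
  exact: measurable_behead.
have -> : lebesgue_step (hd @^-1` F k `&` tl @^-1` G k) =
    (@lebesgue_measure R \x mu)%E (F k `*` G k).
  rewrite /lebesgue_step /pushforward; congr ((_ \x _)%E _).
  apply/seteqP; split=> -[x t] /=; rewrite /hd /tl (tnth_nth x)/=.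
    by move=> [Fx Gt]; split=> //; rewrite (_ : t = [tuple of behead (x :: t)])//;
      exact/val_inj.
  by move=> [Fx Gt]; split=> //; rewrite (_ : [tuple of behead (x :: t)] = t)//;
    exact/val_inj.
by rewrite product_measure1E// lte_mul_pinfty// ge0_fin_numE.
Qed.

HB.instance Definition _ :=
  Measure_isSigmaFinite.Build _ _ _ lebesgue_step lebesgue_step_sigma_finite.

End lebesgue_step.

Fixpoint lebesgue_tuple (R : realType) (d : nat) :
    {sigma_finite_measure set (d.-tuple (measurableTypeR R)) -> \bar R} :=
  match d with
  | 0 => \d_([tuple] : 0.-tuple (measurableTypeR R))
  | n.+1 => lebesgue_step (lebesgue_tuple R n)
  end.

Section function_spaces.
Context {R : realType} {d : nat}.
Local Notation E := 'rV[R]_d.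
Local Notation C := R[i].
Local Notation mu := (lebesgue_tuple R d).

Definition row_of_tuple (t : d.-tuple R) : E := \row_i tnth t i.

Definition dotp (x y : E) : R := \sum_(i < d) x 0 i * y 0 i.

(* The library norm on 'rV[R]_d is the maximum norm. *)
Definition enorm (x : E) : R := Num.sqrt (dotp x x).

Definition cabs (z : C) : R := Normc.normc z.

Definition re (g : E -> C) : E -> R := fun x => complex.Re (g x).
Definition im (g : E -> C) : E -> R := fun x => complex.Im (g x).

Definition ccontinuous (g : E -> C) : Prop :=
  continuous (re g) /\ continuous (im g).

Definition cintegrable (g : E -> C) : Prop :=
  mu.-integrable setT (fun t => (re g (row_of_tuple t))%:E) /\
  mu.-integrable setT (fun t => (im g (row_of_tuple t))%:E).

Definition cintegral (g : E -> C) : C :=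
  (\int[mu]_t re g (row_of_tuple t))%R +i*
  (\int[mu]_t im g (row_of_tuple t))%R.

(* A multi-index is given as the list of the directions of differentiation. *)
Definition partials (s : seq 'I_d) (f : E -> R) : E -> R :=
  foldr (fun i g => fun x => 'D_(delta_mx 0 i) g x) f s.

Definition smooth (f : E -> R) : Prop := forall s : seq 'I_d,
  continuous (partials s f) /\
  forall (i : 'I_d) (x : E), derivable (partials s f) x (delta_mx 0 i).

Definition csmooth (g : E -> C) : Prop := smooth (re g) /\ smooth (im g).

Definition cpartials (s : seq 'I_d) (g : E -> C) : E -> C :=
  fun x => partials s (re g) x +i* partials s (im g) x.

Definition schwartz_seminorm (N : nat) (g : E -> C) : \bar R :=
  ereal_sup [set y | exists (s : seq 'I_d) (x : E), (size s <= N)%N /\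
    y = ((1 + enorm x) ^+ N * cabs (cpartials s g x))%:E].

Definition schwartz : set (E -> C) :=
  [set g | csmooth g /\ forall N, (schwartz_seminorm N g < +oo)%E].

(* A tempered distribution is represented by its extension by 0 to all
   functions E -> C, so that two tempered distributions are equal exactly when
   they are equal as Rocq functions. *)
Definition dist := (E -> C) -> C.

Definition tempered : set dist := [set T : dist |
  [/\ forall (a : C) (g h : E -> C), schwartz g -> schwartz h ->
        T (fun x => a * g x + h x) = a * T g + T h,
      exists (N : nat) (c : R), forall g, schwartz g ->
        ((cabs (T g))%:E <= c%:E * schwartz_seminorm N g)%E
    & forall g, ~ schwartz g -> T g = 0]].

Definition extend0 (T : dist) : dist :=
  fun g => if `[< schwartz g >] then T g else 0.

Definition cis (a : R) : C := cos a +i* sin a.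

Definition fourier (g : E -> C) : E -> C := fun xi =>
  ((2 * pi) `^ (- (d%:R / 2)))%:C%C *
  cintegral (fun x => cis (- dotp x xi) * g x).

Definition inv_fourier (g : E -> C) : E -> C := fun x =>
  ((2 * pi) `^ (- (d%:R / 2)))%:C%C *
  cintegral (fun xi => cis (dotp x xi) * g xi).

Definition dist_fourier (T : dist) : dist := extend0 (fun g => T (fourier g)).

Definition dist_inv_fourier (T : dist) : dist :=
  extend0 (fun g => T (inv_fourier g)).

Definition dist_mul (m : E -> C) (T : dist) : dist :=
  extend0 (fun g => T (fun x => m x * g x)).

Definition represents (h : E -> C) (T : dist) : Prop :=
  forall g, schwartz g ->
    cintegrable (fun x => h x * g x) /\ T g = cintegral (fun x => h x * g x).

(* The continuous function that a regular distribution is identified with;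
   it is unique, and it exists for the distributions [lp_piece] below, which
   have compactly supported Fourier transform. *)
Definition dist_fun (T : dist) : E -> C :=
  xget (fun=> 0) [set h | ccontinuous h /\ represents h T].

Definition resolution_generator (phi0 : E -> C) : Prop :=
  [/\ csmooth phi0,
      forall xi, enorm xi <= 1 -> phi0 xi = 1
    & closure [set xi | phi0 xi != 0] `<=` [set xi | enorm xi <= 2]].

Definition dyadic (phi0 : E -> C) (j : nat) : E -> C := fun xi =>
  if j is k.+1 then phi0 ((2 ^- k.+1) *: xi) - phi0 ((2 ^- k) *: xi)
  else phi0 xi.

Definition lp_piece (phi0 : E -> C) (j : nat) (f : dist) : E -> C :=
  dist_fun (dist_inv_fourier (dist_mul (dyadic phi0 j) (dist_fourier f))).

(* (sum_j a_j^q)^(1/q) for nonnegative a, and sup_j a_j if q = +oo. *)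
Definition lq (q : \bar R) (a : nat -> \bar R) : \bar R :=
  if q is q'%:E then ((\sum_(0 <= j <oo) a j `^ q') `^ q'^-1)%E
  else ereal_sup (range a).

Definition lq_block (q : \bar R) (m n : nat) (a : nat -> \bar R) : \bar R :=
  if q is q'%:E then ((\sum_(m <= j < n) a j `^ q') `^ q'^-1)%E
  else (\big[maxe/0]_(m <= j < n) a j)%E.

Definition Lp (p : \bar R) (g : E -> \bar R) : \bar R :=
  Lnorm mu p (fun t => g (row_of_tuple t)).

Definition weighted_piece (phi0 : E -> C) (s : R) (f : dist) (j : nat) (x : E) :
    \bar R :=
  (2 `^ (j%:R * s) * cabs (lp_piece phi0 j f x))%:E.

(* The quasi-norm is only meaningful on the carrier. *)
Record qspace := QSpace { carrier : set dist ; qnorm : dist -> \bar R }.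

Definition tempered_space (N : dist -> \bar R) : qspace :=
  QSpace [set f | tempered f /\ (N f < +oo)%E] N.

Definition Bspace (phi0 : E -> C) (s : R) (p q : \bar R) : qspace :=
  tempered_space (fun f => lq q (fun j => Lp p (weighted_piece phi0 s f j))).

Definition Fspace (phi0 : E -> C) (s : R) (p q : \bar R) : qspace :=
  tempered_space (fun f =>
    Lp p (fun x => lq q (fun j => weighted_piece phi0 s f j x))).

Definition TFspace (phi0 : E -> C) (b : R) (r : \bar R) (s : R) (p q : \bar R) :
    qspace :=
  tempered_space (fun f => lq r (fun j => (2 `^ (j%:R * b))%:E *
    Lp p (fun x => lq_block q (2 ^ j).-1 (2 ^ j.+1).-1
            (fun nu => weighted_piece phi0 s f nu x)))%E).

Inductive scale := BesovScale | TriebelLizorkinScale.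

Definition Aspace (A : scale) : (E -> C) -> R -> \bar R -> \bar R -> qspace :=
  match A with BesovScale => Bspace | TriebelLizorkinScale => Fspace end.

Definition Kfunctional (A0 A1 : qspace) (t : R) (f : dist) : \bar R :=
  ereal_inf [set y | exists f0 f1 : dist,
    [/\ carrier A0 f0, carrier A1 f1, f = (fun g => f0 g + f1 g)
      & y = (qnorm A0 f0 + t%:E * qnorm A1 f1)%E]].

Definition limiting_integrand (theta beta : R) (A0 A1 : qspace) (f : dist)
    (t : R) : \bar R :=
  ((t `^ (- theta) * (1 - ln t) `^ beta)%:E * Kfunctional A0 A1 t f)%E.

Definition limiting_norm (theta beta : R) (r : \bar R) (A0 A1 : qspace)
    (f : dist) : \bar R :=
  if r is r'%:E then
    ((\int[lebesgue_measure]_(t in `]0%R, 1%R[)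
       (limiting_integrand theta beta A0 A1 f t `^ r' * (t^-1)%:E)) `^ r'^-1)%E
  else ereal_sup [set limiting_integrand theta beta A0 A1 f t | t in `]0%R, 1%R[].

Definition limiting_interpolation (A0 A1 : qspace) (theta beta : R)
    (r : \bar R) : qspace :=
  QSpace [set f | carrier A0 f /\ (limiting_norm theta beta r A0 A1 f < +oo)%E]
    (limiting_norm theta beta r A0 A1).

Definition equal_spaces (X Y : qspace) : Prop :=
  carrier X = carrier Y /\
  exists c1 c2 : R, [/\ 0 < c1, 0 < c2 & forall f, carrier X f ->
    (c1%:E * qnorm X f <= qnorm Y f)%E /\ (qnorm Y f <= c2%:E * qnorm X f)%E].

End function_spaces.

(* Main.v *)
Require Import Defs.
From mathcomp Require Import all_boot all_order all_algebra.
From mathcomp Require Import complex.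
From mathcomp Require Import all_classical all_reals all_analysis.
From mathcomp Require Import measurable_realfun ring lra zify.

(** Why the theorem holds.  Let u_n be the n-th Littlewood-Paley piece of f, let
    c = |s0 - s|, let N_j = 2^j - 1 be the first frequency of the j-th block, and let
    B_j(f) be the Lp norm of the lq norm of the 2^(ns) u_n with N_j <= n < N_(j+1).  The
    norm of the truncated space is the lr norm of the numbers 2^(jb) B_j(f).  The points
    t_j = 2^(-c N_j) cut the unit interval into pieces on which 1 - log t is comparable
    to 2^j and whose logarithmic length is a multiple of 2^j.  So the logarithmic weight
    of exponent b - 1/r turns an integral over the unit interval into an lr norm with
    weights 2^(jb) ([log_norm_blocks], [log_block_bounds]), and it remains to compare
    K(t_j, f), divided by t_j in the second case, with B_j(f).  The comparison need not
    be exact: contributions of other blocks i are harmless if they carry a factor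
    2^(-e |i - j|), by the discrete Hardy inequality [hardy].

    Upper bound for K.  Split f at frequency N_j into [low_part] and [high_part]; one
    of them goes to F^s and the other one to A^(s0), the sign of b deciding which.  The
    pieces of a part are u_n or 0 except for n = N_j and n = N_j + 1, where they are
    bounded in Lp by u_n, by Young's inequality, uniformly in j ([piece_norm_freq_part]).
    In F^s a part only sees blocks on one side of j, the side on which the weight
    2^(ib) grows ([F_freq_part_bound]).  In A^(s0) the change of the smoothness gives a
    factor 2^(-c |n - N_j|).  Since N_j is exponential in j, this factor is smaller,
    up to constants, than any power of 2^(-|i - j|) for n in the block i ([block_decay]).  It therefore beats
    the weights 2^(jb) on both sides, and it allows estimates so crude that they do not
    distinguish the scales A or the exponents q0 ([A_freq_part_bound]).

    Lower bound for K.  If f = X + Y, then B_j(f) is at most a constant times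
    B_j(X) + B_j(Y).  The first term is at most the F^s norm of X.  For t near
    t_j the frequencies n of the block lie on one side of the frequency attached to t,
    where 2^(ns) is at most 2^(n s0), times t or 1/t according to the case, times a
    factor with geometric decay in n.  So B_j(Y) is at most a multiple of t or 1/t times
    the A^(s0) norm of Y ([decomposition_bound], [block_norm_le_D]).

    The two statements are proved together: the boolean [0 < b] exchanges the roles of
    the spaces, and K(t, f) with K(t, f) / t.

    Distributions.  Everything about f is read off the formula u_n(y) = f(k_n(. - y)),
    where k_n is the kernel of the n-th cut-off ([lp_pieceE]).  It comes from
    [tempered_conv], which moves a tempered distribution inside a convolution integral by
    passing through finite Riemann sums.  Fourier inversion is established up to a
    constant: dilating a cut-off shows that the composition of the two transforms is
    multiplication by the integral of its kernel ([inversion_kappa]), and a symmetry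
    argument shows that this integral is nonzero ([kappa_neq0]). *)

Set Implicit Arguments.
Unset Strict Implicit.
Unset Printing Implicit Defensive.

Import Order.TTheory GRing.Theory Num.Theory.
Import numFieldTopology.Exports numFieldNormedType.Exports.

Local Open Scope classical_set_scope.
Local Open Scope ring_scope.

(** * Lebesgue measure on tuples *)

Section affine1.
Context {R : realType}.
Local Notation mR := (measurableTypeR R).
Local Notation lam := (@lebesgue_measure R).

Lemma measurable_affine1 (a v : R) :
  measurable_fun [set: mR] (fun x : mR => a * x + v : mR).
Proof.
apply: measurable_funD; last exact: measurable_cst.
by apply: measurable_funM => //; exact: measurable_cst.
Qed.

(** The rescaled image of Lebesgue measure under an affine map agrees with Lebesgue
    measure on half-open intervals, hence everywhere. *)

(** One coordinate at a time. *)
Lemma integral_affine1 (a v : R) (f : R -> \bar R) : a != 0 ->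
  measurable_fun [set: mR] f -> (forall x, 0 <= f x)%E ->
  (\int[lam]_x f (a * x + v)%R = (`|a|^-1)%:E * \int[lam]_x f x)%E.
Proof.
move=> a0 mf f0.
have na : 0 < `|a| by rewrite normr_gt0.
have nneg : 0 <= `|a| by [].
pose phi := (fun x : mR => a * x + v : mR).
pose m1 := mscale (NngNum nneg)
   (measure_function_pushforward__canonical__measure_function_Measure lam (measurable_affine1 a v)).
have mE A : measurable A -> lam A = m1 A.
  apply: (@lebesgue_measure_unique _ m1) => X /ocitvP[->|[[u w] /= uw ->]].
    by rewrite !measure0.
  rewrite /m1 /mscale /pushforward /=.
  have [agt|alt|] := ltgtP 0 a; last by move=> e; rewrite -e eqxx in a0.
  - have E : pushforward lam phi `]u, w] = lam `](u - v) / a, (w - v) / a]%classic.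
      rewrite /pushforward; congr lam.
      apply/seteqP; split=> x /=; rewrite !in_itv /= ltr_pdivrMr// ler_pdivlMr// mulrC /phi; lra.
    rewrite [pushforward _ _ _]E !lebesgue_measure_itv /= !lte_fin uw ltr_pM2r ?invr_gt0// ltrD2r uw.
    rewrite -!EFinB -EFinM; congr EFin; rewrite gtr0_norm//; field; exact: lt0r_neq0.
  - have E : pushforward lam phi `]u, w] = lam `[(w - v) / a, (u - v) / a[%classic.
      rewrite /pushforward; congr lam.
      apply/seteqP; split=> x /=; rewrite !in_itv /= ler_ndivrMr// ltr_ndivlMr// mulrC /phi; lra.
    rewrite [pushforward _ _ _]E !lebesgue_measure_itv /= !lte_fin uw ltr_nM2r ?invr_lt0// ltrD2r uw.
    rewrite -!EFinB -EFinM; congr EFin; rewrite ltr0_norm//; field; exact: ltr0_neq0.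
have -> : (\int[lam]_x f x = \int[m1]_x f x)%E.
  by apply: eq_measure_integral => A mA _; exact: mE.
rewrite ge0_integral_mscale//= muleA -EFinM mulVf ?lt0r_neq0// mul1e.
by rewrite ge0_integral_pushforward//; exact: measurable_affine1.
Qed.

Lemma integral_inv1Dsqr_lty : (\int[lam]_x ((1 + x ^+ 2)^-1)%:E < +oo)%E.
Proof.
rewrite (ge0_symfun_integralT (f := fun x : R => (1 + x ^+ 2)^-1)).
- have -> : (\int[lam]_(x in [set x : R | (0 <= x)%R]) ((1 + x ^+ 2)^-1)%:E =
             \int[lam]_(x in `[0%R, +oo[) (oneDsqr x)^-1%:E)%E.
    have -> // : [set x : R | (0 <= x)%R] = `[0, +oo[%classic.
    by apply/seteqP; split=> x /=; rewrite in_itv /= andbT.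
  by rewrite integral0y_oneDsqr -EFinM ltry.
- by move=> x; rewrite invr_ge0 addr_ge0// sqr_ge0.
- exact: continuous_oneDsqrV.
- by move=> x /=; rewrite sqrrN.
Qed.
End affine1.

Section tuple_measure.
Context {R : realType}.
Local Notation mR := (measurableTypeR R).
Local Notation mu n := (lebesgue_tuple R n).

Lemma integral_tuple_cons n (f : n.+1.-tuple mR -> \bar R) :
  measurable_fun setT f -> (forall x, 0 <= f x)%E ->
  (\int[mu n.+1]_t f t =
   \int[@lebesgue_measure R]_x \int[mu n]_t f (cons_pair (x, t)))%E.
Proof.
move=> mf f0.
transitivity (\int[@lebesgue_measure R \x mu n]_z (f \o @cons_pair R n) z)%E.
  rewrite -[in RHS](preimage_setT (@cons_pair R n)) -ge0_integral_pushforward//.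
  exact: measurable_cons_pair.
rewrite fubini_tonelli1//.
- by apply: measurableT_comp => //; exact: measurable_cons_pair.
- by move=> x; exact: f0.
Qed.

Definition affine n (a : R) (v t : n.-tuple R) : n.-tuple R :=
  [tuple a * tnth t i + tnth v i | i < n].

Lemma measurable_affine n (a : R) (v : n.-tuple R) :
  measurable_fun [set: n.-tuple mR] (affine a v : n.-tuple mR -> n.-tuple mR).
Proof.
apply/measurable_fun_tnthP => i.
have -> : (@tnth n mR)^~ i \o affine a v = (fun x => a * x + tnth v i) \o (@tnth n mR ^~ i).
  by apply/funext => t /=; rewrite tnth_mktuple.
apply: measurableT_comp; first exact: measurable_affine1.
exact: measurable_tnth.
Qed.

Lemma integral_affine n (a : R) (v : n.-tuple R) (f : n.-tuple mR -> \bar R) :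
  a != 0 -> measurable_fun setT f -> (forall x, 0 <= f x)%E ->
  (\int[mu n]_t f (affine a v t) = (`|a|^-1 ^+ n)%:E * \int[mu n]_t f t)%E.
Proof.
move=> a0; elim: n => [|n IH] in v f *; move=> mf f0.
  rewrite expr0 mul1e; apply: eq_integral => t _; congr f.
  by rewrite tuple0 [RHS]tuple0.
pose v0 := tnth v ord0; pose v' := [tuple of behead v].
have aE x t : affine a v (cons_pair (x, t)) = cons_pair (a * x + v0, affine a v' t).
  apply: eq_from_tnth => i; rewrite tnth_mktuple.
  case: (unliftP ord0 i) => [j ->|->]; last first.
  - by rewrite /v0 (tnth_nth 0) [in RHS](tnth_nth 0).
  - rewrite !tnthS tnth_mktuple /v'; congr (_ + _). rewrite !(tnth_nth 0) /= nth_behead. done.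
rewrite integral_tuple_cons//; last first.
  by apply: measurableT_comp => //; exact: measurable_affine.
have mfc x : measurable_fun [set: n.-tuple mR] (fun t => f (cons_pair (x, t))).
  apply: measurableT_comp => //; apply: measurable_cons => //; exact: measurable_id.
under eq_integral.
  move=> x _.
  under eq_integral do rewrite aE.
  rewrite (IH v' (fun t => f (cons_pair (a * x + v0, t)))) //.
  over.
have mF : measurable_fun [set: mR] (fun x => (\int[mu n]_t f (cons_pair (x, t)))%E).
  apply: (measurable_fun_fubini_tonelli_F (f \o @cons_pair R n)) => //.
  - by apply: measurableT_comp => //; exact: measurable_cons_pair.
  - by move=> z; exact: f0.
have F0 x : (0 <= \int[mu n]_t f (cons_pair (x, t)))%E by apply: integral_ge0.
rewrite (integral_affine1 _ (f := fun x => (`|a|^-1 ^+ n)%:E * \int[mu n]_t f (cons_pair (x, t)))%E a0).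
- by rewrite ge0_integralZl ?lee_fin ?exprn_ge0 ?invr_ge0// muleA -EFinM -exprS integral_tuple_cons.
- exact: measurable_funeM.
- by move=> x; rewrite mule_ge0// lee_fin exprn_ge0// invr_ge0.
Qed.

(** An integrable function which is at least a negative power of 1 + |t|; decay
    estimates are turned into integrability by comparison with it. *)
Definition tweight n (t : n.-tuple R) : R := \prod_(i < n) (1 + tnth t i ^+ 2)^-1.

Lemma measurable_tweight n : measurable_fun [set: n.-tuple mR] (@tweight n : n.-tuple mR -> R).
Proof.
apply: measurable_prod => i _ /=.
apply: (@measurableT_comp _ _ _ _ _ _ (fun x : R => (1 + x ^+ 2)^-1)) => //; last exact: measurable_tnth.
by apply: continuous_measurable_fun => x; exact: continuous_oneDsqrV.
Qed.

Lemma integral_tensor n (w : R -> R) : measurable_fun [set: mR] w -> (forall x, 0 <= w x) ->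
  (\int[mu n]_t (\prod_(i < n) w (tnth t i))%:E =
   (\int[@lebesgue_measure R]_x (w x)%:E) ^+ n)%E.
Proof.
move=> mw w0.
have mP k : measurable_fun [set: k.-tuple mR] (fun t : k.-tuple mR => \prod_(i < k) w (tnth t i)).
  by apply: measurable_prod => i _; apply: (measurableT_comp mw (measurable_tnth i)).
have P0 k (t : k.-tuple R) : 0 <= \prod_(i < k) w (tnth t i) by apply: prodr_ge0.
elim: n => [|n IH].
  rewrite (eq_integral (fun=> 1%E)); last by move=> t _; rewrite big_ord0.
  by rewrite integral_cst//= diracT mul1e.
rewrite integral_tuple_cons; last 2 first.
- by apply/measurable_EFinP; exact: mP.
- by move=> t; rewrite lee_fin.
transitivity (\int[@lebesgue_measure R]_x
    ((w x)%:E * \int[mu n]_t (\prod_(i < n) w (tnth t i))%:E))%E.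
  apply: eq_integral => x _; rewrite -ge0_integralZl//; last 3 first.
  - by apply/measurable_EFinP; exact: mP.
  - by move=> t _; rewrite lee_fin.
  - by rewrite lee_fin.
  apply: eq_integral => t _; rewrite -EFinM big_ord_recl; congr (_ * _)%:E.
  by apply: eq_bigr => i _; rewrite tnthS.
rewrite ge0_integralZr//; last 3 first.
- by apply/measurable_EFinP; exact: mw.
- by move=> x _; rewrite lee_fin.
- by apply: integral_ge0 => t _; rewrite lee_fin.
by rewrite IH expeS.
Qed.

Lemma integral_tweight_lty n : (\int[mu n]_t (tweight t)%:E < +oo)%E.
Proof.
have w0 (x : R) : 0 <= (1 + x ^+ 2)^-1 by rewrite invr_ge0 addr_ge0// sqr_ge0.
rewrite /tweight (@integral_tensor n (fun x => (1 + x ^+ 2)^-1))//.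
- have h := @integral_inv1Dsqr_lty R.
  have h0 : (0 <= \int[@lebesgue_measure R]_x ((1 + x ^+ 2)^-1)%:E)%E.
    by apply: integral_ge0 => x _; rewrite lee_fin.
  have hf : (\int[@lebesgue_measure R]_x ((1 + x ^+ 2)^-1)%:E)%E \is a fin_num by rewrite ge0_fin_numE.
  by rewrite -(fineK hf) -EFin_expe ltry.
- by apply: continuous_measurable_fun => x; exact: continuous_oneDsqrV.
Qed.

(** The normalisation of the measure; it makes integrals of positive continuous
    functions positive. *)
Lemma integral_unit_box n :
  (\int[mu n]_t (\prod_(i < n) \1_(`[0%R, 1%R]%classic : set mR) (tnth t i))%:E = 1)%E.
Proof.
rewrite (@integral_tensor n (\1_(`[0%R, 1%R]%classic : set mR)))//.
  have -> : (\int[@lebesgue_measure R]_x (\1_(`[0%R, 1%R]%classic : set mR) x)%:E = 1)%E.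
    have := @lebesgue_measure_itv R `[0, 1]; rewrite /= lte_fin ltr01 oppr0 adde0 => <-.
    by rewrite integral_indic// setIT.
  by rewrite -EFin_expe expr1n.
Qed.
End tuple_measure.

Section quantisation.
Context {R : realType}.
Local Notation mR := (measurableTypeR R).

(** The cell of x in the grid of mesh 1/(n+1) on [-n, n]. A point whose cell would be
    out of range is sent to the cell 0, so that there are finitely many cells. *)
Definition qidx (n : nat) (x : R) : 'I_(2 * n * n.+1).+1 :=
  inord (Num.truncn ((x + n%:R) * n.+1%:R)).

Definition qval (n : nat) (k : 'I_(2 * n * n.+1).+1) : R := k%:R / n.+1%:R - n%:R.

Lemma qval_le n k : `|@qval n k| <= n%:R.
Proof.
have n1 : 0 < n.+1%:R :> R by [].
rewrite ler_norml /qval lerBrDr lerBlDr; apply/andP; split.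
  by rewrite addNr divr_ge0.
rewrite ler_pdivrMr// -!natrD -natrM ler_nat.
have := ltn_ord k; lia.
Qed.

Lemma qval_qidx n x : `|x| < n%:R -> `|qval (qidx n x) - x| <= n.+1%:R^-1.
Proof.
move=> xn; have n1 : 0 < n.+1%:R :> R by [].
have /andP[xn1 xn2] : - n%:R < x < n%:R by rewrite -ltr_norml.
have y0 : 0 <= (x + n%:R) * n.+1%:R by rewrite mulr_ge0// -lerBlDr sub0r ltW.
have /andP[k1 k2] := truncn_itv y0.
have kM : (Num.truncn ((x + n%:R) * n.+1%:R) < (2 * n * n.+1).+1)%N.
  rewrite ltnS -(ler_nat R) (le_trans k1)// !natrM ler_wpM2r//; lra.
rewrite /qval /qidx inordK//.
set k := Num.truncn _ in k1 k2 *.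
have e : (k%:R / n.+1%:R - n%:R - x) = (k%:R - (x + n%:R) * n.+1%:R) / n.+1%:R.
  by field; rewrite addrC natr1.
rewrite e normrM normfV (gtr0_norm n1) ler_pdivrMr// mulVf ?lt0r_neq0//.
move: k2; rewrite -natr1 => k2; rewrite ler_norml; lra.
Qed.

Lemma qval_qidx_bnd n x : `|qval (qidx n x)| <= `|x| + 1.
Proof.
have [nx|xn] := leP n%:R `|x|.
  by rewrite (le_trans (qval_le _))// (le_trans nx)// lerDl.
have := qval_qidx xn; have : n.+1%:R^-1 <= 1 :> R by rewrite invf_le1// ler1n.
move=> h1 h2; 
by rewrite -[qval _](subrK x) (le_trans (ler_normD _ _))// addrC lerD2l (le_trans h2).
Qed.

Lemma measurable_qidx n (k : 'I_(2 * n * n.+1).+1) :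
  measurable ([set x : mR | qidx n x = k] : set mR).
Proof.
have -> : [set x : mR | qidx n x = k] =
   \bigcup_(m in [set m : nat | inord m = k])
     (fun x : mR => (x + n%:R) * n.+1%:R : mR) @^-1` [set y | Num.truncn y = m].
  by apply/seteqP; split=> [x /= <-|x [m /= <- <-]//]; exists (Num.truncn ((x + n%:R) * n.+1%:R)).
apply: bigcup_measurable => m _; rewrite -[X in measurable X]setTI.
have mf : measurable_fun [set: mR] (fun x : mR => (x + n%:R) * n.+1%:R : mR).
  by apply: measurable_funM => //; apply: measurable_funD => //.
apply: mf => //.
case: m => [|m].
  have -> : [set y : R | Num.truncn y = 0] = `]-oo, 1[%classic.
    apply/seteqP; split=> y /=; rewrite in_itv /=.
      by move=> y0; rewrite ltNge; apply/negP => y1; have := y0; apply/eqP; rewrite -lt0n truncn_gt0.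
    by move=> y1; apply/eqP; rewrite -leqn0 leqNgt truncn_gt0 -ltNge.
  exact: measurable_itv.
have -> : [set y : R | Num.truncn y = m.+1] = `[m.+1%:R, m.+2%:R[%classic.
  apply/seteqP; split=> y /=; rewrite in_itv /=; last exact: truncn_def.
  move=> ym; have y0 : 0 <= y by rewrite ltW// (lt_le_trans ltr01)// -truncn_gt0 ym.
  by have := truncn_itv y0; rewrite ym.
exact: measurable_itv.
Qed.

Context {d : nat}.
Local Notation E := 'rV[R]_d.

Definition cell_index n : finType := {ffun 'I_d -> 'I_(2 * n * n.+1).+1}.

(** Cells of a finite grid on Euclidean space. Replacing x by [cell_point (cell_of n x)]
    gives functions with finitely many values, which converge to the given one if it is
    continuous. This serves for measurability here and for the Riemann sums of
    distributions later. *)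
Definition cell_of n (x : E) : cell_index n := [ffun i => qidx n (x 0 i)].

Definition cell_point n (k : cell_index n) : E := \row_i qval (k i).

Lemma measurable_cell n (k : cell_index n) :
  measurable_fun [set: d.-tuple mR] (fun t => (cell_of n (row_of_tuple t) == k)%:R : R).
Proof.
have -> : (fun t : d.-tuple mR => (cell_of n (row_of_tuple t) == k)%:R : R) =
  fun t => \prod_(i < d) \1_[set x : mR | qidx n x = k i] (tnth t i).
  apply/funext => t; have [e|ne] := eqVneq.
    rewrite big1// => i _; rewrite indicE mem_set//= -e ffunE mxE//.
  have [i ki] : exists i, qidx n (tnth t i) != k i.
    apply/existsP; rewrite -negb_forall; apply: contra ne => /forallP h.
    by apply/eqP/ffunP => i; rewrite ffunE mxE; apply/eqP.
  by rewrite (bigD1 i)//= indicE memNset ?mul0r//=; apply/eqP.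
apply: measurable_prod => i _.
have mI : measurable_fun [set: mR] (\1_[set x : mR | qidx n x = k i] : mR -> R).
  exact: measurable_indic (measurable_qidx _).
exact: (measurableT_comp mI (measurable_tnth i)).
Qed.

Lemma sum_cells (V : nmodType) n (F : cell_index n -> V) x :
  F (cell_of n x) = \sum_k (F k *+ (cell_of n x == k)).
Proof.
rewrite (bigD1 (cell_of n x))//= eqxx mulr1n big1 ?addr0// => k kx.
by rewrite eq_sym (negbTE kx) mulr0n.
Qed.

Lemma norm_coord_le (x : E) i : `|x 0 i| <= `|x|.
Proof.
rewrite [leRHS]mx_normrE.
exact: (le_bigmax _ (fun ij : 'I_1 * 'I_d => `|x ij.1 ij.2|) (0, i)).
Qed.

Lemma norm_le_coord (x : E) e : 0 <= e -> (forall i, `|x 0 i| <= e) -> `|x| <= e.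
Proof.
move=> e0 xe; rewrite [leLHS]mx_normrE; apply: bigmax_le => // -[a b] _ /=.
by rewrite (ord1 a).
Qed.

(** The bound also holds for points off the grid, which makes dominated convergence
    applicable to functions of polynomial growth. *)
Lemma cell_point_bnd n (x : E) : `|cell_point (cell_of n x)| <= `|x| + 1.
Proof.
apply: norm_le_coord => [|i]; first by rewrite addr_ge0.
by rewrite mxE ffunE (le_trans (qval_qidx_bnd _ _))// lerD2r norm_coord_le.
Qed.

Lemma cell_point_near n (x : E) : `|x| < n%:R ->
  `|cell_point (cell_of n x) - x| <= n.+1%:R^-1.
Proof.
move=> xn; apply: norm_le_coord => [|i]; first by rewrite invr_ge0.
by rewrite !mxE ffunE qval_qidx// (le_lt_trans (norm_coord_le _ _)).
Qed.

Lemma cell_point_cvg (x : E) : (fun n => cell_point (cell_of n x)) @ \oo --> x.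
Proof.
apply/cvgrPdist_le => e e0; near=> n.
rewrite distrC (le_trans (cell_point_near _))//.
  by near: n; exact: nbhs_infty_gtr.
rewrite -(invrK e) lef_pV2 ?posrE ?invr_gt0// (@le_trans _ _ n%:R)//.
  by near: n; exact: nbhs_infty_ger.
by rewrite ler_nat.
Unshelve. all: end_near. Qed.

Lemma measurable_quantised (f : E -> R) n :
  measurable_fun [set: d.-tuple mR] (fun t => f (cell_point (cell_of n (row_of_tuple t)))).
Proof.
under eq_fun do rewrite (sum_cells (fun k => f (cell_point k))).
apply: measurable_sum => k.
under eq_fun do rewrite -mulr_natr.
by apply: measurable_funM; [exact: measurable_cst|exact: measurable_cell].
Qed.

(** The product sigma-algebra of the tuples is not defined from the topology; a
    continuous function is measurable as the limit of its quantisations. *)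
Lemma continuous_measurable_tuple (f : E -> R) : continuous f ->
  measurable_fun [set: d.-tuple mR] (f \o @row_of_tuple R d).
Proof.
move=> cf; apply: (measurable_fun_cvg (measurable_quantised f)) => t _ /=.
by apply: continuous_cvg; [exact: cf|exact: cell_point_cvg].
Qed.

End quantisation.

(** * Integration and differentiation on Euclidean space *)

Section integration.
Context {R : realType} {d : nat}.
Local Notation mR := (measurableTypeR R).
Local Notation E := 'rV[R]_d.
Local Notation mu := (lebesgue_tuple R d).
Local Notation rt := (@row_of_tuple R d).

(** Measurability, integrability and the integral for functions of row vectors, read
    through the identification of row vectors with tuples, where the measure lives. *)
Definition emeas (f : E -> R) := measurable_fun [set: d.-tuple mR] (f \o rt).
Definition L1 (f : E -> R) := mu.-integrable setT (fun t => (f (rt t))%:E).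
Definition Int (f : E -> R) : R := \int[mu]_t f (rt t).

Definition weight (x : E) : R := \prod_(i < d) (1 + x 0 i ^+ 2)^-1.

Lemma weightE (t : d.-tuple R) : weight (rt t) = tweight t.
Proof. by apply: eq_bigr => i _; rewrite mxE. Qed.

Lemma weight_ge0 x : 0 <= weight x.
Proof. by apply: prodr_ge0 => i _; rewrite invr_ge0 addr_ge0// sqr_ge0. Qed.

Lemma L1_weight : L1 weight.
Proof.
apply/integrableP; split.
  apply/measurable_EFinP; under eq_fun do rewrite weightE; exact: measurable_tweight.
under eq_integral do rewrite gee0_abs ?lee_fin ?weight_ge0// weightE.
exact: integral_tweight_lty.
Qed.

(** Each of the d factors 1 + x_i^2 is at most (1 + |x|)^2. *)
Lemma weight_lower x : 1 <= (1 + `|x|) ^+ (2 * d) * weight x.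
Proof.
rewrite exprM -[X in _ ^+ X]card_ord -prodr_const -big_split /=.
rewrite [leLHS](_ : 1 = \prod_(i in 'I_d) 1); last by rewrite big1_eq.
apply: ler_prod => i _; rewrite ler01 /=.
have p : 0 < 1 + x 0 i ^+ 2 by rewrite ltr_pwDl// sqr_ge0.
rewrite ler_pdivlMr// mul1r sqrrD expr1n mulr2n mul1r.
have h : x 0 i ^+ 2 <= `|x| ^+ 2.
  by rewrite -[x 0 i ^+ 2]real_normK ?num_real// lerXn2r ?nnegrE// norm_coord_le.
have : 0 <= `|x| by [].
move: h; set u := x 0 i ^+ 2; set w := `|x| ^+ 2; set z := `|x|; lra.
Qed.

Lemma L1_emeas f : L1 f -> emeas f.
Proof. by move=> /integrableP[/measurable_EFinP]. Qed.

Lemma emeas_continuous (f : E -> R) : continuous f -> emeas f.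
Proof. exact: continuous_measurable_tuple. Qed.

Lemma L1_le f g : emeas f -> L1 g -> (forall x, `|f x| <= g x) -> L1 f.
Proof.
move=> mf Lg fg; apply: (le_integrable _ _ _ Lg) => //; first exact/measurable_EFinP.
by move=> t _; rewrite /= lee_fin (le_trans (fg _))// ler_norm.
Qed.

Lemma L1D f g : L1 f -> L1 g -> L1 (fun x => f x + g x).
Proof. by move=> Lf Lg; have := integrableD measurableT Lf Lg. Qed.

Lemma L1Z a f : L1 f -> L1 (fun x => a * f x).
Proof. by move=> Lf; have := integrableZl measurableT a Lf. Qed.

Lemma L1N f : L1 f -> L1 (fun x => - f x).
Proof. by move=> /(L1Z (-1)); under eq_fun do rewrite mulN1r. Qed.

Lemma L1B f g : L1 f -> L1 g -> L1 (fun x => f x - g x).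
Proof. by move=> Lf /L1N; exact: L1D. Qed.

Lemma L1_norm f : L1 f -> L1 (fun x => `|f x|).
Proof.
move=> Lf; apply: (le_integrable _ _ _ Lf) => //.
  by apply/measurable_EFinP; apply: measurableT_comp => //; exact: L1_emeas.
by move=> t _ /=; rewrite normr_id.
Qed.

Lemma L1_0 : L1 (fun=> 0).
Proof. exact: integrable0. Qed.

Lemma IntD f g : L1 f -> L1 g -> Int (fun x => f x + g x) = Int f + Int g.
Proof. by move=> Lf Lg; rewrite /Int RintegralD. Qed.

Lemma IntZ a f : L1 f -> Int (fun x => a * f x) = a * Int f.
Proof. by move=> Lf; rewrite /Int RintegralZl. Qed.

Lemma IntN f : L1 f -> Int (fun x => - f x) = - Int f.
Proof. by move=> Lf; rewrite -[RHS]mulN1r -IntZ//; under [in RHS]eq_fun do rewrite mulN1r. Qed.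

Lemma IntB f g : L1 f -> L1 g -> Int (fun x => f x - g x) = Int f - Int g.
Proof. by move=> Lf Lg; rewrite IntD ?IntN//; exact: L1N. Qed.

Lemma Int0 : Int (fun=> 0) = 0.
Proof. by rewrite /Int /Rintegral integral0. Qed.

Lemma Int_le f g : L1 f -> L1 g -> (forall x, f x <= g x) -> Int f <= Int g.
Proof. by move=> Lf Lg fg; apply: le_Rintegral. Qed.

Lemma Int_ge0 f : (forall x, 0 <= f x) -> 0 <= Int f.
Proof. by move=> f0; apply: Rintegral_ge0. Qed.

Lemma Int_norm f : L1 f -> `|Int f| <= Int (fun x => `|f x|).
Proof. by move=> Lf; apply: le_normr_Rintegral. Qed.

Lemma Int_norm_le f g : L1 f -> L1 g -> (forall x, `|f x| <= g x) -> `|Int f| <= Int g.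
Proof. by move=> Lf Lg fg; rewrite (le_trans (Int_norm Lf))// Int_le//; exact: L1_norm. Qed.

(** The exponent 2d is the one for which the bound implies integrability. *)
Definition decays (C : R) (f : E -> R) := forall x, (1 + `|x|) ^+ (2 * d) * `|f x| <= C.

Lemma decays_weight C f : decays C f -> forall x, `|f x| <= C * weight x.
Proof.
move=> Cf x; have p : 0 < (1 + `|x|) ^+ (2 * d) by rewrite exprn_gt0// ltr_pwDl.
rewrite -(ler_pM2l p) mulrCA; apply: le_trans (Cf x) _.
rewrite ler_peMr ?weight_lower//; apply: le_trans (Cf x); rewrite mulr_ge0// ltW//.
Qed.

Lemma L1_decays C f : emeas f -> decays C f -> L1 f.
Proof. by move=> mf /decays_weight; apply: L1_le => //; apply: L1Z; exact: L1_weight. Qed.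

Lemma Int_lim (f_ : nat -> E -> R) f g : (forall n, emeas (f_ n)) -> emeas f -> L1 g ->
  (forall n x, `|f_ n x| <= g x) -> (forall x, f_ n x @[n --> \oo] --> f x) ->
  Int (f_ n) @[n --> \oo] --> Int f.
Proof.
move=> mf_ mf Lg fg ff.
have Lf_ n : L1 (f_ n) by apply: L1_le (fg n).
have Lf : L1 f.
  apply: (L1_le mf Lg) => x.
  have nf : `|f_ n x| @[n --> \oo] --> `|f x| by apply: cvg_norm; exact: ff.
  rewrite -(cvg_lim _ nf)//; apply: limr_le; first by apply/cvg_ex; exists `|f x|.
  by apply: nearW => n; exact: fg.
apply: fine_cvg; rewrite /Rintegral fineK; last exact: integrable_fin_num.
apply: (@dominated_cvg _ _ _ mu _ _ _ _ (fun t => (g (rt t))%:E)) => //.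
- by move=> n; apply/measurable_EFinP; exact: mf_.
- by move=> t _; apply: cvg_EFin; [exact: nearW|exact: ff].
- by move=> n t _; rewrite /= lee_fin fg.
Qed.

Lemma rt_affine a (v : E) (t : d.-tuple R) :
  a *: rt t + v = rt (affine a [tuple v 0 i | i < d] t).
Proof. by apply/rowP => i; rewrite !mxE !tnth_mktuple. Qed.

Lemma emeas_affine a v f : emeas f -> emeas (fun x => f (a *: x + v)).
Proof.
move=> mf; rewrite /emeas /comp; under eq_fun do rewrite rt_affine.
by apply: (measurableT_comp mf); exact: measurable_affine.
Qed.

Lemma ge0_integral_affineE a v (f : E -> \bar R) : a != 0 ->
  measurable_fun [set: d.-tuple mR] (f \o rt) -> (forall x, 0 <= f x)%E ->
  (\int[mu]_t f (a *: rt t + v)%R = (`|a|^-1 ^+ d)%:E * \int[mu]_t f (rt t))%E.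
Proof.
move=> a0 mf f0; under eq_integral do rewrite rt_affine.
exact: (integral_affine [tuple v 0 i | i < d] (f := f \o rt) a0 mf (fun t => f0 (rt t))).
Qed.

Lemma L1_affine a v f : a != 0 -> L1 f -> L1 (fun x => f (a *: x + v)).
Proof.
move=> a0 Lf; apply/integrableP; split.
  by apply/measurable_EFinP; apply: emeas_affine; exact: L1_emeas.
rewrite (ge0_integral_affineE v (f := fun x => `|(f x)%:E|%E))//.
- apply: lte_mul_pinfty => //.
  by have /integrableP[] := Lf.
- by apply: measurableT_comp => //; apply/measurable_EFinP; exact: L1_emeas.
Qed.

Lemma Int_affine a v f : a != 0 -> L1 f -> Int (fun x => f (a *: x + v)) = `|a|^-1 ^+ d * Int f.
Proof.
move=> a0 Lf; have mf := L1_emeas Lf.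
have ge0 g : L1 g -> (forall x, 0 <= g x) -> Int (fun x => g (a *: x + v)) = `|a|^-1 ^+ d * Int g.
  move=> Lg g0; rewrite /Int /Rintegral (ge0_integral_affineE v (f := fun x => (g x)%:E) a0)//.
  - by rewrite fineM//; exact: integrable_fin_num.
  - by apply/measurable_EFinP; exact: L1_emeas.
have Lp : L1 (fun x => `|f x| + f x) by apply: L1D => //; exact: L1_norm.
have p0 x : 0 <= `|f x| + f x by rewrite -lerBlDr sub0r -normrN ler_norm.
have -> : Int f = Int (fun x => `|f x| + f x) - Int (fun x => `|f x|).
  by rewrite (IntD (L1_norm Lf) Lf) [_ + Int f]addrC addrK.
rewrite mulrBr -!ge0//; last exact: L1_norm.
rewrite -IntB; last 2 first.
- exact: (L1_affine v a0 Lp).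
- exact: (L1_affine v a0 (L1_norm Lf)).
by congr Int; apply/funext => x; rewrite [_ + f _]addrC addrK.
Qed.

Definition emeas2 (f : E -> E -> R) :=
  measurable_fun [set: d.-tuple mR * d.-tuple mR] (fun st => f (rt st.1) (rt st.2)).

Lemma emeas2_1 f : emeas f -> emeas2 (fun x _ => f x).
Proof. by move=> mf; apply: (measurableT_comp mf). Qed.

Lemma emeas2_2 f : emeas f -> emeas2 (fun _ y => f y).
Proof. by move=> mf; apply: (measurableT_comp mf). Qed.

Lemma emeas2M f g : emeas2 f -> emeas2 g -> emeas2 (fun x y => f x y * g x y).
Proof. exact: measurable_funM. Qed.

Lemma emeas2D f g : emeas2 f -> emeas2 g -> emeas2 (fun x y => f x y + g x y).
Proof. exact: measurable_funD. Qed.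

Lemma emeas2N f : emeas2 f -> emeas2 (fun x y => - f x y).
Proof. by move=> mf; apply: (measurableT_comp _ mf). Qed.

Lemma emeas2_dotp : emeas2 (fun x y => dotp x y).
Proof.
rewrite /emeas2 /dotp; apply: measurable_sum => i.
under eq_fun do rewrite !mxE.
apply: measurable_funM.
  exact: (measurableT_comp (@measurable_tnth _ mR d i) measurable_fst).
exact: (measurableT_comp (@measurable_tnth _ mR d i) measurable_snd).
Qed.

Lemma emeas2_sub f : emeas f -> emeas2 (fun x y => f (x - y)).
Proof.
move=> mf; rewrite /emeas2.
have -> : (fun st : d.-tuple mR * d.-tuple mR => f (rt st.1 - rt st.2)) =
   (f \o rt) \o (fun st => [tuple tnth st.1 i - tnth st.2 i | i < d]).
  apply/funext => st /=; congr f; apply/rowP => i; rewrite !mxE tnth_mktuple//.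
apply: (measurableT_comp mf); apply/measurable_fun_tnthP => i.
rewrite /comp; under eq_fun do rewrite tnth_mktuple.
apply: measurable_funB.
  exact: (measurableT_comp (@measurable_tnth _ mR d i) measurable_fst).
exact: (measurableT_comp (@measurable_tnth _ mR d i) measurable_snd).
Qed.

Definition decays2 (C : R) (f : E -> E -> R) :=
  forall x y, (1 + `|x|) ^+ (2 * d) * ((1 + `|y|) ^+ (2 * d) * `|f x y|) <= C.

(** Joint decay gives domination by a product of integrable functions, hence
    integrability for the product measure. *)
Lemma fubini2 C f : emeas2 f -> decays2 C f ->
  Int (fun x => Int (fun y => f x y)) = Int (fun y => Int (fun x => f x y)).
Proof.
move=> mf Cf.
have fw x y : `|f x y| <= C * weight x * weight y.
  have pos (z : E) : 0 < (1 + `|z|) ^+ (2 * d) by rewrite exprn_gt0// ltr_pwDl.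
  have Cx : decays (C * weight x) (f x).
    move=> {}y; apply: le_trans (_ : _ <= `|(1 + `|y|) ^+ (2 * d) * `|f x y| |) _.
      exact: ler_norm.
    apply: (@decays_weight C (fun x => (1 + `|y|) ^+ (2 * d) * `|f x y|)) => {}x.
    by rewrite normrM normr_id (gtr0_norm (pos y)).
  exact: (decays_weight Cx).
have C0 : 0 <= C by apply: le_trans (Cf 0 0); rewrite !mulr_ge0.
have mfE : measurable_fun [set: d.-tuple mR * d.-tuple mR] (fun st => (f (rt st.1) (rt st.2))%:E).
  exact/measurable_EFinP.
have intf : (mu \x mu)%E.-integrable setT (fun st => (f (rt st.1) (rt st.2))%:E).
  apply/(integrable12ltyP mu mu mfE).
  apply: (@le_lt_trans _ _ (\int[mu]_s \int[mu]_t ((C * weight (rt s)) * weight (rt t))%:E)%E).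
    apply: ge0_le_integral => //.
    - by move=> s _; exact: integral_ge0.
    - apply: (measurable_fun_fubini_tonelli_F (m2 := mu) (fun st => `|(f (rt st.1) (rt st.2))%:E|%E)) => //.
      exact: measurableT_comp.
    - apply: (measurable_fun_fubini_tonelli_F (m2 := mu) (fun st => ((C * weight (rt st.1)) * weight (rt st.2))%:E)).
        apply/measurable_EFinP; apply: (@emeas2M (fun x y => C * weight x) (fun x y => weight y)).
          apply: (@emeas2M (fun x y => C) (fun x y => weight x)); first exact: measurable_cst.
          by apply: emeas2_1; apply: L1_emeas L1_weight.
        by apply: emeas2_2; apply: L1_emeas L1_weight.
      by move=> st; rewrite lee_fin !mulr_ge0 ?weight_ge0.
    - move=> s _; apply: ge0_le_integral => //.
      + apply: measurableT_comp => //; apply/measurable_EFinP.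
        exact: (measurableT_comp mf (pair1_measurable s)).
      + apply/measurable_EFinP; apply: measurable_funM => //; exact: L1_emeas L1_weight.
      + by move=> t _; rewrite lee_fin.
  have wfin : (\int[mu]_t (weight (rt t))%:E)%E \is a fin_num by apply: integrable_fin_num => //; exact: L1_weight.
  under eq_integral.
    move=> s _; under eq_integral do rewrite EFinM.
    rewrite ge0_integralZl//; last 3 first.
    - by apply/measurable_EFinP; exact: L1_emeas L1_weight.
    - by move=> t _; rewrite lee_fin weight_ge0.
    - by rewrite lee_fin mulr_ge0// weight_ge0.
    rewrite EFinM; over.
  rewrite -(fineK wfin).
  under eq_integral do rewrite -!EFinM.
  apply: integrable_lty => //; under eq_fun do rewrite mulrAC.
  by apply: L1Z; exact: L1_weight.
have := @Fubini _ _ _ _ _ mu mu _ intf => /= h.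
have dom (g : E -> R) c : emeas g -> (forall x, `|g x| <= c * weight x) -> L1 g.
  by move=> mg gc; apply: (L1_le mg _ gc); apply: L1Z; exact: L1_weight.
have int1 s : L1 (f (rt s)).
  by apply: (dom _ (C * weight (rt s))) => //; exact: (measurableT_comp mf (pair1_measurable s)).
have int2 t : L1 (fun x => f x (rt t)).
  apply: (dom _ (C * weight (rt t))); first exact: (measurableT_comp mf (pair2_measurable t)).
  by move=> x; rewrite mulrAC.
rewrite /Int /Rintegral; congr fine.
transitivity (\int[mu]_s \int[mu]_t (f (rt s) (rt t))%:E)%E.
  apply: eq_integral => s _.
  by rewrite fineK//; apply: integrable_fin_num => //; exact: int1.
rewrite h; apply: eq_integral => t _.
by rewrite fineK//; apply: integrable_fin_num => //; exact: int2.
Qed.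

End integration.

Section calculus.
Context {R : realType} {d : nat}.
Local Notation mR := (measurableTypeR R).
Local Notation E := 'rV[R]_d.
Local Notation mu := (lebesgue_tuple R d).
Local Notation rt := (@row_of_tuple R d).
Local Notation e i := (delta_mx 0 i : E).

Lemma continuous_epsP (f : E -> R) : continuous f <->
  (forall (x : E) (eps : R), 0 < eps -> exists2 de : R, 0 < de & forall y : E, `|y - x| < de -> `|f y - f x| <= eps).
Proof.
split=> [cf x eps e0|H x].
  have h : nbhs (x : [the normedModType R of E]) [set y | `|f x - f y| <= eps].
    have /cvgrPdist_le := cf x; move=> /(_ _ e0); exact.
  have /nbhs_normP[de de0 H] := h.
  by exists de => // y yx; rewrite distrC; apply: H; rewrite /ball_ /= distrC.
apply/(@cvgrPdist_le _ _ _ _ (nbhs_filter _)) => eps eps0.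
have [de de0 h] := H x _ eps0.
have h' : nbhs (x : [the normedModType R of E]) [set y | `|f x - f y| <= eps].
  apply: ((@nbhs_normP R [the normedModType R of E] x _).2); exists de => // y; rewrite /ball_ /= distrC => yx.
  by rewrite distrC; exact: h.
exact: h'.
Qed.

Definition pd (i : 'I_d) (f : E -> R) : E -> R := fun x => 'D_(e i) f x.

Lemma line_quotE (f : E -> R) (x v : E) t :
  (fun h : R => h^-1 *: (((fun h => f (x + h *: v)) \o shift t) (h *: 1) - f (x + t *: v))) =
  (fun h : R => h^-1 *: ((f \o shift (x + t *: v)) (h *: v) - f (x + t *: v))).
Proof.
apply/funext => h /=; congr (_ *: (f _ - _)).
by rewrite [h%:A]mulr1 scalerDl addrCA.
Qed.

Lemma is_derive_line (f : E -> R) (x v : E) t : derivable f (x + t *: v) v ->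
  is_derive t 1 (fun h : R => f (x + h *: v)) ('D_v f (x + t *: v)).
Proof. by move=> df; split; rewrite /derivable /derive line_quotE. Qed.

Lemma derivable_line (f : E -> R) (x v : E) :
  derivable (fun h : R => f (x + h *: v)) 0 1 -> derivable f x v.
Proof. by rewrite /derivable line_quotE scale0r addr0. Qed.

Lemma derive_line (f : E -> R) (x v : E) :
  'D_v f x = 'D_1 (fun h : R => f (x + h *: v)) 0.
Proof. by rewrite /derive line_quotE scale0r addr0. Qed.

Lemma mvt_norm (g dg : R -> R) (a M : R) :
  (forall t : R, is_derive t (1:R) g (dg t)) -> (forall t : R, `|t| <= `|a| -> `|dg t| <= M) ->
  `|g a - g 0| <= M * `|a|.
Proof.
move=> Dg gM.
have cg : continuous g.
  by move=> t; apply: differentiable_continuous; apply/derivable1_diffP; apply: ex_derive.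
have [a0|a0] := leP 0 a.
  have [c + ->] := MVT_segment a0 (fun t _ => Dg t) (continuous_subspaceT cg).
  rewrite in_itv /= subr0 => /andP[c0 ca]; rewrite normrM ler_wpM2r// gM//.
  by rewrite !ger0_norm.
have [c + h] := MVT_segment (ltW a0) (fun t _ => Dg t) (continuous_subspaceT cg).
rewrite in_itv /= => /andP[ca c0]; rewrite distrC h sub0r normrM normrN ler_wpM2r// gM//.
by rewrite (ltr0_norm a0) ler0_norm// lerN2.
Qed.

(** Go from x to y by changing one coordinate at a time and apply the mean value theorem
    on each of the d segments; the path stays in the cube around x through y. *)
Lemma coord_lipschitz (f : E -> R) (x y : E) (M : R) : 0 <= M ->
  (forall (i : 'I_d) (z : E), derivable f z (e i)) ->
  (forall (i : 'I_d) (z : E), `|z - x| <= `|y - x| -> `|pd i f z| <= M) ->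
  `|f y - f x| <= d%:R * M * `|y - x|.
Proof.
move=> M0 Df fM.
pose pt (k : nat) : E := \row_i (if (i < k)%N then y 0 i else x 0 i).
have pt0 : pt 0%N = x by apply/rowP => i; rewrite mxE.
have ptd : pt d = y by apply/rowP => i; rewrite mxE ltn_ord.
have ptS (k : 'I_d) : pt k.+1 = pt k + (y 0 k - x 0 k) *: e k.
  apply/rowP => i; rewrite !mxE eqxx /= ltnS leq_eqVlt.
  have [->|ik] := eqVneq i k; first by rewrite eqxx ltnn mulr1 addrC subrK.
  by rewrite (_ : (i == k :> nat) = false) ?mulr0 ?addr0//; exact/negbTE.
rewrite -{1}ptd -{1}pt0 -(telescope_sumr (fun k => f (pt k)))// big_mkord.
apply: le_trans (ler_norm_sum _ _ _) _.
apply: (@le_trans _ _ (\sum_(i < d) M * `|y - x|)); last first.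
  by rewrite sumr_const card_ord -[leLHS]mulr_natl mulrA.
apply: ler_sum => k _; rewrite ptS.
set a := y 0 k - x 0 k.
have ay : `|a| <= `|y - x| by have := norm_coord_le (y - x) k; rewrite !mxE.
have := @mvt_norm (fun h : R => f (pt k + h *: e k)) (fun h => pd k f (pt k + h *: e k)) a M.
rewrite scale0r addr0 => /(_ (fun t => is_derive_line (Df k _))) h.
apply: le_trans (h _) _; last by rewrite ler_wpM2l.
move=> t ta; apply: fM; apply: norm_le_coord => // i.
rewrite !mxE eqxx /=.
have [->|ik] := eqVneq i k.
  by rewrite ltnn mulr1 addrAC subrr add0r (le_trans ta).
rewrite mulr0 addr0; case: ifP => _; last by rewrite subrr normr0.
by have := norm_coord_le (y - x) i; rewrite !mxE.
Qed.

(** Differentiability along coordinate lines does not imply continuity by itself;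
    locally bounded partial derivatives do, by the Lipschitz estimate. *)
Lemma bounded_pd_continuous (f : E -> R) :
  (forall (i : 'I_d) (z : E), derivable f z (e i)) ->
  (forall x : E, exists M : R, forall (i : 'I_d) (z : E), `|z - x| <= 1 -> `|pd i f z| <= M) ->
  continuous f.
Proof.
move=> Df Mf; apply/continuous_epsP => x eps eps0; have [M fM] := Mf x.
pose M' := `|M| + 1.
have M'0 : 0 < M' by rewrite ltr_wpDl.
have fM' i z : `|z - x| <= 1 -> `|pd i f z| <= M'.
  by move=> /(fM i) h; rewrite (le_trans h)// (le_trans (ler_norm _))// lerDl.
have dM : 0 < d%:R * M' + 1 by rewrite ltr_wpDl// mulr_ge0// ltW.
exists (Num.min 1 (eps / (d%:R * M' + 1))) => /=.
  by rewrite lt_min ltr01 divr_gt0.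
move=> y; rewrite lt_min => /andP[y1 y2].
rewrite (le_trans (@coord_lipschitz f x y M' (ltW M'0) Df _))//.
  by move=> i z zx; apply: fM'; rewrite (le_trans zx)// ltW.
apply: (@le_trans _ _ ((d%:R * M' + 1) * `|y - x|)).
  by rewrite ler_wpM2r// lerDl.
by rewrite mulrC -ler_pdivlMr// ltW.
Qed.

(** On the line through x in the direction e_i this is differentiation under the
    integral in one parameter; a dominating function for the parameters near x is
    enough. *)
Lemma diff_int (phi : E -> E -> R) (G : E -> R) (i : 'I_d) (x : E) :
  (forall x', `|x' - x| <= 1 -> L1 (phi x')) ->
  (forall x' y, derivable (phi^~ y) x' (e i)) ->
  (forall x' y, `|x' - x| <= 1 -> `|pd i (phi^~ y) x'| <= G y) -> L1 G ->
  derivable (fun x => Int (phi x)) x (e i) /\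
  pd i (fun x => Int (phi x)) x = Int (fun y => pd i (phi^~ y) x).
Proof.
move=> Lphi Dphi phiG LG.
have e1 : `|e i| <= 1.
  apply: norm_le_coord => // j; rewrite mxE eqxx /=.
  by case: eqP; rewrite ?normr1 ?normr0.
have near1 (h : R) : h \in `]-1, 1[ -> `|x + h *: e i - x| <= 1.
  rewrite in_itv /= => /andP[h1 h2].
  rewrite addrAC subrr add0r normrZ mulr_ile1// ler_norml; apply/andP; split; exact: ltW.
pose f (h : R) (t : d.-tuple mR) := phi (x + h *: e i) (rt t).
have Df (h : R) (t : d.-tuple mR) : is_derive h 1 (f^~ t) (pd i (phi^~ (rt t)) (x + h *: e i)).
  exact: (is_derive_line (f := phi^~ (rt t)) (Dphi _ _)).
have a1 : [set` `](-1 : R), 1[ ] 0 by rewrite /= in_itv /= ltrN10 ltr01.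
have h1 h : [set` `](-1 : R), 1[ ] h -> mu.-integrable setT (EFin \o f h).
  by move=> /near1 h1; exact: Lphi.
have h2 h t : [set` `](-1 : R), 1[ ] h -> [set: d.-tuple mR] t -> derivable (f^~ t) h 1.
  by move=> _ _; apply: ex_derive.
have G0 t : 0 <= G (rt t).
  by rewrite (le_trans _ (phiG x (rt t) _))// subrr normr0.
have h3 h t : [set` `](-1 : R), 1[ ] h -> [set: d.-tuple mR] t -> `|partial1of2 f h t| <= G (rt t).
  by move=> hh _; rewrite partial1of2E (@derive_val _ _ _ _ _ _ _ (Df h t)) phiG// near1.
have D1 := derivable_under_integral measurableT a1 h1 h2 G0 LG h3.
have D2 := differentiation_under_integral measurableT a1 h1 h2 G0 LG h3.
split; first exact: derivable_line D1.
rewrite /pd derive_line -derive1E [LHS]D2; apply: eq_Rintegral => t _.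
by rewrite partial1of2E (@derive_val _ _ _ _ _ _ _ (Df 0 t)) scale0r addr0.
Qed.

End calculus.

(** * Schwartz functions *)

Section schwartz_real.
Context {R : realType} {d : nat}.
Local Notation E := 'rV[R]_d.
Local Notation C := R[i].
Local Notation e i := (delta_mx 0 i : E).

Lemma is_derive_of_line (f : E -> R) (x v : E) df :
  is_derive (0 : R) (1 : R) (fun h : R => f (x + h *: v)) df -> is_derive x v f df.
Proof.
move=> [D <-]; split; first exact: derivable_line.
by rewrite derive_line.
Qed.

Lemma is_derive_pd (f : E -> R) i x (D : derivable f x (e i)) : is_derive x (e i) f (pd i f x).
Proof. by split. Qed.
Arguments is_derive_pd {f i x} D.

Lemma is_derive_affine (f : E -> R) a (v x : E) i (D : derivable f (a *: x + v) (e i)) :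
  is_derive x (e i) (fun x => f (a *: x + v)) (a * pd i f (a *: x + v)).
Proof.
apply: is_derive_of_line.
have D1 : is_derive (a * 0) 1 (fun h : R => f (a *: x + v + h *: e i)) (pd i f (a *: x + v)).
  have := @is_derive_line R d f (a *: x + v) (e i) (a * 0).
  by rewrite mulr0 scale0r addr0; exact.
have D2 : is_derive (0 : R) 1 (fun h : R => a * h) a.
  by have := is_deriveZ a (is_derive_id (0 : R) 1); rewrite scaler1 => h; exact: h.
have := is_derive1_comp D1 D2; rewrite mulrC.
rewrite (_ : _ \o _ = (fun h : R => f (a *: (x + h *: e i) + v)))//.
by apply/funext => h /=; congr f; rewrite scalerDr scalerA addrAC.
Qed.

Lemma is_derive_coord i (x : E) j : is_derive x (e i) (fun x : E => x 0 j) (j == i)%:R.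
Proof.
apply: is_derive_of_line.
have -> : (fun h : R => (x + h *: e i) 0 j) = (fun h : R => (j == i)%:R * h + x 0 j).
  by apply/funext => h; rewrite !mxE eqxx /= addrC mulrC.
have := is_deriveD (is_deriveZ ((j == i)%:R : R) (is_derive_id (0 : R) 1)) (is_derive_cst (x 0 j) (0 : R) 1).
by rewrite scaler1 addr0 => h; exact: h.
Qed.

Lemma one_norm_sub (x y : E) : 1 + `|x| <= (1 + `|x - y|) * (1 + `|y|).
Proof.
have h : `|x| <= `|x - y| + `|y| by rewrite -{1}[x](subrK y) ler_normD.
have := mulr_ge0 (normr_ge0 (x - y)) (normr_ge0 y).
move: h; set a := `|x|; set b := `|x - y|; set c := `|y|; lra.
Qed.

Lemma one_norm_ge1 (x : E) : 1 <= 1 + `|x|. Proof. by rewrite lerDl. Qed.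
Lemma one_norm_gt0 (x : E) : 0 < 1 + `|x|. Proof. by rewrite ltr_pwDl. Qed.
Lemma one_norm_X_gt0 (x : E) N : 0 < (1 + `|x|) ^+ N.
Proof. exact/exprn_gt0/one_norm_gt0. Qed.
Lemma one_norm_X_ge0 (x : E) N : 0 <= (1 + `|x|) ^+ N.
Proof. exact/ltW/one_norm_X_gt0. Qed.

(** The norm is the maximum norm, which generates the same decay conditions as the
    Euclidean one. *)
Definition rapid (f : E -> R) :=
  forall N, exists B : R, forall x, (1 + `|x|) ^+ N * `|f x| <= B.

(** Real Schwartz functions, given by decay and differentiability of all iterated
    partials; continuity follows. *)
Definition rschwartz (f : E -> R) := forall s,
  rapid (partials s f) /\ forall i x, derivable (partials s f) x (e i).

(** The coinduction principle by which all closure properties are proved: it is enough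
    to exhibit a class of rapidly decreasing functions that is stable under partial
    derivatives. *)
Lemma rschwartz_coind (P : (E -> R) -> Prop) :
  (forall f, P f -> [/\ rapid f, forall i x, derivable f x (e i) & forall i, P (pd i f)]) ->
  forall f, P f -> rschwartz f.
Proof.
move=> HP f Pf s.
suff /HP[] : P (partials s f) by [].
by elim: s => [//|i s /HP[_ _]]; exact.
Qed.

Lemma partials_rcons s i (f : E -> R) : partials (rcons s i) f = partials s (pd i f).
Proof. by rewrite /partials foldr_rcons. Qed.

Lemma rschwartz_rapid f : rschwartz f -> rapid f. Proof. by move=> /(_ [::])[]. Qed.
Lemma rschwartz_der f (fs : rschwartz f) i x : derivable f x (e i). Proof. by have [] := fs [::]. Qed.
Arguments rschwartz_der {f} fs i x.
Lemma rschwartz_pd f (i : 'I_d) : rschwartz f -> rschwartz (pd i f).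
Proof. by move=> fs s; rewrite -partials_rcons. Qed.
Lemma rschwartz_partials f s : rschwartz f -> rschwartz (partials s f).
Proof. by move=> fs; elim: s => [|i s IH]; [exact: fs|exact: rschwartz_pd]. Qed.

Lemma rapid_ge0 f N : rapid f -> exists2 B : R, 0 <= B & forall x, (1 + `|x|) ^+ N * `|f x| <= B.
Proof.
move=> /(_ N)[B fB]; exists B => //; apply: le_trans (fB 0).
by rewrite mulr_ge0// one_norm_X_ge0.
Qed.

Lemma rapid_decays f : rapid f -> exists B, decays B f.
Proof. by move=> /(_ (2 * d)%N). Qed.

Lemma rapid_bnd f : rapid f -> exists2 B : R, 0 <= B & forall x, `|f x| <= B.
Proof. by move=> /(@rapid_ge0 _ 0%N)[B B0 fB]; exists B => // x; have := fB x; rewrite mul1r. Qed.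

Lemma pd_bounds f N : rschwartz f ->
  exists2 B : R, 0 <= B & forall i x, (1 + `|x|) ^+ N * `|pd i f x| <= B.
Proof.
move=> fs.
have /choice[B HB] : forall i, exists B : R, 0 <= B /\ forall x, (1 + `|x|) ^+ N * `|pd i f x| <= B.
  by move=> i; have [B B0 h] := rapid_ge0 N (rschwartz_rapid (rschwartz_pd i fs)); exists B.
exists (\sum_i B i); first by apply: sumr_ge0 => i _; have [] := HB i.
move=> i x; have [_ h] := HB i; apply: le_trans (h x) _.
by rewrite (bigD1 i)//= lerDl sumr_ge0// => j _; have [] := HB j.
Qed.

Lemma rschwartz_continuous f : rschwartz f -> continuous f.
Proof.
move=> fs; apply: bounded_pd_continuous => [i z|x]; first exact: rschwartz_der.
have [B _ fB] := pd_bounds 0%N fs.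
by exists B => i z _; have := fB i z; rewrite mul1r.
Qed.

Lemma rschwartz_emeas f : rschwartz f -> emeas f.
Proof. by move/rschwartz_continuous/emeas_continuous. Qed.

Lemma rschwartz_L1 f : rschwartz f -> L1 f.
Proof.
by move=> fs; have [B fB] := rapid_decays (rschwartz_rapid fs); exact: L1_decays (rschwartz_emeas fs) fB.
Qed.

Lemma rschwartz_lipschitz f N : rschwartz f -> exists2 B : R, 0 <= B & forall x y : E, `|y - x| <= 1 ->
  (1 + `|x|) ^+ N * `|f y - f x| <= B * `|y - x|.
Proof.
move=> fs; have [B B0 fB] := pd_bounds N fs.
exists (d%:R * (2 ^+ N * B)); first by rewrite !mulr_ge0// exprn_ge0.
move=> x y yx.
have := @coord_lipschitz R d f x y (2 ^+ N * B / (1 + `|x|) ^+ N).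
rewrite divr_ge0 ?one_norm_X_ge0 ?mulr_ge0 ?exprn_ge0// => /(_ isT (rschwartz_der fs)) h.
rewrite mulrC -ler_pdivlMr ?one_norm_X_gt0//.
apply: le_trans (h _) _; last by rewrite -!mulrA [_ ^-1 * _]mulrC !mulrA.
move=> i z zx; rewrite ler_pdivlMr ?one_norm_X_gt0// mulrC.
apply: le_trans (_ : _ <= 2 ^+ N * ((1 + `|z|) ^+ N * `|pd i f z|)) _; last first.
  by rewrite ler_wpM2l// exprn_ge0.
rewrite mulrA -exprMn ler_wpM2r// lerXn2r ?nnegrE ?addr_ge0 ?mulr_ge0 ?addr_ge0//.
apply: le_trans (one_norm_sub x z) _; rewrite ler_wpM2r ?addr_ge0// -[2]/(1 + 1) lerD2l.
by rewrite distrC (le_trans zx).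
Qed.

Lemma rapidD f g : rapid f -> rapid g -> rapid (fun x => f x + g x).
Proof.
move=> rf rg N; have [B fB] := rf N; have [B' gB] := rg N; exists (B + B') => x.
apply: le_trans (lerD (fB x) (gB x)); rewrite -mulrDr ler_wpM2l ?one_norm_X_ge0//.
exact: ler_normD.
Qed.

Lemma rapidMbnd f g c : rapid f -> (forall x, `|g x| <= c) -> rapid (fun x => f x * g x).
Proof.
move=> rf gc N; have [B B0 fB] := rapid_ge0 N rf; exists (B * c) => x.
by rewrite normrM mulrA ler_pM// mulr_ge0// one_norm_X_ge0.
Qed.

Lemma rapidM f g : rapid f -> rapid g -> rapid (fun x => f x * g x).
Proof. by move=> rf /rapid_bnd[c _ gc]; exact: rapidMbnd gc. Qed.

Lemma rapidZ a f : rapid f -> rapid (fun x => a * f x).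
Proof.
by move=> rf; under eq_fun do rewrite mulrC; apply: (@rapidMbnd f (fun=> a) `|a|).
Qed.

Lemma rapid_coord i f : rapid f -> rapid (fun x => x 0 i * f x).
Proof.
move=> rf N; have [B fB] := rf N.+1; exists B => x; apply: le_trans (fB x).
rewrite exprSr -mulrA ler_wpM2l ?one_norm_X_ge0// normrM ler_wpM2r//.
by rewrite (le_trans (norm_coord_le x i))// lerDr.
Qed.

Lemma rapid_affine a v f : a != 0 -> rapid f -> rapid (fun x => f (a *: x + v)).
Proof.
move=> a0 rf N; have [B B0 fB] := rapid_ge0 N rf.
pose k := (1 + `|a|^-1) * (1 + `|v|).
have k0 : 0 <= k by rewrite mulr_ge0 ?addr_ge0 ?invr_ge0.
exists (k ^+ N * B) => x; apply: le_trans (_ : _ <= k ^+ N * ((1 + `|a *: x + v|) ^+ N * `|f (a *: x + v)|)) _; last first.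
  by rewrite ler_wpM2l// exprn_ge0.
rewrite mulrA -exprMn ler_wpM2r// lerXn2r ?nnegrE ?addr_ge0 ?mulr_ge0 ?addr_ge0//.
have h1 : 1 + `|a *: x| <= (1 + `|v|) * (1 + `|a *: x + v|).
  by have := one_norm_sub (a *: x) (a *: x + v); rewrite opprD addrA subrr add0r normrN.
have h2 : `|x| = `|a|^-1 * `|a *: x| by rewrite normrZ mulKf// normr_eq0.
have h3 : 1 + `|x| <= (1 + `|a|^-1) * (1 + `|a *: x|).
  rewrite h2; have := mulr_ge0 (normr_ge0 (a^-1)) (normr_ge0 (a *: x)); rewrite normfV.
  have : 0 <= `|a|^-1 by rewrite invr_ge0.
  have : 0 <= `|a *: x| by [].
  set u := `|a|^-1; set w := `|a *: x|; lra.
by rewrite (le_trans h3)// /k -mulrA ler_wpM2l// addr_ge0// invr_ge0.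
Qed.

Lemma rschwartz0 : rschwartz (fun=> 0).
Proof.
apply: (@rschwartz_coind (fun f => f = fun=> 0)) => // f ->; split.
- by move=> N; exists 0 => x; rewrite normr0 mulr0.
- by move=> i x; exact: derivable_cst.
- by move=> i; apply/funext => x; rewrite /pd derive_cst.
Qed.

Lemma pdD f g i x : rschwartz f -> rschwartz g -> pd i (fun x => f x + g x) x = pd i f x + pd i g x.
Proof. by move=> fs gs; have := deriveD (rschwartz_der fs i x) (rschwartz_der gs i x). Qed.

Lemma rschwartzD f g : rschwartz f -> rschwartz g -> rschwartz (fun x => f x + g x).
Proof.
move=> fs gs.
apply: (@rschwartz_coind (fun h => exists f g, [/\ rschwartz f, rschwartz g & h = (fun x => f x + g x)])); last by exists f, g.
move=> _ [{}f [{}g [{}fs {}gs ->]]]; split.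
- by apply: rapidD; exact: rschwartz_rapid.
- by move=> i x; apply: (derivableD (rschwartz_der fs i x) (rschwartz_der gs i x)).
- move=> i; exists (pd i f), (pd i g); split; [exact: rschwartz_pd|exact: rschwartz_pd|].
  by apply/funext => x; rewrite pdD.
Qed.

Lemma pdZ a f i x : rschwartz f -> pd i (fun x => a * f x) x = a * pd i f x.
Proof. by move=> fs; have := deriveZ a (rschwartz_der fs i x). Qed.

Lemma rschwartzZ a f : rschwartz f -> rschwartz (fun x => a * f x).
Proof.
move=> fs.
apply: (@rschwartz_coind (fun h => exists2 f, rschwartz f & h = (fun x => a * f x))); last by exists f.
move=> _ [{}f {}fs ->]; split.
- by apply: rapidZ; exact: rschwartz_rapid.
- by move=> i x; apply: (derivableZ (rschwartz_der fs i x)).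
- by move=> i; exists (pd i f); [exact: rschwartz_pd|apply/funext => x; rewrite pdZ].
Qed.

Lemma rschwartzN f : rschwartz f -> rschwartz (fun x => - f x).
Proof. by move=> /(rschwartzZ (-1)); under eq_fun do rewrite mulN1r. Qed.

Lemma rschwartzB f g : rschwartz f -> rschwartz g -> rschwartz (fun x => f x - g x).
Proof. by move=> fs /rschwartzN; exact: rschwartzD. Qed.

Lemma pdM (f g : E -> R) i x : derivable f x (e i) -> derivable g x (e i) ->
  pd i (fun x => f x * g x) x = f x * pd i g x + g x * pd i f x.
Proof. by move=> df dg; have := deriveM df dg. Qed.

(** The class generated by products is stable under derivatives by the Leibniz rule,
    whereas the products alone are not. *)
Inductive sum_prod : (E -> R) -> Prop :=
| SumProd f g : rschwartz f -> rschwartz g -> sum_prod (fun x => f x * g x)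
| SumProdD f g : sum_prod f -> sum_prod g -> sum_prod (fun x => f x + g x).

Lemma rschwartzM f g : rschwartz f -> rschwartz g -> rschwartz (fun x => f x * g x).
Proof.
move=> fs gs; apply: (@rschwartz_coind sum_prod); last exact: SumProd.
move=> h; elim=> {f g fs gs h} [f g fs gs|f g _ [rf df pf] _ [rg dg pg]]; split.
- by apply: rapidM; exact: rschwartz_rapid.
- by move=> i x; apply: (derivableM (rschwartz_der fs i x) (rschwartz_der gs i x)).
- move=> i; have -> : pd i (fun x => f x * g x) = fun x => f x * pd i g x + g x * pd i f x.
    by apply/funext => x; rewrite pdM//; exact: rschwartz_der.
  by apply: SumProdD; apply: SumProd; [exact: fs|exact: rschwartz_pd|exact: gs|exact: rschwartz_pd].
- exact: (rapidD rf rg).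
- by move=> i x; apply: (derivableD (df i x) (dg i x)).
- move=> i; have -> : pd i (fun x => f x + g x) = fun x => pd i f x + pd i g x.
    by apply/funext => x; exact: (deriveD (df i x) (dg i x)).
  exact: (SumProdD (pf i) (pg i)).
Qed.

(** The stable class consists of the functions x_j f + g, as the derivative of x_j
    produces a term without x_j. *)
Lemma rschwartz_coord j f : rschwartz f -> rschwartz (fun x => x 0 j * f x).
Proof.
move=> fs.
apply: (@rschwartz_coind (fun h => exists f g, [/\ rschwartz f, rschwartz g & h = (fun x => x 0 j * f x + g x)])); last first.
  by exists f, (fun=> 0); split=> //; [exact: rschwartz0|apply/funext => x; rewrite addr0].
move=> _ [{}f [g [{}fs gs ->]]].
have D i x : is_derive x (e i) (fun x => x 0 j * f x + g x)
    (x 0 j * pd i f x + ((j == i)%:R * f x + pd i g x)).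
  have := is_deriveD (is_deriveM (is_derive_coord i x j) (is_derive_pd (rschwartz_der fs i x)))
    (is_derive_pd (rschwartz_der gs i x)).
  rewrite (_ : _ + (_ + _) = x 0 j *: pd i f x + f x *: ((j == i)%:R : R) + pd i g x) => [h|].
    exact: h.
  by rewrite addrA; congr (_ + _ + _); exact: mulrC.
split.
- by apply: rapidD; [apply: rapid_coord|]; exact: rschwartz_rapid.
- by move=> i x; have [] := D i x.
- move=> i; exists (pd i f), (fun x => (j == i)%:R * f x + pd i g x); split.
  + exact: rschwartz_pd.
  + by apply: rschwartzD; [exact: rschwartzZ|exact: rschwartz_pd].
  + by apply/funext => x; have [] := D i x.
Qed.

Lemma pd_affine a v f i x : rschwartz f -> pd i (fun x => f (a *: x + v)) x = a * pd i f (a *: x + v).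
Proof. by move=> fs; have [_] := is_derive_affine (rschwartz_der fs i (a *: x + v)). Qed.

Lemma rschwartz_affine a v f : a != 0 -> rschwartz f -> rschwartz (fun x => f (a *: x + v)).
Proof.
move=> a0 fs.
apply: (@rschwartz_coind (fun h => exists c f, rschwartz f /\ h = (fun x => c * f (a *: x + v)))); last first.
  by exists 1, f; split=> //; apply/funext => x; rewrite mul1r.
move=> _ [c [{}f [{}fs ->]]].
have D i x := is_derive_affine (rschwartz_der fs i (a *: x + v)).
split.
- by apply: rapidZ; apply: rapid_affine => //; exact: rschwartz_rapid.
- by move=> i x; apply: derivableZ; have [] := D i x.
- move=> i; exists (c * a), (pd i f); split; first exact: rschwartz_pd.
  apply/funext => x; rewrite -mulrA -(@derive_val _ _ _ _ _ _ _ (D i x)).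
  by apply: (@deriveZ _ _ _ (fun x => f (a *: x + v))); have [] := D i x.
Qed.

End schwartz_real.
Arguments rschwartz_der {R d f} fs i x.
Arguments is_derive_pd {R d f i x} D.

Section schwartz_complex.
Context {R : realType} {d : nat}.
Local Notation E := 'rV[R]_d.
Local Notation C := R[i].
Local Notation e i := (delta_mx 0 i : E).

Lemma dotpC (x y : E) : dotp x y = dotp y x.
Proof. by apply: eq_bigr => i _; rewrite mulrC. Qed.

Lemma dotpDr (x y z : E) : dotp x (y + z) = dotp x y + dotp x z.
Proof. by rewrite -big_split; apply: eq_bigr => i _; rewrite mxE mulrDr. Qed.

Lemma dotpZr a (x y : E) : dotp x (a *: y) = a * dotp x y.
Proof. by rewrite [RHS]mulr_sumr; apply: eq_bigr => i _; rewrite mxE mulrCA. Qed.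

Lemma dotpNr (x y : E) : dotp x (- y) = - dotp x y.
Proof. by rewrite -scaleN1r dotpZr mulN1r. Qed.

Lemma dotp_delta (x : E) i : dotp x (e i) = x 0 i.
Proof.
rewrite /dotp (bigD1 i)//= mxE !eqxx mulr1 big1 ?addr0// => j ji.
by rewrite mxE (negbTE ji) andbF mulr0.
Qed.

Lemma norm_le_enorm (x : E) : `|x| <= enorm x.
Proof.
apply: norm_le_coord => [|i]; first exact: sqrtr_ge0.
rewrite -sqrtr_sqr ler_wsqrtr// /dotp (bigD1 i)//= -expr2 lerDl.
by apply: sumr_ge0 => j _; rewrite -expr2 sqr_ge0.
Qed.

Lemma enorm_ge0 (x : E) : 0 <= enorm x. Proof. exact: sqrtr_ge0. Qed.

Lemma enorm_le (x : E) : enorm x <= d%:R * `|x|.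
Proof.
have h : dotp x x <= (d%:R * `|x|) ^+ 2.
  apply: (@le_trans _ _ (\sum_(i < d) `|x| ^+ 2)).
    apply: ler_sum => i _; rewrite -expr2 -[x 0 i ^+ 2]real_normK ?num_real//.
    by rewrite lerXn2r ?nnegrE// norm_coord_le.
  rewrite sumr_const card_ord -[leLHS]mulr_natl exprMn ler_wpM2r ?sqr_ge0//.
  by rewrite -natrX ler_nat; case: (d) => // n; rewrite leq_pmulr.
by rewrite -[leRHS]ger0_norm ?mulr_ge0// -sqrtr_sqr ler_wsqrtr.
Qed.

Lemma cabsE (z : C) : cabs z = Num.sqrt (complex.Re z ^+ 2 + complex.Im z ^+ 2).
Proof. by case: z. Qed.

Lemma cabs_ge0 (z : C) : 0 <= cabs z. Proof. by rewrite cabsE sqrtr_ge0. Qed.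

Lemma Re_le_cabs (z : C) : `|complex.Re z| <= cabs z.
Proof. by rewrite cabsE -sqrtr_sqr ler_wsqrtr// lerDl sqr_ge0. Qed.

Lemma Im_le_cabs (z : C) : `|complex.Im z| <= cabs z.
Proof. by rewrite cabsE -sqrtr_sqr ler_wsqrtr// lerDr sqr_ge0. Qed.

Lemma cabs_le (z : C) : cabs z <= `|complex.Re z| + `|complex.Im z|.
Proof.
rewrite cabsE -[leRHS]ger0_norm ?addr_ge0// -sqrtr_sqr ler_wsqrtr//.
rewrite sqrrD !real_normK ?num_real// lerD2r lerDl.
by rewrite mulrn_wge0// mulr_ge0.
Qed.

Lemma cabsM (z w : C) : cabs (z * w) = cabs z * cabs w.
Proof. exact: Normc.normcM. Qed.

Lemma cabsD (z w : C) : cabs (z + w) <= cabs z + cabs w.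
Proof. exact: le_normcD. Qed.

(** Schwartz functions in terms of real and imaginary part. This is equivalent to
    [schwartz], as the next lemmas show. *)
Definition cschwartz (g : E -> C) := rschwartz (re g) /\ rschwartz (im g).

Lemma rschwartz_partials_bound n N (f : E -> R) : rschwartz f -> exists2 B : R, 0 <= B &
  forall s x, (size s <= n)%N -> (1 + `|x|) ^+ N * `|partials s f x| <= B.
Proof.
elim: n f => [|n IH] f fs.
  have [B B0 fB] := rapid_ge0 N (rschwartz_rapid fs).
  by exists B => // -[|//] x _; exact: fB.
have /choice[B HB] : forall i, exists B : R, 0 <= B /\ forall s x, (size s <= n)%N ->
    (1 + `|x|) ^+ N * `|partials s (pd i f) x| <= B.
  by move=> i; have [B B0 h] := IH _ (rschwartz_pd i fs); exists B.
have [B' B'0 fB'] := rapid_ge0 N (rschwartz_rapid fs).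
have S0 : 0 <= \sum_i B i by apply: sumr_ge0 => i _; have [] := HB i.
exists (B' + \sum_i B i); first exact: addr_ge0.
move=> s x; case/lastP: s => [_|s i]; first by rewrite (le_trans (fB' x))// lerDl.
rewrite size_rcons partials_rcons => sn; have [_ h] := HB i; apply: le_trans (h s x sn) _.
rewrite (bigD1 i)//= addrCA lerDl addr_ge0// sumr_ge0// => j _; by have [] := HB j.
Qed.

Lemma schwartz_cschwartz (g : E -> C) : schwartz g -> cschwartz g.
Proof.
move=> [[sre sim] hN].
have key (s : seq 'I_d) N : exists B : R, forall x, (1 + `|x|) ^+ N * cabs (cpartials s g x) <= B.
  pose M := maxn (size s) N.
  exists (fine (schwartz_seminorm M g)) => x.
  have : ((((1 + enorm x) ^+ M * cabs (cpartials s g x))%:E <= schwartz_seminorm M g)%E).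
    by apply: ereal_sup_ubound; exists s, x; split=> //; rewrite leq_maxl.
  have := hN M; case: (schwartz_seminorm M g) => [r _|//|_].
    rewrite lee_fin; apply: le_trans; rewrite ler_wpM2r ?cabs_ge0//.
    apply: (@le_trans _ _ ((1 + `|x|) ^+ M)).
      by rewrite ler_weXn2l ?one_norm_ge1// leq_maxr.
    rewrite lerXn2r ?nnegrE ?addr_ge0 ?enorm_ge0//; exact: lerD (norm_le_enorm x).
  by rewrite leeNy_eq.
split=> s; split.
- move=> N; have [B h] := key s N; exists B => x; apply: le_trans (h x).
  by rewrite ler_wpM2l ?one_norm_X_ge0//; exact: (Re_le_cabs (cpartials s g x)).
- by move=> i x; exact: (sre s).2.
- move=> N; have [B h] := key s N; exists B => x; apply: le_trans (h x).
  by rewrite ler_wpM2l ?one_norm_X_ge0//; exact: (Im_le_cabs (cpartials s g x)).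
- by move=> i x; exact: (sim s).2.
Qed.

(** The constants come from comparing the Euclidean norm with d times the maximum norm,
    and the modulus with the sum of the absolute values of the two parts. *)
Lemma seminorm_le N (g : E -> C) (B : R) :
  (forall s x, (size s <= N)%N -> (1 + `|x|) ^+ N * `|partials s (re g) x| <= B /\
     (1 + `|x|) ^+ N * `|partials s (im g) x| <= B) ->
  (schwartz_seminorm N g <= ((1 + d%:R) ^+ N * (2 * B))%:E)%E.
Proof.
move=> h; apply: ge_ereal_sup => _ [s [x [sN ->]]]; rewrite lee_fin.
have [h1 h2] := h s x sN.
apply: (@le_trans _ _ ((1 + d%:R) ^+ N * ((1 + `|x|) ^+ N * cabs (cpartials s g x)))).
  rewrite mulrA -exprMn ler_wpM2r ?cabs_ge0// lerXn2r ?nnegrE ?mulr_ge0 ?addr_ge0 ?enorm_ge0//.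
  apply: (@le_trans _ _ (1 + d%:R * `|x|)); first by rewrite lerD2l enorm_le.
  rewrite mulrDl mul1r -addrA lerD2l mulrDr mulr1 addrA lerDr addr_ge0//.
rewrite ler_wpM2l ?exprn_ge0 ?addr_ge0//.
apply: (@le_trans _ _ ((1 + `|x|) ^+ N * (`|partials s (re g) x| + `|partials s (im g) x|))).
  by rewrite ler_wpM2l ?one_norm_X_ge0//; exact: (cabs_le (cpartials s g x)).
by rewrite mulrDr (_ : 2 * B = B + B) ?lerD// mulr2n mulrDl mul1r.
Qed.

Lemma cschwartz_schwartz (g : E -> C) : cschwartz g -> schwartz g.
Proof.
move=> [gr gi]; split.
  have key (f : E -> R) : rschwartz f -> smooth f.
    by move=> fs s; split; [exact/rschwartz_continuous/rschwartz_partials|exact: (fs s).2].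
  by split; exact: key.
move=> N.
have [B B0 hr] := rschwartz_partials_bound N N gr.
have [B' B'0 hi] := rschwartz_partials_bound N N gi.
apply: le_lt_trans (@seminorm_le N g (B + B') _) _; last exact: ltry.
move=> s x sN; split.
  by rewrite (le_trans (hr s x sN))// lerDl.
by rewrite (le_trans (hi s x sN))// lerDr.
Qed.

Lemma seminorm_fin N (g : E -> C) : schwartz g -> schwartz_seminorm N g \is a fin_num.
Proof.
move=> [_ /(_ N) h]; rewrite ge0_fin_numE//.
apply: le_trans (_ : _ <= ((1 + enorm 0) ^+ N * cabs (cpartials [::] g 0))%:E)%E _.
  rewrite -[leLHS]/(0%:E) lee_fin; apply: mulr_ge0; last exact: cabs_ge0.
  by apply: exprn_ge0; apply: addr_ge0 => //; exact: enorm_ge0.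
by apply: ereal_sup_ubound; exists [::], 0.
Qed.

Lemma seminorm_ge N (g : E -> C) s x : schwartz g -> (size s <= N)%N ->
  (1 + `|x|) ^+ N * `|partials s (re g) x| <= fine (schwartz_seminorm N g) /\
  (1 + `|x|) ^+ N * `|partials s (im g) x| <= fine (schwartz_seminorm N g).
Proof.
move=> gS sN.
have h : (1 + enorm x) ^+ N * cabs (cpartials s g x) <= fine (schwartz_seminorm N g).
  by rewrite -lee_fin fineK ?seminorm_fin//; apply: ereal_sup_ubound; exists s, x.
have h2 : (1 + `|x|) ^+ N <= (1 + enorm x) ^+ N.
  by rewrite lerXn2r ?nnegrE ?addr_ge0 ?enorm_ge0//; exact: lerD (norm_le_enorm x).
split; apply: le_trans h; rewrite ler_pM ?one_norm_X_ge0//.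
  exact: (Re_le_cabs (cpartials s g x)).
exact: (Im_le_cabs (cpartials s g x)).
Qed.

End schwartz_complex.

Section trigonometric.
Context {R : realType} {d : nat}.
Local Notation E := 'rV[R]_d.
Local Notation e i := (delta_mx 0 i : E).

(** Cosine and sine treated together: differentiation exchanges the values of [b], with
    the sign [dsign b]. *)
Definition trig (b : bool) (a : R) : R := if b then cos a else sin a.
Definition dsign (b : bool) : R := if b then -1 else 1.

Lemma is_derive_trig b (a : R) : is_derive a 1 (trig b) (dsign b * trig (~~ b) a).
Proof.
case: b => /=; first by rewrite mulN1r; exact: is_derive_cos.
by rewrite mul1r; exact: is_derive_sin.
Qed.

Lemma norm_trig b a : `|trig b a| <= 1.
Proof.
by case: b; rewrite /trig ler_norml ?cos_geN1 ?cos_le1 ?sin_geN1 ?sin_le1.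
Qed.

Lemma norm_dsign b : `|dsign b| = 1.
Proof. by case: b; rewrite /dsign ?normrN normr1. Qed.

Lemma trig_continuous b : continuous (trig b).
Proof. by case: b; [exact: continuous_cos|exact: continuous_sin]. Qed.

Lemma emeas2_trig b : emeas2 (fun x y : E => trig b (dotp x y)).
Proof.
apply: (measurableT_comp (f := trig b) _ emeas2_dotp).
by apply: continuous_measurable_fun; exact: trig_continuous.
Qed.

Lemma rt_surj (x : E) : x = row_of_tuple [tuple x 0 i | i < d].
Proof. by apply/rowP => i; rewrite mxE tnth_mktuple. Qed.

Lemma emeas2_l (f : E -> E -> R) x : emeas2 f -> emeas (f x).
Proof. by move=> mf; rewrite (rt_surj x); exact: (measurableT_comp mf (pair1_measurable _)). Qed.

Lemma emeas2_r (f : E -> E -> R) y : emeas2 f -> emeas (f^~ y).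
Proof. by move=> mf; rewrite (rt_surj y); exact: (measurableT_comp mf (pair2_measurable _)). Qed.

Lemma emeasM (f g : E -> R) : emeas f -> emeas g -> emeas (fun x => f x * g x).
Proof. exact: measurable_funM. Qed.

Lemma emeasD (f g : E -> R) : emeas f -> emeas g -> emeas (fun x => f x + g x).
Proof. exact: measurable_funD. Qed.

Lemma is_derive_trig_dotp b (x y : E) i :
  is_derive y (e i) (fun y => trig b (dotp x y)) (dsign b * trig (~~ b) (dotp x y) * x 0 i).
Proof.
apply: is_derive_of_line.
have D2 : is_derive (0 : R) 1 (fun h : R => x 0 i * h + dotp x y) (x 0 i).
  have := is_deriveD (is_deriveZ (x 0 i : R) (is_derive_id (0 : R) 1)) (is_derive_cst (dotp x y) (0 : R) 1).
  by rewrite scaler1 addr0 => h; exact: h.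
have D1 := is_derive_trig b (x 0 i * 0 + dotp x y).
have := @is_derive1_comp _ (trig b) (fun h : R => x 0 i * h + dotp x y) 0 _ _ D1 D2; rewrite mulr0 add0r.
rewrite (_ : _ \o _ = (fun h : R => trig b (dotp x (y + h *: e i))))//.
by apply/funext => h /=; rewrite dotpDr dotpZr dotp_delta addrC mulrC.
Qed.

Lemma rapid_trigM b (y : E) (g : E -> R) : rapid g -> rapid (fun x => trig b (dotp x y) * g x).
Proof.
move=> rg; under eq_fun do rewrite mulrC.
by apply: (@rapidMbnd _ _ _ _ 1) => // x; exact: norm_trig.
Qed.

(** The cosine and sine transforms, of which the Fourier transform is a combination. *)
Definition trig_transform b (g : E -> R) (y : E) : R := Int (fun x => trig b (dotp x y) * g x).

Lemma L1_trig b (g : E -> R) y : rschwartz g -> L1 (fun x => trig b (dotp x y) * g x).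
Proof.
move=> gs; apply: (L1_le _ (L1_norm (rschwartz_L1 gs))).
  by apply: emeasM (rschwartz_emeas gs); exact: (emeas2_r y (emeas2_trig b)).
by move=> x; rewrite normrM ler_piMl// norm_trig.
Qed.

Lemma trig_transform_bound b g y : rschwartz g -> `|trig_transform b g y| <= Int (fun x => `|g x|).
Proof.
move=> gs; apply: Int_norm_le; [exact: L1_trig|exact/L1_norm/rschwartz_L1|].
by move=> x; rewrite normrM ler_piMl// norm_trig.
Qed.

Lemma trig_transform_diff b g i y : rschwartz g ->
  derivable (trig_transform b g) y (e i) /\ pd i (trig_transform b g) y = trig_transform (~~ b) (fun x => dsign b * (x 0 i * g x)) y.
Proof.
move=> gs.
have D x y' : is_derive y' (e i) (fun y => trig b (dotp x y) * g x)
    (trig (~~ b) (dotp x y') * (dsign b * (x 0 i * g x))).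
  have := is_deriveM (is_derive_trig_dotp b x y' i) (is_derive_cst (g x) y' (e i)).
  rewrite scaler0 add0r (_ : _ *: _ = trig (~~ b) (dotp x y') * (dsign b * (x 0 i * g x))) => [h|].
    exact: h.
  by rewrite -[LHS]/(g x * _); ring.
have := @diff_int R d (fun y x => trig b (dotp x y) * g x) (fun x => `|x 0 i * g x|) i y.
case.
- by move=> y' _; exact: L1_trig.
- by move=> y' x; have [] := D x y'.
- move=> y' x _; have [_] := D x y'; rewrite /pd => ->.
  by rewrite normrM [`|dsign b * _|]normrM norm_dsign mul1r ler_piMl// norm_trig.
- exact/L1_norm/rschwartz_L1/rschwartz_coord.
move=> D1 D2; split=> //; rewrite D2; congr Int; apply/funext => x.
by have [_] := D x y.
Qed.

(** Translation does not change the integral; differentiate the translated integral at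
    0. *)
Lemma Int_pd i (f : E -> R) : (forall x, derivable f x (e i)) -> L1 f -> emeas (pd i f) ->
  rapid (pd i f) -> Int (pd i f) = 0.
Proof.
move=> Df Lf mf rf; have [B fB] := rapid_decays rf.
have D (y x' : E) : is_derive x' (e i) (fun x' => f (1 *: x' + y)) (1 * pd i f (1 *: x' + y)).
  exact: is_derive_affine.
have cst_I (x' : E) : Int (fun y => f (1 *: x' + y)) = Int f.
  have := Int_affine x' (oner_neq0 R) Lf; rewrite normr1 invr1 expr1n mul1r => <-.
  by congr Int; apply/funext => y; rewrite !scale1r addrC.
(* the translated function is dominated near 0, with the loss of a factor 2 in 1 +
   |y| *)
have := @diff_int R d (fun x' y => f (1 *: x' + y)) (fun y => (2 ^+ (2 * d) * B) * weight y) i 0.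
case.
- move=> x' _; have := L1_affine x' (oner_neq0 R) Lf.
  by congr L1; apply/funext => y; rewrite !scale1r addrC.
- by move=> x' y; have [] := D y x'.
- move=> x' y; rewrite subr0 => x'1; have [_] := D y x'; rewrite /pd => ->.
  rewrite mul1r scale1r.
  apply: (@decays_weight _ _ _ (fun y => pd i f (x' + y))) => {}y.
  apply: le_trans (_ : _ <= 2 ^+ (2 * d) * ((1 + `|x' + y|) ^+ (2 * d) * `|pd i f (x' + y)|)) _.
    rewrite mulrA -exprMn ler_wpM2r// lerXn2r ?nnegrE ?mulr_ge0 ?addr_ge0//.
    have := one_norm_sub y (x' + y); rewrite opprD addrCA subrr addr0 normrN => h.
    by rewrite (le_trans h)// ler_wpM2r ?addr_ge0// -[2]/(1 + 1) lerD2l.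
  by rewrite ler_wpM2l ?exprn_ge0.
- by apply: L1Z; exact: L1_weight.
move=> _; rewrite (_ : (fun x => Int _) = cst (Int f)); last by apply/funext => x'; exact: cst_I.
rewrite {1}/pd derive_cst => h; rewrite [RHS]h; congr Int; apply/funext => y.
by have [_] := D y 0; rewrite /pd => ->; rewrite mul1r scale1r add0r.
Qed.

(** Integration by parts: multiplication by a coordinate on the transform side is
    differentiation of the function. *)
Lemma trig_transform_coord b (g : E -> R) i (y : E) : rschwartz g -> `|y 0 i * trig_transform b g y| = `|trig_transform (~~ b) (pd i g) y|.
Proof.
move=> gs; set b' := ~~ b.
have D x : is_derive x (e i) (fun x => trig b' (dotp x y) * g x)
   (trig b' (dotp x y) * pd i g x + dsign b' * y 0 i * (trig b (dotp x y) * g x)).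
  have h0 : is_derive x (e i) (fun x => trig b' (dotp x y)) (dsign b' * trig b (dotp x y) * y 0 i).
    have := is_derive_trig_dotp b' y x i; rewrite negbK.
    by under eq_fun do rewrite dotpC; rewrite [dotp y x]dotpC.
  have := is_deriveM h0 (is_derive_pd (rschwartz_der gs i x)).
  rewrite (_ : _ *: _ + _ = trig b' (dotp x y) * pd i g x + dsign b' * y 0 i * (trig b (dotp x y) * g x)) => [h|].
    exact: h.
  by congr (_ + _); rewrite -[LHS]/(g x * _); ring.
have pdE : pd i (fun x => trig b' (dotp x y) * g x) =
  (fun x => trig b' (dotp x y) * pd i g x + dsign b' * y 0 i * (trig b (dotp x y) * g x)).
  by apply/funext => x; have [_] := D x.
have mt c : emeas (fun x => trig c (dotp x y)) by exact: (emeas2_r y (emeas2_trig c)).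
have gs' := rschwartz_pd i gs.
have m1 : emeas (pd i (fun x => trig b' (dotp x y) * g x)).
  rewrite pdE; apply: emeasD; first exact: emeasM (rschwartz_emeas gs').
  by apply: emeasM; [exact: measurable_cst|exact: emeasM (rschwartz_emeas gs)].
have m2 : rapid (pd i (fun x => trig b' (dotp x y) * g x)).
  rewrite pdE; apply: rapidD; first exact/rapid_trigM/rschwartz_rapid.
  by apply: rapidZ; exact/rapid_trigM/rschwartz_rapid.
have := Int_pd (fun x => @ex_derive _ _ _ _ _ _ _ (D x)) (L1_trig b' y gs) m1 m2.
rewrite pdE.
rewrite IntD ?IntZ; [|exact: L1_trig|exact: L1_trig|by apply: L1Z; exact: L1_trig].
move=> /eqP; rewrite addr_eq0 => /eqP h.
by rewrite [in RHS]/trig_transform h normrN -mulrA [in RHS]normrM norm_dsign mul1r.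
Qed.

(** Induction on the power, where the l1 norm of y is used because it is linear in the
    absolute values of the coordinates. *)
Lemma trig_transform_rapid b g : rschwartz g -> rapid (trig_transform b g).
Proof.
have key N : forall b g, rschwartz g -> exists2 B : R, 0 <= B &
    forall y : E, (1 + \sum_i `|y 0 i|) ^+ N * `|trig_transform b g y| <= B.
  elim: N => [|N IH] {}b {}g gs.
    exists (Int (fun x => `|g x|)); first by apply: Int_ge0.
    by move=> y; rewrite mul1r trig_transform_bound.
  have [B0 B00 h0] := IH b g gs.
  have /choice[B HB] : forall i, exists B : R, 0 <= B /\
      forall y : E, (1 + \sum_i `|y 0 i|) ^+ N * `|trig_transform (~~ b) (pd i g) y| <= B.
    by move=> i; have [B ? h] := IH (~~ b) _ (rschwartz_pd i gs); exists B.
  exists (B0 + \sum_i B i).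
    by rewrite addr_ge0// sumr_ge0// => i _; have [] := HB i.
  move=> y; rewrite exprSr -mulrA mulrDl mul1r mulrDr lerD// mulr_suml mulr_sumr.
  by apply: ler_sum => i _; rewrite -normrM trig_transform_coord//; have [_] := HB i.
move=> gs N; have [B B0 h] := key N b g gs; exists B => y; apply: le_trans (h y).
rewrite ler_wpM2r// lerXn2r ?nnegrE ?addr_ge0 ?sumr_ge0// lerD2l.
apply: norm_le_coord => [|i]; first exact: sumr_ge0.
by rewrite (bigD1 i)//= lerDl sumr_ge0.
Qed.

(** Differentiating a transform gives the other transform of x_i g, so transforms of
    Schwartz functions form a stable class. *)
Lemma rschwartz_trig_transform b g : rschwartz g -> rschwartz (trig_transform b g).
Proof.
move=> gs.
apply: (@rschwartz_coind _ _ (fun h => exists b g, rschwartz g /\ h = trig_transform b g)); last by exists b, g.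
move=> _ [{}b [{}g [{}gs ->]]]; split.
- exact: trig_transform_rapid.
- by move=> i x; have [] := trig_transform_diff b i x gs.
- move=> i; exists (~~ b), (fun x : E => dsign b * (x 0 i * g x)); split.
    by apply: rschwartzZ; exact: rschwartz_coord.
  by apply/funext => x; have [] := trig_transform_diff b i x gs.
Qed.

End trigonometric.

(** * The Fourier transform and its multipliers *)

Section complex_integral.
Context {R : realType} {d : nat}.
Local Notation mR := (measurableTypeR R).
Local Notation E := 'rV[R]_d.
Local Notation C := R[i].
Local Notation mu := (lebesgue_tuple R d).

Lemma cReM (z w : C) : complex.Re (z * w) = complex.Re z * complex.Re w - complex.Im z * complex.Im w.
Proof. by case: z; case: w. Qed.
Lemma cImM (z w : C) : complex.Im (z * w) = complex.Re z * complex.Im w + complex.Im z * complex.Re w.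
Proof. by case: z; case: w. Qed.
Lemma cReD (z w : C) : complex.Re (z + w) = complex.Re z + complex.Re w.
Proof. by case: z; case: w. Qed.
Lemma cImD (z w : C) : complex.Im (z + w) = complex.Im z + complex.Im w.
Proof. by case: z; case: w. Qed.
Lemma ReC (a : R) : complex.Re (a%:C)%C = a. Proof. by []. Qed.
Lemma ImC (a : R) : complex.Im (a%:C)%C = 0. Proof. by []. Qed.

Lemma complexP (z w : C) : complex.Re z = complex.Re w -> complex.Im z = complex.Im w -> z = w.
Proof. by case: z => a b; case: w => a' b' /= -> ->. Qed.

Definition cemeas (g : E -> C) := emeas (re g) /\ emeas (im g).

Lemma cintegral_Re (g : E -> C) : complex.Re (cintegral g) = Int (re g). Proof. by []. Qed.
Lemma cintegral_Im (g : E -> C) : complex.Im (cintegral g) = Int (im g). Proof. by []. Qed.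

Lemma cintegrableP (g : E -> C) : cintegrable g <-> L1 (re g) /\ L1 (im g).
Proof. by []. Qed.

Lemma cintegrable_cemeas (g : E -> C) : cintegrable g -> cemeas g.
Proof. by move=> [h1 h2]; split; exact: L1_emeas. Qed.

Lemma cemeasD (g h : E -> C) : cemeas g -> cemeas h -> cemeas (fun x => g x + h x).
Proof.
move=> [g1 g2] [h1 h2]; split.
  rewrite (_ : re _ = fun x => re g x + re h x); first exact: emeasD.
  by apply/funext => x; rewrite /re cReD.
rewrite (_ : im _ = fun x => im g x + im h x); first exact: emeasD.
by apply/funext => x; rewrite /im cImD.
Qed.

Lemma emeasN (f : E -> R) : emeas f -> emeas (fun x => - f x).
Proof. by move=> mf; exact: measurable_funN. Qed.

Lemma cemeasM (g h : E -> C) : cemeas g -> cemeas h -> cemeas (fun x => g x * h x).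
Proof.
move=> [g1 g2] [h1 h2]; split.
  rewrite (_ : re _ = fun x => re g x * re h x + - (im g x * im h x)).
    by apply: emeasD; [exact: emeasM|apply: emeasN; exact: emeasM].
  by apply/funext => x; rewrite /re cReM.
rewrite (_ : im _ = fun x => re g x * im h x + im g x * re h x).
  by apply: emeasD; exact: emeasM.
by apply/funext => x; rewrite /im cImM.
Qed.

Lemma cemeas_cst (a : C) : cemeas (fun=> a).
Proof. by split; exact: measurable_cst. Qed.

Lemma cemeas_cabs (g : E -> C) : cemeas g -> emeas (fun x => cabs (g x)).
Proof.
move=> [g1 g2]; rewrite /emeas /comp; under eq_fun do rewrite cabsE.
apply: (measurableT_comp (f := @Num.sqrt R)).
  by apply: continuous_measurable_fun; exact: sqrt_continuous.
by apply: measurable_funD; apply: measurable_funX.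
Qed.

Lemma cintegrable_le (g : E -> C) h : cemeas g -> L1 h -> (forall x, cabs (g x) <= h x) -> cintegrable g.
Proof.
move=> [g1 g2] Lh gh; split; apply: (L1_le _ Lh) => // x; apply: le_trans (gh x).
  exact: Re_le_cabs.
exact: Im_le_cabs.
Qed.

Lemma L1_cabs (g : E -> C) : cintegrable g -> L1 (fun x => cabs (g x)).
Proof.
move=> gi; have [g1 g2] := gi.
apply: (L1_le _ (L1D (L1_norm g1) (L1_norm g2))).
  by apply: cemeas_cabs; exact: cintegrable_cemeas.
by move=> x; rewrite ger0_norm ?cabs_ge0// cabs_le.
Qed.

Lemma cintegrableD (g h : E -> C) : cintegrable g -> cintegrable h -> cintegrable (fun x => g x + h x).
Proof.
move=> gi hi; apply: (cintegrable_le _ (L1D (L1_cabs gi) (L1_cabs hi))) => [|x].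
  by apply: cemeasD; exact: cintegrable_cemeas.
exact: cabsD.
Qed.

Lemma cintegrableM (g h : E -> C) B : cintegrable g -> cemeas h -> (forall x, cabs (h x) <= B) ->
  cintegrable (fun x => h x * g x).
Proof.
move=> gi mh hB; apply: (cintegrable_le _ (L1Z B (L1_cabs gi))) => [|x].
  by apply: cemeasM => //; exact: cintegrable_cemeas.
by rewrite cabsM ler_wpM2r// cabs_ge0.
Qed.

Lemma cintegrableZ a (g : E -> C) : cintegrable g -> cintegrable (fun x => a * g x).
Proof. by move=> gi; apply: (@cintegrableM _ (fun=> a) (cabs a)) => //; exact: cemeas_cst. Qed.

Lemma cintegralD (g h : E -> C) : cintegrable g -> cintegrable h ->
  cintegral (fun x => g x + h x) = cintegral g + cintegral h.
Proof.
move=> [g1 g2] [h1 h2]; apply: complexP; rewrite ?cReD ?cImD !(cintegral_Re, cintegral_Im).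
  by rewrite -IntD//; congr Int; apply/funext => x; rewrite /re cReD.
by rewrite -IntD//; congr Int; apply/funext => x; rewrite /im cImD.
Qed.

Lemma cintegralZ a (g : E -> C) : cintegrable g -> cintegral (fun x => a * g x) = a * cintegral g.
Proof.
move=> [g1 g2]; apply: complexP; rewrite ?cReM ?cImM !(cintegral_Re, cintegral_Im).
  rewrite -!IntZ// -IntB; [|exact: L1Z|exact: L1Z].
  by congr Int; apply/funext => x; rewrite /re cReM.
rewrite -!IntZ// -IntD; [|exact: L1Z|exact: L1Z].
by congr Int; apply/funext => x; rewrite /im cImM.
Qed.

Lemma cintegral0 : cintegral (fun _ : E => 0 : C) = 0 :> C.
Proof. by apply: complexP; rewrite ?(cintegral_Re, cintegral_Im); exact: Int0. Qed.

Lemma cintegrable0 : cintegrable (fun _ : E => 0 : C).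
Proof. by split; exact: L1_0. Qed.

Lemma cintegrable_sum (J : Type) (s : seq J) (f : J -> E -> C) :
  (forall j, cintegrable (f j)) -> cintegrable (fun x => \sum_(j <- s) f j x).
Proof.
move=> Lf; elim: s => [|j s IH].
  by under eq_fun do rewrite big_nil; exact: cintegrable0.
by under eq_fun do rewrite big_cons; exact: cintegrableD.
Qed.

Lemma cintegral_sum (J : Type) (s : seq J) (f : J -> E -> C) :
  (forall j, cintegrable (f j)) -> cintegral (fun x => \sum_(j <- s) f j x) = \sum_(j <- s) cintegral (f j).
Proof.
move=> Lf; elim: s => [|j s IH].
  by under eq_fun do rewrite big_nil; rewrite big_nil cintegral0.
by under eq_fun do rewrite big_cons; rewrite big_cons -IH cintegralD//; exact: cintegrable_sum.
Qed.

(** The factor 2 comes from estimating the two parts separately. *)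
Lemma cabs_cintegral (g : E -> C) h : cintegrable g -> L1 h -> (forall x, cabs (g x) <= h x) ->
  cabs (cintegral g) <= 2 * Int h.
Proof.
move=> [g1 g2] Lh gh; rewrite (le_trans (cabs_le _))// (_ : 2 * Int h = Int h + Int h); last first.
  by rewrite mulr2n mulrDl mul1r.
rewrite lerD//.
  by apply: Int_norm_le => // x; rewrite (le_trans (Re_le_cabs _)).
by apply: Int_norm_le => // x; rewrite (le_trans (Im_le_cabs _)).
Qed.

Lemma cintegral_affine a v (g : E -> C) : a != 0 -> cintegrable g ->
  cintegral (fun x => g (a *: x + v)) = ((`|a|^-1 ^+ d)%:C)%C * cintegral g.
Proof.
move=> a0 [g1 g2]; apply: complexP; rewrite ?cReM ?cImM ReC ImC mul0r ?subr0 ?addr0 !(cintegral_Re, cintegral_Im).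
  exact: (Int_affine v a0 g1).
exact: (Int_affine v a0 g2).
Qed.

Definition cemeas2 (f : E -> E -> C) :=
  emeas2 (fun x y => complex.Re (f x y)) /\ emeas2 (fun x y => complex.Im (f x y)).

Lemma cemeas2_l f : cemeas f -> cemeas2 (fun x _ => f x).
Proof. by move=> [h1 h2]; split; [exact: (emeas2_1 h1)|exact: (emeas2_1 h2)]. Qed.

Lemma cemeas2_r f : cemeas f -> cemeas2 (fun _ y => f y).
Proof. by move=> [h1 h2]; split; [exact: (emeas2_2 h1)|exact: (emeas2_2 h2)]. Qed.

Lemma cemeas2M f g : cemeas2 f -> cemeas2 g -> cemeas2 (fun x y => f x y * g x y).
Proof.
move=> [f1 f2] [g1 g2]; split.
  under eq_fun do under eq_fun do rewrite cReM.
  exact: (emeas2D (emeas2M f1 g1) (emeas2N (emeas2M f2 g2))).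
under eq_fun do under eq_fun do rewrite cImM.
exact: (emeas2D (emeas2M f1 g2) (emeas2M f2 g1)).
Qed.

Lemma cfubini (f : E -> E -> C) B : cemeas2 f ->
  (forall x y, (1 + `|x|) ^+ (2 * d) * ((1 + `|y|) ^+ (2 * d) * cabs (f x y)) <= B) ->
  cintegral (fun x => cintegral (fun y => f x y)) = cintegral (fun y => cintegral (fun x => f x y)).
Proof.
move=> [f1 f2] fB; apply: complexP.
  apply: (fubini2 f1 (C := B)) => x y; apply: le_trans (fB x y).
  by rewrite !ler_wpM2l ?one_norm_X_ge0// Re_le_cabs.
apply: (fubini2 f2 (C := B)) => x y; apply: le_trans (fB x y).
by rewrite !ler_wpM2l ?one_norm_X_ge0// Im_le_cabs.
Qed.

Lemma cintegral_lim (f_ : nat -> E -> C) (f : E -> C) g : (forall n, cemeas (f_ n)) -> cemeas f -> L1 g ->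
  (forall n x, cabs (f_ n x) <= g x) ->
  (forall x, complex.Re (f_ n x) @[n --> \oo] --> complex.Re (f x)) ->
  (forall x, complex.Im (f_ n x) @[n --> \oo] --> complex.Im (f x)) ->
  complex.Re (cintegral (f_ n)) @[n --> \oo] --> complex.Re (cintegral f) /\
  complex.Im (cintegral (f_ n)) @[n --> \oo] --> complex.Im (cintegral f).
Proof.
move=> mf_ [mf1 mf2] Lg fg cr ci; split.
  apply: (Int_lim (f_ := fun n => re (f_ n)) _ mf1 Lg) => //.
    by move=> n; have [] := mf_ n.
  by move=> n x; apply: le_trans (fg n x); exact: Re_le_cabs.
apply: (Int_lim (f_ := fun n => im (f_ n)) _ mf2 Lg) => //.
  by move=> n; have [] := mf_ n.
by move=> n x; apply: le_trans (fg n x); exact: Im_le_cabs.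
Qed.

(** A positive continuous function is bounded below by a multiple of the indicator of a
    small cube, whose integral is a power of its side. *)
Lemma Int_gt0 (f : E -> R) x0 : continuous f -> L1 f -> (forall x, 0 <= f x) -> 0 < f x0 -> 0 < Int f.
Proof.
move=> cf Lf f0 fx0.
have [] := (continuous_epsP f).1 cf x0 (f x0 / 2); first by rewrite divr_gt0.
move=> de de0 near_f.
pose b (x : E) : R := \prod_(i < d) \1_(`[0%R, 1%R]%classic : set mR) (x 0 i).
have b0 x : 0 <= b x by apply: prodr_ge0 => i _; rewrite indicE.
have bE t : b (row_of_tuple t) = \prod_(i < d) \1_(`[0%R, 1%R]%classic : set mR) (tnth t i).
  by apply: eq_bigr => i _; rewrite mxE.
have mb : emeas b.
  rewrite /emeas /comp; under eq_fun do rewrite bE.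
  apply: measurable_prod => i _.
  exact: (measurableT_comp (measurable_indic (measurable_itv `[0%R, 1%R])) (measurable_tnth i)).
have hb := @integral_unit_box R d.
have Lb : L1 b.
  apply/integrableP; split; first exact/measurable_EFinP.
  under eq_integral do rewrite gee0_abs ?lee_fin// bE.
  by rewrite hb ltry.
have Ib : Int b = 1.
  by rewrite /Int /Rintegral; under eq_integral do rewrite bE; rewrite hb.
have a0 : 2 / de != 0 by rewrite mulf_neq0 ?invr_eq0// gt_eqF.
pose h (x : E) := f x0 / 2 * b ((2 / de) *: x + (- ((2 / de) *: x0))).
have Lh : L1 h by apply: L1Z; exact: L1_affine.
have Ih : 0 < Int h.
  rewrite IntZ; last exact: L1_affine.
  by rewrite Int_affine// Ib mulr1 mulr_gt0 ?divr_gt0// exprn_gt0// invr_gt0 normr_gt0.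
apply: lt_le_trans Ih _; apply: Int_le => // x; rewrite /h.
set z := _ + _; have [-> |bz] := eqVneq (b z) 0; first by rewrite mulr0.
have bi i : 0 <= z 0 i <= 1.
  apply/negPn/negP => zi; move/eqP: bz; apply.
  by rewrite /b (bigD1 i)//= indicE memNset ?mul0r//= in_itv/=; exact/negP.
have b1 : b z <= 1.
  by apply: prodr_ile1 => i _; rewrite indicE ler0n lern1 leq_b1.
apply: (@le_trans _ _ (f x0 / 2)); first by rewrite ler_piMr// divr_ge0// ltW.
have zx : `|x - x0| < de.
  have zn : `|z| <= 1.
    by apply: norm_le_coord => // i; have /andP[h1 h2] := bi i; rewrite ger0_norm.
  have e : x - x0 = (de / 2) *: z.
    have c1 : de / 2 * (2 / de) = 1 by field; rewrite gt_eqF.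
    by rewrite /z scalerDr scalerN !scalerA c1 !scale1r.
  rewrite e normrZ ger0_norm ?divr_ge0 ?(ltW de0)//.
  apply: (@le_lt_trans _ _ (de / 2)); first by rewrite ler_piMr// divr_ge0// ltW.
  by rewrite ltr_pdivrMr// ltr_pMr// ltr1n.
have := near_f x zx; rewrite ler_norml => /andP[+ _]; lra.
Qed.

End complex_integral.

Section fourier_transform.
Context {R : realType} {d : nat}.
Local Notation mR := (measurableTypeR R).
Local Notation E := 'rV[R]_d.
Local Notation C := R[i].

Lemma dotp0 (x : E) : dotp x 0 = 0.
Proof. by rewrite /dotp big1// => i _; rewrite mxE mulr0. Qed.

Lemma cabs_cis a : cabs (cis a : C) = 1.
Proof. by rewrite cabsE /= cos2Dsin2 sqrtr1. Qed.

Lemma cisD a b : cis (a + b) = cis a * cis b :> C.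
Proof. by apply: complexP; rewrite ?cReM ?cImM /= ?cosD ?sinD// addrC. Qed.

Lemma cemeas2_cisN : cemeas2 (fun x y : E => cis (- dotp x y)).
Proof.
split; rewrite /=.
  by under eq_fun do under eq_fun do rewrite cosN; exact: (emeas2_trig true).
by under eq_fun do under eq_fun do rewrite sinN; exact: (emeas2N (emeas2_trig false)).
Qed.

Lemma cemeas2_cis : cemeas2 (fun x y : E => cis (dotp x y)).
Proof. by split; [exact: (emeas2_trig true)|exact: (emeas2_trig false)]. Qed.

Lemma cemeas2_fix_l f (x : E) : cemeas2 f -> cemeas (f x).
Proof. by move=> [h1 h2]; split; [exact: (emeas2_l x h1)|exact: (emeas2_l x h2)]. Qed.

Lemma cemeas2_fix_r f (y : E) : cemeas2 f -> cemeas (f^~ y).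
Proof. by move=> [h1 h2]; split; [exact: (emeas2_r y h1)|exact: (emeas2_r y h2)]. Qed.

Lemma cschwartz_cemeas (g : E -> C) : cschwartz g -> cemeas g.
Proof. by move=> [h1 h2]; split; exact: rschwartz_emeas. Qed.

Lemma cschwartz_cintegrable (g : E -> C) : cschwartz g -> cintegrable g.
Proof. by move=> [h1 h2]; split; exact: rschwartz_L1. Qed.

Lemma cschwartz_ccontinuous (g : E -> C) : cschwartz g -> ccontinuous g.
Proof. by move=> [h1 h2]; split; exact: rschwartz_continuous. Qed.

Lemma cschwartz_bound (g : E -> C) N : cschwartz g ->
  exists2 B : R, 0 <= B & forall x, (1 + `|x|) ^+ N * cabs (g x) <= B.
Proof.
move=> [h1 h2]; have [B B0 fB] := rapid_ge0 N (rschwartz_rapid h1).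
have [B' B'0 fB'] := rapid_ge0 N (rschwartz_rapid h2).
exists (B + B'); first exact: addr_ge0.
move=> x; apply: le_trans (lerD (fB x) (fB' x)); rewrite -mulrDr ler_wpM2l ?one_norm_X_ge0//.
exact: cabs_le.
Qed.

Lemma cschwartz_cabs_le (g : E -> C) : cschwartz g -> exists2 B : R, 0 <= B & forall x, cabs (g x) <= B.
Proof. by move=> /(cschwartz_bound 0%N)[B B0 h]; exists B => // x; have := h x; rewrite mul1r. Qed.

Lemma cschwartzD (g h : E -> C) : cschwartz g -> cschwartz h -> cschwartz (fun x => g x + h x).
Proof.
move=> [g1 g2] [h1 h2]; split.
  by rewrite (_ : re _ = fun x => re g x + re h x); [exact: rschwartzD|apply/funext => x; rewrite /re cReD].
by rewrite (_ : im _ = fun x => im g x + im h x); [exact: rschwartzD|apply/funext => x; rewrite /im cImD].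
Qed.

Lemma cschwartzM (g h : E -> C) : cschwartz g -> cschwartz h -> cschwartz (fun x => g x * h x).
Proof.
move=> [g1 g2] [h1 h2]; split.
  rewrite (_ : re _ = fun x => re g x * re h x - im g x * im h x).
    by apply: rschwartzB; exact: rschwartzM.
  by apply/funext => x; rewrite /re cReM.
rewrite (_ : im _ = fun x => re g x * im h x + im g x * re h x).
  by apply: rschwartzD; exact: rschwartzM.
by apply/funext => x; rewrite /im cImM.
Qed.

Lemma cschwartzZ a (g : E -> C) : cschwartz g -> cschwartz (fun x => a * g x).
Proof.
move=> [g1 g2]; split.
  rewrite (_ : re _ = fun x => complex.Re a * re g x - complex.Im a * im g x).
    by apply: rschwartzB; exact: rschwartzZ.
  by apply/funext => x; rewrite /re cReM.
rewrite (_ : im _ = fun x => complex.Re a * im g x + complex.Im a * re g x).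
  by apply: rschwartzD; exact: rschwartzZ.
by apply/funext => x; rewrite /im cImM.
Qed.

Lemma cschwartz_affine a v (g : E -> C) : a != 0 -> cschwartz g -> cschwartz (fun x => g (a *: x + v)).
Proof.
by move=> a0 [h1 h2]; split; [exact: (rschwartz_affine v a0 h1)|exact: (rschwartz_affine v a0 h2)].
Qed.

Lemma cschwartz_opp (g : E -> C) : cschwartz g -> cschwartz (fun x => g (- x)).
Proof.
have n1 : -1 != 0 :> R by rewrite oppr_eq0 oner_neq0.
by move=> /(cschwartz_affine 0 n1); under eq_fun do rewrite scaleN1r addr0.
Qed.

Lemma cschwartz_sub (g : E -> C) z : cschwartz g -> cschwartz (fun x => g (z - x)).
Proof.
have n1 : -1 != 0 :> R by rewrite oppr_eq0 oner_neq0.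
by move=> /(cschwartz_affine z n1); under eq_fun do rewrite scaleN1r addrC.
Qed.

Definition fourier_cst : C := (((2 * pi) `^ (- (d%:R / 2)))%:C)%C.

Lemma Re_fc_gt0 : 0 < complex.Re fourier_cst.
Proof. by apply: powR_gt0; rewrite mulr_gt0// pi_gt0. Qed.

Lemma fourier_cst_neq0 : fourier_cst != 0.
Proof.
by apply/negP => /eqP h; have := Re_fc_gt0; rewrite h ltxx.
Qed.

Lemma fourierE (g : E -> C) y : fourier g y = fourier_cst * cintegral (fun x => cis (- dotp x y) * g x).
Proof. by []. Qed.

Lemma inv_fourierF (g : E -> C) y : inv_fourier g y = fourier_cst * cintegral (fun x => cis (dotp y x) * g x).
Proof. by []. Qed.

Lemma inv_fourierE (g : E -> C) y : inv_fourier g y = fourier g (- y).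
Proof.
rewrite fourierE /inv_fourier; congr (_ * cintegral _); apply/funext => x.
by rewrite dotpNr opprK dotpC.
Qed.

Opaque Int cintegral fourier inv_fourier.

Lemma fourier_cschwartz (g : E -> C) : cschwartz g -> cschwartz (fourier g).
Proof.
move=> [g1 g2]; have -> : fourier g = fun y => fourier_cst * cintegral (fun x => cis (- dotp x y) * g x).
  by apply/funext => y; exact: fourierE.
apply: cschwartzZ; split.
  rewrite (_ : re _ = fun y => trig_transform true (re g) y + trig_transform false (im g) y).
    by apply: rschwartzD; exact: rschwartz_trig_transform.
  apply/funext => y; rewrite /re cintegral_Re /trig_transform -IntD; [|exact: L1_trig|exact: L1_trig].
  by congr Int; apply/funext => x; rewrite /re cReM /= cosN sinN mulNr opprK.
rewrite (_ : im _ = fun y => trig_transform true (im g) y - trig_transform false (re g) y).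
  by apply: rschwartzB; exact: rschwartz_trig_transform.
apply/funext => y; rewrite /im cintegral_Im /trig_transform -IntB; [|exact: L1_trig|exact: L1_trig].
by congr Int; apply/funext => x; rewrite /im cImM /= cosN sinN mulNr.
Qed.

Lemma inv_fourier_cschwartz (g : E -> C) : cschwartz g -> cschwartz (inv_fourier g).
Proof.
move=> /fourier_cschwartz/cschwartz_opp; congr cschwartz; apply/funext => x; exact/esym/inv_fourierE.
Qed.

Lemma cintegrable_cisN (g : E -> C) y : cintegrable g -> cintegrable (fun x => cis (- dotp x y) * g x).
Proof.
move=> gi; apply: (cintegrableM (B := 1) gi); first exact: (cemeas2_fix_r y cemeas2_cisN).
by move=> x; rewrite cabs_cis.
Qed.

Lemma cintegrable_cis (g : E -> C) y : cintegrable g -> cintegrable (fun x => cis (dotp y x) * g x).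
Proof.
move=> gi; apply: (cintegrableM (B := 1) gi); first exact: (cemeas2_fix_l y cemeas2_cis).
by move=> x; rewrite cabs_cis.
Qed.

Lemma fourierZ a (g : E -> C) : cintegrable g -> fourier (fun x => a * g x) = fun y => a * fourier g y.
Proof.
move=> gi; apply/funext => y; rewrite !fourierE mulrCA -[a * cintegral _]cintegralZ; last exact: cintegrable_cisN.
by congr (_ * cintegral _); apply/funext => x; rewrite mulrCA.
Qed.

(** The hypothesis of Fubini's theorem for an oscillating factor times a product of
    Schwartz functions. *)
Lemma tensor_decay (g h : E -> C) (c : E -> E -> C) : cschwartz g -> cschwartz h -> (forall x y, cabs (c x y) = 1) ->
  exists B : R, forall x y, (1 + `|x|) ^+ (2 * d) * ((1 + `|y|) ^+ (2 * d) * cabs (c x y * g x * h y)) <= B.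
Proof.
move=> gs hs c1; have [B B0 gB] := cschwartz_bound (2 * d) gs; have [B' B'0 hB] := cschwartz_bound (2 * d) hs.
exists (B * B') => x y; rewrite !cabsM c1 mul1r.
rewrite (_ : _ * _ = (1 + `|x|) ^+ (2 * d) * cabs (g x) * ((1 + `|y|) ^+ (2 * d) * cabs (h y))); last by ring.
by apply: ler_pM => //; apply: mulr_ge0; rewrite ?one_norm_X_ge0 ?cabs_ge0.
Qed.

Lemma fourier_mul_formula (g k : E -> C) : cschwartz g -> cschwartz k ->
  cintegral (fun x => fourier g x * k x) = cintegral (fun x => g x * fourier k x).
Proof.
move=> gs ks.
have -> : (fun x => fourier g x * k x) =
    (fun x => fourier_cst * cintegral (fun y => cis (- dotp x y) * k x * g y)).
  apply/funext => x; rewrite fourierE -mulrA; congr (_ * _).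
  rewrite mulrC -cintegralZ; last exact/cintegrable_cisN/cschwartz_cintegrable.
  by congr cintegral; apply/funext => y; rewrite dotpC mulrA [k x * _]mulrC.
have -> : (fun x => g x * fourier k x) =
    (fun y => fourier_cst * cintegral (fun x => cis (- dotp x y) * k x * g y)).
  apply/funext => y; rewrite fourierE mulrCA; congr (_ * _).
  rewrite -cintegralZ; last exact/cintegrable_cisN/cschwartz_cintegrable.
  by congr cintegral; apply/funext => x; rewrite mulrC.
have [B hB] := tensor_decay ks gs (fun x y => cabs_cis (- dotp x y)).
have m2 : cemeas2 (fun x y : E => cis (- dotp x y) * k x * g y).
  apply: cemeas2M; last exact/cemeas2_r/cschwartz_cemeas.
  by apply: cemeas2M; [exact: cemeas2_cisN|exact/cemeas2_l/cschwartz_cemeas].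
have i1 : cintegrable (fun x => cintegral (fun y => cis (- dotp x y) * k x * g y)).
  have e : (fun x => cintegral (fun y => cis (- dotp x y) * k x * g y)) = (fun x => fourier_cst^-1 * (fourier g x * k x)).
    apply/funext => x; rewrite fourierE mulrA mulKf ?fourier_cst_neq0// mulrC -cintegralZ.
      by congr cintegral; apply/funext => y; rewrite dotpC mulrA [k x * _]mulrC.
    exact/cintegrable_cisN/cschwartz_cintegrable.
  rewrite e; apply: cintegrableZ; apply: cschwartz_cintegrable.
  exact: cschwartzM (fourier_cschwartz gs) ks.
have i2 : cintegrable (fun y => cintegral (fun x => cis (- dotp x y) * k x * g y)).
  have e : (fun y => cintegral (fun x => cis (- dotp x y) * k x * g y)) = (fun y => fourier_cst^-1 * (g y * fourier k y)).
    apply/funext => y; rewrite fourierE [g y * _]mulrCA mulKf ?fourier_cst_neq0// -cintegralZ.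
      by congr cintegral; apply/funext => x; rewrite mulrC.
    exact/cintegrable_cisN/cschwartz_cintegrable.
  rewrite e; apply: cintegrableZ; apply: cschwartz_cintegrable.
  exact: cschwartzM gs (fourier_cschwartz ks).
by rewrite (cintegralZ fourier_cst i1) (cintegralZ fourier_cst i2) (cfubini m2 hB).
Qed.

(** The dual of a Fourier multiplier: applying the distributional multiplier to f
    amounts to evaluating f at [mult m g]. *)
Definition mult (m g : E -> C) : E -> C := fourier (fun x => m x * inv_fourier g x).
Definition ker (m : E -> C) : E -> C := fun z => fourier_cst * fourier m z.

Lemma mult_cschwartz m g : cschwartz m -> cschwartz g -> cschwartz (mult m g).
Proof. by move=> ms gs; exact: fourier_cschwartz (cschwartzM ms (inv_fourier_cschwartz gs)). Qed.

Lemma ker_cschwartz m : cschwartz m -> cschwartz (ker m).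
Proof. by move=> ms; exact: (cschwartzZ fourier_cst (fourier_cschwartz ms)). Qed.

(** Exchange the two integrals in the definition of [mult]. *)
Lemma mult_conv m g : cschwartz m -> cschwartz g -> mult m g = fun z => cintegral (fun y => ker m (z - y) * g y).
Proof.
move=> ms gs; apply/funext => z.
have [B hB] := tensor_decay ms gs (fun x y => cabs_cis (- dotp x (z - y))).
have cE (x y : E) : cis (- dotp x (z - y)) = cis (- dotp x z) * cis (dotp x y) :> C.
  by rewrite -cisD dotpDr dotpNr opprD opprK.
have m2 : cemeas2 (fun x y : E => cis (- dotp x (z - y)) * m x * g y).
  apply: cemeas2M; last exact/cemeas2_r/cschwartz_cemeas.
  apply: cemeas2M; last exact/cemeas2_l/cschwartz_cemeas.
  have -> : (fun x y : E => cis (- dotp x (z - y)) : C) = (fun x y => cis (- dotp x z) * cis (dotp x y)).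
    by apply/funext => x; apply/funext => y.
  apply: cemeas2M; last exact: cemeas2_cis.
  by apply: (@cemeas2_l _ _ (fun x => cis (- dotp x z))); exact: (cemeas2_fix_r z cemeas2_cisN).
have e1 x : cintegral (fun y => cis (- dotp x (z - y)) * m x * g y) =
    fourier_cst^-1 * (cis (- dotp x z) * (m x * inv_fourier g x)).
  rewrite inv_fourierF [m x * _]mulrCA [cis _ * (fourier_cst * _)]mulrCA mulKf ?fourier_cst_neq0//.
  rewrite mulrA.
  rewrite -cintegralZ; last exact/cintegrable_cis/cschwartz_cintegrable.
  by congr cintegral; apply/funext => y; rewrite cE; ring.
have e2 y : cintegral (fun x => cis (- dotp x (z - y)) * m x * g y) = (fourier_cst^-1) * fourier m (z - y) * g y.
  rewrite fourierE mulKf ?fourier_cst_neq0// [RHS]mulrC -cintegralZ; last exact/cintegrable_cisN/cschwartz_cintegrable.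
  by congr cintegral; apply/funext => x; ring.
have := cfubini m2 hB.
have -> : (fun x => cintegral (fun y => cis (- dotp x (z - y)) * m x * g y)) =
  (fun x => fourier_cst^-1 * (cis (- dotp x z) * (m x * inv_fourier g x))) by apply/funext.
have -> : (fun y => cintegral (fun x => cis (- dotp x (z - y)) * m x * g y)) =
  (fun y => fourier_cst^-1 * (fourier m (z - y) * g y)) by apply/funext => y; rewrite e2 -mulrA.
have i1 : cintegrable (fun x => m x * inv_fourier g x).
  exact: cschwartz_cintegrable (cschwartzM ms (inv_fourier_cschwartz gs)).
have s2 := cschwartz_sub z (fourier_cschwartz ms).
have i2 : cintegrable (fun y => fourier m (z - y) * g y) by exact: cschwartz_cintegrable (cschwartzM s2 gs).
rewrite !cintegralZ//; last exact: cintegrable_cisN.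
move=> /(mulfI (invr_neq0 fourier_cst_neq0)) h.
rewrite /mult fourierE h -cintegralZ//; congr cintegral; apply/funext => y; rewrite /ker; ring.
Qed.

Lemma mult_lin m (a : C) (g h : E -> C) : cschwartz m -> cschwartz g -> cschwartz h ->
  mult m (fun x => a * g x + h x) = fun y => a * mult m g y + mult m h y.
Proof.
move=> ms gs hs.
have k (z : E) (u : E -> C) : cschwartz u -> cintegrable (fun y => ker m (z - y) * u y).
  by move=> us; exact: cschwartz_cintegrable (cschwartzM (cschwartz_sub z (ker_cschwartz ms)) us).
rewrite (mult_conv ms (cschwartzD (cschwartzZ a gs) hs)).
apply/funext => z; rewrite (mult_conv ms gs) (mult_conv ms hs).
rewrite -(cintegralZ a (k z g gs)).
rewrite -(cintegralD (cintegrableZ a (k z g gs)) (k z h hs)).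
by congr cintegral; apply/funext => y; rewrite mulrDr mulrCA.
Qed.

(** Dilating a cut-off dilates its kernel without changing the L1 norm, which is what
    makes the estimates below uniform in the frequency. *)
Lemma ker_dilate (m : E -> C) (a : R) z : 0 < a -> cschwartz m ->
  ker (fun x => m (a *: x)) z = ((a^-1 ^+ d)%:C)%C * ker m (a^-1 *: z).
Proof.
move=> a0 ms; have an0 : a != 0 by rewrite gt_eqF.
have := cintegral_affine 0 an0 (cintegrable_cisN (a^-1 *: z) (cschwartz_cintegrable ms)).
rewrite gtr0_norm// => h; rewrite /ker !fourierE.
rewrite [RHS]mulrCA [in RHS](mulrCA _ fourier_cst) -h.
congr (_ * (_ * cintegral _)); apply/funext => x.
by rewrite addr0 dotpZr [dotp (a *: x) z]dotpC dotpZr mulrA mulVf// mul1r dotpC.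
Qed.

(** Substitute in the convolution to see the dilated kernel as an average of translates
    at scale a. *)
Lemma mult_dilate (m0 g : E -> C) (a : R) y : 0 < a -> cschwartz m0 -> cschwartz g ->
  mult (fun x => m0 (a *: x)) g y = cintegral (fun v => ker m0 v * g (y - a *: v)).
Proof.
move=> a0 ms gs; have an0 : a != 0 by rewrite gt_eqF.
have n2 : - a != 0 by rewrite oppr_eq0.
have [ma maE] : exists ma, ma = fun x => m0 (a *: x) by eexists.
have mas : cschwartz ma.
  by rewrite maE; have := cschwartz_affine 0 an0 ms; under eq_fun do rewrite addr0.
rewrite -maE (mult_conv mas gs).
have i2 := cschwartz_cintegrable (cschwartzM (cschwartz_sub y (ker_cschwartz mas)) gs).
have h := cintegral_affine y n2 i2; rewrite normrN (gtr0_norm a0) in h.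
have c0 : ((a^-1 ^+ d)%:C)%C != 0 :> C.
  by apply/eqP => -[] /eqP; rewrite expf_eq0 invr_eq0 (negbTE an0) andbF.
have yE (v : E) : y - a *: v = - a *: v + y by rewrite scaleNr addrC.
have i3 : cintegrable (fun v => ker m0 v * g (- a *: v + y)).
  exact: cschwartz_cintegrable (cschwartzM (ker_cschwartz ms) (cschwartz_affine y n2 gs)).
have -> : (fun v => ker m0 v * g (y - a *: v)) = (fun v => ker m0 v * g (- a *: v + y)).
  by apply/funext => v; rewrite yE.
apply: (mulfI c0); apply: etrans (esym h) _.
apply: etrans (cintegralZ _ i3).
apply: (congr1 (@cintegral R d)); apply/funext => v.
have e : y - (- a *: v + y) = a *: v by rewrite scaleNr opprD opprK addrCA subrr addr0.
by rewrite e maE (ker_dilate _ a0 ms) scalerA (mulVf an0) scale1r -mulrA.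
Qed.

(** Compute the limit of the multipliers of symbol m0(a x), for a tending to 0, in two
    ways. The symbols tend to m0 0 = 1, so that the multiplier tends to the composition
    of the two transforms. The convolution formula is an average of g(y - a v) with
    density the kernel, which tends to the integral of the kernel times g y. *)
Lemma inversion_kappa (m0 : E -> C) (g : E -> C) : cschwartz m0 -> m0 0 = 1 -> cschwartz g ->
  fourier (inv_fourier g) = fun y => cintegral (ker m0) * g y.
Proof.
move=> ms m00 gs; apply/funext => y.
pose a (n : nat) : R := n.+1%:R^-1.
have a0 n : 0 < a n by rewrite invr_gt0.
have an0 n : a n != 0 by rewrite gt_eqF.
have a_cvg : a n @[n --> \oo] --> (0 : R) by exact: cvg_harmonic.
have aZ (x : E) : (a n *: x) @[n --> \oo] --> (0 : E).
  by rewrite -[X in _ --> X](scale0r x); apply: cvgZr_tmp => //; exact: cvg_cst.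
pose mn n := fun x => m0 (a n *: x).
have mns n : cschwartz (mn n).
  by have := cschwartz_affine 0 (an0 n) ms; under eq_fun do rewrite addr0.
have mn_cvg x : complex.Re (mn n x) @[n --> \oo] --> (1 : R) /\ complex.Im (mn n x) @[n --> \oo] --> (0 : R).
  have [cr ci] := cschwartz_ccontinuous ms; split.
    by have := continuous_cvg _ (cr 0) (aZ x); rewrite {2}/re m00; exact.
  by have := continuous_cvg _ (ci 0) (aZ x); rewrite {2}/im m00; exact.
have [B B0 mB] := cschwartz_cabs_le ms.
have Gs := inv_fourier_cschwartz gs.
have [G GE] : exists G, G = inv_fourier g by exists (inv_fourier g).
rewrite -GE in Gs *.
(* the symbols tend to 1: the limit is the composition of the transforms *)
have L1_ := cintegral_lim (f_ := fun n x => cis (- dotp x y) * (mn n x * G x))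
  (f := fun x => cis (- dotp x y) * G x) (g := fun x => B * cabs (G x)).
case: L1_.
- move=> n; apply: cemeasM; first exact: (cemeas2_fix_r y cemeas2_cisN).
  exact: cschwartz_cemeas (cschwartzM (mns n) Gs).
- by apply: cemeasM; [exact: (cemeas2_fix_r y cemeas2_cisN)|exact: cschwartz_cemeas].
- by apply/L1Z/L1_cabs/cschwartz_cintegrable.
- by move=> n x; rewrite cabsM cabs_cis mul1r cabsM; exact: (ler_wpM2r (cabs_ge0 (G x)) (mB (a n *: x))).
- move=> x; have [h1 h2] := mn_cvg x.
  have e n : cis (- dotp x y) * (mn n x * G x) = mn n x * (cis (- dotp x y) * G x) by rewrite mulrCA.
  have -> : (fun n => complex.Re (cis (- dotp x y) * (mn n x * G x))) =
      (fun n => complex.Re (mn n x) * complex.Re (cis (- dotp x y) * G x) -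
                complex.Im (mn n x) * complex.Im (cis (- dotp x y) * G x)).
    by apply/funext => n; rewrite e; exact: cReM.
  have := cvgB (cvgMr_tmp (b := complex.Re (cis (- dotp x y) * G x)) h1)
               (cvgMr_tmp (b := complex.Im (cis (- dotp x y) * G x)) h2).
  by rewrite mul1r mul0r subr0; exact.
- move=> x; have [h1 h2] := mn_cvg x.
  have e n : cis (- dotp x y) * (mn n x * G x) = mn n x * (cis (- dotp x y) * G x) by rewrite mulrCA.
  have -> : (fun n => complex.Im (cis (- dotp x y) * (mn n x * G x))) =
      (fun n => complex.Re (mn n x) * complex.Im (cis (- dotp x y) * G x) +
                complex.Im (mn n x) * complex.Re (cis (- dotp x y) * G x)).
    by apply/funext => n; rewrite e; exact: cImM.
  have := cvgD (cvgMr_tmp (b := complex.Im (cis (- dotp x y) * G x)) h1)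
               (cvgMr_tmp (b := complex.Re (cis (- dotp x y) * G x)) h2).
  by rewrite mul1r mul0r addr0; exact.
move=> Lr1 Li1.
(* the kernels concentrate: the limit is a multiple of g *)
have multE n := mult_dilate y (a0 n) ms gs.
have [Bg Bg0 gB] := cschwartz_cabs_le gs.
have [cgr cgi] := cschwartz_ccontinuous gs.
have yZ (v : E) : (y - a n *: v) @[n --> \oo] --> y.
  by rewrite -[X in _ --> X]subr0; apply: cvgB; [exact: cvg_cst|exact: aZ].
have L2_ := cintegral_lim (f_ := fun n v => ker m0 v * g (y - a n *: v))
  (f := fun v => ker m0 v * g y) (g := fun v => Bg * cabs (ker m0 v)).
have k0 := ker_cschwartz ms.
case: L2_.
- move=> n; have n2 : - a n != 0 by rewrite oppr_eq0.
  apply: cemeasM; first exact: cschwartz_cemeas.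
  have := cschwartz_cemeas (cschwartz_affine y n2 gs); congr cemeas; apply/funext => v.
  by rewrite scaleNr addrC.
- by apply: cemeasM; [exact: cschwartz_cemeas|exact: cemeas_cst].
- by apply: L1Z; apply: L1_cabs; exact: cschwartz_cintegrable.
- by move=> n v; rewrite cabsM mulrC; exact: (ler_wpM2r (cabs_ge0 (ker m0 v)) (gB (y - a n *: v))).
- move=> v; rewrite cReM.
  have -> : (fun n => complex.Re (ker m0 v * g (y - a n *: v))) =
     (fun n => complex.Re (ker m0 v) * re g (y - a n *: v) - complex.Im (ker m0 v) * im g (y - a n *: v)).
    by apply/funext => n; rewrite cReM.
  apply: cvgB; apply: cvgMl_tmp.
    exact: (continuous_cvg _ (cgr y) (yZ v)).
  exact: (continuous_cvg _ (cgi y) (yZ v)).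
- move=> v; rewrite cImM.
  have -> : (fun n => complex.Im (ker m0 v * g (y - a n *: v))) =
     (fun n => complex.Re (ker m0 v) * im g (y - a n *: v) + complex.Im (ker m0 v) * re g (y - a n *: v)).
    by apply/funext => n; rewrite cImM.
  apply: cvgD; apply: cvgMl_tmp.
    exact: (continuous_cvg _ (cgi y) (yZ v)).
  exact: (continuous_cvg _ (cgr y) (yZ v)).
move=> Lr2 Li2.
have i4 := cschwartz_cintegrable k0.
have E2 : cintegral (fun v => ker m0 v * g y) = cintegral (ker m0) * g y.
  by rewrite mulrC -(cintegralZ _ i4); congr cintegral; apply/funext => v; rewrite mulrC.
have seqE n : cintegral (fun v => ker m0 v * g (y - a n *: v)) =
    fourier_cst * cintegral (fun x => cis (- dotp x y) * (mn n x * G x)) by rewrite -multE GE.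
rewrite -E2; apply: complexP.
  rewrite fourierE cReM ImC mul0r subr0; apply: (cvg_unique _ _ Lr2) => //.
  have -> : (fun n => complex.Re (cintegral (fun v => ker m0 v * g (y - a n *: v)))) =
    (fun n => complex.Re fourier_cst * complex.Re (cintegral (fun x => cis (- dotp x y) * (mn n x * G x)))).
    by apply/funext => n; rewrite seqE cReM ImC mul0r subr0.
  exact: cvgMl_tmp.
rewrite fourierE cImM ImC mul0r addr0; apply: (cvg_unique _ _ Li2) => //.
have -> : (fun n => complex.Im (cintegral (fun v => ker m0 v * g (y - a n *: v)))) =
    (fun n => complex.Re fourier_cst * complex.Im (cintegral (fun x => cis (- dotp x y) * (mn n x * G x)))).
  by apply/funext => n; rewrite seqE cImM ImC mul0r addr0.
exact: cvgMl_tmp.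
Qed.

Lemma fourier_opp (g : E -> C) : cintegrable g -> fourier (fun x => g (- x)) = fun y => fourier g (- y).
Proof.
move=> gi; apply/funext => y; rewrite !fourierE; congr (_ * _).
have n1 : -1 != 0 :> R by rewrite oppr_eq0 oner_neq0.
have := cintegral_affine 0 n1 (cintegrable_cisN (- y) gi).
rewrite normrN normr1 invr1 expr1n mul1r => <-; congr cintegral; apply/funext => x.
by rewrite addr0 scaleN1r dotpNr opprK [dotp (- x) y]dotpC dotpNr dotpC.
Qed.

Lemma inv_fourier_fourier (g : E -> C) : cschwartz g -> inv_fourier (fourier g) = fourier (inv_fourier g).
Proof.
move=> gs; apply/funext => y; rewrite inv_fourierE.
have -> : inv_fourier g = fun x => fourier g (- x) by apply/funext => x; rewrite inv_fourierE.
by rewrite (fourier_opp (cschwartz_cintegrable (fourier_cschwartz gs))).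
Qed.

(** If the constant were 0, the Fourier transform composed with itself would vanish on
    Schwartz functions. Apply the multiplication formula to a real w and to its
    reflection, whose transform is the conjugate of that of w: the integral of the
    squared modulus of the transform of w would be 0. But at the origin this transform
    is a multiple of the integral of w. *)
Lemma kappa_neq0 (m0 w : E -> C) : cschwartz m0 -> m0 0 = 1 -> cschwartz w -> (forall x, complex.Im (w x) = 0) ->
  0 < Int (re w) -> cintegral (ker m0) != 0.
Proof.
move=> ms m00 ws wr Iw; apply/negP => /eqP k0.
have FF (g : E -> C) : cschwartz g -> fourier (fourier g) = fun=> 0.
  move=> gs; have -> : fourier g = fun y => inv_fourier g (- y).
    by apply/funext => y; rewrite inv_fourierE opprK.
  rewrite (fourier_opp (cschwartz_cintegrable (inv_fourier_cschwartz gs))).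
  by rewrite (inversion_kappa ms m00 gs) k0; apply/funext => y; rewrite mul0r.
have w's := cschwartz_opp ws.
have sw := fourier_cschwartz ws; have sw' := fourier_cschwartz w's.
have e0 := fourier_mul_formula ws sw'.
have z0 : cintegral (fun x => w x * fourier (fourier (fun x => w (- x))) x) = 0.
  rewrite (FF _ w's); transitivity (cintegral (fun _ : E => 0 : C)); last exact: cintegral0.
  by congr cintegral; apply/funext => x; exact: mulr0.
have conjE x : complex.Re (fourier (fun x => w (- x)) x) = complex.Re (fourier w x) /\
               complex.Im (fourier (fun x => w (- x)) x) = - complex.Im (fourier w x).
  rewrite (fourier_opp (cschwartz_cintegrable ws)) !fourierE !cReM !cImM ImC !mul0r !subr0 !addr0.
  rewrite !cintegral_Re !cintegral_Im -mulrN; split; congr (_ * _).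
    congr Int; apply/funext => t; rewrite /re !cReM wr !mulr0 !subr0 /=.
    by rewrite dotpNr opprK cosN.
  have -> : im (fun t => cis (- dotp t x) * w t) = (fun t => - im (fun t => cis (- dotp t (- x)) * w t) t).
    by apply/funext => t; rewrite /im !cImM wr !mulr0 !add0r /= dotpNr opprK sinN mulNr.
  by rewrite (IntN (cintegrable_cisN (- x) (cschwartz_cintegrable ws)).2) opprK.
(* the squared modulus of the transform of w *)
pose f x := complex.Re (fourier w x) ^+ 2 + complex.Im (fourier w x) ^+ 2.
have fE : re (fun x => fourier w x * fourier (fun x => w (- x)) x) = f.
  by apply/funext => x; have [h1 h2] := conjE x; rewrite /re cReM h1 h2 mulrN opprK -!expr2.
have fs : rschwartz f by rewrite -fE; have [] := cschwartzM sw sw'.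
have If : Int f = 0.
  by rewrite -fE -cintegral_Re e0 z0.
have f0 : 0 < f 0.
  have -> : f 0 = (complex.Re fourier_cst * Int (re w)) ^+ 2 + complex.Im (fourier w 0) ^+ 2.
    rewrite /f fourierE cReM ImC mul0r subr0 cintegral_Re; congr ((_ * Int _) ^+ 2 + _).
    apply/funext => t; rewrite /re cReM wr mulr0 subr0 /=.
    by rewrite dotp0 oppr0 cos0 mul1r.
  have p : 0 < complex.Re fourier_cst * Int (re w).
    exact: mulr_gt0 Re_fc_gt0 Iw.
  by apply: (lt_le_trans (exprn_gt0 2 p)); rewrite lerDl; exact: sqr_ge0.
have fge x : 0 <= f x by rewrite /f; apply: addr_ge0; exact: sqr_ge0.
by have := Int_gt0 (rschwartz_continuous fs) (rschwartz_L1 fs) fge f0; rewrite If ltxx.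
Qed.

(** Multipliers compose up to the constant of Fourier inversion, which appears once in
    the middle. *)
Lemma mult_comp (m0 m n g : E -> C) : cschwartz m0 -> m0 0 = 1 -> cschwartz m -> cschwartz n -> cschwartz g ->
  mult m (mult n g) = fun y => cintegral (ker m0) * mult (fun x => m x * n x) g y.
Proof.
move=> s0 m00 ms ns gs.
have hs := cschwartzM ns (inv_fourier_cschwartz gs).
rewrite {1}/mult (_ : inv_fourier (mult n g) = fun x => cintegral (ker m0) * (n x * inv_fourier g x)); last first.
  by rewrite /mult (inv_fourier_fourier hs) (inversion_kappa s0 m00 hs).
have -> : (fun x => m x * (cintegral (ker m0) * (n x * inv_fourier g x))) =
  (fun x => cintegral (ker m0) * (m x * n x * inv_fourier g x)).
  by apply/funext => x; ring.
rewrite fourierZ//; exact: cschwartz_cintegrable (cschwartzM (cschwartzM ms ns) (inv_fourier_cschwartz gs)).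
Qed.

End fourier_transform.

Transparent Int cintegral fourier inv_fourier.

(** * Frequency cut-offs, seminorms and convolutions *)

Section compact_support.
Context {R : realType} {d : nat}.
Local Notation E := 'rV[R]_d.
Local Notation C := R[i].
Local Notation e i := (delta_mx 0 i : E).

Lemma pd_zero_on (f : E -> R) (S : set E) i :
  (forall x, ~ closure S x -> f x = 0) -> forall x, ~ closure S x -> pd i f x = 0.
Proof.
move=> f0 x xS; rewrite /pd.
have oS : open (~` closure S) by rewrite openC; exact: closed_closure.
have nS : nbhs (x : [the normedModType R of 'rV[R]_d]) (~` closure S) by exact: open_nbhs_nbhs.
rewrite -[RHS](derive_cst (0 : R) x (e i)); apply: near_eq_derive.
by apply: (filterS _ nS) => y yS; rewrite f0.
Qed.

Lemma sup_on_ball (f : E -> R) (r : R) : continuous f -> exists B : R, forall x, `|x| <= r -> `|f x| <= B.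
Proof.
move=> cf.
have cA : compact [set x : E | `|x| <= r].
  apply: bounded_closed_compact.
    exists r; split; first exact: num_real.
    by move=> M rM x /= xr; rewrite (le_trans xr)// ltW.
  have -> : [set x : E | `|x| <= r] = (fun x : E => `|x|) @^-1` [set y : R | y <= r] by [].
  by apply: closed_comp => [x _|]; [exact: norm_continuous|exact: closed_le].
have := compact_bounded (continuous_compact (continuous_subspaceT cf) cA).
move=> [M [_ HM]]; exists (M + 1) => x xr.
by apply: (HM (M + 1)); [rewrite ltrDl|exists x].
Qed.

(** All partial derivatives vanish outside of a common closed set, which is bounded, and
    are continuous inside. *)
Lemma smooth_compact_rschwartz (f : E -> R) (S : set E) (r : R) : smooth f ->
  (forall x, ~ closure S x -> f x = 0) -> (forall x, closure S x -> `|x| <= r) -> rschwartz f.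
Proof.
move=> sf f0 Sr s; split; last exact: (sf s).2.
move=> N.
have z x : ~ closure S x -> partials s f x = 0.
  by move: x; elim: s => [|i s IH] //; exact: pd_zero_on.
have [B HB] := sup_on_ball r (sf s).1.
exists ((1 + `|r|) ^+ N * `|B|) => x.
have [xS|xS] := pselect (closure S x); last first.
  by rewrite z// normr0 mulr0 mulr_ge0// exprn_ge0// addr_ge0.
have xr := Sr x xS; apply: ler_pM => //.
- by rewrite lerXn2r ?nnegrE ?addr_ge0// lerD2l (le_trans xr)// ler_norm.
- by rewrite (le_trans (HB x xr))// ler_norm.
Qed.

Lemma generator_cschwartz (phi0 : E -> C) : resolution_generator phi0 -> cschwartz phi0.
Proof.
move=> [[sre sim] _ supp].
have ph0 x : ~ closure [set xi | phi0 xi != 0] x -> phi0 x = 0.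
  move=> nx; apply/eqP/negPn/negP => px; apply: nx; exact: subset_closure.
have bnd x : closure [set xi | phi0 xi != 0] x -> `|x| <= 2.
  by move=> /supp /= h; rewrite (le_trans (norm_le_enorm x)).
split.
  by apply: (smooth_compact_rschwartz sre _ bnd) => x /ph0 h; rewrite /re h.
by apply: (smooth_compact_rschwartz sim _ bnd) => x /ph0 h; rewrite /im h.
Qed.

Lemma enormZ a (x : E) : enorm (a *: x) = `|a| * enorm x.
Proof.
rewrite /enorm -sqrtr_sqr -sqrtrM ?sqr_ge0//; congr Num.sqrt.
by rewrite dotpZr dotpC dotpZr mulrA expr2.
Qed.

Lemma generator_out (phi0 : E -> C) x : resolution_generator phi0 -> 2 < enorm x -> phi0 x = 0.
Proof.
move=> [_ _ supp] x2; apply/eqP/negPn/negP => px.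
have h : [set xi | enorm xi <= 2] x by apply: supp; exact: subset_closure.
by have := lt_le_trans x2 h; rewrite ltxx.
Qed.

Lemma generator_in (phi0 : E -> C) x : resolution_generator phi0 -> enorm x <= 1 -> phi0 x = 1.
Proof. by move=> [_ h _]; exact: h. Qed.

Lemma generator0 (phi0 : E -> C) : resolution_generator phi0 -> phi0 0 = 1.
Proof. by move=> h; apply: (generator_in h); rewrite /enorm dotp0 sqrtr0. Qed.

(** The partial sums of the dyadic resolution. *)
Definition lowpass (phi0 : E -> C) (N : nat) : E -> C := fun x => phi0 ((2 ^- N) *: x).

Lemma lowpass_cschwartz (phi0 : E -> C) N : cschwartz phi0 -> cschwartz (lowpass phi0 N).
Proof.
move=> ps; have n0 : 2 ^- N != 0 :> R by rewrite invr_eq0 expf_eq0 pnatr_eq0 andbF.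
by have := cschwartz_affine 0 n0 ps; under eq_fun do rewrite addr0.
Qed.

Lemma dyadicE (phi0 : E -> C) j : dyadic phi0 j =
  if j is k.+1 then fun x => lowpass phi0 k.+1 x + (-1) * lowpass phi0 k x else lowpass phi0 0.
Proof.
case: j => [|k]; apply/funext => x; rewrite /dyadic /lowpass.
  by rewrite expr0 invr1 scale1r.
by rewrite mulN1r.
Qed.

Lemma dyadic_cschwartz (phi0 : E -> C) j : cschwartz phi0 -> cschwartz (dyadic phi0 j).
Proof.
move=> ps; rewrite dyadicE; case: j => [|k]; first exact: lowpass_cschwartz.
exact: cschwartzD (lowpass_cschwartz k.+1 ps) (cschwartzZ (-1) (lowpass_cschwartz k ps)).
Qed.

Lemma expV2 N : 2 ^- N > 0 :> R. Proof. by rewrite invr_gt0 exprn_gt0. Qed.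

Lemma lowpass_in (phi0 : E -> C) N x : resolution_generator phi0 -> enorm x <= 2 ^+ N -> lowpass phi0 N x = 1.
Proof.
move=> h xN; apply: (generator_in h).
by rewrite enormZ gtr0_norm ?expV2// mulrC ler_pdivrMr ?mul1r// exprn_gt0.
Qed.

Lemma lowpass_out (phi0 : E -> C) N x : resolution_generator phi0 -> 2 ^+ N.+1 < enorm x -> lowpass phi0 N x = 0.
Proof.
move=> h xN; apply: (generator_out h).
by rewrite enormZ gtr0_norm ?expV2// mulrC ltr_pdivlMr ?exprn_gt0// -exprS.
Qed.

Lemma pow2_le m n : (m <= n)%N -> 2 ^+ m <= 2 ^+ n :> R.
Proof. by move=> mn; rewrite ler_weXn2l// ler1n. Qed.

(** For j < N the dyadic ring lies in the ball on which the cut-off is 1. *)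
Lemma lowpass_dyadic_low (phi0 : E -> C) N j : resolution_generator phi0 -> (j < N)%N ->
  (fun x => lowpass phi0 N x * dyadic phi0 j x) = dyadic phi0 j.
Proof.
move=> h jN; apply/funext => x.
have [xN|xN] := leP (enorm x) (2 ^+ N); first by rewrite (lowpass_in h xN) mul1r.
suff -> : dyadic phi0 j x = 0 by rewrite mulr0.
have out k : (k < N)%N -> lowpass phi0 k x = 0.
  by move=> kN; apply: (lowpass_out h); apply: le_lt_trans xN; exact: pow2_le.
rewrite dyadicE; case: j jN => [|k] jN; first exact: out.
by rewrite !out ?mulr0 ?addr0// ltnW.
Qed.

(** For j > N + 1 the ring lies outside of the support of the cut-off. *)
Lemma lowpass_dyadic_high (phi0 : E -> C) N j : resolution_generator phi0 -> (N.+1 < j)%N ->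
  (fun x => lowpass phi0 N x * dyadic phi0 j x) = fun=> 0.
Proof.
move=> h jN; apply/funext => x.
have [xN|xN] := leP (enorm x) (2 ^+ N.+1); last by rewrite (lowpass_out h xN) mul0r.
suff -> : dyadic phi0 j x = 0 by rewrite mulr0.
case: j jN => [//|k]; rewrite ltnS => Nk; rewrite dyadicE.
rewrite !(lowpass_in h) ?mulr1 ?subrr//.
  by rewrite (le_trans xN)// pow2_le.
by rewrite (le_trans xN)// pow2_le// ltnW.
Qed.

End compact_support.

Section schwartz_bounds.
Context {R : realType} {d : nat}.
Local Notation E := 'rV[R]_d.
Local Notation C := R[i].
Local Notation e i := (delta_mx 0 i : E).

(** A bound for a Schwartz seminorm in terms of the maximum norm and of the two real
    parts. *)
Definition sbound (N : nat) (B : R) (g : E -> C) := forall s x, (size s <= N)%N ->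
  (1 + `|x|) ^+ N * `|partials s (re g) x| <= B /\ (1 + `|x|) ^+ N * `|partials s (im g) x| <= B.

(** There are finitely many partials of order at most n, so a bound that holds for every
    Schwartz function separately is uniform over them. *)
Lemma rschwartz_partials_unif (Q : (E -> R) -> R -> Prop) n (f : E -> R) :
  (forall f B B', Q f B -> B <= B' -> Q f B') ->
  (forall f, rschwartz f -> exists2 B : R, 0 <= B & Q f B) -> rschwartz f ->
  exists2 B : R, 0 <= B & forall s, (size s <= n)%N -> Q (partials s f) B.
Proof.
move=> Qm QE; elim: n f => [|n IH] f fs.
  have [B B0 h] := QE f fs; exists B => // -[|//] _; exact: h.
have /choice[B HB] : forall i, exists B : R, 0 <= B /\ forall s, (size s <= n)%N -> Q (partials s (pd i f)) B.
  by move=> i; have [B B0 h] := IH _ (rschwartz_pd i fs); exists B.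
have [B' B'0 fB'] := QE f fs.
have S0 : 0 <= \sum_i B i by apply: sumr_ge0 => i _; have [] := HB i.
exists (B' + \sum_i B i); first exact: addr_ge0.
move=> s; case/lastP: s => [_|s i]; first by apply: (Qm _ _ _ fB'); rewrite lerDl.
rewrite size_rcons partials_rcons => sn; have [_ h] := HB i; apply: (Qm _ _ _ (h s sn)).
rewrite (bigD1 i)//= addrCA lerDl; apply: addr_ge0 => //; apply: sumr_ge0 => j _; by have [] := HB j.
Qed.

Lemma tempered_bound (T : @dist R d) : tempered T -> exists N, exists2 c : R, 0 <= c &
  forall g B, cschwartz g -> sbound N B g -> cabs (T g) <= c * B.
Proof.
move=> [_ [N [c Tc]] _]; exists N, (`|c| * ((1 + d%:R) ^+ N * 2)).
  by rewrite !mulr_ge0// exprn_ge0// addr_ge0.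
move=> g B gs gB; have gS := cschwartz_schwartz gs.
have h := Tc g gS; have h2 := seminorm_le gB.
rewrite -lee_fin; apply: le_trans h _.
apply: (@le_trans _ _ (`|c|%:E * schwartz_seminorm N g)%E).
  apply: lee_wpmul2r; last by rewrite lee_fin ler_norm.
  apply: le_trans (_ : _ <= ((1 + enorm 0) ^+ N * cabs (cpartials [::] g 0))%:E)%E _.
    rewrite -[leLHS]/(0%:E) lee_fin; apply: mulr_ge0; last exact: cabs_ge0.
    by apply: exprn_ge0; apply: addr_ge0 => //; exact: enorm_ge0.
  by apply: ereal_sup_ubound; exists [::], 0.
apply: (@le_trans _ _ (`|c|%:E * ((1 + d%:R) ^+ N * (2 * B))%:E)%E).
  by apply: lee_wpmul2l => //; rewrite lee_fin.
by rewrite -EFinM lee_fin !mulrA.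
Qed.

Lemma temperedD (T T' : @dist R d) : tempered T -> tempered T' -> tempered (fun g => T g + T' g).
Proof.
move=> tT tT'; have [N [c c0 hc]] := tempered_bound tT; have [N' [c' c'0 hc']] := tempered_bound tT'.
move: tT tT' => [linT _ outT] [linT' _ outT']; split.
- by move=> a g h gs hs; rewrite linT// linT'//; ring.
- exists (maxn N N'), (c + c') => g gS.
  have gs := schwartz_cschwartz gS.
  have fin := seminorm_fin (maxn N N') gS.
  have sb M : (M <= maxn N N')%N -> sbound M (fine (schwartz_seminorm (maxn N N') g)) g.
    move=> MN s x sM; have [h1 h2] := seminorm_ge x gS (leq_trans sM MN).
    have wN : (1 + `|x|) ^+ M <= (1 + `|x|) ^+ maxn N N' by rewrite ler_weXn2l// one_norm_ge1.
    split; [apply: le_trans h1|apply: le_trans h2]; apply: ler_wpM2r => //.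
  rewrite -(fineK fin) -EFinM lee_fin (le_trans (cabsD _ _))// mulrDl lerD//.
    by apply: hc => //; apply: sb; rewrite leq_maxl.
  by apply: hc' => //; apply: sb; rewrite leq_maxr.
- by move=> g ng; rewrite outT// outT'// addr0.
Qed.

Lemma tempered_intro (T : @dist R d) N (c : R) :
  (forall (a : C) g h, cschwartz g -> cschwartz h -> T (fun x => a * g x + h x) = a * T g + T h) ->
  (forall g, ~ schwartz g -> T g = 0) ->
  (forall g B, cschwartz g -> sbound N B g -> cabs (T g) <= c * B) -> tempered T.
Proof.
move=> lin out bnd; split.
- by move=> a g h /schwartz_cschwartz gs /schwartz_cschwartz hs; exact: lin.
- exists N, c => g gS; rewrite -(fineK (seminorm_fin N gS)) -EFinM lee_fin.
  by apply: bnd; [exact: schwartz_cschwartz|move=> s x sN; exact: seminorm_ge].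
- exact: out.
Qed.

Lemma temperedZ (a : C) (T : @dist R d) : tempered T -> tempered (fun g => a * T g).
Proof.
move=> tT; have [N [c c0 hc]] := tempered_bound tT.
move: tT => [linT _ outT]; apply: (@tempered_intro _ N (cabs a * c)).
- by move=> b g h /cschwartz_schwartz gs /cschwartz_schwartz hs; rewrite linT//; ring.
- by move=> g ng; rewrite outT// mulr0.
- by move=> g B gs gB; rewrite cabsM -mulrA ler_wpM2l ?cabs_ge0// hc.
Qed.

End schwartz_bounds.

Section convolution.
Context {R : realType} {d : nat}.
Local Notation E := 'rV[R]_d.
Local Notation C := R[i].
Local Notation e i := (delta_mx 0 i : E).

Lemma rapid_weight (g : E -> R) N : rschwartz g ->
  exists2 B : R, 0 <= B & forall y, (1 + `|y|) ^+ N * `|g y| <= B * weight y.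
Proof.
move=> gs; have [B B0 gB] := rapid_ge0 (2 * d + N) (rschwartz_rapid gs); exists B => // y.
have dB : decays B (fun y => (1 + `|y|) ^+ N * g y).
  by move=> x; rewrite normrM (ger0_norm (one_norm_X_ge0 x N)) mulrA -exprD.
by have := decays_weight dB y; rewrite normrM (ger0_norm (one_norm_X_ge0 y N)).
Qed.

(** What is common to the identity and to the quantisation maps: enough to convolve with
    a Schwartz function along q, so that convolutions and their Riemann sums are treated
    at once. *)
Definition tame (q : E -> E) := (forall y, `|q y| <= `|y| + 1) /\
  (forall k : E -> R, continuous k -> emeas (fun y => k (q y))).

Lemma tame_id : tame id.
Proof. by split=> [y|k]; [rewrite lerDl|exact: emeas_continuous]. Qed.

Lemma tame_cell n : tame (fun y => cell_point (cell_of n y)).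
Proof. by split=> [y|k _]; [exact: cell_point_bnd|exact: measurable_quantised]. Qed.

(** The convolution of k and g with the argument of the kernel displaced by q. If q
    takes finitely many values, it is a finite combination of translates of k. *)
Definition rconvq (q : E -> E) (k g : E -> R) (z : E) := Int (fun y => k (z - q y) * g y).

(** The decay in z of a convolution is shared between the two factors; the constant 2^N
    absorbs the displacement of y by q. *)
Lemma tame_weight q z y N : tame q -> (1 + `|z|) ^+ N <= 2 ^+ N * ((1 + `|z - q y|) ^+ N * (1 + `|y|) ^+ N).
Proof.
move=> [hq _]; rewrite -!exprMn lerXn2r ?nnegrE ?mulr_ge0 ?addr_ge0//.
apply: le_trans (one_norm_sub z (q y)) _; rewrite mulrCA ler_wpM2l ?addr_ge0//.
have := hq y; have := normr_ge0 y; lra.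
Qed.

Lemma rconvq_bound q k g N : tame q -> rschwartz k -> rschwartz g ->
  exists2 B : R, 0 <= B & forall z y, (1 + `|z|) ^+ N * `|k (z - q y) * g y| <= B * weight y.
Proof.
move=> tq ks gs; have [B B0 kB] := rapid_ge0 N (rschwartz_rapid ks).
have [B' B'0 gB] := rapid_weight N gs.
exists (2 ^+ N * (B * B')); first by rewrite !mulr_ge0// exprn_ge0.
move=> z y; apply: le_trans (_ : _ <= 2 ^+ N * ((1 + `|z - q y|) ^+ N * (1 + `|y|) ^+ N) * `|k (z - q y) * g y|) _.
  by apply: ler_wpM2r => //; exact: tame_weight.
rewrite -!mulrA; apply: ler_wpM2l; first exact: exprn_ge0.
rewrite normrM (_ : _ * _ = (1 + `|z - q y|) ^+ N * `|k (z - q y)| * ((1 + `|y|) ^+ N * `|g y|)); last by ring.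
apply: ler_pM => //; apply: mulr_ge0 => //; exact: one_norm_X_ge0.
Qed.

Lemma emeas_shift q (k : E -> R) z : tame q -> rschwartz k -> emeas (fun y => k (z - q y)).
Proof.
move=> [_ mq] ks; have n1 : -1 != 0 :> R by rewrite oppr_eq0 oner_neq0.
have := mq _ (rschwartz_continuous (rschwartz_affine z n1 ks)).
by congr emeas; apply/funext => y; rewrite scaleN1r addrC.
Qed.

Lemma L1_rconvq q k g z : tame q -> rschwartz k -> rschwartz g -> L1 (fun y => k (z - q y) * g y).
Proof.
move=> tq ks gs; have [B B0 h] := rconvq_bound 0 tq ks gs.
apply: (L1_le (emeasM (emeas_shift z tq ks) (rschwartz_emeas gs)) (L1Z B L1_weight)) => y.
by have := h z y; rewrite mul1r.
Qed.

Lemma rconvq_diff q k g i z : tame q -> rschwartz k -> rschwartz g ->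
  derivable (rconvq q k g) z (e i) /\ pd i (rconvq q k g) z = rconvq q (pd i k) g z.
Proof.
move=> tq ks gs.
have D y z' : is_derive z' (e i) (fun z => k (z - q y) * g y) (pd i k (z' - q y) * g y).
  have D1 : is_derive z' (e i) (fun z => k (z - q y)) (pd i k (z' - q y)).
    have := @is_derive_affine R d k 1 (- q y) z' i (rschwartz_der ks i _).
    by rewrite mul1r scale1r; under eq_fun do rewrite scale1r.
  have := is_deriveM D1 (is_derive_cst (g y) z' (e i)).
  rewrite scaler0 add0r (_ : _ *: _ = pd i k (z' - q y) * g y) => [h|]; first exact: h.
  exact: mulrC.
have ks' := rschwartz_pd i ks.
have [B B0 kB] := rconvq_bound 0 tq ks' gs.
have [] := @diff_int R d (fun z y => k (z - q y) * g y) (fun y => B * weight y) i z.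
- by move=> z' _; exact: L1_rconvq.
- by move=> z' y; have [] := D y z'.
- by move=> z' y _; have [_] := D y z'; rewrite /pd => ->; have := kB z' y; rewrite mul1r.
- exact: L1Z L1_weight.
move=> D1 D2; split=> //; rewrite D2; apply: (congr1 Int); apply/funext => y.
by have [_] := D y z.
Qed.

Lemma rconvq_rapid q k g : tame q -> rschwartz k -> rschwartz g -> rapid (rconvq q k g).
Proof.
move=> tq ks gs N; have [B B0 h] := rconvq_bound N tq ks gs.
exists (B * Int (@weight R d)) => z; have L := L1_rconvq z tq ks gs.
rewrite -(ger0_norm (one_norm_X_ge0 z N)) -normrM /rconvq -(IntZ _ L) -(IntZ _ L1_weight).
apply: Int_norm_le; [exact: L1Z|exact: L1Z L1_weight|].
by move=> y; rewrite normrM (ger0_norm (one_norm_X_ge0 z N)).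
Qed.

(** Derivatives fall on the kernel, so that the convolutions with a fixed g form a
    stable class. *)
Lemma rschwartz_rconvq q k g : tame q -> rschwartz k -> rschwartz g -> rschwartz (rconvq q k g).
Proof.
move=> tq ks gs.
apply: (@rschwartz_coind _ _ (fun h => exists2 k, rschwartz k & h = rconvq q k g)); last by exists k.
move=> _ [{}k {}ks ->]; split.
- exact: rconvq_rapid.
- by move=> i x; have [] := rconvq_diff i x tq ks gs.
- move=> i; exists (pd i k); first exact: rschwartz_pd.
  by apply/funext => x; have [] := rconvq_diff i x tq ks gs.
Qed.

Lemma partials_rconvq q k g s : tame q -> rschwartz k -> rschwartz g ->
  partials s (rconvq q k g) = rconvq q (partials s k) g.
Proof.
move=> tq ks gs; elim: s => [//|i s IH].
rewrite -[LHS]/(pd i (partials s (rconvq q k g))) IH; apply/funext => x.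
by have [_ ->] := rconvq_diff i x tq (rschwartz_partials s ks) gs.
Qed.

Lemma partialsB (f g : E -> R) s : rschwartz f -> rschwartz g ->
  partials s (fun x => f x - g x) = fun x => partials s f x - partials s g x.
Proof.
move=> fs gs; elim: s => [//|i s IH].
rewrite -[LHS]/(pd i (partials s (fun x => f x - g x))) IH; apply/funext => x.
exact: (deriveB (rschwartz_der (rschwartz_partials s fs) i x) (rschwartz_der (rschwartz_partials s gs) i x)).
Qed.

Lemma partials_shift (f : E -> R) s v : rschwartz f ->
  partials s (fun x => f (x - v)) = fun x => partials s f (x - v).
Proof.
move=> fs; elim: s => [//|i s IH].
rewrite -[LHS]/(pd i (partials s (fun x => f (x - v)))) IH; apply/funext => x.
have := pd_affine 1 (- v) i x (rschwartz_partials s fs); rewrite mul1r scale1r.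
by under eq_fun do rewrite scale1r.
Qed.

Lemma rschwartz_shift (f : E -> R) v : rschwartz f -> rschwartz (fun x => f (x - v)).
Proof.
by move=> fs; have := rschwartz_affine (- v) (oner_neq0 R) fs; under eq_fun do rewrite scale1r.
Qed.

Lemma cschwartz_shift (g : E -> C) v : cschwartz g -> cschwartz (fun x => g (x - v)).
Proof. by move=> [h1 h2]; split; [exact: (rschwartz_shift v h1)|exact: (rschwartz_shift v h2)]. Qed.

(** The modulus of continuity of translations of a Schwartz function, in seminorms with
    polynomial growth in y. The truncation at 1 keeps it bounded for far points. *)
Definition shift_mod (w y : E) : R := Num.min 1 `|w - y|.

Lemma shift_mod_ge0 w y : 0 <= shift_mod w y.
Proof. by rewrite /shift_mod le_min ler01 normr_ge0. Qed.

Lemma one_norm_subX (z y : E) N : (1 + `|z|) ^+ N <= (1 + `|z - y|) ^+ N * (1 + `|y|) ^+ N.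
Proof.
rewrite -exprMn lerXn2r ?nnegrE ?mulr_ge0 ?addr_ge0//; exact: one_norm_sub.
Qed.

Definition shift_growth N (f : E -> R) (B : R) :=
  forall z y, (1 + `|z|) ^+ N * `|f (z - y)| <= B * (1 + `|y|) ^+ N.

Definition shift_cont N (f : E -> R) (B : R) := forall z y w, `|w| <= `|y| + 1 ->
  (1 + `|z|) ^+ N * `|f (z - w) - f (z - y)| <= B * ((1 + `|y|) ^+ N * shift_mod w y).

Lemma rschwartz_shift_growth N f : rschwartz f -> exists2 B : R, 0 <= B & shift_growth N f B.
Proof.
move=> fs; have [B B0 fB] := rapid_ge0 N (rschwartz_rapid fs); exists B => // z y.
apply: le_trans (ler_wpM2r (normr_ge0 _) (one_norm_subX z y N)) _.
by rewrite mulrAC; apply: ler_wpM2r; rewrite ?one_norm_X_ge0.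
Qed.

Lemma rschwartz_shift_cont N f : rschwartz f -> exists2 B : R, 0 <= B & shift_cont N f B.
Proof.
move=> fs; have [B B0 fB] := rschwartz_shift_growth N fs; have [L L0 fL] := rschwartz_lipschitz N fs.
have k0 : 0 <= 2 ^+ N + 1 :> R by rewrite addr_ge0// exprn_ge0.
exists (L + B * (2 ^+ N + 1)); first by apply: addr_ge0 => //; apply: mulr_ge0.
move=> z y w wy; have Y0 := one_norm_X_ge0 y N.
rewrite /shift_mod; case: (leP 1 `|w - y|) => [wy1|wy1].
  rewrite mulr1 mulrDl; apply: ler_wpDl; first exact: mulr_ge0.
  apply: (@le_trans _ _ ((1 + `|z|) ^+ N * `|f (z - w)| + (1 + `|z|) ^+ N * `|f (z - y)|)).
    by rewrite -mulrDr; apply: ler_wpM2l; [exact: one_norm_X_ge0|exact: ler_normB].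
  rewrite mulrDr mulr1 mulrDl; apply: lerD; last exact: fB.
  apply: le_trans (fB z w) _; rewrite -mulrA -exprMn; apply: ler_wpM2l => //.
  rewrite lerXn2r ?nnegrE ?mulr_ge0 ?addr_ge0//.
  by have := normr_ge0 y; lra.
rewrite mulrDl; apply: ler_wpDr; first by rewrite !mulr_ge0.
apply: le_trans (ler_wpM2r (normr_ge0 _) (one_norm_subX z y N)) _.
have e : (z - w) - (z - y) = - (w - y) by apply/rowP => i; rewrite !mxE; ring.
have := fL (z - y) (z - w); rewrite e normrN => /(_ (ltW wy1)) h.
by rewrite mulrAC [leRHS]mulrCA [leLHS]mulrC; apply: ler_wpM2l.
Qed.

End convolution.

(** * Tempered distributions and their Littlewood-Paley pieces *)

Section tempered_convolution.
Context {R : realType} {d : nat}.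
Local Notation E := 'rV[R]_d.
Local Notation C := R[i].
Local Notation e i := (delta_mx 0 i : E).

Definition cconvq (q : E -> E) (K g : E -> C) (z : E) : C := cintegral (fun y => K (z - q y) * g y).

Lemma cconvqE q K g : tame q -> cschwartz K -> cschwartz g ->
  re (cconvq q K g) = (fun z => rconvq q (re K) (re g) z - rconvq q (im K) (im g) z) /\
  im (cconvq q K g) = (fun z => rconvq q (re K) (im g) z + rconvq q (im K) (re g) z).
Proof.
move=> tq [k1 k2] [g1 g2]; split; apply/funext => z.
  rewrite /re /cconvq cintegral_Re /rconvq -(IntB (L1_rconvq z tq k1 g1) (L1_rconvq z tq k2 g2)).
  by apply: (congr1 Int); apply/funext => y; exact: cReM.
rewrite /im /cconvq cintegral_Im /rconvq -(IntD (L1_rconvq z tq k1 g2) (L1_rconvq z tq k2 g1)).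
by apply: (congr1 Int); apply/funext => y; exact: cImM.
Qed.

Lemma cschwartz_cconvq q K g : tame q -> cschwartz K -> cschwartz g -> cschwartz (cconvq q K g).
Proof.
move=> tq Ks gs; have [e1 e2] := cconvqE tq Ks gs; move: Ks gs => [k1 k2] [g1 g2].
split; rewrite ?e1 ?e2.
  exact: (rschwartzB (rschwartz_rconvq tq k1 g1) (rschwartz_rconvq tq k2 g2)).
exact: (rschwartzD (rschwartz_rconvq tq k1 g2) (rschwartz_rconvq tq k2 g1)).
Qed.

Lemma cabs0 : cabs (0 : C) = 0.
Proof. by rewrite cabsE expr0n addr0 sqrtr0. Qed.

Lemma cabsN (z : C) : cabs (- z) = cabs z.
Proof. by rewrite !cabsE !raddfN !sqrrN. Qed.

Section linearity.
Variables (T : @dist R d) (tT : tempered T).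

Lemma tempered_lin (a : C) g h : cschwartz g -> cschwartz h -> T (fun x => a * g x + h x) = a * T g + T h.
Proof. by move=> gs hs; have [lin _ _] := tT; apply: lin; exact: cschwartz_schwartz. Qed.

Lemma cschwartz0 : cschwartz (fun _ : E => 0 : C).
Proof. split; exact: rschwartz0. Qed.

Lemma tempered0 : T (fun=> 0) = 0.
Proof.
have := tempered_lin 1 cschwartz0 cschwartz0; under eq_fun do rewrite mulr0 addr0.
by rewrite mul1r => /eqP; rewrite -subr_eq0 opprD addNKr oppr_eq0 => /eqP.
Qed.

Lemma temperedBE g h : cschwartz g -> cschwartz h -> T (fun x => g x - h x) = T g - T h.
Proof.
move=> gs hs; rewrite [RHS]addrC -mulN1r -(tempered_lin _ hs gs).
by apply: (congr1 T); apply/funext => x; rewrite mulN1r addrC.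
Qed.

Lemma cschwartz_sum (J : Type) (s : seq J) (a : J -> C) (g : J -> E -> C) :
  (forall j, cschwartz (g j)) -> cschwartz (fun x => \sum_(j <- s) a j * g j x).
Proof.
move=> gs; elim: s => [|j s IH]; first by under eq_fun do rewrite big_nil; exact: cschwartz0.
by under eq_fun do rewrite big_cons; exact: cschwartzD (cschwartzZ (a j) (gs j)) IH.
Qed.

Lemma tempered_sum (J : Type) (s : seq J) (a : J -> C) (g : J -> E -> C) :
  (forall j, cschwartz (g j)) -> T (fun x => \sum_(j <- s) a j * g j x) = \sum_(j <- s) a j * T (g j).
Proof.
move=> gs; elim: s => [|j s IH]; first by under eq_fun do rewrite big_nil; rewrite big_nil tempered0.
under eq_fun do rewrite big_cons; rewrite big_cons -IH; apply: tempered_lin => //.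
exact: cschwartz_sum.
Qed.

End linearity.

(** The values of T on the translates of K, that is, the convolution of T with the
    reflection of K, which is a function. *)
Definition orbit (T : @dist R d) (K : E -> C) (y : E) : C := T (fun z => K (z - y)).

(** T is bounded by a Schwartz seminorm, in which translations of K grow polynomially
    and depend continuously on the translation. *)
Lemma orbit_growth T K : tempered T -> cschwartz K -> exists N, exists2 B : R, 0 <= B &
  (forall y, cabs (orbit T K y) <= B * (1 + `|y|) ^+ N) /\
  (forall y w, `|w| <= `|y| + 1 -> cabs (orbit T K w - orbit T K y) <= B * ((1 + `|y|) ^+ N * shift_mod w y)).
Proof.
move=> tT Ks; have [N [c c0 Tc]] := tempered_bound tT; exists N; have [k1 k2] := Ks.
have Qm : forall (f : E -> R) (B B' : R), shift_growth N f B -> B <= B' -> shift_growth N f B'.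
  by move=> f B B' fB BB' z y; apply: le_trans (fB z y) _; apply: ler_wpM2r => //; exact: one_norm_X_ge0.
have Qm' : forall (f : E -> R) (B B' : R), shift_cont N f B -> B <= B' -> shift_cont N f B'.
  move=> f B B' fB BB' z y w wy; apply: le_trans (fB z y w wy) _; apply: ler_wpM2r => //.
  by apply: mulr_ge0; [exact: one_norm_X_ge0|exact: shift_mod_ge0].
have [B1 B10 G1] := rschwartz_partials_unif N Qm (@rschwartz_shift_growth R d N) k1.
have [B2 B20 G2] := rschwartz_partials_unif N Qm (@rschwartz_shift_growth R d N) k2.
have [B3 B30 G3] := rschwartz_partials_unif N Qm' (@rschwartz_shift_cont R d N) k1.
have [B4 B40 G4] := rschwartz_partials_unif N Qm' (@rschwartz_shift_cont R d N) k2.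
have S0 : 0 <= B1 + B2 + B3 + B4 by rewrite !addr_ge0.
exists (c * (B1 + B2 + B3 + B4)); first exact: mulr_ge0.
split=> [y|y w wy].
  have Y0 := one_norm_X_ge0 y N.
  rewrite -mulrA; apply: Tc; first exact: cschwartz_shift.
  move=> s z sN; rewrite /re /im (partials_shift _ _ k1) (partials_shift _ _ k2); split.
    by apply: le_trans (G1 s sN z y) _; apply: ler_wpM2r => //; lra.
  by apply: le_trans (G2 s sN z y) _; apply: ler_wpM2r => //; lra.
have M0 : 0 <= (1 + `|y|) ^+ N * shift_mod w y.
  by apply: mulr_ge0; [exact: one_norm_X_ge0|exact: shift_mod_ge0].
rewrite /orbit -(temperedBE tT (cschwartz_shift w Ks) (cschwartz_shift y Ks)) -mulrA; apply: Tc.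
  by have := cschwartzD (cschwartz_shift w Ks) (cschwartzZ (-1) (cschwartz_shift y Ks)); under eq_fun do rewrite mulN1r.
move=> s z sN.
have -> : re (fun x => K (x - w) - K (x - y)) = fun x => re K (x - w) - re K (x - y).
  by apply/funext => x; rewrite /re raddfB.
have -> : im (fun x => K (x - w) - K (x - y)) = fun x => im K (x - w) - im K (x - y).
  by apply/funext => x; rewrite /im raddfB.
rewrite !partialsB ?partials_shift; try exact: rschwartz_shift; try assumption.
split.
  by apply: le_trans (G3 s sN z y w wy) _; apply: ler_wpM2r => //; lra.
by apply: le_trans (G4 s sN z y w wy) _; apply: ler_wpM2r => //; lra.
Qed.

Lemma orbit_ccontinuous T K : tempered T -> cschwartz K -> ccontinuous (orbit T K).
Proof.
move=> tT Ks; have [N [B B0 [_ h]]] := orbit_growth tT Ks.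
suff H (x : E) (eps : R) : 0 < eps ->
    exists2 de : R, 0 < de & forall y, `|y - x| < de -> cabs (orbit T K y - orbit T K x) <= eps.
  split; apply/continuous_epsP => x eps e0; have [de de0 Hd] := H x eps e0; exists de => // y yx.
    rewrite /re -raddfB; apply: le_trans (Re_le_cabs _) _; exact: Hd.
  rewrite /im -raddfB; apply: le_trans (Im_le_cabs _) _; exact: Hd.
move=> e0; have X0 := one_norm_X_gt0 x N.
have M0 : 0 < B * (1 + `|x|) ^+ N + 1 by rewrite ltr_wpDl// mulr_ge0// ltW.
exists (Num.min 1 (eps / (B * (1 + `|x|) ^+ N + 1))).
  by rewrite lt_min ltr01 divr_gt0.
move=> y; rewrite lt_min => /andP[yx1 yx2].
have yx : `|y| <= `|x| + 1.
  by have := ler_normD (y - x) x; rewrite subrK; lra.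
apply: le_trans (h x y yx) _; rewrite mulrA.
apply: (@le_trans _ _ ((B * (1 + `|x|) ^+ N + 1) * `|y - x|)).
  apply: ler_pM.
  - by rewrite mulr_ge0// ltW.
  - exact: shift_mod_ge0.
  - by rewrite lerDl.
  - by rewrite /shift_mod ge_min lexx orbT.
by rewrite mulrC -ler_pdivlMr// ltW.
Qed.

Lemma ccontinuous_cemeas (h : E -> C) : ccontinuous h -> cemeas h.
Proof. by move=> [h1 h2]; split; exact: emeas_continuous. Qed.

Lemma cvg_squeeze0 (u v : nat -> R) l : (forall n, `|u n - l| <= v n) -> v n @[n --> \oo] --> 0 ->
  u n @[n --> \oo] --> l.
Proof.
move=> uv v0; apply/subr_cvg0; apply/norm_cvg0P.
apply: (@squeeze_cvgr _ _ _ _ (fun=> 0) v) => //; last exact: cvg_cst.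
by apply: nearW => n; rewrite normr_ge0 uv.
Qed.

Lemma cvg_scale0 (a : R) (u : nat -> R) : u n @[n --> \oo] --> 0 -> a * u n @[n --> \oo] --> 0.
Proof. by move=> u0; rewrite -(mulr0 a); exact: cvgMl_tmp. Qed.

Lemma cvg_cabs0 (u : nat -> C) (l : C) (v : nat -> R) : (forall n, cabs (u n - l) <= v n) ->
  v n @[n --> \oo] --> 0 -> complex.Re (u n) @[n --> \oo] --> complex.Re l /\
  complex.Im (u n) @[n --> \oo] --> complex.Im l.
Proof.
move=> uv v0; split; apply: (cvg_squeeze0 _ v0) => n; apply: le_trans (uv n).
  by rewrite -raddfB; exact: Re_le_cabs.
by rewrite -raddfB; exact: Im_le_cabs.
Qed.

Local Notation qn n := (fun y : E => cell_point (cell_of n y)).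

Lemma shift_mod_cvg (y : E) : shift_mod (cell_point (cell_of n y)) y @[n --> \oo] --> (0 : R).
Proof.
have h : `|cell_point (cell_of n y) - y| @[n --> \oo] --> (0 : R).
  have /subr_cvg0 h := @cell_point_cvg R d y.
  have := @cvg_norm R [the normedModType R of 'rV[R]_d] _ _ _ _ _ h.
  by rewrite normr0; exact.
apply: (cvg_squeeze0 (v := fun n => `|cell_point (cell_of n y) - y|)) => // n.
by rewrite subr0 ger0_norm ?shift_mod_ge0// /shift_mod ge_min lexx orbT.
Qed.

Lemma emeas_cell n (k : cell_index n) : emeas (fun y : E => (cell_of n y == k)%:R : R).
Proof. exact: measurable_cell. Qed.

Lemma emeas_sum (J : Type) (s : seq J) (f : J -> E -> R) :
  (forall j, emeas (f j)) -> emeas (fun x => \sum_(j <- s) f j x).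
Proof.
move=> fm; elim: s => [|j s IH].
  by under eq_fun do rewrite big_nil; exact: measurable_cst.
by under eq_fun do rewrite big_cons; exact: emeasD.
Qed.

Lemma emeas_cells n (F : cell_index n -> E -> R) : (forall k, emeas (F k)) ->
  emeas (fun y => F (cell_of n y) y).
Proof.
move=> Fm; have -> : (fun y => F (cell_of n y) y) =
    fun y => \sum_k (cell_of n y == k)%:R * F k y.
  apply/funext => y; rewrite (sum_cells (fun k => F k y)); apply: eq_bigr => k _.
  by rewrite mulr_natl.
by apply: emeas_sum => k; apply: emeasM (emeas_cell k) (Fm k).
Qed.

Lemma emeas_shift_mod n : emeas (fun y : E => shift_mod (cell_point (cell_of n y)) y).
Proof.
apply: (@emeas_cells n (fun k y => shift_mod (cell_point k) y)) => k.
apply: emeas_continuous; apply/continuous_epsP => x eps e0; exists eps => // y yx.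
have h : `| `|cell_point k - y| - `|cell_point k - x| | <= `|y - x|.
  apply: le_trans (ler_dist_dist _ _) _.
  have -> : cell_point k - y - (cell_point k - x) = - (y - x) by apply/rowP => i; rewrite !mxE; ring.
  by rewrite normrN.
rewrite /shift_mod; move: h; have := ltW yx.
by case: (leP 1 `|cell_point k - y|); case: (leP 1 `|cell_point k - x|); rewrite !ler_norml => *;
  apply/andP; split; lra.
Qed.

Lemma shift_mod_le1 (w y : E) : shift_mod w y <= 1.
Proof. by rewrite /shift_mod ge_min lexx. Qed.

Lemma rapid_L1_weighted (g : E -> R) N : rschwartz g -> L1 (fun y => (1 + `|y|) ^+ N * `|g y|).
Proof.
move=> gs; have [B B0 gB] := rapid_weight N gs.
have m : emeas (fun y : E => (1 + `|y|) ^+ N).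
  elim: N {gB} => [|N IH]; first exact: measurable_cst.
  under eq_fun do rewrite exprS.
  apply: (emeasM _ IH); apply: emeas_continuous; apply/continuous_epsP => x eps e0; exists eps => // y yx.
  have -> : 1 + `|y| - (1 + `|x|) = `|y| - `|x| by ring.
  apply: le_trans (ler_dist_dist _ _) _; exact: ltW.
apply: (L1_le (emeasM m (measurableT_comp (@normr_measurable _ setT) (rschwartz_emeas gs))) (L1Z B L1_weight)) => y.
by rewrite ger0_norm ?gB// mulr_ge0// one_norm_X_ge0.
Qed.

(** The size of the error made in replacing a convolution with g by its Riemann sum of
    mesh 1/(n+1), in a Schwartz seminorm of index N. *)
Definition quant_error N n (g : E -> R) : R :=
  Int (fun y => shift_mod (cell_point (cell_of n y)) y * ((1 + `|y|) ^+ N * `|g y|)).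

Lemma L1_quant_error N n (g : E -> R) : rschwartz g ->
  L1 (fun y => shift_mod (cell_point (cell_of n y)) y * ((1 + `|y|) ^+ N * `|g y|)).
Proof.
move=> gs; have L := rapid_L1_weighted N gs.
apply: (L1_le (emeasM (emeas_shift_mod n) (L1_emeas L)) L) => y.
have g0 : 0 <= (1 + `|y|) ^+ N * `|g y| by rewrite mulr_ge0// one_norm_X_ge0.
rewrite normrM (ger0_norm g0) ger0_norm ?shift_mod_ge0//.
by rewrite ler_piMl// shift_mod_le1.
Qed.

Lemma quant_error_cvg N (g : E -> R) : rschwartz g -> quant_error N n g @[n --> \oo] --> (0 : R).
Proof.
move=> gs; have L := rapid_L1_weighted N gs.
rewrite -(@Int0 R d); apply: (Int_lim _ _ L).
- by move=> n; exact: L1_emeas (L1_quant_error N n gs).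
- exact: measurable_cst.
- move=> n y; have g0 : 0 <= (1 + `|y|) ^+ N * `|g y| by rewrite mulr_ge0// one_norm_X_ge0.
  rewrite normrM (ger0_norm g0) ger0_norm ?shift_mod_ge0//.
  by rewrite ler_piMl// shift_mod_le1.
- by move=> y; under eq_fun do rewrite mulrC; apply: cvg_scale0; exact: shift_mod_cvg.
Qed.

Lemma rconvq_error N (k : E -> R) B n (g : E -> R) z : rschwartz k -> shift_cont N k B -> rschwartz g ->
  (1 + `|z|) ^+ N * `|rconvq (qn n) k g z - rconvq id k g z| <= B * quant_error N n g.
Proof.
move=> ks kB gs; have tq := @tame_cell R d n; have ti := @tame_id R d.
rewrite -(ger0_norm (one_norm_X_ge0 z N)) -normrM /rconvq.
have M1 := L1_rconvq z tq ks gs; have M2 := L1_rconvq z ti ks gs.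
rewrite -(IntB M1 M2) -(IntZ _ (L1B M1 M2)) /quant_error -(IntZ _ (L1_quant_error N n gs)).
apply: Int_norm_le; [exact: L1Z (L1B M1 M2)|exact: L1Z (L1_quant_error N n gs)|].
move=> y; rewrite -mulrBl mulrA normrM normrM (ger0_norm (one_norm_X_ge0 z N)).
rewrite !mulrA; apply: ler_wpM2r => //.
apply: le_trans (kB z y _ (cell_point_bnd n y)) _.
by rewrite (mulrC ((1 + `|y|) ^+ N)) mulrA.
Qed.

Lemma partialsD (f g : E -> R) s : rschwartz f -> rschwartz g ->
  partials s (fun x => f x + g x) = fun x => partials s f x + partials s g x.
Proof.
move=> fs gs; elim: s => [//|i s IH].
rewrite -[LHS]/(pd i (partials s (fun x => f x + g x))) IH; apply/funext => x.
exact: (deriveD (rschwartz_der (rschwartz_partials s fs) i x) (rschwartz_der (rschwartz_partials s gs) i x)).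
Qed.

Lemma cconvq_error N K g : cschwartz K -> cschwartz g -> exists2 B : R, 0 <= B & forall n,
  sbound N (B * (quant_error N n (re g) + quant_error N n (im g)))
    (fun z => cconvq (qn n) K g z - cconvq id K g z).
Proof.
move=> Ks gs; have [k1 k2] := Ks; have [g1 g2] := gs.
have Qm' : forall (f : E -> R) (B B' : R), shift_cont N f B -> B <= B' -> shift_cont N f B'.
  move=> f B B' fB BB' z y w wy; apply: le_trans (fB z y w wy) _; apply: ler_wpM2r => //.
  by apply: mulr_ge0; [exact: one_norm_X_ge0|exact: shift_mod_ge0].
have [B3 B30 G3] := rschwartz_partials_unif N Qm' (@rschwartz_shift_cont R d N) k1.
have [B4 B40 G4] := rschwartz_partials_unif N Qm' (@rschwartz_shift_cont R d N) k2.
have Qpos n (f : E -> R) : 0 <= quant_error N n f.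
  apply: Int_ge0 => y; apply: mulr_ge0; first exact: shift_mod_ge0.
  by rewrite mulr_ge0// one_norm_X_ge0.
exists (B3 + B4); first exact: addr_ge0.
move=> n s z sN; have tq := @tame_cell R d n; have ti := @tame_id R d.
have [e1 e2] := cconvqE tq Ks gs; have [e3 e4] := cconvqE ti Ks gs.
have -> : re (fun z => cconvq (qn n) K g z - cconvq id K g z) =
    fun z => re (cconvq (qn n) K g) z - re (cconvq id K g) z.
  by apply/funext => x; rewrite /re raddfB.
have -> : im (fun z => cconvq (qn n) K g z - cconvq id K g z) =
    fun z => im (cconvq (qn n) K g) z - im (cconvq id K g) z.
  by apply/funext => x; rewrite /im raddfB.
have S (q : E -> E) (k h : E -> R) : tame q -> rschwartz k -> rschwartz h -> rschwartz (rconvq q k h) by exact: rschwartz_rconvq.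
have X0 := one_norm_X_ge0 z N.
rewrite e1 e2 e3 e4 (partialsB _ (rschwartzB (S _ _ _ tq k1 g1) (S _ _ _ tq k2 g2)) (rschwartzB (S _ _ _ ti k1 g1) (S _ _ _ ti k2 g2))).
rewrite (partialsB _ (rschwartzD (S _ _ _ tq k1 g2) (S _ _ _ tq k2 g1)) (rschwartzD (S _ _ _ ti k1 g2) (S _ _ _ ti k2 g1))).
rewrite (partialsB _ (S _ _ _ tq k1 g1) (S _ _ _ tq k2 g2)) (partialsB _ (S _ _ _ ti k1 g1) (S _ _ _ ti k2 g2)).
rewrite (partialsD _ (S _ _ _ tq k1 g2) (S _ _ _ tq k2 g1)) (partialsD _ (S _ _ _ ti k1 g2) (S _ _ _ ti k2 g1)).
rewrite !partials_rconvq; try assumption.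
have H1 g' := @rconvq_error N _ _ n g' z (rschwartz_partials s k1) (G3 s sN).
have H2 g' := @rconvq_error N _ _ n g' z (rschwartz_partials s k2) (G4 s sN).
have p1 := mulr_ge0 B30 (Qpos n (im g)); have p2 := mulr_ge0 B30 (Qpos n (re g)).
have p3 := mulr_ge0 B40 (Qpos n (im g)); have p4 := mulr_ge0 B40 (Qpos n (re g)).
have tri (a b c e X u v : R) : 0 <= X -> X * `|a - c| <= u -> X * `|b - e| <= v ->
    X * `|a - b - (c - e)| <= u + v /\ X * `|a + b - (c + e)| <= u + v.
  move=> Xp h1 h2; split; (apply: le_trans (lerD h1 h2); rewrite -mulrDr; apply: ler_wpM2l => //).
    by rewrite (_ : a - b - (c - e) = (a - c) - (b - e)); [exact: ler_normB|ring].
  by rewrite (_ : a + b - (c + e) = (a - c) + (b - e)); [exact: ler_normD|ring].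
split.
  apply: le_trans (tri _ _ _ _ _ _ _ X0 (H1 _ g1) (H2 _ g2)).1 _.
  by rewrite mulrDl !mulrDr; lra.
apply: le_trans (tri _ _ _ _ _ _ _ X0 (H1 _ g2) (H2 _ g1)).2 _.
by rewrite mulrDl !mulrDr; lra.
Qed.

Lemma cintegrable_cell n (k : cell_index n) (g : E -> C) : cschwartz g ->
  cintegrable (fun y => ((cell_of n y == k)%:R : C) * g y).
Proof.
move=> gs; have m : cemeas (fun y : E => (cell_of n y == k)%:R : C).
  split.
    have -> : re (fun y : E => (cell_of n y == k)%:R : C) = (fun y => (cell_of n y == k)%:R : R).
      by apply/funext => y; rewrite /re; case: eqP.
    exact: emeas_cell.
  have -> : im (fun y : E => (cell_of n y == k)%:R : C) = (fun y => 0).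
    by apply/funext => y; rewrite /im; case: eqP.
  exact: measurable_cst.
apply: (cintegrableM (cschwartz_cintegrable gs) m (B := 1)) => x.
by rewrite cabsE; case: eqP => _ /=; rewrite ?expr1n ?expr0n ?addr0 ?sqrtr1 ?sqrtr0.
Qed.

(** With finitely many cells the convolution is a finite combination of translates, and
    T is linear. *)
Lemma tempered_quantised T K g n : tempered T -> cschwartz K -> cschwartz g ->
  T (cconvq (qn n) K g) = cintegral (fun y => orbit T K (cell_point (cell_of n y)) * g y).
Proof.
move=> tT Ks gs.
have key (F : cell_index n -> C) : cintegral (fun y => F (cell_of n y) * g y) =
    \sum_k F k * cintegral (fun y => ((cell_of n y == k)%:R : C) * g y).
  have ci k := cintegrableZ (F k) (cintegrable_cell k gs).
  have -> : (fun y => F (cell_of n y) * g y) =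
      fun y => \sum_k F k * (((cell_of n y == k)%:R : C) * g y).
    apply/funext => y; rewrite (sum_cells F) mulr_suml; apply: eq_bigr => k _.
    by case: (cell_of n y == k); rewrite /= ?mulr1n ?mulr0n ?mul1r ?mul0r ?mulr0.
  rewrite (cintegral_sum _ ci); apply: eq_bigr => k _; exact: (cintegralZ _ (cintegrable_cell k gs)).
rewrite (key (fun k => orbit T K (cell_point k))).
have -> : cconvq (qn n) K g = fun z => \sum_k cintegral (fun y => ((cell_of n y == k)%:R : C) * g y) * K (z - cell_point k).
  by apply/funext => z; rewrite /cconvq (key (fun k => K (z - cell_point k))); apply: eq_bigr => k _; rewrite mulrC.
rewrite (tempered_sum tT _ _ (fun k => cschwartz_shift (cell_point k) Ks)).
by apply: eq_bigr => k _; rewrite mulrC.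
Qed.

Lemma orbit_cintegrable T K g : tempered T -> cschwartz K -> cschwartz g -> cintegrable (fun y => orbit T K y * g y).
Proof.
move=> tT Ks gs; have [N [B B0 [hB _]]] := orbit_growth tT Ks.
have [g1 g2] := gs.
have L := L1Z B (L1D (rapid_L1_weighted N g1) (rapid_L1_weighted N g2)).
apply: (cintegrable_le (cemeasM (ccontinuous_cemeas (orbit_ccontinuous tT Ks)) (cschwartz_cemeas gs)) L) => y.
rewrite cabsM -mulrDr mulrA; apply: ler_pM; [exact: cabs_ge0|exact: cabs_ge0|exact: hB|exact: cabs_le].
Qed.

(** True for Riemann sums by linearity. On the left they converge in the Schwartz
    seminorm that controls T, on the right by dominated convergence. *)
Lemma tempered_conv T K g : tempered T -> cschwartz K -> cschwartz g ->
  T (fun z => cintegral (fun y => K (z - y) * g y)) = cintegral (fun y => orbit T K y * g y).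
Proof.
move=> tT Ks gs; have [N [B B0 [hB hC]]] := orbit_growth tT Ks; have [g1 g2] := gs.
have [N' [c c0 Tc]] := tempered_bound tT; have [B' B'0 eB] := cconvq_error N' Ks gs.
have ti := @tame_id R d.
have lim1 : complex.Re (T (cconvq (qn n) K g)) @[n --> \oo] --> complex.Re (T (cconvq id K g)) /\
    complex.Im (T (cconvq (qn n) K g)) @[n --> \oo] --> complex.Im (T (cconvq id K g)).
  apply: (cvg_cabs0 (v := fun n => c * (B' * (quant_error N' n (re g) + quant_error N' n (im g))))) => [n|].
    have tq := @tame_cell R d n.
    rewrite -(temperedBE tT (cschwartz_cconvq tq Ks gs) (cschwartz_cconvq ti Ks gs)); apply: Tc; last exact: eB.
    by have := cschwartzD (cschwartz_cconvq tq Ks gs) (cschwartzZ (-1) (cschwartz_cconvq ti Ks gs)); under eq_fun do rewrite mulN1r.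
  apply: cvg_scale0; apply: cvg_scale0; rewrite -(addr0 0).
  exact: cvgD (quant_error_cvg N' g1) (quant_error_cvg N' g2).
have L := L1Z (B * 2 ^+ N) (L1D (rapid_L1_weighted N g1) (rapid_L1_weighted N g2)).
have cvg_orb (y : E) : complex.Re (orbit T K (cell_point (cell_of n y)) * g y) @[n --> \oo] --> complex.Re (orbit T K y * g y) /\
   complex.Im (orbit T K (cell_point (cell_of n y)) * g y) @[n --> \oo] --> complex.Im (orbit T K y * g y).
  apply: (cvg_cabs0 (v := fun n => B * ((1 + `|y|) ^+ N * shift_mod (cell_point (cell_of n y)) y) * cabs (g y))) => [n|].
    rewrite -mulrBl cabsM; apply: ler_wpM2r; first exact: cabs_ge0.
    exact: (hC y _ (cell_point_bnd n y)).
  by under eq_fun do rewrite mulrC; do 3 apply: cvg_scale0; exact: shift_mod_cvg.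
have Mo n : cemeas (fun y => orbit T K (cell_point (cell_of n y)) * g y).
  apply: cemeasM (cschwartz_cemeas gs); split.
    exact: (emeas_cells (F := fun k _ => complex.Re (orbit T K (cell_point k))) (fun k => measurable_cst _)).
  exact: (emeas_cells (F := fun k _ => complex.Im (orbit T K (cell_point k))) (fun k => measurable_cst _)).
have dom n y : cabs (orbit T K (cell_point (cell_of n y)) * g y) <=
    B * 2 ^+ N * ((1 + `|y|) ^+ N * `|re g y| + (1 + `|y|) ^+ N * `|im g y|).
  rewrite cabsM -mulrDr mulrA; apply: ler_pM; [exact: cabs_ge0|exact: cabs_ge0| |exact: cabs_le].
  apply: le_trans (hB _) _; rewrite -mulrA -exprMn; apply: ler_wpM2l => //.
  rewrite lerXn2r ?nnegrE ?mulr_ge0 ?addr_ge0//.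
  by have := cell_point_bnd n y; have := normr_ge0 y; lra.
have [l1 l2] := cintegral_lim Mo (cintegrable_cemeas (orbit_cintegrable tT Ks gs)) L
  dom (fun y => (cvg_orb y).1) (fun y => (cvg_orb y).2).
have eq1 : (fun n => complex.Re (T (cconvq (qn n) K g))) =
    (fun n => complex.Re (cintegral (fun y => orbit T K (cell_point (cell_of n y)) * g y))).
  by apply/funext => n; rewrite (tempered_quantised n tT Ks gs).
have eq2 : (fun n => complex.Im (T (cconvq (qn n) K g))) =
    (fun n => complex.Im (cintegral (fun y => orbit T K (cell_point (cell_of n y)) * g y))).
  by apply/funext => n; rewrite (tempered_quantised n tT Ks gs).
have [m1 m2] := lim1; rewrite eq1 in m1; rewrite eq2 in m2; apply: complexP.
  exact: (cvg_unique _ m1 l1).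
exact: (cvg_unique _ m2 l2).
Qed.

End tempered_convolution.

Section littlewood_paley_pieces.
Context {R : realType} {d : nat}.
Local Notation E := 'rV[R]_d.
Local Notation C := R[i].

(** The squared modulus of a dilated and translated generator is a nonnegative test
    function that is 1 at x0 and supported near x0. If f x0 were positive, the integral
    against it would be positive. *)
Lemma bump_test (phi0 : E -> C) (f : E -> R) x0 : resolution_generator phi0 -> continuous f ->
  (forall w : E -> R, cschwartz (fun x => (w x)%:C%C) -> Int (fun x => f x * w x) = 0 /\ L1 (fun x => f x * w x)) ->
  ~ 0 < f x0.
Proof.
move=> hphi cf h f0; have ps := generator_cschwartz hphi.
have f2 : 0 < f x0 / 2 by rewrite divr_gt0.
have [de de0 Hd] := (continuous_epsP f).1 cf x0 (f x0 / 2) f2.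
(* the generator vanishes at Euclidean norm above 2, so this scale puts the bump in the
   ball of radius de *)
have [a aE] : exists a : R, a = 4 / de by eexists.
have a0 : a != 0 by rewrite aE mulf_neq0// ?invr_eq0 gt_eqF.
have Gs := cschwartz_affine (- (a *: x0)) a0 ps.
have [G GE] : exists G, G = fun x => phi0 (a *: x + - (a *: x0)) by eexists.
rewrite -GE in Gs.
have ws : cschwartz (fun x => ((re G x ^+ 2 + im G x ^+ 2)%:C)%C).
  have [g1 g2] := Gs; split.
    have := rschwartzD (rschwartzM g1 g1) (rschwartzM g2 g2); congr rschwartz.
  exact: rschwartz0.
have [I0f Lf] := h _ ws.
have w0 x : 0 <= re G x ^+ 2 + im G x ^+ 2 by rewrite addr_ge0// sqr_ge0.
have fw0 x : 0 <= f x * (re G x ^+ 2 + im G x ^+ 2).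
  have [near|far] := ltP `|x - x0| de.
    rewrite mulr_ge0//; have := Hd x near; rewrite ler_norml => /andP[h1 _]; lra.
  suff Gx : G x = 0 by rewrite /re /im Gx expr0n addr0 mulr0.
  rewrite GE; apply: (generator_out hphi); apply: lt_le_trans (norm_le_enorm _).
  rewrite -scalerBr normrZ aE normrM normfV (gtr0_norm de0) gtr0_norm//.
  rewrite mulrAC ltr_pdivlMr//; have := far; lra.
have cw : continuous (fun x => f x * (re G x ^+ 2 + im G x ^+ 2)).
  have cr := (cschwartz_ccontinuous ws).1.
  by move=> x; have := cvgM (cf x) (cr x); exact.
have p0 : 0 < f x0 * (re G x0 ^+ 2 + im G x0 ^+ 2).
  have Gx : G x0 = 1 by rewrite GE subrr generator0.
  by rewrite /re /im Gx expr1n expr0n addr0 mulr1.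
have := Int_gt0 cw Lf fw0 p0; by rewrite I0f ltxx.
Qed.

Lemma cschwartz_real_mul (h : E -> C) (w : E -> R) :
  (re (fun x => h x * (w x)%:C%C) = fun x => re h x * w x) /\
  (im (fun x => h x * (w x)%:C%C) = fun x => im h x * w x).
Proof.
split; apply/funext => x; rewrite /re /im ?cReM ?cImM /=; ring.
Qed.

(** Test the differences of the real parts and of the imaginary parts with bumps, at
    both signs. *)
Lemma represents_unique (phi0 : E -> C) (T : @dist R d) h h' : resolution_generator phi0 ->
  ccontinuous h -> represents h T -> ccontinuous h' -> represents h' T -> h = h'.
Proof.
move=> hphi [c1 c2] rh [c1' c2'] rh'.
have key (w : E -> R) : cschwartz (fun x => (w x)%:C%C) ->
   [/\ L1 (fun x => re h x * w x), L1 (fun x => re h' x * w x), L1 (fun x => im h x * w x),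
       L1 (fun x => im h' x * w x) & Int (fun x => re h x * w x) = Int (fun x => re h' x * w x) /\
         Int (fun x => im h x * w x) = Int (fun x => im h' x * w x)].
  move=> ws; have [i1 e1] := rh _ (cschwartz_schwartz ws); have [i2 e2] := rh' _ (cschwartz_schwartz ws).
  have [r1 m1] := cschwartz_real_mul h w; have [r2 m2] := cschwartz_real_mul h' w.
  move: i1 i2 => /cintegrableP[a1 a2] /cintegrableP[b1 b2].
  have e3 := congr1 (@complex.Re R) (etrans (esym e1) e2).
  have e4 := congr1 (@complex.Im R) (etrans (esym e1) e2).
  rewrite !cintegral_Re in e3; rewrite !cintegral_Im in e4.
  by rewrite r1 r2 in e3 *; rewrite m1 m2 in e4 *; rewrite r1 in a1; rewrite m1 in a2;
    rewrite r2 in b1; rewrite m2 in b2; split.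
have eqr (u v : E -> R) : continuous u -> continuous v ->
    (forall w : E -> R, cschwartz (fun x => (w x)%:C%C) ->
      [/\ L1 (fun x => u x * w x), L1 (fun x => v x * w x) & Int (fun x => u x * w x) = Int (fun x => v x * w x)]) ->
    forall x, ~ 0 < u x - v x.
  move=> cu cv H x; apply: (bump_test (f := fun x => u x - v x) hphi).
    by move=> y; apply: continuousB; [exact: cu|exact: cv].
  move=> w /H [l1 l2 e].
  have -> : (fun x => (u x - v x) * w x) = fun x => u x * w x - v x * w x by apply/funext => y; rewrite mulrBl.
  by rewrite (IntB l1 l2) e subrr; split=> //; exact: L1B.
have eqr2 (u v : E -> R) : continuous u -> continuous v ->
    (forall w : E -> R, cschwartz (fun x => (w x)%:C%C) ->
      [/\ L1 (fun x => u x * w x), L1 (fun x => v x * w x) & Int (fun x => u x * w x) = Int (fun x => v x * w x)]) ->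
    forall x, u x = v x.
  move=> cu cv H x; have h1 := eqr u v cu cv H x.
  have h2 := eqr v u cv cu (fun w ws => let: And3 a b c := H w ws in And3 b a (esym c)) x.
  apply/eqP; rewrite eq_le -[X in X && _]subr_le0 -[X in _ && X]subr_le0 !leNgt.
  by apply/andP; split; apply/negP.
apply/funext => x; apply: complexP.
  by apply: (eqr2 (re h) (re h')) => // w /key[? ? _ _ [? _]].
by apply: (eqr2 (im h) (im h')) => // w /key[_ _ ? ? [_ ?]].
Qed.

Lemma dist_fun_eq (phi0 : E -> C) (T : @dist R d) h : resolution_generator phi0 ->
  ccontinuous h -> represents h T -> dist_fun T = h.
Proof.
move=> hphi ch rh; rewrite /dist_fun; apply: xget_unique => //.
by move=> h' [ch' rh']; exact: (represents_unique hphi ch' rh').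
Qed.

Lemma extend0E (T : @dist R d) g : cschwartz g -> extend0 T g = T g.
Proof. by move=> gs; rewrite /extend0 asboolT//; exact: cschwartz_schwartz. Qed.

Lemma dist_multiplier (m g : E -> C) (f : @dist R d) : cschwartz m -> cschwartz g ->
  dist_inv_fourier (dist_mul m (dist_fourier f)) g = f (mult m g).
Proof.
move=> ms gs; have is_ := inv_fourier_cschwartz gs.
rewrite /dist_inv_fourier (extend0E _ gs) /dist_mul (extend0E _ is_) /dist_fourier.
by rewrite (extend0E _ (cschwartzM ms is_)).
Qed.

(** Combine [mult_conv] and [tempered_conv]: a multiplier of symbol m applied to f is
    the function [orbit f (ker m)]. *)
Lemma multiplier_orbit (m g : E -> C) (f : @dist R d) : tempered f -> cschwartz m -> cschwartz g ->
  cintegrable (fun x => orbit f (ker m) x * g x) /\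
  f (mult m g) = cintegral (fun x => orbit f (ker m) x * g x).
Proof.
move=> tf ms gs; have ks := ker_cschwartz ms; split; first exact: (orbit_cintegrable tf ks gs).
by rewrite (mult_conv ms gs) (tempered_conv tf ks gs).
Qed.

(** The function [orbit f (ker (dyadic phi0 j))] is continuous and represents the
    multiplier, and such a function is unique. *)
Lemma lp_pieceE (phi0 : E -> C) j (f : @dist R d) : resolution_generator phi0 -> tempered f ->
  lp_piece phi0 j f = orbit f (ker (dyadic phi0 j)).
Proof.
move=> hphi tf; have ms := dyadic_cschwartz j (generator_cschwartz hphi).
apply: (dist_fun_eq hphi); first exact: (orbit_ccontinuous tf (ker_cschwartz ms)).
move=> g /schwartz_cschwartz gs; rewrite (dist_multiplier _ ms gs); exact: multiplier_orbit.
Qed.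

Lemma lp_piece_ccontinuous (phi0 : E -> C) j (f : @dist R d) : resolution_generator phi0 -> tempered f ->
  ccontinuous (lp_piece phi0 j f).
Proof.
move=> hphi tf; rewrite (lp_pieceE _ hphi tf); apply: (orbit_ccontinuous tf).
exact: ker_cschwartz (dyadic_cschwartz j (generator_cschwartz hphi)).
Qed.

Lemma lp_pieceD (phi0 : E -> C) j (f f' : @dist R d) x : resolution_generator phi0 -> tempered f ->
  tempered f' -> lp_piece phi0 j (fun g => f g + f' g) x = lp_piece phi0 j f x + lp_piece phi0 j f' x.
Proof. by move=> hphi tf tf'; rewrite !lp_pieceE//; exact: temperedD. Qed.

Lemma rconv_sym (k g : E -> R) : rschwartz k -> rschwartz g -> rconvq id k g = rconvq id g k.
Proof.
move=> ks gs; apply/funext => z; rewrite /rconvq.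
have n1 : (-1 : R) != 0 by rewrite oppr_eq0 oner_neq0.
have := Int_affine z n1 (L1_rconvq z (@tame_id R d) ks gs).
rewrite normrN normr1 invr1 expr1n mul1r => <-.
apply: (congr1 Int); apply/funext => y; rewrite mulrC; congr (g _ * k _).
  by rewrite scaleN1r addrC.
by apply/rowP => i; rewrite !mxE; ring.
Qed.

Lemma rconv_sbound N (k g : E -> R) B z : rschwartz k -> rschwartz g -> (forall x, (1 + `|x|) ^+ N * `|g x| <= B) ->
  (1 + `|z|) ^+ N * `|rconvq id g k z| <= B * Int (fun y => (1 + `|y|) ^+ N * `|k y|).
Proof.
move=> ks gs gB; have M := L1_rconvq z (@tame_id R d) gs ks.
have K := rapid_L1_weighted N ks.
rewrite -(ger0_norm (one_norm_X_ge0 z N)) -normrM /rconvq -(IntZ _ M) -(IntZ _ K).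
apply: Int_norm_le; [exact: L1Z M|exact: L1Z K|].
move=> y; rewrite normrM (ger0_norm (one_norm_X_ge0 z N)).
apply: le_trans (ler_wpM2r (normr_ge0 _) (one_norm_subX z y N)) _.
rewrite normrM [leLHS](_ : _ = (1 + `|z - y|) ^+ N * `|g (z - y)| * ((1 + `|y|) ^+ N * `|k y|)); last by ring.
by apply: ler_wpM2r; [rewrite mulr_ge0// one_norm_X_ge0|exact: gB].
Qed.

(** In the convolution the derivatives may be put on g instead of on the kernel, so that
    seminorms of g control the seminorms of the same index. *)
Lemma mult_sbound N (m : E -> C) : cschwartz m -> exists2 c : R, 0 <= c &
  forall g B, cschwartz g -> sbound N B g -> sbound N (c * B) (mult m g).
Proof.
move=> ms; have ks := ker_cschwartz ms; have [k1 k2] := ks.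
have [c1 c1E] : exists c : R, c = Int (fun y => (1 + `|y|) ^+ N * `|re (ker m) y|) by eexists.
have [c2 c2E] : exists c : R, c = Int (fun y => (1 + `|y|) ^+ N * `|im (ker m) y|) by eexists.
have pos (k : E -> R) : 0 <= Int (fun y => (1 + `|y|) ^+ N * `|k y|).
  by apply: Int_ge0 => y; rewrite mulr_ge0// one_norm_X_ge0.
exists (c1 + c2); first by rewrite c1E c2E addr_ge0.
move=> g B gs gB s z sN; have [g1 g2] := gs; have ti := @tame_id R d.
have S (k h : E -> R) : rschwartz k -> rschwartz h -> rschwartz (rconvq id k h) by exact: rschwartz_rconvq.
have [e1 e2] := cconvqE ti ks gs.
rewrite (mult_conv ms gs) -/(cconvq id (ker m) g) e1 e2.
rewrite (rconv_sym k1 g1) (rconv_sym k2 g2) (rconv_sym k1 g2) (rconv_sym k2 g1).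
rewrite (partialsB _ (S _ _ g1 k1) (S _ _ g2 k2)) (partialsD _ (S _ _ g2 k1) (S _ _ g1 k2)).
rewrite (partials_rconvq _ ti g1 k1) (partials_rconvq _ ti g2 k2) (partials_rconvq _ ti g2 k1) (partials_rconvq _ ti g1 k2).
have B1 x : (1 + `|x|) ^+ N * `|partials s (re g) x| <= B by have [] := gB s x sN.
have B2 x : (1 + `|x|) ^+ N * `|partials s (im g) x| <= B by have [] := gB s x sN.
have G1 := rschwartz_partials s g1; have G2 := rschwartz_partials s g2.
have h1 := rconv_sbound z k1 G1 B1; have h2 := rconv_sbound z k2 G2 B2.
have h3 := rconv_sbound z k1 G2 B2; have h4 := rconv_sbound z k2 G1 B1.
rewrite -c1E in h1 h3; rewrite -c2E in h2 h4.
have X0 := one_norm_X_ge0 z N.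
split; rewrite mulrDl (mulrC c1) (mulrC c2).
  by apply: le_trans (ler_wpM2l X0 (ler_normB _ _)) _; rewrite mulrDr; exact: lerD.
by apply: le_trans (ler_wpM2l X0 (ler_normD _ _)) _; rewrite mulrDr; exact: lerD.
Qed.

(** The constant of Fourier inversion. *)
Definition kappa (phi0 : E -> C) : C := cintegral (ker phi0).

Lemma kappa_generator (phi0 : E -> C) : resolution_generator phi0 -> kappa phi0 != 0.
Proof.
move=> hphi; have ps := generator_cschwartz hphi; have [p1 p2] := ps.
have ws : cschwartz (fun x => ((re phi0 x ^+ 2 + im phi0 x ^+ 2)%:C)%C).
  by split; [have := rschwartzD (rschwartzM p1 p1) (rschwartzM p2 p2); congr rschwartz|exact: rschwartz0].
apply: (kappa_neq0 ps (generator0 hphi) ws (fun x => erefl)).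
apply: (@Int_gt0 _ _ _ 0).
- exact: (cschwartz_ccontinuous ws).1.
- exact: rschwartz_L1 ws.1.
- by move=> x; rewrite /re /= addr_ge0// sqr_ge0.
- by rewrite /re /= /re /im (generator0 hphi) /= expr1n expr0n addr0.
Qed.

(** The multiplier of symbol [lowpass phi0 N] applied to f, normalised by the constant
    of Fourier inversion so that pieces at low frequencies are unchanged. *)
Definition low_part (phi0 : E -> C) (N : nat) (f : @dist R d) : @dist R d :=
  extend0 (fun g => (kappa phi0)^-1 * f (mult (lowpass phi0 N) g)).

Definition high_part (phi0 : E -> C) (N : nat) (f : @dist R d) : @dist R d :=
  fun g => f g + (-1) * low_part phi0 N f g.

Lemma low_part_tempered (phi0 : E -> C) N (f : @dist R d) : resolution_generator phi0 -> tempered f ->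
  tempered (low_part phi0 N f).
Proof.
move=> hphi tf; have [M [c c0 fourier_cst]] := tempered_bound tf.
have ms := lowpass_cschwartz N (generator_cschwartz hphi).
have [c' c'0 mB] := mult_sbound M ms.
apply: (@tempered_intro _ _ _ M (cabs (kappa phi0)^-1 * (c * c'))).
- move=> a g h gs hs; rewrite /low_part (extend0E _ gs) (extend0E _ hs) (extend0E _ (cschwartzD (cschwartzZ a gs) hs)).
  rewrite (mult_lin a ms gs hs) (tempered_lin tf a (mult_cschwartz ms gs) (mult_cschwartz ms hs)).
  rewrite mulrDr; congr (_ + _); exact: mulrCA.
- by move=> g ng; rewrite /low_part /extend0 asboolF.
- move=> g B gs gB; rewrite /low_part (extend0E _ gs) cabsM -!mulrA; apply: ler_wpM2l; first exact: cabs_ge0.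
  by apply: fourier_cst; [exact: mult_cschwartz|exact: mB].
Qed.

Lemma high_part_tempered (phi0 : E -> C) N (f : @dist R d) : resolution_generator phi0 -> tempered f ->
  tempered (high_part phi0 N f).
Proof. by move=> hphi tf; apply: temperedD => //; apply: temperedZ; exact: low_part_tempered. Qed.

Lemma low_part_high_part (phi0 : E -> C) N (f : @dist R d) : f = fun g => low_part phi0 N f g + high_part phi0 N f g.
Proof. by apply/funext => g; rewrite /high_part; ring. Qed.

(** The pieces of the low part as a convolution of the pieces of f. Evaluating f at a
    convolution is done by [tempered_conv]; the reflection comes from the duality. *)
Lemma lp_piece_low_part (phi0 : E -> C) N j (f : @dist R d) x : resolution_generator phi0 -> tempered f ->
  lp_piece phi0 j (low_part phi0 N f) x =
  (kappa phi0)^-1 * cintegral (fun y => lp_piece phi0 j f y * ker (lowpass phi0 N) (y - x)).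
Proof.
move=> hphi tf; have ps := generator_cschwartz hphi; have ms := lowpass_cschwartz N ps.
have ks := ker_cschwartz ms; have ds := ker_cschwartz (dyadic_cschwartz j ps).
rewrite (lp_pieceE _ hphi (low_part_tempered N hphi tf)) (lp_pieceE _ hphi tf) /orbit.
rewrite /low_part (extend0E _ (cschwartz_shift x ds)); congr (_ * _).
rewrite -/(orbit f (ker (dyadic phi0 j))) -(tempered_conv tf ds (cschwartz_shift x ks)).
apply: (congr1 f); rewrite (mult_conv ms (cschwartz_shift x ds)); apply/funext => z.
have n1 : (-1 : R) != 0 by rewrite oppr_eq0 oner_neq0.
have := cintegral_affine (z + x) n1 (cschwartz_cintegrable (cschwartzM (cschwartz_sub z ks) (cschwartz_shift x ds))).
rewrite normrN normr1 invr1 expr1n mul1r => <-.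
apply: (congr1 (@cintegral R d)); apply/funext => y.
have -> : z - (-1 *: y + (z + x)) = y - x by apply/rowP => i; rewrite !mxE; ring.
have -> : -1 *: y + (z + x) - x = z - y by apply/rowP => i; rewrite !mxE; ring.
exact: mulrC.
Qed.

(** The composition of the two multipliers has the product as its symbol; the constant
    of inversion cancels with the normalisation. *)
Lemma lp_piece_low_part_orbit (phi0 : E -> C) N j (f : @dist R d) : resolution_generator phi0 -> tempered f ->
  lp_piece phi0 j (low_part phi0 N f) = orbit f (ker (fun x => lowpass phi0 N x * dyadic phi0 j x)).
Proof.
move=> hphi tf; have ps := generator_cschwartz hphi; have ms := lowpass_cschwartz N ps.
have ds := dyadic_cschwartz j ps; have mds := cschwartzM ms ds.
apply: (dist_fun_eq hphi); first exact: (orbit_ccontinuous tf (ker_cschwartz mds)).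
move=> g /schwartz_cschwartz gs; rewrite (dist_multiplier _ ds gs).
have [h1 <-] := multiplier_orbit tf mds gs; split=> //.
rewrite /low_part (extend0E _ (mult_cschwartz ds gs)) (mult_comp ps (generator0 hphi) ms ds gs).
have lin0 (a : C) h : cschwartz h -> f (fun y => a * h y) = a * f h.
  move=> hs; have := tempered_lin tf a hs cschwartz0; rewrite (tempered0 tf) addr0 => <-.
  by apply: (congr1 f); apply/funext => y; rewrite addr0.
by rewrite (lin0 _ _ (mult_cschwartz mds gs)) mulKf// kappa_generator.
Qed.

Lemma lp_piece_low_part_low (phi0 : E -> C) N j (f : @dist R d) : resolution_generator phi0 -> tempered f ->
  (j < N)%N -> lp_piece phi0 j (low_part phi0 N f) = lp_piece phi0 j f.
Proof.
by move=> hphi tf jN; rewrite (lp_piece_low_part_orbit _ _ hphi tf) lowpass_dyadic_low// (lp_pieceE _ hphi tf).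
Qed.

Lemma fourier0 : fourier (fun _ : E => 0 : C) = fun=> 0.
Proof.
apply/funext => y; rewrite fourierE; under eq_fun do rewrite mulr0.
by rewrite cintegral0 mulr0.
Qed.

Lemma lp_piece_low_part_high (phi0 : E -> C) N j (f : @dist R d) x : resolution_generator phi0 -> tempered f ->
  (N.+1 < j)%N -> lp_piece phi0 j (low_part phi0 N f) x = 0.
Proof.
move=> hphi tf jN; rewrite (lp_piece_low_part_orbit _ _ hphi tf) lowpass_dyadic_high// /orbit /ker.
rewrite fourier0; under eq_fun do rewrite mulr0.
exact: tempered0.
Qed.

Lemma lp_piece_high_part (phi0 : E -> C) N j (f : @dist R d) x : resolution_generator phi0 -> tempered f ->
  lp_piece phi0 j (high_part phi0 N f) x = lp_piece phi0 j f x - lp_piece phi0 j (low_part phi0 N f) x.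
Proof.
move=> hphi tf; rewrite (lp_pieceE _ hphi (high_part_tempered N hphi tf)) (lp_pieceE _ hphi tf).
by rewrite (lp_pieceE _ hphi (low_part_tempered N hphi tf)) /orbit /high_part mulN1r.
Qed.

End littlewood_paley_pieces.

(** * Weighted sequences *)

Section weights.
Context {R : realType}.

(** The distance of two natural numbers; one of the truncated differences is 0. *)
Definition ndist (i j : nat) : nat := (i - j + (j - i))%N.

(** Weights in the distance of the indices: with a negative exponent e the decay of
    off-diagonal contributions. *)
Definition wt (e : R) (i j : nat) : R := 2 `^ (e * (ndist i j)%:R).

Lemma two_powD (a b : R) : 2 `^ (a + b) = 2 `^ a * 2 `^ b.
Proof. by rewrite powRD// pnatr_eq0 implybT. Qed.

Lemma two_pow_gt0 (a : R) : 0 < 2 `^ a. Proof. exact: powR_gt0. Qed.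

Lemma two_pow_le (a b : R) : a <= b -> 2 `^ a <= 2 `^ b.
Proof. by move=> ab; rewrite ler_powR// ler1n. Qed.

Lemma ndistC i j : ndist i j = ndist j i.
Proof. by rewrite /ndist addnC. Qed.

Lemma wtC e i j : wt e i j = wt e j i. Proof. by rewrite /wt ndistC. Qed.

Lemma wt_gt0 e i j : 0 < wt e i j. Proof. exact: two_pow_gt0. Qed.

Lemma wt_ge0 e i j : 0 <= wt e i j. Proof. exact: ltW (wt_gt0 _ _ _). Qed.

Lemma wtD e e' i j : wt (e + e') i j = wt e i j * wt e' i j.
Proof. by rewrite /wt mulrDl two_powD. Qed.

Lemma wtK e i j : wt (- e) i j * wt e i j = 1.
Proof. by rewrite -wtD addNr /wt mul0r powRr0. Qed.

Lemma wt_pow e r i j : wt e i j `^ r = wt (e * r) i j.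
Proof. by rewrite /wt -powRrM mulrAC. Qed.

Lemma wt_le1 e i j : 0 <= e -> wt (- e) i j <= 1.
Proof.
by move=> e0; rewrite -(powRr0 2) two_pow_le// mulNr oppr_le0 mulr_ge0.
Qed.

(** Two geometric series, one on each side of j. The induction needs the exact partial
    sums, whose form depends on the side of j on which n lies. *)
Lemma geometric_sum_le (rho : R) j n : 0 <= rho -> rho < 1 ->
  \sum_(0 <= i < n) rho ^+ ndist i j <= 2 / (1 - rho).
Proof.
move=> r0 r1; have p : 0 < 1 - rho by rewrite subr_gt0.
rewrite ler_pdivlMr// mulrC.
suff h : (1 - rho) * (\sum_(0 <= i < n) rho ^+ ndist i j) <=
    if (n <= j)%N then rho ^+ (j - n).+1 else 2 - rho ^+ (n - j).
  apply: le_trans h _; case: ifP => _; last by rewrite gerBl exprn_ge0.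
  by rewrite (@le_trans _ _ 1) ?ler1n// exprn_ile1// ltW.
elim: n => [|n IH]; first by rewrite big_nil mulr0 leq0n exprn_ge0.
rewrite big_nat_recr//= mulrDr.
case: (ltngtP n j) IH => nj IH.
- rewrite /ndist (eqP (ltnW nj)) add0n.
  have -> : (j - n)%N = (j - n.+1).+1 by lia.
  have {}IH : (1 - rho) * (\sum_(0 <= i < n) rho ^+ ndist i j) <= rho ^+ (j - n.+1).+2.
    by apply: le_trans IH _; rewrite (_ : (j - n).+1 = (j - n.+1).+2)//; lia.
  by apply: le_trans (lerD IH (lexx _)) _; rewrite !exprS; lra.
- rewrite /ndist (eqP (ltnW nj)) addn0.
  have -> : (n.+1 - j)%N = (n - j).+1 by lia.
  by apply: le_trans (lerD IH (lexx _)) _; rewrite !exprS; lra.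
- rewrite nj /ndist subnn addn0 expr0 subSnn expr1.
  move: IH; rewrite nj subnn expr1 => IH.
  by apply: le_trans (lerD IH (lexx _)) _; lra.
Qed.

Definition geom_const (e : R) : R := 2 / (1 - 2 `^ (- e)).

Lemma two_powN_lt1 (e : R) : 0 < e -> 2 `^ (- e) < 1.
Proof.
move=> e0; rewrite -[ltRHS](powRr0 2) /powR pnatr_eq0 /= ltr_expR.
by rewrite ltr_pM2r ?oppr_lt0// ln_gt0// ltr1n.
Qed.

Lemma geom_const_gt0 e : 0 < e -> 0 < geom_const e.
Proof. by move=> e0; rewrite divr_gt0// subr_gt0 two_powN_lt1. Qed.

Lemma wt_sum_le e j n : 0 < e -> \sum_(0 <= i < n) wt (- e) i j <= geom_const e.
Proof.
move=> e0; apply: le_trans (geometric_sum_le j n (powR_ge0 2 (- e)) (two_powN_lt1 e0)).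
by apply: ler_sum => i _; rewrite /wt powRrM powR_mulrn// powR_ge0.
Qed.

(** Compare the logarithms: ln is concave and lies below each of its tangents, and the
    slope h is chosen to be absorbed by the exponential. *)
Lemma power_exp_bound (B e : R) : 0 <= B -> 0 < e ->
  exists2 C : R, 0 < C & forall y, 1 <= y -> y `^ B <= C * 2 `^ (e * y).
Proof.
move=> B0 e0; have l2 : 0 < ln 2 :> R by rewrite ln_gt0// ltr1n.
have B1 : 0 < B + 1 by rewrite ltr_wpDl.
have [h hE] : exists h : R, h = e * ln 2 / (B + 1) by eexists.
have h0 : 0 < h by rewrite hE divr_gt0// mulr_gt0.
(* the constant that results from the tangent of ln at 1 / h *)
exists (expR (- B - B * ln h)); first exact: expR_gt0.
move=> y y1; have y0 : 0 < y by rewrite (lt_le_trans ltr01).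
rewrite /powR (gt_eqF y0) pnatr_eq0 /= -expRD ler_expR.
have lny : ln h + ln y <= h * y - 1.
  have e1 : 1 + (h * y - 1) = h * y by ring.
  have hy : 0 < h * y by rewrite mulr_gt0.
  by have := @le_ln1Dx R (h * y - 1); rewrite e1 lnM ?posrE// => -> //; lra.
have Bh : B * h <= e * ln 2.
  by rewrite hE mulrA ler_pdivrMr// mulrC ler_wpM2l ?mulr_ge0 ?lerDl// ltW.
have a1 : B * (ln h + ln y) <= B * (h * y - 1) by rewrite ler_wpM2l.
have a2 : B * h * y <= e * ln 2 * y by rewrite ler_wpM2r// ltW.
by move: a1 a2; rewrite !mulrDr !mulrA mulrN1 (mulrAC e); lra.
Qed.

(** The j-th block is [block_start j <= n < block_start j.+1]. *)
Definition block_start (j : nat) : nat := (2 ^ j).-1.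

Definition block_index (n : nat) : nat := trunc_log 2 n.+1.

Lemma block_startS j : (2 ^ j = (block_start j).+1)%N.
Proof. by rewrite /block_start prednK// expn_gt0. Qed.

Lemma block_start_le i j : (i <= j)%N -> (block_start i <= block_start j)%N.
Proof. by move=> ij; rewrite -ltnS -!block_startS leq_pexp2l. Qed.

Lemma block_start_ge j : (j <= block_start j)%N.
Proof. by rewrite -ltnS -block_startS ltn_expl. Qed.

Lemma in_block n j : (block_start j <= n < block_start j.+1)%N = (block_index n == j).
Proof.
have := trunc_log_bounds (isT : (1 < 2)%N) (ltn0Sn n); rewrite -/(block_index n) => /andP[h1 h2].
rewrite -(ltnS (block_start j)) -block_startS -[X in _ && X]ltnS -(block_startS j.+1).
apply/andP/eqP => [[a1 a2]|<-]; last by rewrite h1 h2.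
apply/eqP; rewrite eqn_leq; apply/andP; split.
  by rewrite -ltnS -(ltn_exp2l _ _ (isT : (1 < 2)%N)); exact: leq_ltn_trans h1 a2.
by rewrite -ltnS -(ltn_exp2l _ _ (isT : (1 < 2)%N)); exact: leq_ltn_trans a1 h2.
Qed.

(** The start of a block is exponentially far from the points of distant blocks. *)
Lemma block_dist n j : (2 ^ ndist (block_index n) j <= 2 * (ndist n (block_start j)).+1)%N.
Proof.
have : (block_index n == block_index n) by []; rewrite -in_block; move: (block_index n) => i.
rewrite /ndist -(ltnS (block_start i)) -block_startS -[X in _ && X]ltnS -(block_startS i.+1) => /andP[h1 h2].
have e := block_startS j; case: (leqP j i) => ji.
  rewrite (eqP ji) addn0; have p : (0 < 2 ^ (i - j))%N by rewrite expn_gt0.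
  have ei : (2 ^ i = 2 ^ (i - j) * 2 ^ j)%N by rewrite -expnD subnK.
  have pj : (0 < 2 ^ j)%N by rewrite expn_gt0.
  move: ei h1 p pj e; move: (2 ^ (i - j))%N (2 ^ j)%N (2 ^ i)%N => a b c -> h1 p pj e.
  have : (a + b <= a * b + 1)%N by nia.
  lia.
rewrite (eqP (ltnW ji)) add0n.
have ei : (2 ^ j = 2 ^ (j - i.+1) * 2 ^ i.+1)%N by rewrite -expnD subnK.
have em : (2 ^ (j - i) = 2 * 2 ^ (j - i.+1))%N by rewrite -expnS; congr (2 ^ _)%N; lia.
have p : (0 < 2 ^ (j - i.+1))%N by rewrite expn_gt0.
have pj : (0 < 2 ^ i.+1)%N by rewrite expn_gt0.
rewrite em; move: ei h2 p pj e; move: (2 ^ (j - i.+1))%N (2 ^ j)%N (2 ^ i.+1)%N => a b c ei h2 p pj e.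
have : (a + c <= a * c + 1)%N by nia.
lia.
Qed.

(** Exponential decay in the frequency is superpolynomial in 2^(block index), hence
    faster than any geometric decay in the block index. *)
Lemma block_decay (B e : R) : 0 <= B -> 0 < e -> exists2 C : R, 0 < C &
  forall n j, wt (- e) n (block_start j) <= C * wt (- B) (block_index n) j.
Proof.
move=> B0 e0; have e2 : 0 < e / 2 by rewrite divr_gt0.
have [C C0 hC] := power_exp_bound B0 e2; exists (C * 2 `^ e); first by rewrite mulr_gt0// two_pow_gt0.
move=> n j; have := block_dist n j; move: (block_index n) => i h.
have -> : wt (- e) n (block_start j) = wt (- e) n (block_start j) * wt B i j * wt (- B) i j.
  by rewrite -mulrA (mulrC (wt B i j)) wtK mulr1.
apply: ler_wpM2r; first exact: wt_ge0.
have hw : wt B i j <= C * 2 `^ (e * (ndist n (block_start j)).+1%:R).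
  have := hC (2 * (ndist n (block_start j)).+1)%:R.
  rewrite ler1n muln_gt0 => /(_ isT); rewrite natrM mulrA mulfVK//.
  apply: le_trans; rewrite /wt mulrC powRrM powR_mulrn//.
  by rewrite ge0_ler_powR// ?nnegrE ?exprn_ge0// -natrX -natrM ler_nat.
apply: le_trans (ler_wpM2l (wt_ge0 _ _ _) hw) _.
rewrite mulrCA; apply: ler_wpM2l; first exact: ltW.
rewrite /wt -two_powD; apply: two_pow_le.
by rewrite -natr1 mulrDr; lra.
Qed.

End weights.

Section ereal_sequences.
Context {R : realType}.
Local Open Scope ereal_scope.
Implicit Types (q r : \bar R) (a b v : nat -> \bar R).

Lemma poweR_mono (r : R) (x y : \bar R) : (0 <= r)%R -> 0 <= x -> x <= y -> x `^ r <= y `^ r.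
Proof.
move=> r0 x0 xy; apply: (gt0_ler_poweR r0) => //; rewrite in_itv /= ?x0 ?leey//.
by rewrite (le_trans x0).
Qed.

Lemma poweRK (r : R) (x : \bar R) : (0 < r)%R -> 0 <= x -> (x `^ r) `^ r^-1 = x.
Proof. by move=> r0 x0; rewrite -poweRrM mulfV ?gt_eqF// poweRe1. Qed.

Lemma poweRVK (r : R) (x : \bar R) : (0 < r)%R -> 0 <= x -> (x `^ r^-1) `^ r = x.
Proof. by move=> r0 x0; rewrite -poweRrM mulVf ?gt_eqF// poweRe1. Qed.

Lemma nneseries_le_ub a M : (forall i, 0 <= a i) ->
  (forall n, \sum_(0 <= i < n) a i <= M) -> \sum_(0 <= i <oo) a i <= M.
Proof.
by move=> a0 h; apply: lime_le; [exact: is_cvg_nneseries|exact: nearW].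
Qed.

Lemma nneseries_term a k : (forall i, 0 <= a i) -> a k <= \sum_(0 <= i <oo) a i.
Proof.
move=> a0; rewrite (@nneseriesD1 _ a k xpredT)// leeDl//.
exact: nneseries_ge0.
Qed.

Lemma wt_series_le e j : (0 < e)%R -> \sum_(0 <= i <oo) (wt (- e) i j : R)%:E <= (geom_const e)%:E.
Proof.
move=> e0; apply: nneseries_le_ub => [i|n]; first by rewrite lee_fin wt_ge0.
by rewrite sumEFin lee_fin wt_sum_le.
Qed.

Lemma lq_fin (q : R) a : lq q%:E a = (\sum_(0 <= j <oo) a j `^ q) `^ q^-1.
Proof. by []. Qed.

Lemma lq_ge0 q a : 0 < q -> (forall i, 0 <= a i) -> 0 <= lq q a.
Proof.
case: q => [q||] // q0 a0; first exact: poweR_ge0.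
by apply: le_trans (a0 0%N) _; apply: ereal_sup_ubound; exists 0%N.
Qed.

Lemma lq_mono q a b : 0 < q -> (forall i, 0 <= a i) -> (forall i, a i <= b i) -> lq q a <= lq q b.
Proof.
case: q => [q||] // q0 a0 ab.
  rewrite lte_fin in q0.
  apply: poweR_mono; first by rewrite invr_ge0 ltW.
    by apply: nneseries_ge0 => *; exact: poweR_ge0.
  by apply: lee_nneseries => [*|*]; [exact: poweR_ge0|exact: poweR_mono (ltW q0) _ _].
apply: ge_ereal_sup => _ [i _ <-]; apply: le_trans (ab i) _.
by apply: ereal_sup_ubound; exists i.
Qed.

Lemma lq_term q a k : 0 < q -> (forall i, 0 <= a i) -> a k <= lq q a.
Proof.
case: q => [q||] // q0 a0; last by apply: ereal_sup_ubound; exists k.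
rewrite lte_fin in q0; rewrite -[leLHS](poweRK q0 (a0 k)).
apply: poweR_mono; [by rewrite invr_ge0 ltW|exact: poweR_ge0|].
by apply: (nneseries_term (a := fun k => a k `^ q)) => i; exact: poweR_ge0.
Qed.

Lemma lqZ_le q (c : R) a : 0 < q -> (0 <= c)%R -> (forall i, 0 <= a i) ->
  lq q (fun i => c%:E * a i) <= c%:E * lq q a.
Proof.
case: q => [q||] // q0 c0 a0.
  rewrite lte_fin in q0; rewrite !lq_fin.
  have -> : \sum_(0 <= j <oo) (c%:E * a j) `^ q = \sum_(0 <= j <oo) (c%:E `^ q * a j `^ q).
    by apply: eq_eseriesr => j _; rewrite poweRM.
  rewrite nneseriesZl => [|i _]; last exact: poweR_ge0.
  rewrite poweRM; [|by rewrite lee_fin powR_ge0|by apply: nneseries_ge0 => *; exact: poweR_ge0].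
  by rewrite -[(c `^ q)%:E]/(c%:E `^ q) poweRK.
apply: ge_ereal_sup => _ [i _ <-]; apply: lee_wpmul2l => //.
by apply: ereal_sup_ubound; exists i.
Qed.

(** A sequence with geometric decay off N is controlled in every lq quasi-norm, q < 1
    included, by a bound for its term at N. *)
Lemma lq_dominated q (e : R) : 0 < q -> (0 < e)%R -> exists2 C : R, (0 < C)%R &
  forall N a S, 0 <= S -> (forall i, 0 <= a i) -> (forall i, a i <= (wt (- e) i N)%:E * S) ->
  lq q a <= C%:E * S.
Proof.
case: q => [q||] // q0 e0; last first.
  exists 1%R => // N a S S0 a0 aS; apply: ge_ereal_sup => _ [i _ <-].
  apply: le_trans (aS i) _; apply: lee_wpmul2r => //.
  by rewrite lee_fin wt_le1// ltW.
rewrite lte_fin in q0; have eq0 : (0 < e * q)%R by rewrite mulr_gt0.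
exists (geom_const (e * q) `^ q^-1)%R; first by rewrite powR_gt0// geom_const_gt0.
move=> N a [S| |] // S0 a0 aS; last first.
  by rewrite gt0_muley ?leey// lte_fin powR_gt0// geom_const_gt0.
rewrite lq_fin.
apply: (@le_trans _ _ (((geom_const (e * q))%:E * (S `^ q)%:E) `^ q^-1)); last first.
  rewrite poweRM; [|by rewrite lee_fin ltW// geom_const_gt0|by rewrite lee_fin powR_ge0].
  by rewrite -[(S `^ q)%:E]/(S%:E `^ q) poweRK.
apply: poweR_mono; first by rewrite invr_ge0 ltW.
  by apply: nneseries_ge0 => *; exact: poweR_ge0.
apply: (@le_trans _ _ (\sum_(0 <= i <oo) (S `^ q)%:E * (wt (- (e * q)) i N)%:E)).
  apply: lee_nneseries => [*|i _]; first exact: poweR_ge0.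
  apply: le_trans (poweR_mono (ltW q0) (a0 i) (aS i)) _.
  rewrite poweRM; [|by rewrite lee_fin wt_ge0|by []].
  by rewrite -[(wt (- e) i N)%:E `^ q]/(((wt (- e) i N) `^ q)%R%:E) wt_pow mulNr muleC.
rewrite nneseriesZl => [|i _]; last by rewrite lee_fin wt_ge0.
by rewrite muleC; apply: lee_wpmul2r; [rewrite lee_fin powR_ge0|exact: wt_series_le].
Qed.

(** Each term is at most wt (-e) times the weighted sum, so that up to weights with
    geometric growth all lq quasi-norms are comparable. *)
Lemma lq_le_wsum q (e : R) : 0 < q -> (0 < e)%R -> exists2 C : R, (0 < C)%R &
  forall N a, (forall i, 0 <= a i) ->
  lq q a <= C%:E * \sum_(0 <= i <oo) (wt e i N)%:E * a i.
Proof.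
move=> q0 e0; have [C C0 h] := lq_dominated q0 e0; exists C => // N a a0.
have p i : 0 <= (wt e i N)%:E * a i by rewrite mule_ge0// lee_fin wt_ge0.
apply: (h N) => // [|i]; first by apply: nneseries_ge0 => *; exact: p.
rewrite -[leLHS]mul1e -(wtK e i N) EFinM -muleA; apply: lee_wpmul2l; first by rewrite lee_fin wt_ge0.
exact: (nneseries_term (a := fun i => (wt e i N)%:E * a i)).
Qed.

(** Geometric decay off the diagonal acts boundedly on lr for every r. Half of the
    exponent turns the l1 norm in i into an lr norm, by the bound of each term by the
    whole; the other half is summed in j after exchanging the sums. This avoids
    Minkowski's inequality, which fails for r < 1. *)
Lemma hardy r (e : R) : 0 < r -> (0 < e)%R -> exists2 C : R, (0 < C)%R &
  forall u v, (forall i, 0 <= v i) -> (forall i, 0 <= u i) ->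
  (forall j, u j <= \sum_(0 <= i <oo) (wt (- e) i j)%:E * v i) -> lq r u <= C%:E * lq r v.
Proof.
case: r => [r||] // r0 e0; last first.
  exists (geom_const e); first exact: geom_const_gt0.
  move=> u v v0 u0 uv; have L0 := lq_ge0 r0 v0.
  apply: ge_ereal_sup => _ [j _ <-]; apply: le_trans (uv j) _.
  case: (lq +oo v) L0 (fun k => lq_term k r0 v0) => [L| |] // L0 vL; last first.
    by rewrite gt0_muley ?leey// lte_fin geom_const_gt0.
  apply: (@le_trans _ _ (\sum_(0 <= i <oo) L%:E * (wt (- e) i j)%:E)).
    apply: lee_nneseries => [i _ _|i _]; first by rewrite mule_ge0// lee_fin wt_ge0.
    by rewrite muleC; apply: lee_wpmul2r; [rewrite lee_fin wt_ge0|exact: vL].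
  rewrite nneseriesZl => [|i _]; last by rewrite lee_fin wt_ge0.
  by rewrite muleC; apply: lee_wpmul2r => //; exact: wt_series_le.
rewrite lte_fin in r0; have e2 : (0 < e / 2)%R by rewrite divr_gt0.
have er : (0 < e / 2 * r)%R by rewrite mulr_gt0.
have [G GE] : exists G, G = geom_const (e / 2) by eexists.
have [H HE] : exists H, H = geom_const (e / 2 * r) by eexists.
have G0 : (0 < G)%R by rewrite GE geom_const_gt0.
have H0 : (0 < H)%R by rewrite HE geom_const_gt0.
exists (G * H `^ r^-1)%R; first by rewrite mulr_gt0// powR_gt0.
move=> u v v0 u0 uv; rewrite !lq_fin.
have t0 j i : 0 <= (wt (- (e / 2 * r)) i j)%:E * v i `^ r.
  by rewrite mule_ge0 ?poweR_ge0// lee_fin wt_ge0.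
have key j : u j `^ r <= (G `^ r)%:E * \sum_(0 <= i <oo) (wt (- (e / 2 * r)) i j)%:E * v i `^ r.
  have [T TE] : exists T, T = \sum_(0 <= i <oo) (wt (- (e / 2 * r)) i j)%:E * v i `^ r by eexists.
  rewrite -TE; have T0 : 0 <= T by rewrite TE; apply: nneseries_ge0 => *; exact: t0.
  have vT i : (wt (- (e / 2)) i j)%:E * v i <= T `^ r^-1.
    have w0 : 0 <= (wt (- (e / 2)) i j)%:E * v i by rewrite mule_ge0// lee_fin wt_ge0.
    rewrite -[leLHS](poweRK r0 w0); apply: poweR_mono; [by rewrite invr_ge0 ltW|exact: poweR_ge0|].
    rewrite poweRM// ?lee_fin ?wt_ge0// poweR_EFin wt_pow mulNr TE.
    exact: (nneseries_term (a := fun i => (wt (- (e / 2 * r)) i j)%:E * v i `^ r)).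
  case: T T0 vT {TE} => [T| |] // T0 vT; last first.
    by rewrite gt0_muley ?leey// lte_fin powR_gt0.
  have : u j <= G%:E * (T `^ r^-1)%:E.
    apply: le_trans (uv j) _.
    apply: (@le_trans _ _ (\sum_(0 <= i <oo) (T `^ r^-1)%:E * (wt (- (e / 2)) i j)%:E)).
      apply: lee_nneseries => [i _ _|i _]; first by rewrite mule_ge0// lee_fin wt_ge0.
      have -> : (- e = - (e / 2) + - (e / 2))%R by lra.
      rewrite wtD EFinM -muleA [leRHS]muleC; apply: lee_wpmul2l; first by rewrite lee_fin wt_ge0.
      exact: vT.
    rewrite nneseriesZl => [|i _]; last by rewrite lee_fin wt_ge0.
    by rewrite muleC; apply: lee_wpmul2r; [rewrite lee_fin powR_ge0|rewrite GE; exact: wt_series_le].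
  move=> h; apply: le_trans (poweR_mono (ltW r0) (u0 j) h) _.
  rewrite poweRM; [|by rewrite lee_fin ltW|by rewrite lee_fin powR_ge0].
  by rewrite -[(T `^ r^-1)%:E]/(T%:E `^ r^-1) poweRVK.
apply: (@le_trans _ _ (((G `^ r)%:E * (H%:E * \sum_(0 <= i <oo) v i `^ r)) `^ r^-1)); last first.
  have V0 : 0 <= \sum_(0 <= i <oo) v i `^ r by apply: nneseries_ge0 => *; exact: poweR_ge0.
  have H0' : 0 <= H%:E by rewrite lee_fin ltW.
  have G0' : 0 <= G%:E by rewrite lee_fin ltW.
  rewrite poweRM; [|by rewrite lee_fin powR_ge0|exact: mule_ge0].
  by rewrite (poweRM _ H0' V0) -[(G `^ r)%:E]/(G%:E `^ r) (poweRK r0 G0') EFinM muleA.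
apply: poweR_mono; [by rewrite invr_ge0 ltW|by apply: nneseries_ge0 => *; exact: poweR_ge0|].
apply: (@le_trans _ _ (\sum_(0 <= j <oo) ((G `^ r)%:E * \sum_(0 <= i <oo) (wt (- (e / 2 * r)) i j)%:E * v i `^ r))).
  by apply: lee_nneseries => [*|j _]; [exact: poweR_ge0|exact: key].
rewrite nneseriesZl => [|j _]; last by apply: nneseries_ge0 => *; exact: t0.
apply: lee_wpmul2l; first by rewrite lee_fin powR_ge0.
rewrite nneseries_interchange// -nneseriesZl => [|i _]; last exact: poweR_ge0.
apply: lee_nneseries => [i _ _|i _]; first by apply: nneseries_ge0 => *; exact: t0.
case: (v i) (v0 i) => [x| |] // x0; last first.
  by rewrite poweRyr ?gt_eqF// gt0_muley ?leey// lte_fin.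
rewrite poweR_EFin; under eq_eseriesr do rewrite muleC wtC.
rewrite nneseriesZl => [|k _]; last by rewrite lee_fin wt_ge0.
by rewrite muleC; apply: lee_wpmul2r; [rewrite lee_fin powR_ge0|rewrite HE; exact: wt_series_le].
Qed.

(** The sum is at most twice the larger term; valid for all positive exponents. *)
Lemma poweR_add_le (r : R) (x y : \bar R) : (0 < r)%R -> 0 <= x -> 0 <= y ->
  (x + y) `^ r <= (2 `^ r)%:E * (x `^ r + y `^ r).
Proof.
move=> r0 x0 y0; have xy z w : 0 <= z -> z <= w -> (z + w) `^ r <= (2 `^ r)%:E * w `^ r.
  move=> z0 zw; have w0 := le_trans z0 zw.
  have h : z + w <= 2%:E * w by rewrite -[2%:E]/(1 + 1) ge0_muleDl// mul1e leeD2r.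
  apply: le_trans (poweR_mono (ltW r0) (adde_ge0 z0 w0) h) _.
  by rewrite poweRM.
have [h|/ltW h] := leP x y.
  apply: le_trans (xy _ _ x0 h) _; apply: lee_wpmul2l; first by rewrite lee_fin powR_ge0.
  by rewrite leeDr// poweR_ge0.
rewrite addeC; apply: le_trans (xy _ _ y0 h) _; apply: lee_wpmul2l; first by rewrite lee_fin powR_ge0.
by rewrite leeDl// poweR_ge0.
Qed.

Lemma lq_quasi_triangle q : 0 < q -> exists2 C : R, (0 < C)%R &
  forall a b, (forall i, 0 <= a i) -> (forall i, 0 <= b i) ->
  lq q (fun i => a i + b i) <= C%:E * (lq q a + lq q b).
Proof.
case: q => [q||] // q0; last first.
  exists 1%R => // a b a0 b0; rewrite mul1e; apply: ge_ereal_sup => _ [i _ <-].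
  by apply: leeD; apply: ereal_sup_ubound; exists i.
rewrite lte_fin in q0.
exists (2 * 2 `^ q^-1)%R; first by rewrite mulr_gt0// powR_gt0.
move=> a b a0 b0; rewrite !lq_fin.
have A0 c : 0 <= \sum_(0 <= i <oo) (c i : \bar R) `^ q by apply: nneseries_ge0 => *; exact: poweR_ge0.
apply: (@le_trans _ _ (((2 `^ q)%:E * (\sum_(0 <= i <oo) a i `^ q + \sum_(0 <= i <oo) b i `^ q)) `^ q^-1)).
  apply: poweR_mono; [by rewrite invr_ge0 ltW|exact: A0|].
  rewrite -nneseriesD => [|*|*]; try exact: poweR_ge0.
  rewrite -nneseriesZl => [|*]; last by rewrite adde_ge0// poweR_ge0.
  by apply: lee_nneseries => [*|i _]; [exact: poweR_ge0|exact: poweR_add_le].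
rewrite poweRM; [|by rewrite lee_fin powR_ge0|exact: adde_ge0].
rewrite -[(2 `^ q)%:E]/(2%:E `^ q) poweRK// EFinM -muleA.
apply: lee_wpmul2l => //; apply: poweR_add_le => //; by rewrite invr_gt0.
Qed.

(** A block norm is the norm of the sequence extended by 0. *)
Definition cut (m n : nat) a (j : nat) : \bar R := if (m <= j < n)%N then a j else 0.

Lemma cut_ge0 m n a : (forall i, 0 <= a i) -> forall i, 0 <= cut m n a i.
Proof. by move=> a0 i; rewrite /cut; case: ifP. Qed.

Lemma lq_blockE q m n a : 0 < q -> (forall i, 0 <= a i) -> lq_block q m n a = lq q (cut m n a).
Proof.
case: q => [q||] // q0 a0; last first.
  apply/eqP; rewrite eq_le; apply/andP; split.
    rewrite /lq_block big_seq; apply: (big_ind (fun x => x <= lq +oo (cut m n a))).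
    - by apply: lq_ge0 => // i; exact: cut_ge0.
    - by move=> x y; rewrite ge_max => -> ->.
    - move=> i; rewrite mem_index_iota => imn; apply: ereal_sup_ubound; exists i => //.
      by rewrite /cut imn.
  apply: ge_ereal_sup => _ [i _ <-]; rewrite /cut /lq_block; case: ifP => imn.
    by apply: le_bigmax_seq => //; rewrite mem_index_iota.
  by apply: (big_ind (fun x => 0 <= x)) => // x y x0 y0; rewrite le_max x0.
rewrite lte_fin in q0; rewrite lq_fin /lq_block; congr (_ `^ _).
rewrite (@nneseries_split _ _ 0 n) => [|*]; last exact: poweR_ge0.
rewrite add0n [X in _ + X]eseries0 ?adde0; last first.
  by move=> i ni _; rewrite /cut ltnNge ni andbF poweR0r// gt_eqF.
have [mn|nm] := leqP m n; last first.
  rewrite big_geq ?(ltnW nm)// big_nat big1// => i /andP[_ lin].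
  rewrite /cut; case: ifP => [/andP[h _]|_]; first lia.
  by rewrite poweR0r// gt_eqF.
rewrite (@big_cat_nat _ _ _ m 0 n)//= [X in _ = X + _]big_nat [X in _ = X + _]big1 ?add0e.
  by apply: eq_big_nat => i imn; rewrite /cut imn.
move=> i /andP[_ im]; rewrite /cut; case: ifP => [/andP[h _]|_]; first lia.
by rewrite poweR0r// gt_eqF.
Qed.

Lemma lq_block_ge0 q m n a : 0 < q -> (forall i, 0 <= a i) -> 0 <= lq_block q m n a.
Proof. by move=> q0 a0; rewrite lq_blockE//; apply: lq_ge0 => // i; exact: cut_ge0. Qed.

Lemma lq_block_le q m n a : 0 < q -> (forall i, 0 <= a i) -> lq_block q m n a <= lq q a.
Proof.
move=> q0 a0; rewrite lq_blockE//; apply: lq_mono => // i; first exact: cut_ge0.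
by rewrite /cut; case: ifP.
Qed.

Lemma lq_block_mono q m n a b : 0 < q -> (forall i, 0 <= a i) ->
  (forall i, (m <= i < n)%N -> a i <= b i) -> (forall i, 0 <= b i) -> lq_block q m n a <= lq_block q m n b.
Proof.
move=> q0 a0 ab b0; rewrite !lq_blockE//; apply: lq_mono => // i; first exact: cut_ge0.
by rewrite /cut; case: ifP => // /ab.
Qed.

Lemma lq_block_term q m n a k : 0 < q -> (forall i, 0 <= a i) -> (m <= k < n)%N -> a k <= lq_block q m n a.
Proof.
move=> q0 a0 kmn; rewrite lq_blockE//.
by have := @lq_term q (cut m n a) k q0 (cut_ge0 m n a0); rewrite {1}/cut kmn.
Qed.

Lemma lq_block_quasi_triangle q : 0 < q -> exists2 C : R, (0 < C)%R &
  forall m n a b, (forall i, 0 <= a i) -> (forall i, 0 <= b i) ->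
  lq_block q m n (fun i => a i + b i) <= C%:E * (lq_block q m n a + lq_block q m n b).
Proof.
move=> q0; have [C C0 h] := lq_quasi_triangle q0; exists C => // m n a b a0 b0.
rewrite !lq_blockE//; last by move=> i; exact: adde_ge0.
have -> : cut m n (fun i => a i + b i) = fun i => cut m n a i + cut m n b i.
  by apply/funext => i; rewrite /cut; case: ifP => //; rewrite adde0.
by apply: h => i; exact: cut_ge0.
Qed.

(** Equality holds, as the blocks partition the indices; for a finite exponent the sum
    over n terms is compared with the sum over the first n blocks, which contain
    them. *)
Lemma lq_le_blocks q a : 0 < q -> (forall i, 0 <= a i) ->
  lq q a <= lq q (fun i => lq_block q (block_start i) (block_start i.+1) a).
Proof.
case: q => [q||] // q0 a0; last first.
  apply: ge_ereal_sup => _ [n _ <-].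
  apply: le_trans (lq_term (a := fun i => lq_block +oo (block_start i) (block_start i.+1) a) (block_index n) q0 _); last first.
    by move=> i; exact: lq_block_ge0.
  by apply: lq_block_term => //; rewrite in_block.
have q0' := q0; rewrite lte_fin in q0'; rewrite !lq_fin; apply: poweR_mono; first by rewrite invr_ge0 ltW.
  by apply: nneseries_ge0 => *; exact: poweR_ge0.
apply: nneseries_le_ub => [i|n]; first exact: poweR_ge0.
apply: (@le_trans _ _ (\sum_(0 <= i < block_start n) a i `^ q)).
  rewrite (@big_cat_nat _ _ _ n 0 (block_start n))//= ?block_start_ge// leeDl//.
  by apply: sume_ge0 => *; exact: poweR_ge0.
suff -> : \sum_(0 <= i < block_start n) a i `^ q = \sum_(0 <= i < n) lq_block q%:E (block_start i) (block_start i.+1) a `^ q.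
  by apply: nneseries_lim_ge => *; exact: poweR_ge0.
elim: n => [|n IH]; first by rewrite /block_start expn0 !big_nil.
rewrite (@big_cat_nat _ _ _ (block_start n))//= ?block_start_le// IH big_nat_recr//=; congr (_ + _).
by rewrite /lq_block poweRVK//; apply: sume_ge0 => *; exact: poweR_ge0.
Qed.

End ereal_sequences.

(** * Lp norms *)

Section monotone_integral.
Context {disp : measure_display} {T : measurableType disp} {R : realType} (mu : {measure set T -> \bar R}).
Local Open Scope ereal_scope.

(** The integral of a nonnegative function is a supremum over the simple functions below
    it, and there are more of them below a larger function. *)
Lemma ge0_integral_mono (D : set T) (f g : T -> \bar R) : (forall x, D x -> 0 <= f x) ->
  (forall x, D x -> f x <= g x) -> \int[mu]_(x in D) f x <= \int[mu]_(x in D) g x.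
Proof.
move=> f0 fg; rewrite !ge0_integralE//; last by move=> x Dx; apply: le_trans (fg x Dx); exact: f0.
apply: le_ereal_sup => _ [h hf <-]; exists h => // x; apply: le_trans (hf x) _.
by rewrite /patch; case: ifPn => // /set_mem; exact: fg.
Qed.

End monotone_integral.

Section Lp_theory.
Context {R : realType} {d : nat}.
Local Notation mR := (measurableTypeR R).
Local Notation E := 'rV[R]_d.
Local Notation mu := (lebesgue_tuple R d).
Local Notation rt := (@row_of_tuple R d).
Variables (p : R) (p1 : 1 <= p).
Local Open Scope ereal_scope.

Let p0 : (0 < p)%R. Proof. exact: lt_le_trans p1. Qed.

Lemma LpE (g : E -> \bar R) : (forall x, 0 <= g x) ->
  Lp p%:E g = (\int[mu]_t (g (rt t) `^ p)) `^ p^-1.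
Proof.
move=> g0; rewrite /Lp unlock /Lnorm; congr (_ `^ _).
by apply: eq_integral => t _; rewrite gee0_abs.
Qed.

Lemma Lp_ge0 (g : E -> \bar R) : 0 <= Lp p%:E g. Proof. exact: Lnorm_ge0. Qed.

Lemma Lp_mono (f g : E -> \bar R) : (forall x, 0 <= f x) -> (forall x, f x <= g x) ->
  Lp p%:E f <= Lp p%:E g.
Proof.
move=> f0 fg; have g0 x : 0 <= g x by apply: le_trans (fg x).
rewrite !LpE//; apply: poweR_mono; first by rewrite invr_ge0 ltW.
  by apply: integral_ge0 => t _; exact: poweR_ge0.
apply: ge0_integral_mono => t _; first exact: poweR_ge0.
exact: poweR_mono (ltW p0) _ _.
Qed.

Lemma emeas_powR (r : R) (g : E -> R) : emeas g -> emeas (fun x => g x `^ r)%R.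
Proof. by rewrite /emeas => mg; exact: (measurableT_comp (@measurable_powR R r) mg). Qed.

Lemma measurable_EFin_pow (g : E -> R) : emeas g ->
  measurable_fun [set: d.-tuple mR] (fun t => (g (rt t))%:E `^ p).
Proof.
by move=> /(emeas_powR p)/measurable_EFinP.
Qed.

Lemma LpZ (c : R) (g : E -> R) : (0 <= c)%R -> emeas g -> (forall x, (0 <= g x)%R) ->
  Lp p%:E (fun x => (c * g x)%:E) = c%:E * Lp p%:E (fun x => (g x)%:E).
Proof.
move=> c0 mg g0; rewrite !LpE => [|x|x]; last 2 first.
- by rewrite lee_fin.
- by rewrite lee_fin mulr_ge0.
under eq_integral => t _ do rewrite EFinM poweRM ?lee_fin//.
rewrite ge0_integralZl//; last 3 first.
- exact: measurable_EFin_pow.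
- by move=> *; exact: poweR_ge0.
- exact: poweR_ge0.
rewrite poweRM; [|exact: poweR_ge0|by apply: integral_ge0 => *; exact: poweR_ge0].
by rewrite poweRK// lee_fin.
Qed.

Lemma LpD (f g : E -> R) : emeas f -> emeas g ->
  Lp p%:E (fun x => (f x + g x)%:E) <= Lp p%:E (fun x => (f x)%:E) + Lp p%:E (fun x => (g x)%:E).
Proof. by move=> mf mg; have := @minkowski_EFin _ _ _ mu (f \o rt) (g \o rt) p mf mg p1; exact. Qed.

Lemma Lp0 : Lp p%:E (fun _ : E => 0%:E) = 0.
Proof. by apply: Lnorm0; rewrite eqe gt_eqF. Qed.

Lemma Lp_sum (g : nat -> E -> R) n : (forall i, emeas (g i)) ->
  Lp p%:E (fun x => (\sum_(0 <= i < n) g i x)%:E) <= \sum_(0 <= i < n) Lp p%:E (fun x => (g i x)%:E).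
Proof.
move=> mg; elim: n => [|n IH].
  by rewrite big_nil; under [X in Lp _ X]eq_fun do rewrite big_nil; rewrite Lp0.
rewrite big_nat_recr//=; under [X in Lp _ X]eq_fun do rewrite big_nat_recr//=.
apply: le_trans (LpD _ (mg n)) _; last by rewrite leeD2r.
by apply: emeas_sum => i; exact: mg.
Qed.

(** Minkowski's inequality for finite sums and monotone convergence. *)
Lemma Lp_series (g : nat -> E -> R) : (forall i, emeas (g i)) -> (forall i x, (0 <= g i x)%R) ->
  Lp p%:E (fun x => \sum_(0 <= i <oo) (g i x)%:E) <= \sum_(0 <= i <oo) Lp p%:E (fun x => (g i x)%:E).
Proof.
move=> mg g0; have gi0 x i : 0 <= (g i x)%:E by rewrite lee_fin.
rewrite LpE; last by move=> x; apply: nneseries_ge0 => i _ _; exact: gi0.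
have [S SE] : exists S, S = \sum_(0 <= i <oo) Lp p%:E (fun x => (g i x)%:E) by eexists.
rewrite -SE; have S0 : 0 <= S by rewrite SE; apply: nneseries_ge0 => *; exact: Lp_ge0.
rewrite -[leRHS](poweRK p0 S0); apply: poweR_mono; first by rewrite invr_ge0 ltW.
  by apply: integral_ge0 => *; exact: poweR_ge0.
have [P PE] : exists P : nat -> d.-tuple mR -> \bar R,
    P = fun n t => (\sum_(0 <= i < n) g i (rt t))%:E `^ p by eexists.
have Pnd t : {homo P ^~ t : n m / (n <= m)%N >-> n <= m}.
  move=> n m nm; rewrite PE; apply: (poweR_mono (ltW p0)).
    by rewrite lee_fin; apply: sumr_ge0 => i _; exact: g0.
  rewrite lee_fin (big_cat_nat _ nm)//= lerDl; apply: sumr_ge0 => i _; exact: g0.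
have PS t n : P n t <= limn (P ^~ t).
  rewrite (cvg_lim _ (ereal_nondecreasing_cvgn (Pnd t)))//; by apply: ereal_sup_ubound; exists n.
have P0 n t : 0 <= P n t by rewrite PE; exact: poweR_ge0.
have mP n : measurable_fun [set: d.-tuple mR] (P n).
  rewrite PE; apply: (measurable_EFin_pow (g := fun x => \sum_(0 <= i < n) g i x)%R); apply: emeas_sum => i; exact: mg.
apply: (@le_trans _ _ (\int[mu]_t limn (P ^~ t))).
  apply: ge0_integral_mono => t _; first exact: poweR_ge0.
  have L0 : 0 <= limn (P ^~ t) by apply: le_trans (PS t 0%N).
  rewrite -[leRHS](poweRVK p0 L0); apply: (poweR_mono (ltW p0)).
    by apply: nneseries_ge0 => i _ _; exact: gi0.
  apply: nneseries_le_ub => [i|n]; first exact: gi0.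
  have Q0 : 0 <= (\sum_(0 <= i < n) g i (rt t))%:E by rewrite lee_fin; apply: sumr_ge0 => i _; exact: g0.
  rewrite sumEFin -[leLHS](poweRK p0 Q0); apply: poweR_mono; first by rewrite invr_ge0 ltW.
    exact: poweR_ge0.
  by have := PS t n; rewrite {1}PE.
rewrite monotone_convergence//.
apply: lime_le.
  apply: ereal_nondecreasing_is_cvgn => n m nm; apply: ge0_integral_mono => t _ //; exact: Pnd.
apply: nearW => n.
have L0 : 0 <= \int[mu]_x P n x by apply: integral_ge0.
rewrite -[leLHS](poweRVK p0 L0); apply: (poweR_mono (ltW p0)); first exact: poweR_ge0.
have -> : (\int[mu]_x P n x) `^ p^-1 = Lp p%:E (fun x => (\sum_(0 <= i < n) g i x)%:E).
  rewrite LpE ?PE// => x; rewrite lee_fin; apply: sumr_ge0 => i _; exact: g0.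
apply: le_trans (Lp_sum n mg) _; rewrite SE; apply: nneseries_lim_ge => *; exact: Lp_ge0.
Qed.

Lemma Lp_wseries (c : nat -> R) (g : nat -> E -> R) (f : E -> \bar R) :
  (forall i, (0 <= c i)%R) -> (forall i, emeas (g i)) -> (forall i x, (0 <= g i x)%R) ->
  (forall x, 0 <= f x) -> (forall x, f x <= \sum_(0 <= i <oo) (c i)%:E * (g i x)%:E) ->
  Lp p%:E f <= \sum_(0 <= i <oo) (c i)%:E * Lp p%:E (fun x => (g i x)%:E).
Proof.
move=> c0 mg g0 f0 fg; apply: le_trans (Lp_mono f0 fg) _.
apply: le_trans (Lp_series (g := fun i x => (c i * g i x)%R) _ _) _.
- by move=> i; apply: emeasM => //; exact: measurable_cst.
- by move=> i x; exact: mulr_ge0.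
- by apply: lee_nneseries => [i _ _|i _]; [exact: Lp_ge0|rewrite LpZ].
Qed.

End Lp_theory.

Section young.
Context {R : realType} {d : nat}.
Local Notation mR := (measurableTypeR R).
Local Notation E := 'rV[R]_d.
Local Notation mu := (lebesgue_tuple R d).
Local Notation rt := (@row_of_tuple R d).
Local Open Scope ereal_scope.

Lemma Int_EFin (f : E -> R) : L1 f -> (Int f)%:E = \int[mu]_t (f (rt t))%:E.
Proof. by move=> L; rewrite /Int /Rintegral fineK//; exact: integrable_fin_num. Qed.

(** Write k = k^(1/p) k^(1/q) for the conjugate exponent q, use the inequality of
    Hoelder for fixed x, and integrate in x by the theorem of Tonelli. *)
Lemma young (p : R) (h k : E -> R) : (1 < p)%R -> emeas h -> (forall x, (0 <= h x)%R) ->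
  L1 k -> (forall x, (0 <= k x)%R) -> (forall x, L1 (fun y => h y * k (x - y)%R)%R) ->
  Lp p%:E (fun x => (Int (fun y => h y * k (x - y))%R)%:E) <= (Int k)%:E * Lp p%:E (fun x => (h x)%:E).
Proof.
move=> p1 mh h0 Lk k0 Lhk.
have p0 : (0 < p)%R by rewrite (lt_trans ltr01).
have [q [q0 pq]] : exists q : R, (0 < q)%R /\ (p^-1 + q^-1 = 1)%R.
  (* the conjugate exponent *)
  exists ((1 - p^-1)^-1)%R; rewrite invrK invr_gt0 subr_gt0 invf_lt1//; split=> //; ring.
have mk := L1_emeas Lk; have K0 : (0 <= Int k)%R by apply: Int_ge0.
have n1 : (-1)%R != 0%R :> R by rewrite oppr_eq0 oner_neq0.
have mks x : emeas (fun y => k (x - y)%R).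
  by have := emeas_affine (-1) x mk; congr emeas; apply/funext => y; rewrite scaleN1r addrC.
have Kshift x : \int[mu]_t (k (x - rt t)%R)%:E = (Int k)%:E.
  have mkE : measurable_fun [set: d.-tuple mR] ((fun x => (k x)%:E) \o rt) by exact/measurable_EFinP.
  have := ge0_integral_affineE x n1 mkE (fun x => _); rewrite normrN normr1 invr1 expr1n mul1e (Int_EFin Lk) => <-.
    by apply: eq_integral => t _; rewrite scaleN1r addrC.
  by move=> z; rewrite lee_fin.
have Kshift' y : \int[mu]_t (k (rt t - y)%R)%:E = (Int k)%:E.
  have mkE : measurable_fun [set: d.-tuple mR] ((fun x => (k x)%:E) \o rt) by exact/measurable_EFinP.
  have := ge0_integral_affineE (- y) (oner_neq0 R) mkE (fun x => _); rewrite normr1 invr1 expr1n mul1e (Int_EFin Lk) => <-.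
    by apply: eq_integral => t _; rewrite scale1r.
  by move=> z; rewrite lee_fin.
have [A AE] : exists A : E -> \bar R, A = fun x => \int[mu]_t (h (rt t) `^ p * k (x - rt t))%R%:E by eexists.
have hol x : (Int (fun y => h y * k (x - y))%R)%:E `^ p <= (Int k)%:E `^ (p / q) * A x.
  have A0 : 0 <= A x by rewrite AE; apply: integral_ge0 => t _; rewrite lee_fin mulr_ge0// powR_ge0.
  have kpow r : emeas (fun y => k (x - y) `^ r)%R.
    exact: emeas_powR.
  have := @hoelder _ _ _ mu (fun t => h (rt t) * k (x - rt t) `^ p^-1)%R (fun t => k (x - rt t) `^ q^-1)%R p q
     (emeasM mh (kpow (p^-1)%R)) (kpow (q^-1)%R) p0 q0 pq.
  have IE : 'N[mu]_1[EFin \o ((fun t => h (rt t) * k (x - rt t) `^ p^-1) \* (fun t => k (x - rt t) `^ q^-1))%R] =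
      (Int (fun y => h y * k (x - y))%R)%:E.
    rewrite Lnorm1 (Int_EFin (Lhk x)); apply: eq_integral => t _ /=.
    rewrite -mulrA -powRD; last by rewrite pq oner_eq0.
    by rewrite pq powRr1// ger0_norm// mulr_ge0.
  have FE : 'N[mu]_p%:E[EFin \o (fun t => h (rt t) * k (x - rt t) `^ p^-1)%R] = A x `^ p^-1.
    rewrite unlock /Lnorm AE; congr (_ `^ _); apply: eq_integral => t _ /=.
    rewrite ger0_norm ?mulr_ge0 ?powR_ge0// powRM ?powR_ge0//.
    by rewrite -powRrM mulVf ?gt_eqF// powRr1.
  have GE : 'N[mu]_q%:E[EFin \o (fun t => k (x - rt t) `^ q^-1)%R] = (Int k)%:E `^ q^-1.
    rewrite unlock /Lnorm -(Kshift x); congr (_ `^ _); apply: eq_integral => t _ /=.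
    by rewrite ger0_norm ?powR_ge0// -powRrM mulVf ?gt_eqF// powRr1.
  rewrite IE FE GE => H.
  have J0 : 0 <= (Int (fun y => h y * k (x - y))%R)%:E by rewrite lee_fin; apply: Int_ge0 => y; exact: mulr_ge0.
  apply: le_trans (poweR_mono (ltW p0) J0 H) _.
  rewrite poweRM; [|exact: poweR_ge0|exact: poweR_ge0].
  rewrite poweRVK// muleC -poweRrM [(q^-1 * p)%R]mulrC; exact: lexx.
have mhp : emeas (fun y => h y `^ p)%R by exact: emeas_powR.
have H0 : 0 <= \int[mu]_t (h (rt t) `^ p)%R%:E by apply: integral_ge0 => t _; rewrite lee_fin powR_ge0.
have IA : \int[mu]_s A (rt s) = (Int k)%:E * \int[mu]_t (h (rt t) `^ p)%R%:E.
  rewrite AE.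
  have m2 : emeas2 (fun x y => h y `^ p * k (x - y))%R by apply: emeas2M; [exact: emeas2_2|exact: emeas2_sub].
  have -> := @fubini_tonelli _ _ _ _ _ mu mu (fun st => (h (rt st.2) `^ p * k (rt st.1 - rt st.2))%R%:E) _ _.
  - rewrite -ge0_integralZl ?lee_fin//; last 2 first.
    + exact/measurable_EFinP.
    + by move=> *; rewrite lee_fin powR_ge0.
    apply: eq_integral => t _ /=.
    under eq_integral => s _ do rewrite EFinM.
    rewrite ge0_integralZl ?lee_fin ?powR_ge0//; last 2 first.
    + apply/measurable_EFinP; have := emeas_affine 1 (- rt t) mk; apply: eq_measurable_fun => s _ /=.
      by rewrite scale1r.
    + by move=> *; rewrite lee_fin.
    by rewrite Kshift' muleC.
  - exact/measurable_EFinP.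
  - by move=> st; rewrite lee_fin mulr_ge0// powR_ge0.
rewrite LpE//; last by move=> x; rewrite lee_fin; apply: Int_ge0 => y; exact: mulr_ge0.
rewrite LpE => [|x]; last by rewrite lee_fin.
have mA : measurable_fun [set: d.-tuple mR] (fun s => A (rt s)).
  rewrite AE.
  have m2 : emeas2 (fun x y => h y `^ p * k (x - y))%R by apply: emeas2M; [exact: emeas2_2|exact: emeas2_sub].
  apply: (@measurable_fun_fubini_tonelli_F _ _ _ _ _ mu (fun st => (h (rt st.2) `^ p * k (rt st.1 - rt st.2))%R%:E)).
    exact/measurable_EFinP.
  by move=> st; rewrite lee_fin mulr_ge0// powR_ge0.
have A0 x : 0 <= A x by rewrite AE; apply: integral_ge0 => t _; rewrite lee_fin mulr_ge0// powR_ge0.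
apply: (@le_trans _ _ (((Int k)%:E `^ (p / q) * ((Int k)%:E * \int[mu]_t (h (rt t) `^ p)%R%:E)) `^ p^-1)).
  apply: poweR_mono; first by rewrite invr_ge0 ltW.
    by apply: integral_ge0 => *; exact: poweR_ge0.
  apply: (@le_trans _ _ (\int[mu]_t ((Int k)%:E `^ (p / q) * A (rt t)))).
    by apply: ge0_integral_mono => t _; [exact: poweR_ge0|exact: hol].
  by rewrite ge0_integralZl ?IA//; exact: poweR_ge0.
have KE : 0 <= (Int k)%:E by rewrite lee_fin.
rewrite (poweRM _ (poweR_ge0 _ _) (mule_ge0 KE H0)) (poweRM _ KE H0) muleA -poweRrM.
apply: lee_wpmul2r; first exact: poweR_ge0.
rewrite !poweR_EFin -EFinM lee_fin.
have -> : (p / q * p^-1 = q^-1)%R by field; rewrite !gt_eqF.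
rewrite -powRD; last by rewrite addrC pq oner_eq0.
by rewrite addrC pq powRr1.
Qed.

End young.

(** * Block norms *)

Section block_functions.
Context {R : realType}.

(** The block norm of a real sequence as a real number, whose measurability in a
    parameter is immediate. *)
Definition rblock (q : \bar R) (m n : nat) (u : nat -> R) : R :=
  if q is q'%:E then (\sum_(m <= j < n) u j `^ q') `^ q'^-1
  else \big[Num.max/0]_(m <= j < n) u j.

Lemma lq_block_EFin q m n (u : nat -> R) : lq_block q m n (fun j => (u j)%:E) = (rblock q m n u)%:E.
Proof.
case: q => [q| |] /=; rewrite /lq_block /rblock.
- by rewrite -[(_ `^ _)%:E]/((_)%:E `^ _)%E -sumEFin.
- by rewrite (big_morph EFin EFin_max (erefl _)).
- by rewrite (big_morph EFin EFin_max (erefl _)).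
Qed.

Lemma rblock_ge0 q m n (u : nat -> R) : (0 < q)%E -> (forall j, 0 <= u j) -> 0 <= rblock q m n u.
Proof.
move=> q0 u0; rewrite -lee_fin -lq_block_EFin; exact: lq_block_ge0.
Qed.

(** A sequence with a single term is an instance of [lq_dominated], which covers all
    exponents at once. *)
Lemma lq_block_single (q : \bar R) : (0 < q)%E -> exists2 C : R, 0 < C & forall m n k (x : R), 0 <= x ->
  (lq_block q m n (fun i => (if i == k then x else 0)%:E) <= (C * (if (m <= k < n)%N then x else 0))%:E)%E.
Proof.
move=> q0; have [C C0 h] := lq_dominated q0 (ltr01 : 0 < 1 :> R); exists C => // m n k x x0.
have p0 i : (0 <= (if i == k then x else 0 : R)%:E)%E by rewrite lee_fin; case: ifP.
rewrite lq_blockE// EFinM; apply: (h k) => [|i|i].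
- by rewrite lee_fin; case: ifP.
- exact: cut_ge0.
- rewrite /cut -EFinM; have [->|ik] := eqVneq i k.
    case: ifP => _; last by rewrite mulr0.
    by rewrite /wt /ndist subnn mulr0 powRr0 mul1r.
  have w0 := wt_ge0 (-1 : R) i k.
  by case: ifP => _; rewrite lee_fin; apply: mulr_ge0 => //; case: ifP.
Qed.

End block_functions.

Section block_measurability.
Context {R : realType} {d : nat}.
Local Notation E := 'rV[R]_d.

Lemma emeas_max (J : Type) (s : seq J) (f : J -> E -> R) :
  (forall j, emeas (f j)) -> emeas (fun x => \big[Num.max/0]_(j <- s) f j x).
Proof.
move=> fm; elim: s => [|j s IH].
  by under eq_fun do rewrite big_nil; exact: measurable_cst.
by under eq_fun do rewrite big_cons; exact: (measurable_maxr (fm j) IH).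
Qed.

Lemma emeas_rblock q m n (u : nat -> E -> R) : (forall j, emeas (u j)) ->
  emeas (fun x => rblock q m n (fun j => u j x)).
Proof.
move=> um; case: q => [q| |]; rewrite /rblock.
- by apply: emeas_powR; apply: emeas_sum => j; exact: emeas_powR.
- by apply: emeas_max.
- by apply: emeas_max.
Qed.

End block_measurability.

Section pieces.
Context {R : realType} {d : nat}.
Local Notation E := 'rV[R]_d.
Local Notation C := R[i].
Variables (phi0 : E -> C) (hphi : resolution_generator phi0) (p : R) (p1 : 1 < p).

Let p1' : 1 <= p. Proof. exact: ltW. Qed.

Definition amp (n : nat) (f : @dist R d) (x : E) : R := cabs (lp_piece phi0 n f x).

Lemma amp_ge0 n f x : 0 <= amp n f x. Proof. exact: cabs_ge0. Qed.

Lemma emeas_amp n f : tempered f -> emeas (amp n f).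
Proof. by move=> tf; apply: cemeas_cabs; apply: ccontinuous_cemeas; exact: lp_piece_ccontinuous. Qed.

Definition piece_norm (n : nat) (f : @dist R d) : \bar R := Lp p%:E (fun x => (amp n f x)%:E).

Lemma piece_norm_ge0 n f : (0 <= piece_norm n f)%E. Proof. exact: Lp_ge0. Qed.

Lemma cabs_real (a : R) : cabs ((a%:C)%C : C) = `|a|.
Proof. by rewrite cabsE /= expr0n addr0 sqrtr_sqr. Qed.

(** The cut-offs are dilations of each other. *)
Lemma ker_lowpass_L1 N : Int (fun z => cabs (ker (lowpass phi0 N) z)) = Int (fun z => cabs (ker phi0 z)).
Proof.
have ps := generator_cschwartz hphi.
have [a [aE a0]] : exists a : R, a = (2 ^- N)^-1 /\ 0 < a.
  by exists (2 ^- N)^-1; split => //; rewrite invr_gt0 expV2.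
have L := L1_cabs (cschwartz_cintegrable (ker_cschwartz ps)).
have -> : (fun z => cabs (ker (lowpass phi0 N) z)) = fun z => a ^+ d * cabs (ker phi0 (a *: z)).
  apply/funext => z; rewrite (ker_dilate z (expV2 N) ps) -aE cabsM cabs_real.
  by rewrite ger0_norm// exprn_ge0// ltW.
have an0 : a != 0 by rewrite gt_eqF.
have La := L1_affine 0 an0 L; have := Int_affine 0 an0 L.
have ez : (fun z => cabs (ker phi0 (a *: z + 0))) = fun z => cabs (ker phi0 (a *: z)).
  by apply/funext => z; rewrite addr0.
rewrite ez in La *.
rewrite (IntZ _ La) => ->; rewrite gtr0_norm// mulrA -exprMn mulfV// expr1n mul1r.
by [].
Qed.

(** Young's inequality for the convolution formula of the pieces of the low part; the
    constant does not depend on N because the kernels have equal L1 norms. *)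
Lemma piece_norm_low_part : exists2 K : R, 0 < K & forall N n f, tempered f -> (piece_norm n (low_part phi0 N f) <= K%:E * piece_norm n f)%E.
Proof.
have ps := generator_cschwartz hphi.
have [a aE] : exists a : R, a = 2 * cabs (kappa phi0)^-1 by eexists.
have a0 : 0 <= a by rewrite aE mulr_ge0// cabs_ge0.
have K0 : 0 <= Int (fun z => cabs (ker phi0 z)) by apply: Int_ge0 => z; exact: cabs_ge0.
exists (Int (fun z => cabs (ker phi0 z)) * a + 1); first by rewrite ltr_wpDl// mulr_ge0.
move=> N n f tf; have ks := ker_cschwartz (lowpass_cschwartz N ps).
have n1 : -1 != 0 :> R by rewrite oppr_eq0 oner_neq0.
have Lk := L1_cabs (cschwartz_cintegrable ks).
have [k kE] : exists k, k = fun z => cabs (ker (lowpass phi0 N) (- z)) by eexists.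
have kA : k = fun z => cabs (ker (lowpass phi0 N) (-1 *: z + 0)).
  by rewrite kE; apply/funext => z; rewrite addr0 scaleN1r.
have Lk' : L1 k by rewrite kA; exact: (L1_affine 0 n1 Lk).
have Ik : Int k = Int (fun z => cabs (ker phi0 z)).
  rewrite kA (Int_affine 0 n1 Lk) normrN normr1 invr1 expr1n mul1r; exact: ker_lowpass_L1.
have k0 z : 0 <= k z by rewrite kE cabs_ge0.
have Li x : cintegrable (fun y => lp_piece phi0 n f y * ker (lowpass phi0 N) (y - x)).
  rewrite (lp_pieceE _ hphi tf); apply: (orbit_cintegrable tf); last exact: cschwartz_shift.
  exact: ker_cschwartz (dyadic_cschwartz n ps).
have Lhk x : L1 (fun y => amp n f y * k (x - y)).
  have := L1_cabs (Li x); congr L1; apply/funext => y; rewrite cabsM /amp kE opprB; exact: erefl.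
have Lhk' x : L1 (fun y => (a * amp n f y) * k (x - y)).
  by have := L1Z a (Lhk x); under eq_fun do rewrite mulrA.
have bound x : ((amp n (low_part phi0 N f) x)%:E <= (Int (fun y => (a * amp n f y) * k (x - y)))%:E)%E.
  rewrite lee_fin /amp (lp_piece_low_part _ _ _ hphi tf) cabsM.
  have -> : (fun y => a * amp n f y * k (x - y)) = fun y => a * (amp n f y * k (x - y)).
    by apply/funext => y; rewrite mulrA.
  rewrite (IntZ _ (Lhk x)) aE -mulrA [leRHS]mulrCA; apply: ler_wpM2l; first exact: cabs_ge0.
  apply: (cabs_cintegral (Li x) (Lhk x)) => y; rewrite cabsM /amp kE opprB; exact: lexx.
have Mh := emeas_amp n tf.
apply: le_trans (Lp_mono p1' _ bound) _; first by move=> x; rewrite lee_fin amp_ge0.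
apply: le_trans (young p1 _ _ Lk' k0 Lhk') _.
- by apply: emeasM => //; exact: measurable_cst.
- by move=> x; rewrite mulr_ge0// amp_ge0.
rewrite (LpZ p1' a0 Mh (amp_ge0 n f)) muleA -EFinM Ik; apply: lee_wpmul2r; first exact: piece_norm_ge0.
by rewrite lee_fin lerDl.
Qed.

(** Treats the two parts at once; [hi] selects the high one. *)
Definition freq_part (hi : bool) N (f : @dist R d) : @dist R d := if hi then high_part phi0 N f else low_part phi0 N f.

Lemma freq_part_tempered hi N f : tempered f -> tempered (freq_part hi N f).
Proof. by case: hi => tf; [exact: high_part_tempered|exact: low_part_tempered]. Qed.

Lemma piece_norm_freq_part : exists2 K : R, 0 < K & forall hi N n f, tempered f -> (piece_norm n (freq_part hi N f) <= K%:E * piece_norm n f)%E.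
Proof.
have [K K0 hK] := piece_norm_low_part; exists (1 + K); first by rewrite addr_gt0.
move=> [] N n f tf; rewrite /freq_part; last first.
  apply: le_trans (hK N n f tf) _; apply: lee_wpmul2r; first exact: piece_norm_ge0.
  by rewrite lee_fin lerDr.
have th := low_part_tempered N hphi tf.
apply: (@le_trans _ _ (Lp p%:E (fun x => (amp n f x + amp n (low_part phi0 N f) x)%:E))).
  apply: (Lp_mono p1') => x; first by rewrite lee_fin amp_ge0.
  rewrite lee_fin /amp (lp_piece_high_part _ _ _ hphi tf); apply: le_trans (cabsD _ _) _.
  by rewrite cabsN.
apply: le_trans (LpD p1' (emeas_amp n tf) (emeas_amp n th)) _.
by rewrite EFinD ge0_muleDl ?lee_fin// ?mul1e ?leeD2l// ?hK// ltW.
Qed.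

(** The indices at which a part can have a nonzero piece. *)
Definition relevant (hi : bool) (N n : nat) : bool := if hi then (N <= n)%N else (n <= N.+1)%N.

Lemma amp_freq_part_irrelevant hi N n f x : tempered f -> ~~ relevant hi N n -> amp n (freq_part hi N f) x = 0.
Proof.
case: hi => tf; rewrite /relevant /freq_part /amp -ltnNge => h.
  by rewrite (lp_piece_high_part _ _ _ hphi tf) (lp_piece_low_part_low hphi tf h) subrr cabs0.
by rewrite (lp_piece_low_part_high x hphi tf h) cabs0.
Qed.

(** Away from N and N + 1 the pieces of a part are 0 or those of f. *)
Lemma amp_freq_part_le hi N n f x : tempered f -> n != N -> n != N.+1 -> amp n (freq_part hi N f) x <= amp n f x.
Proof.
move=> tf nN nN1; have [rel|irr] := boolP (relevant hi N n); last first.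
  by rewrite amp_freq_part_irrelevant ?amp_ge0.
rewrite /amp; case: hi rel; rewrite /relevant /freq_part => rel.
  have h : (N.+1 < n)%N by lia.
  by rewrite (lp_piece_high_part _ _ _ hphi tf) (lp_piece_low_part_high x hphi tf h) subr0.
have h : (n < N)%N by lia.
by rewrite (lp_piece_low_part_low hphi tf h).
Qed.

Lemma piece_norm_freq_part_irrelevant hi N n f : tempered f -> ~~ relevant hi N n -> piece_norm n (freq_part hi N f) = 0.
Proof.
move=> tf irr; rewrite /piece_norm; under [X in Lp _ X]eq_fun do rewrite (amp_freq_part_irrelevant _ tf irr).
exact: Lp0.
Qed.

Section block_norms.
Variables (q : \bar R) (q0 : (0 < q)%E) (s : R).

Definition wamp (f : @dist R d) n x : R := 2 `^ (n%:R * s) * amp n f x.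

Lemma wamp_ge0 f n x : 0 <= wamp f n x. Proof. by rewrite mulr_ge0 ?powR_ge0 ?amp_ge0. Qed.

Lemma emeas_wamp f n : tempered f -> emeas (wamp f n).
Proof. by move=> tf; apply: emeasM; [exact: measurable_cst|exact: emeas_amp]. Qed.

Lemma wamp_Lp f n : tempered f -> Lp p%:E (fun x => (wamp f n x)%:E) = ((2 `^ (n%:R * s))%:E * piece_norm n f)%E.
Proof. by move=> tf; rewrite (LpZ p1' (powR_ge0 _ _) (emeas_amp n tf) (amp_ge0 n f)). Qed.

Definition block_fun (j : nat) (f : @dist R d) (x : E) : R := rblock q (block_start j) (block_start j.+1) (fun n => wamp f n x).

Lemma block_fun_ge0 j f x : 0 <= block_fun j f x.
Proof. by apply: rblock_ge0 => // n; exact: wamp_ge0. Qed.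

Lemma emeas_block_fun j f : tempered f -> emeas (block_fun j f).
Proof. by move=> tf; apply: emeas_rblock => n; exact: emeas_wamp. Qed.

Lemma block_funE j f x : (block_fun j f x)%:E = lq_block q (block_start j) (block_start j.+1) (fun n => weighted_piece phi0 s f n x).
Proof. by rewrite /block_fun -lq_block_EFin. Qed.

(** The Lp norm over a block that occurs in the definition of the truncated space. *)
Definition block_norm (j : nat) (f : @dist R d) : \bar R := Lp p%:E (fun x => (block_fun j f x)%:E).

Lemma block_norm_ge0 j f : (0 <= block_norm j f)%E. Proof. exact: Lp_ge0. Qed.

Lemma block_norm_term j n f : tempered f -> block_index n = j -> ((2 `^ (n%:R * s))%:E * piece_norm n f <= block_norm j f)%E.
Proof.
move=> tf nj; rewrite -(wamp_Lp n tf); apply: (Lp_mono p1') => x; first by rewrite lee_fin wamp_ge0.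
rewrite /block_fun -lq_block_EFin.
apply: (lq_block_term (a := fun n => (wamp f n x)%:E)) => // [i|]; first by rewrite lee_fin wamp_ge0.
by rewrite in_block nj.
Qed.

(** All pieces in the block but at most two are dominated pointwise; for the two
    remaining ones the Lp bound of a single piece suffices. A vector-valued maximal
    inequality is thus avoided. *)
Lemma block_norm_freq_part : exists2 K : R, 0 < K & forall hi N j f, tempered f -> (block_norm j (freq_part hi N f) <= K%:E * block_norm j f)%E.
Proof.
have [K1 K10 h1] := lq_block_quasi_triangle q0; have [K2 K20 h2] := @lq_block_single R q q0.
have [K3 K30 h3] := piece_norm_freq_part.
(* the pointwise term, and the two exceptional pieces *)
exists (K1 + 2 * (K1 * K1 * K2 * K3)); first by rewrite addr_gt0// !mulr_gt0.
have expand (a b c u v : R) : u * (a + u * (v * b + v * c)) = u * a + u * u * v * b + u * u * v * c by ring.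
move=> hi N j f tf; have tp := freq_part_tempered hi N tf.
pose e k x := if (block_start j <= k < block_start j.+1)%N then wamp (freq_part hi N f) k x else 0.
have e0 k x : 0 <= e k x by rewrite /e; case: ifP => // _; exact: wamp_ge0.
have me k : emeas (e k).
  by rewrite /e; case: (_ && _); [exact: emeas_wamp|exact: measurable_cst].
have pt x : ((block_fun j (freq_part hi N f) x)%:E <= (K1 * block_fun j f x + (K1 * K1 * K2) * e N x + (K1 * K1 * K2) * e N.+1 x)%:E)%E.
  pose sg k := fun i => (if i == k then wamp (freq_part hi N f) k x else 0)%:E.
  have sg0 k i : (0 <= sg k i)%E by rewrite /sg lee_fin; case: ifP => // _; exact: wamp_ge0.
  have sgE k : (wamp (freq_part hi N f) k x)%:E = sg k k by rewrite /sg eqxx.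
  have w0 g n : (0 <= (wamp g n x)%:E)%E by rewrite lee_fin wamp_ge0.
  rewrite /block_fun -lq_block_EFin.
  apply: (@le_trans _ _ (lq_block q (block_start j) (block_start j.+1) (fun n => (wamp f n x)%:E + (sg N n + sg N.+1 n))%E)).
    apply: lq_block_mono => // [n _|n]; last by rewrite !adde_ge0.
    have [->|nN] := eqVneq n N; first by rewrite sgE addeCA leeDl// adde_ge0.
    have [->|nN1] := eqVneq n N.+1; first by rewrite sgE addeA leeDr// adde_ge0.
    apply: le_trans (leeDl _ (adde_ge0 (sg0 N n) (sg0 N.+1 n))); rewrite lee_fin /wamp ler_wpM2l ?powR_ge0//.
    exact: amp_freq_part_le.
  apply: le_trans (h1 _ _ _ _ (w0 f) (fun n => adde_ge0 (sg0 N n) (sg0 N.+1 n))) _.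
  apply: le_trans (lee_wpmul2l _ (leeD (lexx _) (h1 _ _ _ _ (sg0 N) (sg0 N.+1)))) _.
    by rewrite lee_fin ltW.
  have S1 := h2 (block_start j) (block_start j.+1) N _ (wamp_ge0 (freq_part hi N f) N x).
  have S2 := h2 (block_start j) (block_start j.+1) N.+1 _ (wamp_ge0 (freq_part hi N f) N.+1 x).
  apply: le_trans (lee_wpmul2l _ (leeD (lexx _) (lee_wpmul2l _ (leeD S1 S2)))) _.
  - by rewrite lee_fin ltW.
  - by rewrite lee_fin ltW.
  rewrite lq_block_EFin -[leLHS]/((K1 * (block_fun j f x + K1 * (K2 * e N x + K2 * e N.+1 x)))%:E) lee_fin.
  by rewrite expand.
have eb k : (Lp p%:E (fun x => (e k x)%:E) <= K3%:E * block_norm j f)%E.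
  rewrite /e; case kj: (_ && _); last first.
    by rewrite Lp0//; apply: mule_ge0; [rewrite lee_fin ltW|exact: block_norm_ge0].
  rewrite (wamp_Lp _ tp); apply: le_trans (lee_wpmul2l _ (h3 hi N k f tf)) _; first by rewrite lee_fin powR_ge0.
  rewrite muleCA; apply: lee_wpmul2l; first by rewrite lee_fin ltW.
  by apply: block_norm_term => //; apply/eqP; rewrite -in_block.
clearbody e.
apply: le_trans (Lp_mono p1' _ pt) _; first by move=> x; rewrite lee_fin block_fun_ge0.
have K112 : 0 <= K1 * K1 * K2 by rewrite !mulr_ge0// ltW.
have Me k : emeas (fun x => (K1 * K1 * K2) * e k x) by apply: emeasM => //; exact: measurable_cst.
have Mb : emeas (fun x => K1 * block_fun j f x) by apply: emeasM; [exact: measurable_cst|exact: emeas_block_fun].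
apply: le_trans (LpD p1' (emeasD Mb (Me N)) (Me N.+1)) _.
apply: le_trans (leeD2r _ (LpD p1' Mb (Me N))) _.
rewrite (LpZ p1' (ltW K10) (emeas_block_fun j tf) (block_fun_ge0 j f)) !(LpZ p1' K112 (me _) (e0 _)).
have K0' : (0 <= (K1 * K1 * K2)%:E)%E by rewrite lee_fin.
apply: le_trans (leeD (leeD (lexx _) (lee_wpmul2l K0' (eb N))) (lee_wpmul2l K0' (eb N.+1))) _.
rewrite -/(block_norm j f) !muleA -!EFinM.
have p3 : (0 <= (K1 * K1 * K2 * K3)%:E)%E by rewrite lee_fin mulr_ge0// ltW.
have p4 : (0 <= K1%:E)%E by rewrite lee_fin ltW.
rewrite -!ge0_muleDl ?adde_ge0// -!EFinD; apply: lee_wpmul2r; first exact: block_norm_ge0.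
by rewrite lee_fin; lra.
Qed.

Lemma block_norm_freq_part_irrelevant hi N j f : tempered f ->
  (forall n, block_index n = j -> ~~ relevant hi N n) -> block_norm j (freq_part hi N f) = 0.
Proof.
move=> tf irr; rewrite /block_norm.
have -> : (fun x => (block_fun j (freq_part hi N f) x)%:E) = fun=> 0%:E.
  apply/funext => x; rewrite /block_fun -lq_block_EFin.
  apply/eqP; rewrite eq_le; apply/andP; split; last by apply: lq_block_ge0 => // i; rewrite lee_fin wamp_ge0.
  apply: (@le_trans _ _ (lq_block q (block_start j) (block_start j.+1) (fun=> 0%:E))).
    apply: lq_block_mono => // [i|i imn]; first by rewrite lee_fin wamp_ge0.
    rewrite /wamp amp_freq_part_irrelevant ?mulr0//; apply: irr.
    by apply/eqP; rewrite -in_block.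
  have [K K0 h] := lq_dominated q0 (ltr01 : 0 < 1 :> R).
  rewrite lq_blockE//; apply: le_trans (h 0%N _ 0%E _ _ _) _ => // [i|i|].
  - exact: cut_ge0.
  - by rewrite mule0 /cut; case: ifP.
  - by rewrite mule0.
exact: Lp0.
Qed.

Lemma block_norm_triangle : exists2 K : R, 0 < K & forall j f f', tempered f -> tempered f' ->
  (block_norm j (fun g => f g + f' g)%R <= K%:E * (block_norm j f + block_norm j f'))%E.
Proof.
have [K1 K10 h1] := lq_block_quasi_triangle q0; exists K1 => // j f f' tf tf'.
have K1' := ltW K10; have mf := emeas_block_fun j tf; have mf' := emeas_block_fun j tf'.
have pt x : ((block_fun j (fun g => f g + f' g) x)%:E <= (K1 * block_fun j f x + K1 * block_fun j f' x)%:E)%E.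
  have w0 g n : (0 <= (wamp g n x)%:E)%E by rewrite lee_fin wamp_ge0.
  rewrite -mulrDr EFinM EFinD /block_fun -!lq_block_EFin.
  apply: le_trans (h1 _ _ _ _ (w0 f) (w0 f')).
  apply: lq_block_mono => // [n _|n]; last by rewrite adde_ge0.
  rewrite -EFinD lee_fin /wamp -mulrDr ler_wpM2l ?powR_ge0// /amp (lp_pieceD _ _ hphi tf tf').
  exact: cabsD.
apply: le_trans (Lp_mono p1' _ pt) _; first by move=> x; rewrite lee_fin block_fun_ge0.
apply: le_trans (LpD p1' (emeasM _ mf) (emeasM _ mf')) _; try exact: measurable_cst.
rewrite (LpZ p1' K1' mf (block_fun_ge0 j f)) (LpZ p1' K1' mf' (block_fun_ge0 j f')).
by rewrite -ge0_muleDr ?Lp_ge0.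
Qed.

(** A crude bound of a block by its single pieces, with growing weights that are
    compensated later by a change of smoothness. *)
Lemma block_norm_le_wsum (e : R) : 0 < e -> exists2 K : R, 0 < K & forall N j f, tempered f ->
  (block_norm j f <= K%:E * \sum_(0 <= n <oo) (wt e n N)%:E *
     (if block_index n == j then (2 `^ (n%:R * s))%:E * piece_norm n f else 0))%E.
Proof.
move=> e0; have [K K0 h] := lq_le_wsum q0 e0; exists K => // N j f tf.
pose g n x := if block_index n == j then wamp f n x else 0.
have g0 n x : 0 <= g n x by rewrite /g; case: ifP => // _; exact: wamp_ge0.
have mg n : emeas (g n) by rewrite /g; case: (_ == _); [exact: emeas_wamp|exact: measurable_cst].
have W0 n : (0 <= (wt e n N)%:E)%E by rewrite lee_fin wt_ge0.
apply: le_trans (Lp_wseries p1' (c := fun n => K * wt e n N) (g := g) _ mg g0 _ _) _.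
- by move=> n; rewrite mulr_ge0 ?wt_ge0// ltW.
- by move=> x; rewrite lee_fin block_fun_ge0.
- move=> x; rewrite /block_fun -lq_block_EFin lq_blockE//; last by move=> i; rewrite lee_fin wamp_ge0.
  apply: le_trans (h N _ (cut_ge0 _ _ _)) _; first by move=> i; rewrite lee_fin wamp_ge0.
  rewrite -nneseriesZl => [|n _]; last by apply: mule_ge0 => //; apply: cut_ge0 => i; rewrite lee_fin wamp_ge0.
  apply: lee_nneseries => [n _ _|n _].
    apply: mule_ge0; first by rewrite lee_fin ltW.
    by apply: mule_ge0 => //; apply: cut_ge0 => i; rewrite lee_fin wamp_ge0.
  rewrite muleA -EFinM; apply: lee_wpmul2l; first by rewrite lee_fin mulr_ge0 ?wt_ge0// ltW.
  by rewrite /cut in_block /g; case: ifP.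
rewrite -nneseriesZl => [|n _]; last first.
  by apply: mule_ge0 => //; case: ifP => // _; rewrite mule_ge0 ?lee_fin ?powR_ge0 ?piece_norm_ge0.
apply: lee_nneseries => [n _ _|n _]; first by rewrite mule_ge0 ?Lp_ge0// lee_fin mulr_ge0 ?wt_ge0// ltW.
rewrite EFinM -muleA; apply: lee_wpmul2l; first by rewrite lee_fin ltW.
apply: lee_wpmul2l => //; rewrite /g; case: (_ == _); first by rewrite (wamp_Lp _ tf).
by rewrite Lp0.
Qed.

Definition Fnorm (f : @dist R d) : \bar R := qnorm (Fspace phi0 s p%:E q) f.

Lemma Fnorm_ge0 f : (0 <= Fnorm f)%E. Proof. exact: Lp_ge0. Qed.

Lemma block_norm_le_Fnorm j f : (block_norm j f <= Fnorm f)%E.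
Proof.
apply: (Lp_mono p1') => x; first by rewrite lee_fin block_fun_ge0.
by rewrite block_funE; apply: lq_block_le => // n; rewrite lee_fin wamp_ge0.
Qed.

(** A crude bound by the blocks. Since the weights depend on the distance of blocks and
    not of frequencies, they are compensated by powers of 2^j. *)
Lemma Fnorm_le_wsum (e : R) : 0 < e -> exists2 K : R, 0 < K & forall j f, tempered f ->
  (Fnorm f <= K%:E * \sum_(0 <= i <oo) (wt e i j)%:E * block_norm i f)%E.
Proof.
move=> e0; have [K K0 h] := lq_le_wsum q0 e0; exists K => // j f tf.
have w0 x n : (0 <= weighted_piece phi0 s f n x)%E by rewrite lee_fin wamp_ge0.
have W0 n : (0 <= (wt e n j)%:E)%E by rewrite lee_fin wt_ge0.
apply: le_trans (Lp_wseries p1' (c := fun n => K * wt e n j) (g := fun i => block_fun i f) _ _ _ _ _) _.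
- by move=> n; rewrite mulr_ge0 ?wt_ge0// ltW.
- by move=> i; exact: emeas_block_fun.
- by move=> i x; exact: block_fun_ge0.
- by move=> x; exact: lq_ge0.
- move=> x; apply: le_trans (lq_le_blocks q0 (w0 x)) _.
  apply: le_trans (h j _ _) _; first by move=> i; exact: lq_block_ge0.
  rewrite -nneseriesZl => [|n _]; last by apply: mule_ge0 => //; exact: lq_block_ge0.
  apply: lee_nneseries => [n _ _|n _].
    apply: mule_ge0; first by rewrite lee_fin ltW.
    by apply: mule_ge0 => //; exact: lq_block_ge0.
  by rewrite muleA -EFinM block_funE.
rewrite -nneseriesZl => [|n _]; last by apply: mule_ge0 => //; exact: block_norm_ge0.
apply: lee_nneseries => [n _ _|n _]; first by rewrite mule_ge0 ?Lp_ge0// lee_fin mulr_ge0 ?wt_ge0// ltW.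
by rewrite EFinM -muleA.
Qed.

End block_norms.

Section scale_norms.
Variables (A : scale) (q : \bar R) (q0 : (0 < q)%E) (s : R).

Definition Anorm (f : @dist R d) : \bar R := qnorm (Aspace A phi0 s p%:E q) f.

Lemma Anorm_ge0 f : (0 <= Anorm f)%E.
Proof. by rewrite /Anorm; case: A; [apply: lq_ge0 => // i; exact: Lp_ge0|exact: Lp_ge0]. Qed.

Lemma piece_norm_le_Anorm n f : tempered f -> ((2 `^ (n%:R * s))%:E * piece_norm n f <= Anorm f)%E.
Proof.
move=> tf; rewrite -(wamp_Lp s n tf) /Anorm; case: A => /=.
  by apply: (lq_term (a := fun j => Lp p%:E (weighted_piece phi0 s f j))) => // i; exact: Lp_ge0.
apply: (Lp_mono p1') => x; first by rewrite lee_fin wamp_ge0.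
apply: (lq_term (a := fun j => weighted_piece phi0 s f j x)) => // i.
by rewrite lee_fin wamp_ge0.
Qed.

(** The point at which the two scales and all parameters q0 become equivalent, at the
    price of weights with geometric growth in the frequency. *)
Lemma Anorm_le_wsum (e : R) : 0 < e -> exists2 K : R, 0 < K & forall N f, tempered f ->
  (Anorm f <= K%:E * \sum_(0 <= n <oo) (wt e n N)%:E * ((2 `^ (n%:R * s))%:E * piece_norm n f))%E.
Proof.
move=> e0; have [K K0 h] := lq_le_wsum q0 e0; exists K => // N f tf.
have w0 x n : (0 <= weighted_piece phi0 s f n x)%E by rewrite lee_fin wamp_ge0.
have W0 n : (0 <= (wt e n N)%:E)%E by rewrite lee_fin wt_ge0.
rewrite /Anorm; case: A => /=.
  apply: le_trans (h N _ _) _; first by move=> i; exact: Lp_ge0.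
  apply: lee_wpmul2l; first by rewrite lee_fin ltW.
  apply: lee_nneseries => [n _ _|n _]; first by rewrite mule_ge0 ?Lp_ge0.
  by rewrite -(wamp_Lp s n tf).
apply: le_trans (Lp_wseries p1' (c := fun n => K * wt e n N) (g := wamp s f) _ _ _ _ _) _.
- by move=> n; rewrite mulr_ge0 ?wt_ge0// ltW.
- by move=> i; exact: emeas_wamp.
- by move=> i x; exact: wamp_ge0.
- by move=> x; exact: lq_ge0.
- move=> x; apply: le_trans (h N _ (w0 x)) _.
  rewrite -nneseriesZl => [|n _]; last exact: mule_ge0.
  apply: lee_nneseries => [n _ _|n _]; last by rewrite muleA -EFinM.
  apply: mule_ge0; first by rewrite lee_fin ltW.
  by apply: mule_ge0.
rewrite -nneseriesZl => [|n _]; last by rewrite !mule_ge0 ?piece_norm_ge0// lee_fin powR_ge0.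
apply: lee_nneseries => [n _ _|n _]; first by rewrite mule_ge0 ?Lp_ge0// lee_fin mulr_ge0 ?wt_ge0// ltW.
by rewrite EFinM -muleA (wamp_Lp s n tf).
Qed.

End scale_norms.

End pieces.

(** * Splitting a distribution at a frequency *)

Section reconstruction.
Context {R : realType} {d : nat}.
Local Notation E := 'rV[R]_d.
Local Notation C := R[i].
Variables (phi0 : E -> C) (hphi : resolution_generator phi0) (p : R) (p1 : 1 < p).
Variables (A : scale) (q qA : \bar R) (q0 : (0 < q)%E) (qA0 : (0 < qA)%E) (s s0 b : R).
Hypotheses (ss0 : s != s0) (b0 : b != 0) (updown : (s < s0) = (0 < b)).

Local Notation up := (0 < b).
Local Notation c := (`|s0 - s|).
Local Notation be := (`|b|).
Local Notation bnn := (block_norm phi0 p q s).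
Local Notation pnn := (piece_norm phi0 p).
Local Notation FN := (Fnorm phi0 p q s).
Local Notation AN := (Anorm phi0 p A qA s0).

Lemma gap_gt0 : 0 < c. Proof. by rewrite normr_gt0 subr_eq0 eq_sym. Qed.

Lemma rate_gt0 : 0 < be. Proof. by rewrite normr_gt0. Qed.

(** The sign of s0 - s is the one of b in both cases of the theorem. *)
Lemma gapE : s0 - s = if up then c else - c.
Proof.
rewrite -updown; case: ltP => h; first by rewrite gtr0_norm// subr_gt0.
by rewrite ler0_norm ?opprK// subr_le0.
Qed.

Lemma rateE : b = if up then be else - be.
Proof. by case: ltP => h; [rewrite gtr0_norm|rewrite ler0_norm// opprK]. Qed.

(** At the start of the j-th block this is the parameter t_j of the K-functional if b is
    positive, and its inverse if b is negative. *)
Definition tau (N : nat) : R := 2 `^ (N%:R * (s - s0)).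

Lemma tau_gt0 N : 0 < tau N. Proof. exact: two_pow_gt0. Qed.

(** The sequence whose lr quasi-norm is the norm of the truncated space. *)
Definition summand (j : nat) (f : @dist R d) : \bar R := ((2 `^ (j%:R * b))%:E * bnn j f)%E.

Lemma summand_ge0 j f : (0 <= summand j f)%E.
Proof. by rewrite mule_ge0 ?block_norm_ge0// lee_fin powR_ge0. Qed.

(** The blocks on which a part obtained by splitting at the start of the block j can be
    nonzero; the part of low frequencies reaches the block j + 1 if j = 0. *)
Definition relevant_block (hi : bool) (i j : nat) : bool := if hi then (j <= i)%N else (i <= j.+1)%N.

Lemma ndist_le i j : (i <= j)%N -> (ndist i j)%:R = j%:R - i%:R :> R.
Proof. by move=> ij; rewrite /ndist (eqP ij) add0n natrB. Qed.

Lemma ndist_ge i j : (j <= i)%N -> (ndist i j)%:R = i%:R - j%:R :> R.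
Proof. by move=> ij; rewrite ndistC ndist_le. Qed.

Lemma ndistS i : (ndist i.+1 i)%:R = 1 :> R.
Proof. by rewrite ndist_ge// -natr1 addrAC subrr add0r. Qed.

Lemma wt_split (x y z : R) i j : x + y = z -> wt x i j * wt y i j = wt z i j.
Proof. by move=> <-; rewrite wtD. Qed.

(** On the relevant side the sign of the exponent makes the weight decay; the constant
    takes care of the index N + 1 of the low part. *)
Lemma side_weight hi (x : R) N n : 0 <= x -> relevant hi N n ->
  2 `^ ((N%:R - n%:R) * (if hi then x else - x)) <= 2 `^ (2 * x) * wt (- x) n N.
Proof.
move=> x0; rewrite /relevant /wt -two_powD; case: hi => h; apply: two_pow_le.
  by rewrite ndist_ge// mulrC mulNr -mulrN opprB; lra.
have [nN|Nn] := leqP n N; first by rewrite ndist_le// mulrC mulNr; lra.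
have -> : n = N.+1 by lia.
by rewrite ndistS -natr1; lra.
Qed.

(** On the side of the relevant blocks the weight 2^(ib) grows away from j, and this
    leaves half of the rate |b| as decay. *)
Lemma block_side_weight i j : relevant_block up i j ->
  2 `^ (j%:R * b) * wt (be / 2) i j <= 2 `^ (2 * be) * (wt (- (be / 2)) i j * 2 `^ (i%:R * b)).
Proof.
move=> rij; have h : relevant up j i by [].
have := side_weight (normr_ge0 b) h; rewrite -rateE => h1.
have -> : j%:R * b = (j%:R - i%:R) * b + i%:R * b by ring.
rewrite two_powD mulrAC [leRHS]mulrA; apply: ler_wpM2r; first exact: powR_ge0.
apply: le_trans (ler_wpM2r (wt_ge0 _ _ _) h1) _.
have e : wt (- be) i j * wt (be / 2) i j = wt (- (be / 2)) i j.
  by apply: wt_split; field.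
rewrite -mulrA e; exact: lexx.
Qed.

(** A decay by 3/2 of the rate |b| is enough on both sides. *)
Lemma block_any_weight i j :
  2 `^ (j%:R * b) * wt (- (be + be / 2)) i j <= wt (- (be / 2)) i j * 2 `^ (i%:R * b).
Proof.
rewrite opprD wtD [leLHS]mulrA [leLHS]mulrC; apply: ler_wpM2l; first exact: wt_ge0.
rewrite /wt -two_powD; apply: two_pow_le.
suff : (j%:R - i%:R) * b <= be * (ndist i j)%:R by lra.
apply: le_trans (ler_norm _) _; rewrite normrM mulrC; apply: ler_wpM2l => //.
have [ij|ji] := leqP i j; first by rewrite ndist_le// ger0_norm// subr_ge0 ler_nat.
by rewrite ndist_ge ?(ltnW ji)// ltr0_norm ?opprB// subr_lt0 ltr_nat.
Qed.

Local Open Scope ereal_scope.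

(** The bound for the K-functional at the j-th point, to which [hardy] applies. *)
Definition wsum j f : \bar R := \sum_(0 <= i <oo) (wt (- (be / 2)) i j)%:E * summand i f.

Lemma wsum_ge0 j f : 0 <= wsum j f.
Proof. by apply: nneseries_ge0 => i _ _; rewrite mule_ge0 ?summand_ge0// lee_fin wt_ge0. Qed.

(** X is the part given to F^s: only blocks on the side on which 2^(ib) grows
    contribute. It is stated for any X that has the bounds of a part, to be used with X
    = f at j = 0 as well. *)
Lemma F_freq_part_bound (K0 : R) : (0 < K0)%R -> exists2 K : R, (0 < K)%R & forall j f X,
  tempered f -> tempered X -> (forall i, bnn i X <= K0%:E * bnn i f) ->
  (forall i, ~~ relevant_block up i j -> bnn i X = 0) ->
  (2 `^ (j%:R * b))%R%:E * FN X <= K%:E * wsum j f.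
Proof.
move=> K00; have be2 : (0 < be / 2)%R by rewrite divr_gt0// rate_gt0.
have [K1 K10 h1] := Fnorm_le_wsum hphi p1 q0 s be2.
exists (K1 * (2 `^ (2 * be) * K0))%R; first by rewrite !mulr_gt0// two_pow_gt0.
move=> j f X tf tX bX zX.
have P0 : 0 <= (2 `^ (j%:R * b))%R%:E :> \bar R by rewrite lee_fin powR_ge0.
apply: le_trans (lee_wpmul2l P0 (h1 j X tX)) _.
rewrite muleCA (EFinM K1) -muleA; apply: lee_wpmul2l; first by rewrite lee_fin ltW.
have w0 i : 0 <= (wt (be / 2) i j)%:E * bnn i X by rewrite mule_ge0 ?block_norm_ge0// lee_fin wt_ge0.
have v0 i : 0 <= (wt (- (be / 2)) i j)%:E * summand i f by rewrite mule_ge0 ?summand_ge0// lee_fin wt_ge0.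
rewrite -!nneseriesZl//; apply: lee_nneseries => [i _ _|i _]; first exact: mule_ge0.
have [rij|irr] := boolP (relevant_block up i j); last first.
  by rewrite zX// !mule0 mule_ge0// lee_fin !mulr_ge0 ?powR_ge0// ltW.
have W0 : 0 <= (wt (be / 2) i j)%:E :> \bar R by rewrite lee_fin wt_ge0.
apply: le_trans (lee_wpmul2l P0 (lee_wpmul2l W0 (bX i))) _.
rewrite /summand !muleA -!EFinM; apply: lee_wpmul2r; first exact: block_norm_ge0.
rewrite lee_fin mulrAC [leRHS](_ : _ = 2 `^ (2 * be) * (wt (- (be / 2)) i j * 2 `^ (i%:R * b)) * K0)%R; last by ring.
by rewrite [leLHS]mulrAC; apply: ler_wpM2r; [exact: ltW|exact: block_side_weight].
Qed.

(** Y is the part given to A^(s0). The change of smoothness gives the decay c in |n -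
    N_j|. Half of it pays for the crude bound of the norm, one quarter is used to sum
    over the n in a block, and the last quarter becomes by [block_decay] a decay in the
    blocks which is faster than the growth of the weights. *)
Lemma A_freq_part_bound (K0 : R) : (0 < K0)%R -> exists2 K : R, (0 < K)%R & forall j f Y,
  tempered f -> tempered Y -> (forall n, pnn n Y <= K0%:E * pnn n f) ->
  (forall n, ~~ relevant (~~ up) (block_start j) n -> pnn n Y = 0) ->
  (2 `^ (j%:R * b))%R%:E * ((tau (block_start j))%:E * AN Y) <= K%:E * wsum j f.
Proof.
move=> K00; have c0 := gap_gt0; have be0 := rate_gt0.
have c2 : (0 < c / 2)%R by rewrite divr_gt0.
have c4 : (0 < c / 4)%R by rewrite divr_gt0.
have [K1 K10 h1] := Anorm_le_wsum hphi p1 A qA0 s0 c2.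
have B0 : (0 <= be + be / 2)%R by rewrite addr_ge0// ltW// divr_gt0.
have [K3 K30 h3] := block_decay B0 c4.
have G0 := geom_const_gt0 c4.
exists (K1 * (2 `^ (2 * c) * K0 * K3 * geom_const (c / 4)))%R.
  apply: (mulr_gt0 K10); apply: (mulr_gt0 _ G0); apply: (mulr_gt0 _ K30); apply: (mulr_gt0 _ K00).
  exact: two_pow_gt0.
move=> j f Y tf tY pY zY; have [N NE] : exists N, N = block_start j by eexists.
pose G i := (wt (- (be + be / 2)) i j)%:E * bnn i f.
have G0' i : 0 <= G i by rewrite mule_ge0 ?block_norm_ge0// lee_fin wt_ge0.
have KK0 : (0 <= 2 `^ (2 * c) * K0 * K3)%R by rewrite !mulr_ge0 ?powR_ge0// ltW.
have key n : (tau N)%:E * ((wt (c / 2) n N)%:E * ((2 `^ (n%:R * s0))%R%:E * pnn n Y)) <=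
    (2 `^ (2 * c) * K0 * K3)%:E * ((wt (- (c / 4)) n N)%:E * G (block_index n)).
  have R0 : 0 <= (2 `^ (2 * c) * K0 * K3)%:E * ((wt (- (c / 4)) n N)%:E * G (block_index n)).
    apply: mule_ge0; first by rewrite lee_fin.
    by apply: mule_ge0 => //; rewrite lee_fin wt_ge0.
  have [rel|irr] := boolP (relevant (~~ up) N n); last by rewrite zY -?NE// !mule0.
  have tl : (tau N * 2 `^ (n%:R * s0) <= 2 `^ (2 * c) * wt (- c) n N * 2 `^ (n%:R * s))%R.
    have := side_weight (ltW c0) rel; have := gapE.
    case: (up) => /= gE h; rewrite /tau -two_powD.
      have -> : (N%:R * (s - s0) + n%:R * s0 = (N%:R - n%:R) * - c + n%:R * s)%R by rewrite -gE; ring.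
      by rewrite two_powD ler_wpM2r ?powR_ge0.
    have -> : (N%:R * (s - s0) + n%:R * s0 = (N%:R - n%:R) * c + n%:R * s)%R.
      have cE : (s - s0 = c)%R by have := gE; lra.
      by rewrite -cE; ring.
    by rewrite two_powD ler_wpM2r ?powR_ge0.
  have T0 : 0 <= (tau N)%:E :> \bar R by rewrite lee_fin ltW// tau_gt0.
  have W2 : 0 <= (wt (c / 2) n N)%:E :> \bar R by rewrite lee_fin wt_ge0.
  have S0 : 0 <= (2 `^ (n%:R * s0))%R%:E :> \bar R by rewrite lee_fin powR_ge0.
  apply: le_trans (lee_wpmul2l T0 (lee_wpmul2l W2 (lee_wpmul2l S0 (pY n)))) _.
  have -> : (tau N)%:E * ((wt (c / 2) n N)%:E * ((2 `^ (n%:R * s0))%R%:E * (K0%:E * pnn n f))) =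
      (tau N * 2 `^ (n%:R * s0) * wt (c / 2) n N * K0)%R%:E * pnn n f.
    by rewrite !muleA -!EFinM; congr (_%:E * _); ring.
  have bt := block_norm_term hphi p1 q0 s tf (erefl (block_index n)).
  apply: (@le_trans _ _ ((2 `^ (2 * c) * wt (- c) n N * wt (c / 2) n N * K0)%R%:E * ((2 `^ (n%:R * s))%R%:E * pnn n f))).
    rewrite muleA -EFinM; apply: lee_wpmul2r; first exact: piece_norm_ge0.
    rewrite lee_fin [leRHS](_ : _ = 2 `^ (2 * c) * wt (- c) n N * 2 `^ (n%:R * s) * (wt (c / 2) n N * K0))%R; last by ring.
    by rewrite -mulrA; apply: ler_wpM2r; [exact: mulr_ge0 (wt_ge0 _ _ _) (ltW K00)|exact: tl].
  apply: le_trans (lee_wpmul2l _ bt) _.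
    rewrite lee_fin; apply: (mulr_ge0 _ (ltW K00)); apply: (mulr_ge0 _ (wt_ge0 _ _ _)).
    exact: (mulr_ge0 (powR_ge0 _ _) (wt_ge0 _ _ _)).
  rewrite /G !muleA -!EFinM; apply: lee_wpmul2r; first exact: block_norm_ge0.
  rewrite lee_fin.
  have h2c : (- c + c / 2 = - (c / 2))%R by field.
  have h4c : (- (c / 4) + - (c / 4) = - (c / 2))%R by field.
  have wE : (wt (- c) n N * wt (c / 2) n N = wt (- (c / 4)) n N * wt (- (c / 4)) n N)%R.
    by rewrite (wt_split _ _ h2c) (wt_split _ _ h4c).
  rewrite [leLHS](_ : _ = 2 `^ (2 * c) * K0 * wt (- (c / 4)) n N * wt (- (c / 4)) n N)%R; last first.
    by rewrite -[RHS]mulrA -wE; ring.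
  rewrite [leRHS](_ : _ = 2 `^ (2 * c) * K0 * wt (- (c / 4)) n N * (K3 * wt (- (be + be / 2)) (block_index n) j))%R; last by ring.
  apply: ler_wpM2l; last by rewrite NE; exact: h3.
  exact: (mulr_ge0 (mulr_ge0 (powR_ge0 _ _) (ltW K00)) (wt_ge0 _ _ _)).
have S0 : 0 <= \sum_(0 <= i <oo) G i by apply: nneseries_ge0 => *; exact: G0'.
have T0 : 0 <= (tau N)%:E :> \bar R by rewrite lee_fin ltW// tau_gt0.
have p0 n : 0 <= (wt (c / 2) n N)%:E * ((2 `^ (n%:R * s0))%R%:E * pnn n Y).
  by rewrite !mule_ge0 ?piece_norm_ge0// lee_fin ?wt_ge0 ?powR_ge0.
have AY : (tau N)%:E * AN Y <= K1%:E * ((2 `^ (2 * c) * K0 * K3)%:E * ((geom_const (c / 4))%:E * \sum_(0 <= i <oo) G i)).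
  apply: le_trans (lee_wpmul2l T0 (h1 N Y tY)) _.
  rewrite muleCA; apply: lee_wpmul2l; first by rewrite lee_fin ltW.
  rewrite -nneseriesZl//.
  apply: (@le_trans _ _ (\sum_(0 <= n <oo) (2 `^ (2 * c) * K0 * K3)%:E * ((wt (- (c / 4)) n N)%:E * G (block_index n)))).
    by apply: lee_nneseries => [n _ _|n _]; [exact: mule_ge0|exact: key].
  rewrite nneseriesZl; last by move=> n _; rewrite mule_ge0// lee_fin wt_ge0.
  apply: lee_wpmul2l; first by rewrite lee_fin.
  case: (\sum_(0 <= i <oo) G i) S0 (fun k => nneseries_term k G0') => [S| |] // S0 GS; last first.
    by rewrite gt0_muley ?leey// lte_fin.
  apply: (@le_trans _ _ (\sum_(0 <= n <oo) S%:E * (wt (- (c / 4)) n N)%:E)).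
    apply: lee_nneseries => [n _ _|n _]; first by rewrite mule_ge0// lee_fin wt_ge0.
    by rewrite [leRHS]muleC; apply: lee_wpmul2l; [rewrite lee_fin wt_ge0|exact: GS].
  rewrite nneseriesZl; last by move=> n _; rewrite lee_fin wt_ge0.
  by rewrite muleC; apply: lee_wpmul2r => //; exact: wt_series_le.
rewrite -NE; apply: le_trans (lee_wpmul2l _ AY) _; first by rewrite lee_fin powR_ge0.
have SG : (2 `^ (j%:R * b))%R%:E * \sum_(0 <= i <oo) G i <= wsum j f.
  rewrite -nneseriesZl//; apply: lee_nneseries => [i _ _|i _].
    by rewrite mule_ge0// lee_fin powR_ge0.
  rewrite /G /summand !muleA -!EFinM; apply: lee_wpmul2r; first exact: block_norm_ge0.
  by rewrite lee_fin block_any_weight.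
have -> : (2 `^ (j%:R * b))%R%:E * (K1%:E * ((2 `^ (2 * c) * K0 * K3)%:E * ((geom_const (c / 4))%:E * \sum_(0 <= i <oo) G i))) =
   (K1 * (2 `^ (2 * c) * K0 * K3 * geom_const (c / 4)))%:E * ((2 `^ (j%:R * b))%R%:E * \sum_(0 <= i <oo) G i).
  by rewrite !muleA -!EFinM; congr (_%:E * _); ring.
apply: lee_wpmul2l SG; rewrite lee_fin; exact: mulr_ge0 (ltW K10) (mulr_ge0 KK0 (ltW G0)).
Qed.

(** The quasi-triangle inequality on the j-th block; X is estimated there by its F^s
    norm. On the block all frequencies lie on one side of N, so that passing from s0 to
    s in the pieces of Y gives geometric decay from N on, which compensates a crude
    bound of the block by single pieces. *)
Lemma decomposition_bound : exists2 K : R, (0 < K)%R & forall j N X Y, tempered X -> tempered Y ->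
  (forall n, block_index n = j -> if up then (N <= n)%N else (n <= N)%N) ->
  bnn j (fun g => X g + Y g)%R <= K%:E * (FN X + (tau N)%:E * AN Y).
Proof.
have c0 := gap_gt0; have c2 : (0 < c / 2)%R by rewrite divr_gt0.
have [K1 K10 h1] := block_norm_triangle hphi p1 q0 s.
have [K2 K20 h2] := block_norm_le_wsum hphi p1 q0 s c2.
have G0 := geom_const_gt0 c2.
exists (K1 * (1 + K2 * geom_const (c / 2)))%R; first by rewrite mulr_gt0// addr_gt0// mulr_gt0.
move=> j N X Y tX tY side.
apply: le_trans (h1 j X Y tX tY) _; rewrite EFinM -muleA; apply: lee_wpmul2l; first by rewrite lee_fin ltW.
have T0 : 0 <= (tau N)%:E * AN Y by rewrite mule_ge0 ?Anorm_ge0// lee_fin ltW// tau_gt0.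
have X0 : 0 <= FN X by exact: Fnorm_ge0.
have bY : bnn j Y <= (K2 * geom_const (c / 2))%:E * ((tau N)%:E * AN Y).
  apply: le_trans (h2 N j Y tY) _; rewrite EFinM -muleA; apply: lee_wpmul2l; first by rewrite lee_fin ltW.
  have key n : (wt (c / 2) n N)%:E * (if block_index n == j then (2 `^ (n%:R * s))%R%:E * pnn n Y else 0) <=
      (wt (- (c / 2)) n N)%:E * ((tau N)%:E * AN Y).
    case: eqP => [/side nj|_]; last by rewrite mule0 mule_ge0// lee_fin wt_ge0.
    have e : (2 `^ (n%:R * s) <= tau N * wt (- c) n N * 2 `^ (n%:R * s0))%R.
      rewrite /tau /wt -!two_powD; apply: two_pow_le.
      have := gapE; move: nj; case: (up) => nj gE.
        have sE : (s = s0 - c)%R by rewrite -gE; ring.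
        have -> : (s - s0 = - c)%R by rewrite -gE; ring.
        by rewrite ndist_ge// [X in (n%:R * X)%R]sE; lra.
      have sE : (s = s0 + c)%R by have := gE; lra.
      have -> : (s - s0 = c)%R by have := gE; lra.
      by rewrite ndist_le// [X in (n%:R * X)%R]sE; lra.
    have wE : (wt (c / 2) n N * wt (- c) n N = wt (- (c / 2)) n N)%R by apply: wt_split; field.
    rewrite -wE EFinM -muleA; apply: lee_wpmul2l; first by rewrite lee_fin wt_ge0.
    apply: (@le_trans _ _ ((tau N * wt (- c) n N)%:E * ((2 `^ (n%:R * s0))%R%:E * pnn n Y))).
      by rewrite muleA -EFinM; apply: lee_wpmul2r; [exact: piece_norm_ge0|rewrite lee_fin].
    apply: le_trans (lee_wpmul2l _ (piece_norm_le_Anorm hphi p1 A qA0 s0 n tY)) _.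
      by rewrite lee_fin; apply: mulr_ge0; [exact: ltW (tau_gt0 N)|exact: wt_ge0].
    by rewrite EFinM muleAC muleC; exact: lexx.
  apply: (@le_trans _ _ (\sum_(0 <= n <oo) (wt (- (c / 2)) n N)%:E * ((tau N)%:E * AN Y))).
    apply: lee_nneseries => [n _ _|n _]; last exact: key.
    by rewrite mule_ge0 ?lee_fin ?wt_ge0//; case: ifP => // _; rewrite mule_ge0 ?piece_norm_ge0// lee_fin powR_ge0.
  case: ((tau N)%:E * AN Y) T0 => [S| |] // S0; last by rewrite gt0_muley ?leey// lte_fin.
  under eq_eseriesr do rewrite muleC.
  rewrite nneseriesZl; last by move=> n _; rewrite lee_fin wt_ge0.
  by rewrite muleC; apply: lee_wpmul2r => //; exact: wt_series_le.
apply: le_trans (leeD (block_norm_le_Fnorm phi0 p1 q0 s j X) bY) _.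
have g0 : (0 <= K2 * geom_const (c / 2))%R by rewrite mulr_ge0// ltW.
rewrite ge0_muleDr//; apply: leeD.
  by rewrite -[leLHS]mul1e; apply: lee_wpmul2r => //; rewrite lee_fin lerDl.
by apply: lee_wpmul2r => //; rewrite lee_fin lerDr.
Qed.

Lemma freq_part_block_norm_irrelevant hi i j f : tempered f -> ~~ relevant_block hi i j -> bnn i (freq_part phi0 hi (block_start j) f) = 0.
Proof.
move=> tf irr; apply: (block_norm_freq_part_irrelevant hphi p1 q0 s tf) => n /eqP.
rewrite -in_block => /andP[h1 h2]; move: irr; rewrite /relevant_block /relevant; case: hi; rewrite -!ltnNge => h.
  exact: leq_trans h2 (block_start_le h).
have := block_start_le h; have := block_startS j; have := block_startS j.+2; rewrite !expnS; lia.
Qed.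

(** The two parts of f satisfy the hypotheses on X and Y of the two preceding bounds. *)
Lemma K_upper_bound : exists2 K : R, (0 < K)%R & forall j f, tempered f ->
  (2 `^ (j%:R * b))%R%:E * (FN (freq_part phi0 up (block_start j) f) + (tau (block_start j))%:E * AN (freq_part phi0 (~~ up) (block_start j) f))
  <= K%:E * wsum j f.
Proof.
have [K1 K10 h1] := block_norm_freq_part hphi p1 q0 s; have [K2 K20 h2] := piece_norm_freq_part hphi p1.
have [K3 K30 h3] := F_freq_part_bound K10; have [K4 K40 h4] := A_freq_part_bound K20.
exists (K3 + K4)%R; first exact: addr_gt0.
move=> j f tf; rewrite ge0_muleDr ?Fnorm_ge0 ?mule_ge0 ?Anorm_ge0 ?lee_fin ?(ltW (tau_gt0 _))//.
have p3 : 0 <= K3%:E by rewrite lee_fin ltW.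
have p4 : 0 <= K4%:E by rewrite lee_fin ltW.
rewrite (EFinD K3) (ge0_muleDl _ p3 p4); apply: leeD.
  apply: h3 => //; first exact: freq_part_tempered.
    by move=> i; exact: h1.
  by move=> i; exact: freq_part_block_norm_irrelevant.
apply: h4 => //; first exact: freq_part_tempered.
  by move=> i; exact: h2.
by move=> n; exact: piece_norm_freq_part_irrelevant.
Qed.

Lemma tau0 : tau (block_start 0) = 1%R. Proof. by rewrite /tau /block_start mul0r powRr0. Qed.

(** At j = 0 the whole of f is relevant for the larger space, so no splitting takes
    place. This shows that f lies in that space. *)
Lemma base_bound : exists2 K : R, (0 < K)%R & forall f, tempered f ->
  (if up then FN f else AN f) <= K%:E * wsum 0 f.
Proof.
have [K3 K30 h3] := F_freq_part_bound ltr01; have [K4 K40 h4] := A_freq_part_bound ltr01.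
exists (K3 + K4)%R; first exact: addr_gt0.
move=> f tf; have W0 := wsum_ge0 0 f.
case u : (up).
  apply: (@le_trans _ _ (K3%:E * wsum 0 f)); last first.
    by apply: lee_wpmul2r => //; rewrite lee_fin lerDl ltW.
  have := h3 0%N f f tf tf; rewrite mul0r powRr0 mul1e; apply.
    by move=> i; rewrite mul1e.
  by move=> i; rewrite /relevant_block u.
apply: (@le_trans _ _ (K4%:E * wsum 0 f)); last first.
  by apply: lee_wpmul2r => //; rewrite lee_fin lerDr ltW.
have := h4 0%N f f tf tf; rewrite tau0 mul0r powRr0 !mul1e; apply.
  by move=> i; rewrite mul1e.
by move=> n; rewrite /relevant u.
Qed.

End reconstruction.

(** * Norms on the unit interval with a logarithmic weight *)

Section limiting_norms.
Context {R : realType}.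
Variables (c b : R) (c0 : 0 < c) (r : \bar R) (r0 : (0 < r)%E).
Local Notation mR := (measurableTypeR R).
Local Notation lam := (@lebesgue_measure R).

(** The subdivision points t_j of the unit interval; they decrease doubly
    exponentially. *)
Definition knot (j : nat) : R := 2 `^ (- (c * (block_start j)%:R)).

Local Notation Ib j := (`[knot j.+1, knot j[%classic : set R).
Local Notation U := (`]0%R, 1%R[%classic : set R).

Lemma knot_gt0 j : 0 < knot j. Proof. exact: two_pow_gt0. Qed.

Lemma knot0 : knot 0 = 1. Proof. by rewrite /knot /block_start mulr0 oppr0 powRr0. Qed.

Lemma knot_le i j : (i <= j)%N -> knot j <= knot i.
Proof.
by move=> ij; apply: two_pow_le; rewrite lerN2 ler_pM2l// ler_nat block_start_le.
Qed.

Lemma ln_knot j : ln (knot j) = - (c * (block_start j)%:R) * ln 2.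
Proof. exact: ln_powR. Qed.

Lemma block_start_lt j : (block_start j < block_start j.+1)%N.
Proof. by rewrite -ltnS -!block_startS expnS; have := expn_gt0 2 j; lia. Qed.

Lemma knot_lt j : knot j.+1 < knot j.
Proof.
rewrite -(@ltr_ln R) ?posrE ?knot_gt0// !ln_knot ltr_pM2r ?ln_gt0 ?ltr1n//.
by rewrite ltrN2 ltr_pM2l// ltr_nat block_start_lt.
Qed.

Lemma knot_le1 j : knot j <= 1. Proof. by rewrite -knot0 knot_le. Qed.

Lemma in_Ib j t : Ib j t -> [/\ 0 < t, t < 1, knot j.+1 <= t & t < knot j].
Proof.
rewrite /= in_itv/= => /andP[h1 h2]; split=> //; first exact: lt_le_trans (knot_gt0 _) h1.
exact: lt_le_trans h2 (knot_le1 j).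
Qed.

Lemma knot_small (t : R) : 0 < t -> exists j, knot j <= t.
Proof.
move=> t0; have l2 : 0 < ln 2 :> R by rewrite ln_gt0// ltr1n.
have cl : 0 < c * ln 2 by rewrite mulr_gt0.
exists (Num.bound (- ln t / (c * ln 2))).
rewrite -ler_ln ?posrE ?knot_gt0// ln_knot mulNr lerNl mulrAC mulrC -ler_pdivrMr//.
apply: le_trans (ler_norm _) _.
apply: le_trans (ltW (archi_boundP (normr_ge0 _))) _.
rewrite ler_nat; apply: leq_trans (block_start_ge _).
by rewrite /Num.bound normr_id.
Qed.

Lemma Ib_cover : U = \bigcup_j Ib j.
Proof.
apply/seteqP; split=> [t|t [j _ /in_Ib[h1 h2 _ _]]]; last by rewrite /= in_itv/= h1 h2.
rewrite /= in_itv/= => /andP[t0 t1].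
have [j jt] := knot_small t0.
have ex : exists j, knot j <= t by exists j.
have [m mt min] := ex_minnP ex.
case: m mt min => [|m] mt min; first by move: mt; rewrite knot0 leNgt t1.
exists m => //; rewrite /= in_itv/= mt /= ltNge; apply/negP => h.
by have := min _ h; rewrite ltnn.
Qed.

Lemma Ib_triv : trivIset [set: nat] (fun j => Ib j).
Proof.
apply/trivIsetP => i j _ _; wlog ij : i j / (i < j)%N => [H|_].
  rewrite neq_ltn => /orP[h|h]; first by apply: H => //; rewrite neq_ltn h.
  by rewrite setIC; apply: H => //; rewrite neq_ltn h.
rewrite -subset0 => t [/in_Ib[_ _ h1 _] /in_Ib[_ _ _ h2]].
by have := lt_le_trans (lt_le_trans h2 (knot_le ij)) h1; rewrite ltxx.
Qed.

Lemma mIb j : measurable (Ib j : set mR). Proof. exact: measurable_itv. Qed.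

(** The power is monotone in the base, increasing or decreasing with the sign of e. *)
Lemma pow_between (a y z e : R) : 0 < a -> a <= y -> y <= z -> y `^ e <= a `^ e + z `^ e.
Proof.
move=> a0 ay yz; have y0 := lt_le_trans a0 ay; have z0 := lt_le_trans y0 yz.
have [e0|e0] := leP 0 e.
  by rewrite (@le_trans _ _ (z `^ e)) ?lerDr ?powR_ge0// ge0_ler_powR// ?nnegrE ltW.
have inv x : x `^ e = (x `^ (- e))^-1 by rewrite -powRN opprK.
rewrite (@le_trans _ _ (a `^ e)) ?lerDl ?powR_ge0// (inv y) (inv a) lef_pV2 ?posrE ?powR_gt0//.
by rewrite ge0_ler_powR// ?nnegrE ?oppr_ge0 ltW.
Qed.

Definition expo : R := b - fine (r^-1)%E.

(** On the j-th interval - ln t lies between c ln 2 (2^j - 1) and c ln 2 (2^(j+1) - 1),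
    so 1 - ln t is comparable to 2^j, for j = 0 as well. *)
Lemma log_weight : exists2 k : R, 0 < k & forall j t, Ib j t ->
  (1 - ln t) `^ expo <= k * 2 `^ (j%:R * expo) /\ 2 `^ (j%:R * expo) <= k * (1 - ln t) `^ expo.
Proof.
have l2 : 0 < ln 2 :> R by rewrite ln_gt0// ltr1n.
have cl : 0 < c * ln 2 by rewrite mulr_gt0.
(* bounds for (1 - ln t) / 2^j on the j-th interval, valid for all j *)
have [a aE] : exists a : R, a = Num.min 1 (c * ln 2) by eexists.
have [z zE] : exists z : R, z = 1 + 2 * (c * ln 2) by eexists.
have a0 : 0 < a by rewrite aE lt_min ltr01.
have [a1 acl] : a <= 1 /\ a <= c * ln 2 by rewrite aE !ge_min !lexx orbT.
have z0 : 0 < z by rewrite zE addr_gt0// mulr_gt0.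
exists (a `^ expo + z `^ expo + (a `^ (- expo) + z `^ (- expo))).
  by rewrite !addr_gt0// powR_gt0.
move=> j t /in_Ib[t0 t1 h1 h2].
have P0 : 0 < 2 ^+ j :> R by rewrite exprn_gt0.
have P1 : 1 <= 2 ^+ j :> R by rewrite exprn_ege1// ler1n.
have Pj k : 2 `^ (j%:R * k) = (2 ^+ j) `^ k :> R by rewrite powRrM powR_mulrn.
have block_startE k : (block_start k)%:R = 2 ^+ k - 1 :> R by rewrite -natrX block_startS -natr1 addrK.
have L1 : - ln t <= c * ln 2 * (2 * 2 ^+ j - 1).
  move: h1; rewrite -ler_ln ?posrE ?knot_gt0// ln_knot block_startE exprS => h1; lra.
have L2 : c * ln 2 * (2 ^+ j - 1) <= - ln t.
  by move: h2; rewrite -ltr_ln ?posrE ?knot_gt0// ln_knot block_startE => /ltW h2; lra.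
have [y yE] : exists y : R, y = (1 - ln t) / 2 ^+ j by eexists.
have mE : 1 - ln t = 2 ^+ j * y by rewrite yE mulrCA mulfV ?mulr1// gt_eqF.
have ay : a <= y.
  rewrite yE ler_pdivlMr//.
  have : a * (2 ^+ j - 1) <= c * ln 2 * (2 ^+ j - 1) by rewrite ler_wpM2r// subr_ge0.
  lra.
have yz : y <= z.
  rewrite yE ler_pdivrMr// zE; nra.
have y0 := lt_le_trans a0 ay.
have B1 := pow_between expo a0 ay yz; have B2 := pow_between (- expo) a0 ay yz.
have Q := powR_ge0 a expo; have Q2 := powR_ge0 z expo.
have Q3 := powR_ge0 a (- expo); have Q4 := powR_ge0 z (- expo).
rewrite mE powRM ?(ltW P0) ?(ltW y0)// Pj; split.
  by rewrite mulrC; apply: ler_wpM2r; [exact: powR_ge0|lra].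
have e3 : (2 ^+ j) `^ expo = y `^ (- expo) * ((2 ^+ j) `^ expo * y `^ expo).
  by rewrite mulrCA powRN mulVf ?mulr1// gt_eqF// powR_gt0.
by rewrite [leLHS]e3; apply: ler_wpM2r; [rewrite mulr_ge0 ?powR_ge0|lra].
Qed.

Local Open Scope ereal_scope.

Lemma measurable_invr_pos (D : set mR) : measurable D -> (forall t, D t -> (0 < t)%R) ->
  measurable_fun D (fun t : mR => (t^-1)%:E).
Proof.
move=> mD D0; apply/measurable_EFinP.
apply: (@eq_measurable_fun _ _ _ _ _ (fun t : mR => (t `^ (-1))%R)).
  by move=> t /set_mem /D0 t0; rewrite powR_inv1// ltW.
by apply: measurable_funTS; exact: measurable_powR.
Qed.

Lemma log_integral (x y : R) : (0 < x)%R -> (x < y)%R ->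
  \int[lam]_(t in `[x, y[) (t^-1)%:E = (ln y - ln x)%:E.
Proof.
move=> x0 xy; rewrite integral_itv_bndo_bndc; last first.
  by apply: measurable_invr_pos => // t; rewrite /= in_itv/= => /andP[h _]; exact: lt_le_trans h.
have pos t : t \in `[x, y]%R -> (0 < t)%R by rewrite in_itv/= => /andP[h _]; exact: lt_le_trans h.
rewrite (continuous_FTC2 xy (F := @ln R))//.
- apply: continuous_in_subspaceT => t /set_mem /pos t0.
  by apply: inv_continuous; rewrite gt_eqF.
- have cl t : (0 < t)%R -> {for t, continuous (@ln R)} by exact: continuous_ln.
  split.
  + move=> t; rewrite in_itv/= => /andP[h _]; have t0 := lt_trans x0 h.
    by have [] := is_derive1_ln t0.
  + exact: cvg_at_right_filter (cl x x0).
  + exact: cvg_at_left_filter (cl y (lt_trans x0 xy)).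
- move=> t; rewrite in_itv/= => /andP[h _]; have t0 := lt_trans x0 h.
  by rewrite derive1E; have [_ ->] := is_derive1_ln t0.
Qed.

Lemma Ib_log_integral j : \int[lam]_(t in Ib j) (t^-1)%:E = (c * ln 2 * 2 ^+ j)%:E.
Proof.
rewrite log_integral ?knot_gt0 ?knot_lt// !ln_knot; congr (_%:E).
have -> : ((block_start j.+1)%:R = (block_start j)%:R + 2 ^+ j :> R)%R.
  by rewrite -natrX -natrD; congr (_%:R); have := block_startS j; have := block_startS j.+1; rewrite expnS; lia.
by ring.
Qed.

Definition log_integrand (D : R -> \bar R) (t : R) : \bar R := ((1 - ln t) `^ expo)%R%:E * D t.

(** The limiting interpolation norm of a function D, which will be K(t, f) or K(t, f) /
    t. *)
Definition log_norm (D : R -> \bar R) : \bar R :=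
  if r is r'%:E then (\int[lam]_(t in U) (log_integrand D t `^ r' * (t^-1)%:E)) `^ r'^-1
  else ereal_sup [set log_integrand D t | t in U].

Definition log_block (D : R -> \bar R) (j : nat) : \bar R :=
  if r is r'%:E then (\int[lam]_(t in Ib j) (log_integrand D t `^ r' * (t^-1)%:E)) `^ r'^-1
  else ereal_sup [set log_integrand D t | t in Ib j].

Lemma log_integrand_ge0 D t : (forall t, 0 <= D t) -> 0 <= log_integrand D t.
Proof. by move=> D0; rewrite mule_ge0// lee_fin powR_ge0. Qed.

Lemma Ib_mid j : Ib j (knot j.+1).
Proof. by rewrite /= in_itv/= lexx knot_lt. Qed.

Lemma integrand_ge0 D j (r' : R) t : Ib j t -> 0 <= log_integrand D t `^ r' * (t^-1)%:E.
Proof.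
by move=> /in_Ib[t0 _ _ _]; rewrite mule_ge0 ?poweR_ge0// lee_fin invr_ge0 ltW.
Qed.

Lemma log_block_ge0 D j : (forall t, 0 <= D t) -> 0 <= log_block D j.
Proof.
move=> D0; rewrite /log_block; case: r => [r'| |]; first exact: poweR_ge0.
- apply: le_trans (log_integrand_ge0 (knot j.+1) D0) _; apply: ereal_sup_ubound; exists (knot j.+1) => //; exact: Ib_mid.
- apply: le_trans (log_integrand_ge0 (knot j.+1) D0) _; apply: ereal_sup_ubound; exists (knot j.+1) => //; exact: Ib_mid.
Qed.

Lemma measurable_log_integrand (r' : R) (D : R -> \bar R) : measurable_fun (U : set mR) D ->
  measurable_fun (U : set mR) (fun t => log_integrand D t `^ r' * (t^-1)%:E).
Proof.
move=> mD; have mU : measurable (U : set mR) by exact: measurable_itv.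
apply: emeasurable_funM; last first.
  by apply: measurable_invr_pos => // t; rewrite /= in_itv/= => /andP[].
apply: (measurableT_comp (measurable_poweR r')).
apply: emeasurable_funM mD; apply/measurable_EFinP; apply: measurable_funTS.
apply: (measurableT_comp (@measurable_powR R expo)).
by apply: measurable_funB.
Qed.

(** The intervals between consecutive knots partition the unit interval. *)
Lemma log_norm_blocks (D : R -> \bar R) : measurable_fun (U : set mR) D -> (forall t, 0 <= D t) -> log_norm D = lq r (log_block D).
Proof.
move=> mD D0; rewrite /log_norm /log_block; case: r r0 => [r'| |] // rpos; last first.
  apply/eqP; rewrite eq_le; apply/andP; split.
    apply: ge_ereal_sup => _ [t tU <-]; move: tU; rewrite Ib_cover => -[j _ tj].
    apply: (@le_trans _ _ (ereal_sup [set log_integrand D t | t in Ib j])).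
      by apply: ereal_sup_ubound; exists t.
    by apply: ereal_sup_ubound; exists j.
  apply: ge_ereal_sup => _ [j _ <-]; apply: ge_ereal_sup => _ [t tj <-].
  by apply: ereal_sup_ubound; exists t => //; rewrite Ib_cover; exists j.
rewrite lte_fin in rpos; rewrite lq_fin; congr (_ `^ _).
have mI := measurable_log_integrand r' mD; rewrite Ib_cover in mI *.
rewrite (@ge0_integral_bigcup _ _ _ lam _ _ mIb mI _ Ib_triv); last first.
  by move=> t [j _ tj]; exact: integrand_ge0 tj.
apply: eq_eseriesr => j _; rewrite poweRVK//; apply: integral_ge0 => t tj; exact: integrand_ge0 tj.
Qed.

Lemma block_constant (r' : R) (k : \bar R) j : 0 <= k ->
  \int[lam]_(t in Ib j) (k * (t^-1)%:E) = k * (c * ln 2 * 2 ^+ j)%:E.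
Proof.
move=> k0; rewrite ge0_integralZl ?Ib_log_integral//.
- apply: measurable_invr_pos; first exact: mIb.
  by move=> t /in_Ib[].
- by move=> t /in_Ib[t0 _ _ _]; rewrite lee_fin invr_ge0 ltW.
Qed.

(** The logarithmic length of the interval contributes 2^(j/r), which restores the
    exponent b. *)
Lemma rexp_split (r' : R) j : (0 < r')%R -> r = r'%:E ->
  ((c * ln 2 * 2 ^+ j) `^ r'^-1 * 2 `^ (j%:R * expo) = (c * ln 2) `^ r'^-1 * 2 `^ (j%:R * b))%R.
Proof.
move=> rp rE; have l2 : (0 <= c * ln 2)%R by rewrite mulr_ge0// ?(ltW c0)// ln_ge0// ler1n.
rewrite powRM ?exprn_ge0// -mulrA; congr (_ * _)%R.
rewrite -powR_mulrn// -powRrM -two_powD /expo rE fine_invr; congr (_ `^ _)%R; ring.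
Qed.

(** On a single interval the weight is comparable to a constant, so bounds for D become
    bounds for the norm. *)
Lemma log_block_bounds : exists2 k : R, (0 < k)%R & forall D j, (forall t, 0 <= D t) ->
  (forall M, 0 <= M -> (forall t, Ib j t -> D t <= M) -> log_block D j <= k%:E * ((2 `^ (j%:R * b))%R%:E * M)) /\
  (forall m, 0 <= m -> (forall t, Ib j t -> m <= D t) -> (2 `^ (j%:R * b))%R%:E * m <= k%:E * log_block D j).
Proof.
have [w w0 hw] := log_weight.
have l2 : (0 < c * ln 2)%R by rewrite mulr_gt0// ln_gt0// ltr1n.
have W0 : 0 <= w%:E by rewrite lee_fin ltW.
have E0 j : 0 <= (2 `^ (j%:R * expo))%R%:E :> \bar R by rewrite lee_fin powR_ge0.
have up D j M t : (forall t, 0 <= D t) -> D t <= M -> Ib j t -> log_integrand D t <= (w * 2 `^ (j%:R * expo))%R%:E * M.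
  move=> D0 DM tj; have [h _] := hw j t tj.
  apply: (@le_trans _ _ ((w * 2 `^ (j%:R * expo))%R%:E * D t)).
    by apply: lee_wpmul2r => //; rewrite lee_fin.
  by apply: lee_wpmul2l => //; rewrite lee_fin mulr_ge0 ?powR_ge0// ltW.
have lo D j m t : 0 <= m -> m <= D t -> Ib j t -> (w^-1 * 2 `^ (j%:R * expo))%R%:E * m <= log_integrand D t.
  move=> m0 mD tj; have [_ h] := hw j t tj.
  apply: (@le_trans _ _ ((w^-1 * 2 `^ (j%:R * expo))%R%:E * D t)).
    by apply: lee_wpmul2l => //; rewrite lee_fin mulr_ge0 ?powR_ge0// invr_ge0 ltW.
  apply: lee_wpmul2r; first exact: le_trans mD.
  by rewrite lee_fin ler_pdivrMl.
case rE : r => [r'| |]; last by move: r0; rewrite rE.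
  have rp : (0 < r')%R by move: r0; rewrite rE lte_fin.
  have rV : (0 <= r'^-1)%R by rewrite invr_ge0 ltW.
  have [a aE] : exists a : R, a = ((c * ln 2) `^ r'^-1)%R by eexists.
  have a0 : (0 < a)%R by rewrite aE powR_gt0.
  have cst (k : R) (M : \bar R) j : (0 <= k)%R -> 0 <= M ->
      (\int[lam]_(t in Ib j) (((k * 2 `^ (j%:R * expo))%R%:E * M) `^ r' * (t^-1)%:E)) `^ r'^-1 =
      (k * a)%:E * ((2 `^ (j%:R * b))%R%:E * M).
    move=> k0 M0; have P0 : 0 <= (k * 2 `^ (j%:R * expo))%R%:E * M.
      by rewrite mule_ge0// lee_fin mulr_ge0 ?powR_ge0.
    have L0 : 0 <= (c * ln 2 * 2 ^+ j)%:E by rewrite lee_fin mulr_ge0 ?exprn_ge0// ltW.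
    rewrite (block_constant r' _ (poweR_ge0 _ _)) (poweRM _ (poweR_ge0 _ _) L0) (poweRK rp P0).
    rewrite poweR_EFin muleAC -EFinM [RHS]muleA -EFinM; congr (_%:E * _).
    by rewrite aE -[RHS]mulrA -(rexp_split j rp rE); ring.
  exists (w * a + w / a)%R; first by rewrite addr_gt0// ?divr_gt0// mulr_gt0.
  move=> D j D0; split=> [M M0 DM|m m0 mD]; rewrite /log_block rE.
    apply: (@le_trans _ _ ((w * a)%:E * ((2 `^ (j%:R * b))%R%:E * M))); last first.
      apply: lee_wpmul2r; first by rewrite mule_ge0// lee_fin powR_ge0.
      by rewrite lee_fin lerDl divr_ge0// ltW.
    rewrite -cst// ?(ltW w0)//; apply: poweR_mono => //.
      by apply: integral_ge0 => t tj; exact: integrand_ge0 tj.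
    apply: ge0_integral_mono => t tj; first exact: integrand_ge0 tj.
    have [t0 _ _ _] := in_Ib tj; apply: lee_wpmul2r; first by rewrite lee_fin invr_ge0 ltW.
    apply: poweR_mono (ltW rp) _ _; first exact: log_integrand_ge0.
    by apply: up => //; exact: DM.
  apply: (@le_trans _ _ ((w / a)%:E * ((w^-1 * a)%:E * ((2 `^ (j%:R * b))%R%:E * m)))).
    rewrite muleA -EFinM (_ : (w / a * (w^-1 * a))%R = 1%R) ?mul1e ?lexx//.
    by rewrite mulrACA mulfV ?gt_eqF// mulVf ?gt_eqF// mulr1.
  have wa0 : 0 <= (w / a)%:E by rewrite lee_fin divr_ge0// ltW.
  have L0 := log_block_ge0 j D0; rewrite /log_block rE in L0.
  apply: (@le_trans _ _ ((w / a)%:E * (\int[lam]_(t in Ib j) (log_integrand D t `^ r' * (t^-1)%:E)) `^ r'^-1)).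
    apply: lee_wpmul2l => //; rewrite -cst ?invr_ge0 ?(ltW w0)//; apply: poweR_mono => //.
      apply: integral_ge0 => t /in_Ib[t0 _ _ _]; rewrite mule_ge0 ?poweR_ge0// lee_fin invr_ge0 ltW//.
    apply: ge0_integral_mono => t tj; have [t0 _ _ _] := in_Ib tj.
      by rewrite mule_ge0 ?poweR_ge0// lee_fin invr_ge0 ltW.
    apply: lee_wpmul2r; first by rewrite lee_fin invr_ge0 ltW.
    apply: poweR_mono (ltW rp) _ _.
      by rewrite mule_ge0// lee_fin mulr_ge0 ?powR_ge0// invr_ge0 ltW.
    by apply: lo => //; exact: mD.
  by apply: lee_wpmul2r => //; rewrite lee_fin lerDr mulr_ge0// ltW.
have eb : expo = b by rewrite /expo rE /= subr0.
exists (w + w)%R; first by rewrite addr_gt0.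
move=> D j D0; split=> [M M0 DM|m m0 mD]; rewrite /log_block rE.
  apply: ge_ereal_sup => _ [t tj <-].
  apply: le_trans (up D j M t D0 (DM t tj) tj) _; rewrite eb EFinM -muleA.
  apply: lee_wpmul2r; first by rewrite mule_ge0// lee_fin powR_ge0.
  by rewrite lee_fin lerDl ltW.
apply: (@le_trans _ _ (w%:E * log_integrand D (knot j.+1))).
  apply: (@le_trans _ _ (w%:E * ((w^-1 * 2 `^ (j%:R * expo))%R%:E * m))).
    by rewrite muleA -EFinM mulrA mulfV ?gt_eqF// mul1r eb lexx.
  by apply: lee_wpmul2l => //; apply: lo => //; [apply: mD; exact: Ib_mid|exact: Ib_mid].
apply: (@le_trans _ _ ((w + w)%:E * log_integrand D (knot j.+1))).
  by apply: lee_wpmul2r; [exact: log_integrand_ge0|rewrite lee_fin lerDl ltW].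
apply: lee_wpmul2l; first by rewrite lee_fin addr_ge0// ltW.
by apply: ereal_sup_ubound; exists (knot j.+1) => //; exact: Ib_mid.
Qed.

End limiting_norms.

(** * The K-functional and the interpolation theorem *)

Section ereal_scaling.
Context {R : realType}.
Local Open Scope ereal_scope.

Lemma EFinK (a : R) (x : \bar R) : (0 < a)%R -> (a^-1)%:E * (a%:E * x) = x.
Proof. by move=> a0; rewrite muleA -EFinM mulVf ?mul1e// gt_eqF. Qed.

Lemma EFinVK (a : R) (x : \bar R) : (0 < a)%R -> a%:E * ((a^-1)%:E * x) = x.
Proof. by move=> a0; rewrite muleA -EFinM mulfV ?mul1e// gt_eqF. Qed.

End ereal_scaling.

Section K_functional.
Context {R : realType} {d : nat}.
Variables (A0 A1 : @qspace R d).
Hypotheses (n0 : forall f, (0 <= qnorm A0 f)%E) (n1 : forall f, (0 <= qnorm A1 f)%E).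
Local Notation mR := (measurableTypeR R).
Local Notation K := (Kfunctional A0 A1).
Local Open Scope ereal_scope.

Lemma K_ge0 t f : (0 <= t)%R -> 0 <= K t f.
Proof.
move=> t0; apply: le_ereal_inf_tmp => _ [f0 [f1 [_ _ _ ->]]].
by rewrite adde_ge0// mule_ge0// lee_fin.
Qed.

Lemma K_le t f f0 f1 : carrier A0 f0 -> carrier A1 f1 -> f = (fun g => f0 g + f1 g)%R ->
  K t f <= qnorm A0 f0 + t%:E * qnorm A1 f1.
Proof. by move=> c0 c1 e; apply: ereal_inf_lbound; exists f0, f1. Qed.

Lemma K_mono t t' f : (t <= t')%R -> K t f <= K t' f.
Proof.
move=> tt'; apply: le_ereal_inf_tmp => _ [f0 [f1 [c0 c1 e ->]]].
apply: le_trans (K_le t c0 c1 e) _; apply: leeD => //.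
by apply: lee_wpmul2r => //; rewrite lee_fin.
Qed.

(** K(t, f) / t is nonincreasing: divide the infimum by t. *)
Lemma K_scaling t t' f : (0 < t)%R -> (t <= t')%R -> (t'^-1)%:E * K t' f <= (t^-1)%:E * K t f.
Proof.
move=> t0 tt'; have t'0 := lt_le_trans t0 tt'.
rewrite -[leLHS](EFinK _ t0); apply: lee_wpmul2l.
  by rewrite lee_fin invr_ge0 ltW.
apply: le_ereal_inf_tmp => _ [f0 [f1 [c0 c1 e ->]]].
rewrite muleA -EFinM; have q0 : (0 <= t / t')%R by rewrite divr_ge0// ltW.
apply: le_trans (lee_wpmul2l _ (K_le t' c0 c1 e)) _; first by rewrite lee_fin.
rewrite ge0_muleDr ?mule_ge0 ?lee_fin ?(ltW t'0)//; apply: leeD.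
  by rewrite -[leRHS]mul1e; apply: lee_wpmul2r => //; rewrite lee_fin ler_pdivrMr// mul1r.
by rewrite muleA -EFinM divfK ?gt_eqF.
Qed.

(** The preimages of half-lines under a monotone function are intervals. *)
Lemma monotone_measurable (g : R -> \bar R) :
  (forall x y, (0 < x)%R -> (x <= y)%R -> (y < 1)%R -> g x <= g y) ->
  measurable_fun (`]0%R, 1%R[%classic : set mR) g.
Proof.
move=> gm mD; apply: (measurability _ (ErealGenOInfty.measurableE R)) => //.
move=> _ [_ [x ->] <-]; apply: is_interval_measurable => y z /=.
rewrite !in_itv/= !andbT => -[/andP[y0 y1] gy] [/andP[z0 z1] gz] w /andP[yw wz]; split.
  by rewrite in_itv/= (lt_le_trans y0 yw) (le_lt_trans wz z1).
rewrite in_itv/= andbT; apply: lt_le_trans gy _; apply: gm => //; exact: le_lt_trans wz z1.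
Qed.

Variables (theta : R) (f : @dist R d).

(** K(t, f) for theta = 0 and K(t, f) / t for theta = 1, extended by 0 to make it
    nonnegative on the whole line. *)
Definition normalized_K (t : R) : \bar R :=
  if (0 < t)%R then (t `^ (- theta))%R%:E * K t f else 0.

Lemma normalized_K_ge0 t : 0 <= normalized_K t.
Proof.
rewrite /normalized_K; case: ifP => // t0; apply: mule_ge0; first by rewrite lee_fin powR_ge0.
by apply: K_ge0; exact: ltW.
Qed.

Lemma measurable_normalized_K : measurable_fun (`]0%R, 1%R[%classic : set mR) normalized_K.
Proof.
apply: (@eq_measurable_fun _ _ _ _ _ (fun t => (t `^ (- theta))%R%:E * K t f)).
  by move=> t /set_mem; rewrite /= in_itv/= /normalized_K => /andP[-> _].
apply: emeasurable_funM; first by apply/measurable_EFinP; apply: measurable_funTS; exact: measurable_powR.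
by apply: monotone_measurable => x y _ xy _; exact: K_mono.
Qed.

(** The general logarithmic norm is the one of limiting interpolation, with the power of
    t included in the function. *)
Lemma limiting_normE (b : R) (r : \bar R) :
  limiting_norm theta (b - fine (r^-1)) r A0 A1 f = log_norm b r normalized_K.
Proof.
have e t : (`]0%R, 1%R[%classic : set R) t ->
    limiting_integrand theta (b - fine (r^-1)) A0 A1 f t = log_integrand b r normalized_K t.
  rewrite /= in_itv/= => /andP[t0 _].
  by rewrite /limiting_integrand /log_integrand /normalized_K t0 /expo EFinM muleA [X in X * _]muleC.
rewrite /limiting_norm /log_norm; case: r e => [r'| |] e.
- by congr (_ `^ _); apply: eq_integral => t /set_mem tU; rewrite e.
- by congr ereal_sup; apply/seteqP; split=> _ [t tU <-]; exists t => //; rewrite e.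
- by congr ereal_sup; apply/seteqP; split=> _ [t tU <-]; exists t => //; rewrite e.
Qed.

End K_functional.

Section comparison.
Context {R : realType} {d : nat}.
Local Notation E := 'rV[R]_d.
Variables (phi0 : E -> R[i]) (hphi : resolution_generator phi0) (p : R) (p1 : 1 < p).
Variables (A : scale) (q qA r : \bar R) (q0 : (0 < q)%E) (qA0 : (0 < qA)%E) (r0 : (0 < r)%E) (s s0 b : R).
Hypotheses (ss0 : s != s0) (b0 : b != 0) (updown : (s < s0) = (0 < b)).

Local Notation up := (0 < b).
Local Notation c := (`|s0 - s|).
Local Notation be := (`|b|).
Local Notation FS := (Fspace phi0 s p%:E q).
Local Notation AS := (Aspace A phi0 s0 p%:E qA).
Local Notation FN := (Fnorm phi0 p q s).
Local Notation AN := (Anorm phi0 p A qA s0).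
Local Notation X0 := (if up then FS else AS).
Local Notation X1 := (if up then AS else FS).
Local Notation theta := (if up then 0 else 1 : R).
Local Notation summ := (summand phi0 p q s b).
Local Notation ws := (wsum phi0 p q s b).
Local Notation tauN := (tau s s0).
Local Notation D f := (normalized_K X0 X1 theta f).
Local Notation knt := (knot c).

Local Open Scope ereal_scope.

Let c0 : (0 < c)%R. Proof. exact: gap_gt0. Qed.

Lemma couple_ge0 f : 0 <= qnorm X0 f.
Proof. by case: (up); [exact: Fnorm_ge0|exact: Anorm_ge0]. Qed.

Lemma couple_ge1 f : 0 <= qnorm X1 f.
Proof. by case: (up); [exact: Anorm_ge0|exact: Fnorm_ge0]. Qed.

Lemma D_ge0 f t : 0 <= D f t.
Proof. by apply: normalized_K_ge0; [exact: couple_ge0|exact: couple_ge1]. Qed.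

Lemma tau_knot j : tauN (block_start j) = (if up then knt j else (knt j)^-1)%R.
Proof.
have := gapE updown; rewrite /tau /knot; case: (up) => gE.
  by congr (_ `^ _)%R; rewrite -gE; ring.
rewrite -powRN opprK; congr (_ `^ _)%R.
have cE : (s - s0 = c)%R by lra.
by rewrite -cE; ring.
Qed.

Lemma freq_part_split hi N f : f = (fun g => freq_part phi0 hi N f g + freq_part phi0 (~~ hi) N f g)%R.
Proof.
rewrite {1}(low_part_high_part phi0 N f); apply/funext => g; rewrite /freq_part; case: hi => //=.
exact: addrC.
Qed.

(** Use the splitting of f at the start of the j-th block as a competitor in the
    K-functional. *)
Lemma D_knot_le j f : tempered f ->
  D f (knt j) <= FN (freq_part phi0 up (block_start j) f) + (tauN (block_start j))%:E * AN (freq_part phi0 (~~ up) (block_start j) f).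
Proof.
move=> tf; have t0 := knot_gt0 c j.
have [tX tY] : tempered (freq_part phi0 up (block_start j) f) /\ tempered (freq_part phi0 (~~ up) (block_start j) f).
  by split; exact: freq_part_tempered.
have [x xE] : exists x, x = FN (freq_part phi0 up (block_start j) f) by eexists.
have [y yE] : exists y, y = AN (freq_part phi0 (~~ up) (block_start j) f) by eexists.
have T0 : (0 < tauN (block_start j))%R := tau_gt0 s s0 (block_start j).
have x0 : 0 <= x by rewrite xE; exact: Fnorm_ge0.
have y0 : 0 <= y by rewrite yE; exact: Anorm_ge0.
rewrite -xE -yE.
have [xfin|] := ltP x +oo; last by rewrite leye_eq => /eqP ->; rewrite addye ?leey// -ltNye (lt_le_trans ltNy0)// mule_ge0// lee_fin ltW.
have [yfin|] := ltP y +oo; last first.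
  by rewrite leye_eq => /eqP ->; rewrite gt0_muley ?lte_fin// addey ?leey// -ltNye (lt_le_trans ltNy0).
have cX : carrier FS (freq_part phi0 up (block_start j) f) by split=> //; rewrite -[X in X < _]xE.
have cY : carrier AS (freq_part phi0 (~~ up) (block_start j) f).
  by move: tY yE yfin; rewrite /Anorm; case: A => tY yE yfin; split=> //; rewrite -[X in X < _]yE.
have e := freq_part_split up (block_start j) f.
rewrite /normalized_K t0 tau_knot; move: cX cY e xE yE; case: (up) => /= cX cY e xE yE.
  rewrite oppr0 powRr0 mul1e xE yE; exact: K_le.
rewrite powR_inv1 ?(ltW t0)//.
have e' : f = (fun g => freq_part phi0 true (block_start j) f g + freq_part phi0 false (block_start j) f g)%R by exact: freq_part_split.
apply: le_trans (lee_wpmul2l _ (@K_le _ _ AS FS (knt j) f _ _ cY cX e')) _; first by rewrite lee_fin invr_ge0 ltW.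
have V0 : 0 <= qnorm FS (freq_part phi0 false (block_start j) f) by exact: Fnorm_ge0.
rewrite ge0_muleDr -?[qnorm AS _]/(AN _) -?yE ?mule_ge0 ?lee_fin ?(ltW t0)//.
by rewrite muleA -EFinM mulVf ?gt_eqF// mul1e addeC -[qnorm FS _]/(FN _) -xE.
Qed.

(** K(t, f) is monotone and K(t, f) / t is antitone, so one of the two ends of the
    interval bounds the values inside. *)
Lemma D_Ib_le f j t : (`[knt j.+1, knt j[%classic : set R) t -> D f t <= D f (knt j) + D f (knt j.+1).
Proof.
move=> tj; have [t0 t1 h1 h2] := in_Ib c0 tj.
have k0 := knot_gt0 c j; have k1 := knot_gt0 c j.+1.
have := D_ge0 f (knt j); have := D_ge0 f (knt j.+1).
rewrite /normalized_K t0 k0 k1; case: (up) => /= p0 p1'.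
  apply: le_trans (leeDl _ p0); rewrite oppr0 !powRr0 !mul1e.
  by apply: K_mono (ltW h2); exact: Anorm_ge0.
apply: le_trans (leeDr _ p1'); rewrite (powR_inv1 (ltW t0)) (powR_inv1 (ltW k1)).
by apply: K_scaling => //; [exact: Anorm_ge0|exact: Fnorm_ge0].
Qed.

(** The distances of i to j and to j + 1 differ by at most one. *)
Lemma wsum_shift j f : ws j.+1 f <= (2 `^ (be / 2))%R%:E * ws j f.
Proof.
have p0 i k : 0 <= (wt (- (be / 2)) i k)%:E * summ i f by rewrite mule_ge0 ?summand_ge0// lee_fin wt_ge0.
rewrite /wsum -nneseriesZl//; apply: lee_nneseries => [i _ _|i _]; first exact: p0.
rewrite [leRHS]muleA -EFinM; apply: lee_wpmul2r; first exact: summand_ge0.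
rewrite lee_fin /wt -two_powD; apply: two_pow_le.
have h : (ndist i j <= (ndist i j.+1).+1)%N by rewrite /ndist; lia.
have : ((ndist i j)%:R <= (ndist i j.+1).+1%:R :> R)%R by rewrite ler_nat.
have be0 : (0 <= be / 2)%R by rewrite divr_ge0.
by rewrite -natr1 => h'; have := ler_wpM2l be0 h'; lra.
Qed.

(** The bounds of [D_knot_le] and [K_upper_bound] at the knots are spread over the
    intervals by monotonicity and summed by [hardy]. *)
Lemma log_norm_le_summand : exists2 C : R, (0 < C)%R & forall f, tempered f ->
  log_norm b r (D f) <= C%:E * lq r (summ^~ f).
Proof.
have [K1 K10 h1] := K_upper_bound hphi p1 A q0 qA0 ss0 b0 updown.
have [k k0 hk] := log_block_bounds b c0 r0.
have be2 : (0 < be / 2)%R by rewrite divr_gt0// rate_gt0.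
have [C C0 hC] := hardy r0 be2.
have [K2 K2E] : exists K2 : R, K2 = (k * (K1 + 2 `^ (- b) * (K1 * 2 `^ (be / 2))))%R by eexists.
have b2 : (0 < 2 `^ (- b) :> R)%R by exact: two_pow_gt0.
have b3 : (0 < 2 `^ (be / 2) :> R)%R by exact: two_pow_gt0.
have K20 : (0 < K2)%R by rewrite K2E mulr_gt0// addr_gt0// mulr_gt0// mulr_gt0.
exists (C * K2)%R; first exact: mulr_gt0.
move=> f tf; rewrite (log_norm_blocks b c0 r0 _ (D_ge0 f)); last first.
  by apply: measurable_normalized_K => g; first [exact: couple_ge0|exact: couple_ge1].
have s0' i : 0 <= summ i f by exact: summand_ge0.
have upk j : (2 `^ (j%:R * b))%R%:E * D f (knt j) <= K1%:E * ws j f.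
  apply: le_trans (h1 j f tf); apply: lee_wpmul2l; first by rewrite lee_fin powR_ge0.
  exact: D_knot_le.
have lb j : log_block c b r (D f) j <= K2%:E * ws j f.
  have [hM _] := hk (D f) j (D_ge0 f).
  apply: le_trans (hM _ (adde_ge0 (D_ge0 f _) (D_ge0 f _)) (fun t tj => D_Ib_le f tj)) _.
  rewrite K2E EFinM -muleA; apply: lee_wpmul2l; first by rewrite lee_fin ltW.
  have W0 : 0 <= ws j f by exact: wsum_ge0.
  rewrite ge0_muleDr ?D_ge0// (EFinD K1) ge0_muleDl ?lee_fin ?(ltW K10)//; last first.
    by rewrite mulr_ge0 ?ltW// mulr_gt0.
  apply: leeD; first exact: upk.
  have -> : (2 `^ (j%:R * b) = 2 `^ (- b) * 2 `^ (j.+1%:R * b) :> R)%R.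
    by rewrite -two_powD; congr (_ `^ _)%R; rewrite -natr1; ring.
  rewrite !EFinM -!muleA; apply: lee_wpmul2l; first by rewrite lee_fin ltW.
  apply: le_trans (upk j.+1) _; apply: lee_wpmul2l; first by rewrite lee_fin ltW.
  exact: wsum_shift.
have l0 j : 0 <= log_block c b r (D f) j by apply: log_block_ge0 => //; exact: D_ge0.
have v0 i : 0 <= K2%:E * summ i f by rewrite mule_ge0// lee_fin ltW.
apply: le_trans (hC _ (fun i => K2%:E * summ i f) v0 l0 _) _.
  move=> j; apply: le_trans (lb j) _.
  rewrite /wsum -nneseriesZl; last by move=> i _; rewrite mule_ge0// lee_fin wt_ge0.
  apply: lee_nneseries => [i _ _|i _]; last by rewrite muleCA.
  by apply: mule_ge0; [rewrite lee_fin ltW|apply: mule_ge0; [rewrite lee_fin; exact: wt_ge0|exact: s0']].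
rewrite (EFinM C) -muleA; apply: lee_wpmul2l; first by rewrite lee_fin ltW.
by apply: lqZ_le => //; exact: ltW.
Qed.

(** Membership in the larger space is part of the definition of the interpolation
    space. *)
Lemma base_finite f : tempered f -> lq r (summ^~ f) < +oo -> qnorm X0 f < +oo.
Proof.
move=> tf fin.
have [K1 K10 h1] := base_bound hphi p1 A q0 qA0 ss0 b0 updown.
have be2 : (0 < be / 2)%R by rewrite divr_gt0// rate_gt0.
have [C C0 hC] := hardy r0 be2.
have h := hC (ws^~ f) (summ^~ f) (fun i => summand_ge0 _ _ _ _ _ _ _) (fun j => wsum_ge0 _ _ _ _ _ _ _) (fun j => lexx _).
have W : ws 0 f < +oo.
  apply: le_lt_trans (le_trans (lq_term 0 r0 (fun j => wsum_ge0 phi0 p q s b j f)) h) _.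
  by rewrite lte_mul_pinfty// lee_fin ltW.
have := h1 f tf; rewrite -[FN f]/(qnorm FS f) -[AN f]/(qnorm AS f) => h2.
have -> : qnorm X0 f = if up then qnorm FS f else qnorm AS f by case: (up).
by apply: le_lt_trans h2 _; rewrite lte_mul_pinfty ?wsum_ge0// lee_fin ltW.
Qed.

(** The interval of t at which the i-th block is recovered. A decomposition at t bounds
    the block only if t lies on the correct side of it: t at least t_i for b > 0, and t
    below t_(i+1) for b < 0. *)
Definition recovery_index (i : nat) : nat := if up then i.-1 else i.+1.

Lemma recovery_index_dist i : (ndist (recovery_index i) i <= 1)%N.
Proof. by rewrite /recovery_index /ndist; case: (up); clear -i; lia. Qed.

(** Every decomposition of f bounds the block by [decomposition_bound], taken at the
    start of the block if b > 0 and at its end if b < 0. The factor 1 / t_1 accounts for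
    the block 0, which has no predecessor. *)
Lemma block_norm_le_D : exists2 C : R, (0 < C)%R & forall f i t, (`[knt (recovery_index i).+1, knt (recovery_index i)[%classic : set R) t ->
  block_norm phi0 p q s i f <= C%:E * D f t.
Proof.
have [K K0 hK] := decomposition_bound hphi p1 A q0 qA0 ss0 updown.
have t10 := knot_gt0 c 1; have t11 : (knt 1 <= 1)%R := knot_le1 c0 1.
exists (K / knt 1)%R; first by rewrite divr_gt0.
move=> f i t tj; have [t0 t1 l1 l2] := in_Ib c0 tj.
have KV : (0 < K / knt 1)%R by rewrite divr_gt0.
have KVV : 0 <= ((K / knt 1)^-1)%:E by rewrite lee_fin invr_ge0 ltW.
rewrite -[leLHS](EFinVK _ KV); apply: lee_wpmul2l; first by rewrite lee_fin ltW.
rewrite /normalized_K t0; have := updown; move: l1 l2 hK; rewrite /recovery_index.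
have tk j := tau_knot j; move: tk; case u : (up) => /= tk l1 l2 hK su.
  rewrite oppr0 powRr0 mul1e; apply: le_ereal_inf_tmp => _ [f0 [f1 [cF cA -> ->]]].
  have tF : tempered f0 by case: cF.
  have tA : tempered f1 by move: cA; case: (A) => -[].
  have side n : block_index n = i -> (block_start i <= n)%N by move/eqP; rewrite -in_block => /andP[].
  have kt : (knt i <= t / knt 1)%R.
    rewrite ler_pdivlMr//; case: (i) l1 => [|m] /= l1; first by rewrite knot0 mul1r.
    by rewrite (le_trans _ l1)// ler_piMr// ltW// knot_gt0.
  have F0 : 0 <= qnorm FS f0 by exact: Fnorm_ge0.
  have A0' : 0 <= qnorm AS f1 by exact: Anorm_ge0.
  apply: le_trans (lee_wpmul2l KVV (hK i (block_start i) f0 f1 tF tA side)) _.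
  apply: (@le_trans _ _ (((K / knt 1)^-1)%:E * (K / knt 1)%:E * (qnorm FS f0 + t%:E * qnorm AS f1))); last first.
    by rewrite -EFinM mulVf ?gt_eqF// mul1e.
  rewrite -muleA; apply: lee_wpmul2l => //; rewrite EFinM -muleA; apply: lee_wpmul2l; first by rewrite lee_fin ltW.
  rewrite ge0_muleDr ?mule_ge0 ?lee_fin ?(ltW t0)//; apply: leeD.
    by rewrite -[leLHS]mul1e; apply: lee_wpmul2r => //; rewrite lee_fin invf_ge1.
  by rewrite muleA -EFinM; apply: lee_wpmul2r => //; rewrite lee_fin tk mulrC.
rewrite powR_inv1 ?(ltW t0)//.
have tV : 0 <= (t^-1)%:E by rewrite lee_fin invr_ge0 ltW.
rewrite -[leLHS](EFinK _ t0); apply: lee_wpmul2l => //.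
apply: le_ereal_inf_tmp => _ [f0 [f1 [cA cF -> ->]]].
have tF : tempered f1 by case: cF.
have tA : tempered f0 by move: cA; case: (A) => -[].
have side n : block_index n = i -> (n <= block_start i.+1)%N by move/eqP; rewrite -in_block => /andP[_ /ltnW].
have F0 : 0 <= qnorm FS f1 by exact: Fnorm_ge0.
have A0' : 0 <= qnorm AS f0 by exact: Anorm_ge0.
have tE : 0 <= t%:E by rewrite lee_fin ltW.
have -> : (fun g => f0 g + f1 g)%R = (fun g => f1 g + f0 g)%R by apply/funext => g; exact: addrC.
apply: le_trans (lee_wpmul2l tE (lee_wpmul2l KVV (hK i (block_start i.+1) f1 f0 tF tA side))) _.
rewrite tk.
have step : FN f1 + ((knt i.+1)^-1)%:E * AN f0 <= (t^-1)%:E * (qnorm AS f0 + t%:E * qnorm FS f1).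
  rewrite ge0_muleDr ?mule_ge0// addeC; apply: leeD.
    by apply: lee_wpmul2r => //; rewrite lee_fin lef_pV2 ?posrE ?knot_gt0// ltW.
  by rewrite muleA -EFinM mulVf ?gt_eqF// mul1e.
have K0' : 0 <= K%:E by rewrite lee_fin ltW.
apply: le_trans (lee_wpmul2l tE (lee_wpmul2l KVV (lee_wpmul2l K0' step))) _.
rewrite !muleA -!EFinM -[leRHS]mul1e; apply: lee_wpmul2r.
  by rewrite adde_ge0// mule_ge0.
rewrite lee_fin; apply: le_trans t11; rewrite le_eqVlt; apply/orP; left; apply/eqP.
have tn : t != 0%R by rewrite gt_eqF.
have kn : knt 1 != 0%R by rewrite gt_eqF.
have Kn : K != 0%R by rewrite gt_eqF.
by field; rewrite tn kn Kn.
Qed.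

(** A shift of the index by at most one is dominated by a kernel with geometric decay,
    so that [hardy] also covers this comparison. *)
Lemma summand_le_log_norm : exists2 C : R, (0 < C)%R & forall f, tempered f ->
  lq r (summ^~ f) <= C%:E * log_norm b r (D f).
Proof.
have [K1 K10 h1] := block_norm_le_D; have [k k0 hk] := log_block_bounds b c0 r0.
have [C C0 hC] := hardy r0 (ltr01 : (0 < 1 :> R)%R).
have [K2 K2E] : exists K2 : R, K2 = (2 `^ be * (K1 * k * 2))%R by eexists.
have b2 : (0 < 2 `^ be :> R)%R by exact: two_pow_gt0.
have K20 : (0 < K2)%R by rewrite K2E !mulr_gt0.
exists (C * K2)%R; first exact: mulr_gt0.
move=> f tf; rewrite (log_norm_blocks b c0 r0 _ (D_ge0 f)); last first.
  by apply: measurable_normalized_K => g; first [exact: couple_ge0|exact: couple_ge1].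
have l0 j : 0 <= log_block c b r (D f) j by apply: log_block_ge0 => //; exact: D_ge0.
have v0 i : 0 <= K2%:E * log_block c b r (D f) i by rewrite mule_ge0// lee_fin ltW.
have key i : summ i f <= K2%:E * ((wt (- 1) (recovery_index i) i)%:E * log_block c b r (D f) (recovery_index i)).
  have [_ hm] := hk (D f) (recovery_index i) (D_ge0 f).
  have m0 : 0 <= (K1^-1)%:E * block_norm phi0 p q s i f by rewrite mule_ge0 ?block_norm_ge0// lee_fin invr_ge0 ltW.
  have {}hm : (2 `^ ((recovery_index i)%:R * b))%R%:E * ((K1^-1)%:E * block_norm phi0 p q s i f) <= k%:E * log_block c b r (D f) (recovery_index i).
    apply: (hm _ m0) => t tj; rewrite -[leRHS](EFinK _ K10).
    by apply: lee_wpmul2l; [rewrite lee_fin invr_ge0 ltW|exact: h1].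
  have w2 : (1 <= 2 * wt (- 1) (recovery_index i) i :> R)%R.
    rewrite /wt -[X in (X * _)%R](powRr1 (ler0n R 2)) -two_powD -[leLHS](powRr0 2); apply: two_pow_le.
    by have := recovery_index_dist i; rewrite -(ler_nat R); lra.
  have e1 : (2 `^ (i%:R * b) <= 2 `^ be * 2 `^ ((recovery_index i)%:R * b) :> R)%R.
    rewrite -two_powD; apply: two_pow_le.
    suff : ((i%:R - (recovery_index i)%:R) * b <= be)%R by lra.
    rewrite /recovery_index; case: ltP => bp.
      rewrite ger0_norm ?(ltW bp)// -[leRHS]mul1r; apply: ler_wpM2r; first exact: ltW.
      by case: (i) => [|m] /=; [rewrite subrr|rewrite -natr1 addrAC subrr add0r].
    rewrite ler0_norm// -natr1; lra.
  apply: (@le_trans _ _ ((2 `^ be * K1)%:E * ((2 `^ ((recovery_index i)%:R * b))%R%:E * ((K1^-1)%:E * block_norm phi0 p q s i f)))).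
    rewrite /summand !muleA -!EFinM; apply: lee_wpmul2r; first exact: block_norm_ge0.
    rewrite lee_fin [leRHS](_ : _ = 2 `^ be * 2 `^ ((recovery_index i)%:R * b))%R//.
    by field; rewrite gt_eqF.
  apply: le_trans (lee_wpmul2l _ hm) _; first by rewrite lee_fin mulr_ge0// ltW.
  rewrite !muleA -!EFinM; apply: lee_wpmul2r; first exact: l0.
  rewrite lee_fin K2E (_ : 2 `^ be * (K1 * k * 2) * wt (- 1) (recovery_index i) i = 2 `^ be * K1 * k * (2 * wt (- 1) (recovery_index i) i))%R; last by ring.
  by rewrite ler_peMr// !mulr_ge0// ltW.
apply: le_trans (hC _ (fun i => K2%:E * log_block c b r (D f) i) v0 (fun i => summand_ge0 _ _ _ _ _ _ _) _) _.
  move=> i; apply: le_trans (key i) _; rewrite muleCA.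
  apply: (nneseries_term (a := fun j => (wt (- 1) j i)%:E * (K2%:E * log_block c b r (D f) j))) => j.
  by rewrite mule_ge0// lee_fin wt_ge0.
rewrite (EFinM C) -muleA; apply: lee_wpmul2l; first by rewrite lee_fin ltW.
by apply: lqZ_le => //; exact: ltW.
Qed.

Lemma TF_normE f : qnorm (TFspace phi0 b r s p%:E q) f = lq r (summ^~ f).
Proof.
rewrite /=; congr lq; apply/funext => j; rewrite /summand /block_norm; congr (_ * Lp _ _).
by apply/funext => x; rewrite block_funE.
Qed.

Lemma TF_limiting_interpolation :
  equal_spaces (TFspace phi0 b r s p%:E q) (limiting_interpolation X0 X1 theta (b - fine (r^-1)) r).
Proof.
have [C1 C10 h1] := log_norm_le_summand; have [C2 C20 h2] := summand_le_log_norm.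
have car0 f : carrier X0 f -> tempered f by case: (up) => [[]//|]; case: (A) => -[].
split.
  apply/seteqP; split=> f.
    move=> [tf fin]; have fin' : lq r (summ^~ f) < +oo by rewrite -TF_normE.
    split.
      by have := base_finite tf fin'; case: (up); last case: (A); split.
    rewrite limiting_normE; apply: le_lt_trans (h1 f tf) _.
    by rewrite lte_mul_pinfty ?lee_fin ?(ltW C10)//; apply: lq_ge0 => // i; exact: summand_ge0.
  move=> [cf fin]; have tf := car0 f cf; split=> //.
  rewrite -[X in X < _]/(qnorm (TFspace phi0 b r s p%:E q) f) TF_normE; apply: le_lt_trans (h2 f tf) _; rewrite limiting_normE in fin.
  have L0 : 0 <= log_norm b r (D f).
    rewrite (log_norm_blocks b c0 r0 _ (D_ge0 f)); last first.
      by apply: measurable_normalized_K => g; first [exact: couple_ge0|exact: couple_ge1].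
    by apply: lq_ge0 => // j; apply: log_block_ge0 => //; exact: D_ge0.
  by rewrite lte_mul_pinfty// lee_fin ltW.
exists (C2^-1)%R, C1; split=> //; first by rewrite invr_gt0.
move=> f [tf _]; rewrite TF_normE /= limiting_normE; split; last exact: h1.
rewrite -[leRHS](EFinK _ C20).
by apply: lee_wpmul2l; [rewrite lee_fin invr_ge0 ltW|exact: h2].
Qed.

End comparison.

Theorem theorem4p8 (R : realType) (d : nat) (hd : (0 < d)%N)
    (phi0 : 'rV[R]_d -> R[i]) (hphi0 : resolution_generator phi0)
    (A : scale) (p : R) (hp : 1 < p) (q q0 r : \bar R)
    (hq : (0 < q)%E) (hq0 : (0 < q0)%E) (hr : (0 < r)%E)
    (s s0 : R) (hs : s != s0) (b : R) (hb : b != 0) :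
  (s < s0 -> 0 < b ->
     equal_spaces (TFspace phi0 b r s p%:E q)
       (limiting_interpolation (Fspace phi0 s p%:E q) (Aspace A phi0 s0 p%:E q0)
          0 (b - fine (r^-1)%E) r)) /\
  (s0 < s -> b < 0 ->
     equal_spaces (TFspace phi0 b r s p%:E q)
       (limiting_interpolation (Aspace A phi0 s0 p%:E q0) (Fspace phi0 s p%:E q)
          1 (b - fine (r^-1)%E) r)).
Proof.
split=> [ss b0|ss b0].
  have ud : (s < s0) = (0 < b) by rewrite ss b0.
  by have := TF_limiting_interpolation hphi0 hp A hq hq0 hr hs hb ud; rewrite b0.
have nb : (0 < b) = false by rewrite ltNge (ltW b0).
have ud : (s < s0) = (0 < b) by rewrite nb ltNge (ltW ss).
by have := TF_limiting_interpolation hphi0 hp A hq hq0 hr hs hb ud; rewrite nb.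
Qed.
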